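(* For each $n$ there exists a finite class $\mathcal{MD}_n$ of tropical $2$-cycles (''minimal model'' $2$-cycles, possibly living in different ambient spaces $\mathbb R^m$) such that for every tropical $2$-cycle $[F]$ in $\mathbb R^n$ satisfying the Hodge index theorem, and every regular tuple $(T_1,T_2,[F])$ with $T_1,T_2$ reduced, one of the following holds: (I) the tuple $(T_1,T_2,[F])$ forms a regular fibration; or (II) there exists a surjective $\mathbb{Z}$-linear map $\pi\colon\mathbb R^n\twoheadrightarrow\mathbb R^m$ such that $\pi_*[F]\in\mathcal{MD}_n$, and moreover there exist tropical regular functions $M_1,M_2$ on $\mathbb R^m$ such that $(M_1,M_2,\pi_*[F])$ is a regular tuple and $T_i=\pi^*M_i$ for $i\in\{1,2\}$.
   Context: **Fans and cycles.** A tropical $k$-fan in $\mathbb R^n$ is a rational polyhedral fan $F$, pure of dimension $k$, with weights $\omega_F\colon F^{(k)}\to\mathbb Z_{\ge0}$ ($F^{(j)}$ = set of $j$-dimensional cones) that is balanced: for all $\tau\in F^{(k-1)}$, $\sum_{\sigma\in F^{(k)},\sigma>\tau}\omega_F(\sigma)v_{\sigma/\tau}\in\langle\tau\rangle:=\operatorname{span}_{\mathbb R}(\tau)$, where $v_{\sigma/\tau}\in\mathbb Z_\sigma:=\langle\sigma\rangle\cap\mathbb Z^n$ represents the primitive generator of $\mathbb Z_\sigma/\mathbb Z_\tau$ pointing into $\sigma$. $|F|$ is the union of the cones. A refinement of $F$ is a tropical fan each of whose cones lies in a cone of $F$, with the same support and induced weights; two tropical fans are equivalent if, after discarding maximal cones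 of weight zero, they have a common refinement. A tropical $k$-cycle $[F]$ is an equivalence class; it is always assumed represented by an $F$ with strictly positive weights, and $|F|$ refers to such an $F$. **Functions.** A tropical regular function on $\mathbb R^n$ is $T=\max(l_1,\dots,l_q)$ with $l_i\in(\mathbb Z^n)^\vee$; it is always assumed that one of the defining functionals is $0$, so that $T=\max(0,l_1,\dots)$. $\mathrm{Newt}(T)$ is the convex hull of the defining functionals, and $T$ is reduced if its defining functionals are exactly the vertices of $\mathrm{Newt}(T)$. A $\mathbb Z$-linear map $\Phi\colon\mathbb R^n\to\mathbb R^m$ is a linear map with $\Phi(\mathbb Z^n)\subseteq\mathbb Z^m$, and $\Phi^*M:=M\circ\Phi$. **Product and degree.** If $T$ is linear on each cone of a representative $F$ (refine if needed), $T\cdot[F]$ is the $(k-1)$-cycle represented by the cones of $F$ of dimension $\le k-1$, with the weight of $\tau\in F^{(k-1)}$ equal to $\sum_{\sigma>\tau}T_\sigma(\omega_F(\sigma)v_{\sigma/\tau})-T_\tau\big(\sum_{\sigma>\tau}\omega_F(\sigma)v_{\sigma/\tau}\big)$, where $T_\sigma,T_\tau$ are the linear functionals on $\langle\sigma\rangle,\langle\tau\rangle$ extending $T|_\sigma,T|_\tau$. For $k$ functions, $T_1\cdots T_k\cdot[F]$ is the origin with an integer weight $\deg(T_1\cdots T_k\cdot[F])$. The tuple $(T_1,\dots,T_k,[F])$ is regular if this degree is $1$; the $k$-cycle $[F]$ (or fan $F$) is regular if it belongs to some regular tuple. **Pushforward.** For a $\mathbb Z$-linear map $\Phi\colon\mathbb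 R^n\to\mathbb R^m$, after refining $F$ so that the images of the cones on which $\Phi$ is injective form a fan, $\Phi_*[F]$ is represented by the cones $\sigma'=\Phi(\sigma)$ with $\sigma\in F^{(k)}$, $\dim\Phi(\sigma)=k$ (and their faces), with weights $\sum_{\sigma\colon\Phi(\sigma)=\sigma'}\omega_F(\sigma)[\mathbb Z_{\sigma'}:\Phi(\mathbb Z_\sigma)]$. **Hodge index theorem.** A tropical $2$-cycle $[F]$ in $\mathbb R^n$ satisfies the Hodge index theorem if $\big(\deg(M_1\cdot M_2\cdot[F])\big)^2\ge\deg(M_1\cdot M_1\cdot[F])\cdot\deg(M_2\cdot M_2\cdot[F])$ for all tropical regular functions $M_1,M_2$ on $\mathbb R^n$. **Regular fibration.** A regular tuple $(T_1,\dots,T_k,[F])$ forms a regular fibration if there is a $\mathbb Z$-linear map $p\colon\mathbb R^n\to\mathbb R^{m}$ such that: (i) $p(|F|)$ is the support $|G|$ of a regular tropical $r$-fan $G$ with $0<r<k$ (weights of $G$ are nonnegative integers, possibly zero, and $|G|$ is the union of all cones of $G$); (ii) there are a nonempty subset $S=\{s_1,\dots,s_r\}\subseteq\{1,\dots,k\}$ and tropical regular functions $M_{s_1},\dots,M_{s_r}$ on $\mathbb R^{m}$ with $T_{s_i}=p^*(M_{s_i})$ for all $i$ and $\deg(M_{s_1}\cdots M_{s_r}\cdot[G])=1$. *)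

(* Defs.v *)
From HB Require Import structures.
From mathcomp Require Import all_boot all_order all_algebra finmap.
From mathcomp Require Import boolp classical_sets functions cardinality fsbigop.
From mathcomp Require Import reals.

Set Implicit Arguments.
Unset Strict Implicit.
Unset Printing Implicit Defensive.

Import Order.TTheory GRing.Theory Num.Theory.
Local Open Scope classical_set_scope.
Local Open Scope ring_scope.

(* R^n is 'rV[R]_n and its dual is 'cV[R]_n; the real numbers are an arbitrary
   R : realType.  Cones are subsets of R^n, and quantities that are uniquely
   determined by a property (linear span, linear extension, degree) or determined
   up to an irrelevant choice (lattice normal vector) are picked with xget. *)

Section Lattice.
Context {R : realType} {n : nat}.
Local Notation V := 'rV[R]_n.

Definition pairing (x : V) (l : 'cV[R]_n) : R := (x *m l) 0 0.

Definition Zn : set V := [set map_mx (fun a : int => a%:~R) z | z in [set: 'rV[int]_n]].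

(* The smallest linear subspace containing A. *)
Definition lin_span (A : set V) : {vspace V} :=
  xget 0%VS [set U : {vspace V} |
    (forall x, A x -> x \in U) /\
    (forall W : {vspace V}, (forall x, A x -> x \in W) -> (U <= W)%VS)].

Definition cone_dim (A : set V) : nat := \dim (lin_span A).

(* Z_sigma = <sigma> ∩ Z^n *)
Definition lattice_of (A : set V) : set V := [set x | Zn x /\ x \in lin_span A].

End Lattice.

Section Fans.
Context {R : realType} {n : nat}.
Local Notation V := 'rV[R]_n.

Definition rational_cone (sigma : set V) : Prop :=
  exists s : seq 'rV[int]_n,
    sigma = [set x | exists2 c : nat -> R, (forall i, 0 <= c i) &
      x = \sum_(i < size s) c i *: map_mx (fun a : int => a%:~R) s`_i].

Definition face (tau sigma : set V) : Prop :=
  exists2 l : 'cV[R]_n, (forall x, sigma x -> 0 <= pairing x l) &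
    tau = [set x | sigma x /\ pairing x l = 0].

(* Lineality spaces are allowed, and so is the empty fan (it represents the
   zero cycle). *)
Definition is_fan (C : set (set V)) : Prop :=
  [/\ finite_set C,
      (forall sigma, C sigma -> rational_cone sigma),
      (forall sigma tau, C sigma -> face tau sigma -> C tau) &
      (forall sigma tau, C sigma -> C tau ->
         face (sigma `&` tau) sigma /\ face (sigma `&` tau) tau)].

(* Only the weights of the cones of top dimension are meaningful. *)
Record wfan := WFan { cones : set (set V); weight : set V -> nat }.

Implicit Types (F : wfan) (sigma tau : set V) (k : nat).

Definition cones_of_dim F k : set (set V) :=
  [set sigma | cones F sigma /\ cone_dim sigma = k].

Definition support F : set V := \bigcup_(sigma in cones F) sigma.

(* The sigma > tau of dimension k. *)
Definition star F k tau : set (set V) :=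
  [set sigma | cones_of_dim F k sigma /\ face tau sigma].

Definition pure F k : Prop :=
  forall tau, cones F tau -> exists2 sigma, cones_of_dim F k sigma & tau `<=` sigma.

(* v represents the generator of Z_sigma / Z_tau on the side of sigma. *)
Definition primitive_generator sigma tau (v : V) : Prop :=
  [/\ lattice_of sigma v,
      (forall x, lattice_of sigma x ->
         exists a : int, lattice_of tau (x - a%:~R *: v)) &
      (exists2 u, u \in lin_span tau & sigma (v + u))].

Definition lattice_normal sigma tau : V :=
  xget 0 [set v | primitive_generator sigma tau v].

Definition weighted_normals F k tau : V :=
  \sum_(sigma \in star F k tau) (weight F sigma)%:R *: lattice_normal sigma tau.

Definition balanced F k : Prop :=
  forall tau, cones F tau -> (cone_dim tau).+1 = k ->
    weighted_normals F k tau \in lin_span tau.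

Definition tropical_fan k F : Prop :=
  [/\ is_fan (cones F), pure F k & balanced F k].

Definition refines k F' F : Prop :=
  [/\ tropical_fan k F',
      (forall sigma', cones F' sigma' ->
         exists2 sigma, cones F sigma & sigma' `<=` sigma),
      support F' = support F &
      (forall sigma' sigma, cones_of_dim F' k sigma' -> cones_of_dim F k sigma ->
         sigma' `<=` sigma -> weight F' sigma' = weight F sigma)].

Definition positive k F : Prop :=
  forall sigma, cones_of_dim F k sigma -> (0 < weight F sigma)%N.

(* F after discarding its maximal cones of weight zero. *)
Definition positive_part k F : wfan :=
  WFan [set tau | exists sigma,
          [/\ cones_of_dim F k sigma, (0 < weight F sigma)%N & face tau sigma]]
       (weight F).

Definition fan_equiv k F1 F2 : Prop :=
  exists F, refines k F (positive_part k F1) /\ refines k F (positive_part k F2).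

(* The tropical k-cycle [F], as the set of its representatives. *)
Definition cycle_of k F : set wfan :=
  [set F' | tropical_fan k F' /\ fan_equiv k F F'].

Definition is_cycle k (X : set wfan) : Prop :=
  exists2 F, tropical_fan k F & X = cycle_of k F.

(* The support |F| of a representative with positive weights. *)
Definition cycle_support k (X : set wfan) : set V :=
  [set x | exists F, [/\ X F, positive k F & support F x]].

End Fans.

Arguments wfan R n : clear implicits.

Record tropical_function (n : nat) := TropicalFunction {
  functionals : seq 'cV[int]_n;
  functionals0 : 0 \in functionals }.

Section Functions.
Context {R : realType} {n : nat}.
Local Notation V := 'rV[R]_n.
Implicit Types (T : tropical_function n) (sigma tau : set V).

Definition realify (l : 'cV[int]_n) : 'cV[R]_n := map_mx (fun a : int => a%:~R) l.

(* The default value 0 of the maximum is harmless, as 0 is a functional of T. *)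
Definition teval T (x : V) : R :=
  \big[Num.max/0]_(l <- functionals T) pairing x (realify l).

Definition newton_polytope T : set 'cV[R]_n :=
  let s := functionals T in
  [set y | exists c : nat -> R,
    [/\ (forall i, 0 <= c i), \sum_(i < size s) c i = 1 &
        y = \sum_(i < size s) c i *: realify s`_i]].

(* A vertex is a face consisting of a single point. *)
Definition vertex (P : set 'cV[R]_n) (y : 'cV[R]_n) : Prop :=
  P y /\ exists x : V, forall z, P z -> z <> y -> pairing x z < pairing x y.

Definition reduced T : Prop :=
  [set realify l | l in [set l | l \in functionals T]] =
  [set y | vertex (newton_polytope T) y].

Definition linear_on T sigma : Prop :=
  exists l : 'cV[R]_n, forall x, sigma x -> teval T x = pairing x l.

(* T_sigma, meant to be evaluated on the span of sigma only. *)
Definition linear_ext T sigma : 'cV[R]_n :=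
  xget 0 [set l | forall x, sigma x -> teval T x = pairing x l].

(* The fan H, with the displayed weights, represents T . [F]; here F has
   dimension k.+1 and T is linear on its cones. *)
Definition is_divisor k T (F H : wfan R n) : Prop :=
  [/\ (forall sigma, cones F sigma -> linear_on T sigma),
      cones H = [set tau | cones F tau /\ (cone_dim tau <= k)%N] &
      (forall tau, cones_of_dim F k tau ->
        (weight H tau)%:R =
          \sum_(sigma \in star F k.+1 tau)
            pairing ((weight F sigma)%:R *: lattice_normal sigma tau)
                    (linear_ext T sigma)
          - pairing (weighted_normals F k.+1 tau) (linear_ext T tau))].

(* The k-cycle T . X, for a k.+1-cycle X. *)
Definition cycle_mul k T (X : set (wfan R n)) : set (wfan R n) :=
  [set H' | exists F H, [/\ X F, is_divisor k T F H & cycle_of k H H']].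

(* The k-cycle T_1 ... T_j . X, for a (k + j)-cycle X. *)
Fixpoint cycle_mul_seq k (Ts : seq (tropical_function n)) (X : set (wfan R n)) :=
  if Ts is T :: Ts' then cycle_mul k T (cycle_mul_seq k.+1 Ts' X) else X.

(* The weight of the origin; the zero 0-cycle is also represented by the empty
   fan. *)
Definition origin_weight (H : wfan R n) : nat :=
  if `[< cones H [set 0] >] then weight H [set 0] else 0%N.

(* deg (T_1 ... T_k . X), for X a k-cycle with k = size Ts. *)
Definition degree (Ts : seq (tropical_function n)) (X : set (wfan R n)) : nat :=
  xget 0%N [set origin_weight H | H in cycle_mul_seq 0 Ts X].

Definition regular_tuple k (Ts : k.-tuple (tropical_function n))
    (X : set (wfan R n)) : Prop :=
  is_cycle k X /\ degree Ts X = 1%N.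

Definition regular_cycle k (X : set (wfan R n)) : Prop :=
  exists Ts : k.-tuple (tropical_function n), regular_tuple Ts X.

Definition hodge_index (X : set (wfan R n)) : Prop :=
  forall M1 M2 : tropical_function n,
    (degree [:: M1; M1] X * degree [:: M2; M2] X <= degree [:: M1; M2] X ^ 2)%N.

End Functions.

Arguments reduced R {n} T.

Section Maps.
Context {R : realType} {n m : nat}.
Implicit Types Phi : {linear 'rV[R]_n -> 'rV[R]_m}.

Definition zlinear Phi : Prop := forall x, Zn x -> Zn (Phi x).

(* [L : L'], as the number of cosets x + L' with x in L; the value is 0 if the
   index is infinite. *)
Definition lattice_index (L L' : set 'rV[R]_m) : nat :=
  #|` fset_set [set [set x + y | y in L'] | x in L] |.

(* H, with the displayed weights, represents the pushforward of [F]; here the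
   images of the cones of F on which Phi is injective form a fan. *)
Definition is_pushforward k Phi (F : wfan R n) (H : wfan R m) : Prop :=
  [/\ is_fan [set Phi @` sigma | sigma in
        [set sigma | cones F sigma /\ set_inj sigma Phi]],
      cones H = [set tau | exists sigma, [/\ cones_of_dim F k sigma,
        cone_dim (Phi @` sigma) = k & face tau (Phi @` sigma)]] &
      (forall sigma', cones_of_dim H k sigma' ->
        weight H sigma' =
          (\big[addn/0]_(sigma \in
              [set sigma | cones_of_dim F k sigma /\ Phi @` sigma = sigma'])
            (weight F sigma *
             lattice_index (lattice_of sigma') (Phi @` lattice_of sigma)))%N)].

(* The k-cycle Phi_* X, for a k-cycle X. *)
Definition pushforward k Phi (X : set (wfan R n)) : set (wfan R m) :=
  [set H' | exists F H, [/\ X F, is_pushforward k Phi F H & cycle_of k H H']].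

End Maps.

Definition regular_fibration (R : realType) (n k : nat)
    (Ts : k.-tuple (tropical_function n)) (X : set (wfan R n)) : Prop :=
  regular_tuple Ts X /\
  exists (m : nat) (p : {linear 'rV[R]_n -> 'rV[R]_m}) (r : nat) (G : wfan R m),
    [/\ zlinear p,
        (0 < r < k)%N,
        tropical_fan r G /\ regular_cycle r (cycle_of r G),
        p @` cycle_support k X = support G &
        exists (s : 'I_r -> 'I_k) (M : r.-tuple (tropical_function m)),
          [/\ injective s,
              (forall i x, teval (tnth Ts (s i)) x = teval (tnth M i) (p x)) &
              degree M (cycle_of r G) = 1%N]].

(* Main.v *)
(* The degree D(f, g) = deg(f . g . X) is symmetric and monotone in the tropical
   functions f and g.  Hence, for a 2-cone sigma of weight w and functionals s of
   Ta and s' of Tb, w * |s /\ s'| <= D(Ta, Tb), where s /\ s' is evaluated on a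
   basis of Z_sigma.  As D(T1, T2) = 1, the Hodge inequality for T1 and T2 gives
   D(T1, T1) * D(T2, T2) <= 1.

   If D(Ta, Ta) = 0, the functionals of Ta are pairwise proportional on every cone,
   so a Z-basis of the lattice they generate maps |F| onto a union of rays; with the
   pushforward of Tb . X as weights these rays form a regular 1-fan.

   Otherwise all these degrees are 1.  Let pi be given by a Z-basis of the lattice
   generated by the functionals of T1 and T2, so that T_i = pi^* M_i; by the
   projection formula the M_i have the same degrees on Y = pi_* X.  The basis can be
   chosen with coordinates in [-1, 1] with respect to linearly independent
   functionals, so the Pluecker coordinates of the cones of Y, multiplied by the
   weights, are bounded by n^2.  The cones of Y thus lie in finitely many planes, and
   by balancing the weight is constant on every 2-dimensional cell of a fixed
   hyperplane arrangement: there are finitely many such Y. *)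
Require Import Defs.
From mathcomp Require Import all_boot all_order all_algebra finmap.
From mathcomp Require Import boolp classical_sets functions cardinality fsbigop.
From mathcomp Require Import reals.
From mathcomp Require Import ring lra zify.

Set Implicit Arguments.
Unset Strict Implicit.
Unset Printing Implicit Defensive.

Import Order.TTheory GRing.Theory Num.Theory.
Local Open Scope classical_set_scope.
Local Open Scope ring_scope.

(** * Rational polyhedral cones and fans *)

Section Cones.
Context {R : realType} {n : nat}.
Local Notation V := 'rV[R]_n.
Implicit Types (x y v w : V) (l m : 'cV[R]_n) (s t : seq V) (sigma tau : set V).

(** A cycle is a class of fans under refinement, while product, degree and pushforward are defined
    on chosen representatives, with chosen normals and chosen linear extensions. The obstacle is to
    compare these choices. It is removed by the density [delta F x v], the weight met when leaving
    the lattice vector x in direction v. For tropical 2-fans, equivalence is the same as equality of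
    densities ([delta_equiv_eq], [delta_equiv]), and balancing, divisors and degrees become sums
    over directions at lattice vectors that mention no cone. The values that [degree] picks exist
    because a fine enough representative carries a chain of divisors ([derivation_exists]), and
    agree because every chain computes [DEG] of the density. Symmetry of the degree is also what
    makes divisors balanced: a linear functional has zero divisor, so its degree with any other
    function vanishes in either order. In the finiteness argument the weight is multiplied into the
    bound on minors, so the same constant bounds the number of planes and the weights; a cycle is
    then encoded by one bounded number per cell of a fixed arrangement. *)

Lemma pairingDl x y l : pairing (x + y) l = pairing x l + pairing y l.
Proof. by rewrite /pairing mulmxDl mxE. Qed.
Lemma pairingDr x l m : pairing x (l + m) = pairing x l + pairing x m.
Proof. by rewrite /pairing mulmxDr mxE. Qed.
Lemma pairingZl a x l : pairing (a *: x) l = a * pairing x l.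
Proof. by rewrite /pairing -scalemxAl mxE. Qed.
Lemma pairingZr a x l : pairing x (a *: l) = a * pairing x l.
Proof. by rewrite /pairing -scalemxAr mxE. Qed.
Lemma pairing0l l : pairing 0 l = 0.
Proof. by rewrite /pairing mul0mx mxE. Qed.
Lemma pairing0r x : pairing x 0 = 0.
Proof. by rewrite /pairing mulmx0 mxE. Qed.
Lemma pairingNl x l : pairing (- x) l = - pairing x l.
Proof. by rewrite /pairing mulNmx mxE. Qed.
Lemma pairingNr x l : pairing x (- l) = - pairing x l.
Proof. by rewrite /pairing mulmxN mxE. Qed.
Lemma pairingBr x l m : pairing x (l - m) = pairing x l - pairing x m.
Proof. by rewrite pairingDr pairingNr. Qed.
Lemma pairing_suml (I : Type) (r : seq I) (P : pred I) (F : I -> V) l :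
  pairing (\sum_(i <- r | P i) F i) l = \sum_(i <- r | P i) pairing (F i) l.
Proof.
by apply: (big_morph (fun x => pairing x l)) => [x y|]; rewrite ?pairingDl ?pairing0l.
Qed.
Lemma pairing_sumr (I : Type) (r : seq I) (P : pred I) (F : I -> 'cV[R]_n) x :
  pairing x (\sum_(i <- r | P i) F i) = \sum_(i <- r | P i) pairing x (F i).
Proof.
by apply: (big_morph (fun l => pairing x l)) => [l m|]; rewrite ?pairingDr ?pairing0r.
Qed.
Definition pairingE := (pairingDl, pairingDr, pairingZl, pairingZr, pairing0l,
  pairing0r, pairingNl, pairingNr).

Lemma pairing_delta x i : pairing x (delta_mx i 0) = x 0 i.
Proof.
rewrite /pairing mxE (bigD1 i) //= big1 ?addr0 => [|j ji]; first by rewrite mxE !eqxx mulr1.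
by rewrite mxE (negbTE ji) mulr0.
Qed.

Lemma pairing_eq0 x : (forall l, pairing x l = 0) -> x = 0.
Proof. by move=> h; apply/rowP => i; rewrite -pairing_delta h mxE. Qed.

Definition Cone (s : seq V) : set V :=
  [set x | exists2 c : nat -> R, (forall i, 0 <= c i) & x = \sum_(i < size s) c i *: s`_i].

Lemma Cone_nil : Cone [::] = [set 0].
Proof.
apply/seteqP; split=> x /=; first by case=> c _; rewrite big_ord0.
by move=> ->; exists (fun=> 0) => //; rewrite big_ord0.
Qed.

Lemma Cone_cons z s x : Cone (z :: s) x <-> exists2 a : R, 0 <= a & Cone s (x - a *: z).
Proof.
split.
  case=> c c0 /=; rewrite big_ord_recl /= => ->; exists (c 0%N) => //.
  by exists (fun i => c i.+1) => //; rewrite addrAC subrr add0r.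
case=> a a0 [c c0 E]; exists (fun i => if i is j.+1 then c j else a).
  by case.
by rewrite /= big_ord_recl /= -E addrC subrK.
Qed.

Lemma Cone0 s : Cone s 0.
Proof. by exists (fun=> 0) => //; rewrite big1 // => i _; rewrite scale0r. Qed.

Lemma ConeD s x y : Cone s x -> Cone s y -> Cone s (x + y).
Proof.
move=> [c c0 ->] [d d0 ->]; exists (fun i => c i + d i) => [i|]; first exact: addr_ge0.
by rewrite -big_split /=; apply: eq_bigr => i _; rewrite scalerDl.
Qed.

Lemma ConeZ s a x : 0 <= a -> Cone s x -> Cone s (a *: x).
Proof.
move=> a0 [c c0 ->]; exists (fun i => a * c i) => [i|]; first exact: mulr_ge0.
by rewrite scaler_sumr; apply: eq_bigr => i _; rewrite scalerA.
Qed.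

Lemma Cone_mem s z : z \in s -> Cone s z.
Proof.
elim: s => // y s IH; rewrite inE => /orP[/eqP->|zs]; apply/Cone_cons.
  by exists 1 => //; rewrite scale1r subrr; apply: Cone0.
by exists 0 => //; rewrite scale0r subr0; apply: IH.
Qed.

(** Lets conditions stable under nonnegative combinations be checked on generators, without handling
    coefficient functions. *)
Lemma Cone_ind (P : V -> Prop) s :
  P 0 -> (forall x y, P x -> P y -> P (x + y)) ->
  (forall a x, 0 <= a -> P x -> P (a *: x)) ->
  (forall z, z \in s -> P z) -> forall x, Cone s x -> P x.
Proof.
move=> P0 PD PZ; elim: s => [|z s IH] Ps x; first by rewrite Cone_nil => ->.
move/Cone_cons => [a a0 /IH h]; rewrite -(subrK (a *: z) x); apply: PD.
  by apply: h => y ys; apply: Ps; rewrite inE ys orbT.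
by apply: PZ => //; apply: Ps; rewrite inE eqxx.
Qed.

Lemma Cone_pairing_ge0 s l : (forall z, z \in s -> 0 <= pairing z l) ->
  forall x, Cone s x -> 0 <= pairing x l.
Proof.
move=> h; apply: Cone_ind => //; rewrite ?pairingE //.
  by move=> x y; rewrite pairingE; apply: addr_ge0.
by move=> a x; rewrite pairingE; apply: mulr_ge0.
Qed.

(* Fourier-Motzkin elimination of one variable. *)
Lemma linear_ineq_solvable (s : seq (R * R)) :
  (forall p, p \in s -> p.2 = 0 -> 0 <= p.1) ->
  (forall p q, p \in s -> q \in s -> q.2 < 0 -> 0 < p.2 -> 0 <= p.1 * - q.2 + q.1 * p.2) ->
  exists a, forall p, p \in s -> a * p.2 <= p.1.
Proof.
move=> h0 h; pose lo := [seq p <- s | p.2 < 0]; pose hi := [seq p <- s | 0 < p.2].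
have bnd a : (forall p, p \in s -> p.2 < 0 -> p.1 / p.2 <= a) ->
    (forall p, p \in s -> 0 < p.2 -> a <= p.1 / p.2) ->
    forall p, p \in s -> a * p.2 <= p.1.
  move=> hl hu p ps; have [lt0|gt0|e0] := ltrgtP p.2 0.
  - by have := hl p ps lt0; rewrite ler_ndivrMr.
  - by have := hu p ps gt0; rewrite ler_pdivlMr.
  - by rewrite e0 mulr0; apply: h0.
have cmp p q : p \in s -> q \in s -> q.2 < 0 -> 0 < p.2 -> q.1 / q.2 <= p.1 / p.2.
  move=> ps qs q0 p0; have := h p q ps qs q0 p0 => H.
  rewrite ler_pdivlMr // mulrAC ler_ndivrMr //; lra.
have maxP (r : seq (R*R)) (f : R*R -> R) : r != [::] ->
    exists2 p, p \in r & forall q, q \in r -> f q <= f p.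
  elim: r => // p [|q r] IH _.
    by exists p; rewrite ?mem_head // => q; rewrite inE => /eqP->.
  have [//|m mr mx] := IH; have [le|lt] := leP (f p) (f m).
    by by exists m => [|k]; rewrite in_cons ?mr ?orbT // => /orP[/eqP->//|/mx].
  exists p; rewrite ?mem_head // => k; rewrite inE => /orP[/eqP->//|/mx km].
  by apply: (le_trans km); apply: ltW.
(* Choose a as the largest lower bound if there is one, else the smallest upper bound, else 0. *)
have [lo0|/(maxP _ (fun p => p.1 / p.2))[q]] := eqVneq lo [::]; last first.
  rewrite mem_filter => /andP[q0 qs] mx; exists (q.1 / q.2); apply: bnd => p ps p0.
    by apply: mx; rewrite mem_filter p0.
  exact: cmp.
have [hi0|/(maxP _ (fun p => - (p.1 / p.2)))[q]] := eqVneq hi [::]; last first.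
  rewrite mem_filter => /andP[q0 qs] mx; exists (q.1 / q.2); apply: bnd => p ps p0.
    exact: cmp.
  by rewrite -lerN2; apply: mx; rewrite mem_filter p0.
exists 0; apply: bnd => p ps p0.
  by have : p \in lo; [rewrite mem_filter p0 | rewrite lo0].
by have : p \in hi; [rewrite mem_filter p0 | rewrite hi0].
Qed.

Lemma linear_ineq_solvable_ge0 (s : seq (R * R)) :
  (forall p, p \in s -> 0 <= p.2 -> 0 <= p.1) ->
  (forall p q, p \in s -> q \in s -> q.2 < 0 -> 0 < p.2 -> 0 <= p.1 * - q.2 + q.1 * p.2) ->
  exists2 a, 0 <= a & forall p, p \in s -> a * p.2 <= p.1.
Proof.
(* The extra pair [(0, -1)] encodes the constraint 0 <= a. *)
move=> h0 h; have [||a ha] := @linear_ineq_solvable ((0, -1) :: s).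
- by move=> p; rewrite inE => /orP[/eqP->//|ps e0]; apply: h0 => //; rewrite e0.
- move=> p q; rewrite !inE => /orP[/eqP->|ps] /orP[/eqP->|qs] //=.
  + by move=> _; rewrite ltr0N1.
  + by move=> _; rewrite ltr0N1.
  + by move=> _ p0; rewrite opprK mulr1 mul0r addr0; apply: h0 => //; apply: ltW.
  + exact: h.
exists a; first by have /= := ha (0, -1) (mem_head _ _); lra.
by move=> p ps; apply: ha; rewrite inE ps orbT.
Qed.

End Cones.

Section RationalCones.
Context {R : realType} {n : nat}.
Local Notation V := 'rV[R]_n.
Implicit Types (x y v w : V) (sigma tau : set V).

Definition rz (z : 'rV[int]_n) : V := map_mx (fun a : int => a%:~R) z.
Local Notation rl := (@realify R n).

Lemma pairing_rz z (l : 'cV[int]_n) : pairing (rz z) (rl l) = ((z *m l) 0 0)%:~R.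
Proof. by rewrite /pairing /rz /realify -map_mxM mxE. Qed.
Lemma rzD (z t : 'rV[int]_n) : rz (z + t) = rz z + rz t. Proof. exact: map_mxD. Qed.
Lemma rzN z : rz (- z) = - rz z. Proof. exact: map_mxN. Qed.
Lemma rzZ (a : int) z : rz (a *: z) = a%:~R *: rz z. Proof. exact: map_mxZ. Qed.
Lemma rz0 : rz 0 = 0. Proof. exact: map_mx0. Qed.
Lemma rlD (z t : 'cV[int]_n) : rl (z + t) = rl z + rl t. Proof. exact: map_mxD. Qed.
Lemma rlN z : rl (- z) = - rl z. Proof. exact: map_mxN. Qed.
Lemma rlZ (a : int) z : rl (a *: z) = a%:~R *: rl z. Proof. exact: map_mxZ. Qed.
Lemma rl0 : rl 0 = 0. Proof. exact: map_mx0. Qed.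
Lemma rl_delta i : rl (delta_mx i 0) = delta_mx i 0. Proof. exact: map_delta_mx. Qed.
Lemma pairing_delta_int x i : pairing x (rl (delta_mx i 0)) = x 0 i.
Proof. by rewrite rl_delta pairing_delta. Qed.

Lemma rational_coneE sigma :
  rational_cone sigma <-> exists s : seq 'rV[int]_n, sigma = Cone (map rz s).
Proof.
split=> -[s ->]; exists s; apply/seteqP; split=> x [c c0 ->];
  by exists c => //; rewrite size_map; apply: eq_bigr => i _; rewrite (nth_map 0).
Qed.

(** Half of the Minkowski-Weyl theorem, by Fourier-Motzkin elimination: x lies in the cone with the
    extra generator z if x - a z satisfies the old inequalities for some a >= 0. Eliminating a
    leaves the inequalities that are nonnegative at z, together with the positive combinations,
    vanishing at z, of two inequalities of opposite sign at z. *)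
Lemma Cone_hrep (s : seq 'rV[int]_n) : exists L : seq 'cV[int]_n,
  forall x, Cone (map rz s) x <-> (forall l, l \in L -> 0 <= pairing x (rl l)).
Proof.
elim: s => [|z s [L IH]].
  exists ([seq delta_mx i 0 | i <- enum 'I_n] ++ [seq - delta_mx i 0 | i <- enum 'I_n]).
  move=> x; rewrite Cone_nil /=; split=> [-> l _|h]; first by rewrite pairing0l.
  apply/rowP => i; rewrite mxE; apply/le_anti/andP; split.
    have /h : (- delta_mx i 0 : 'cV[int]_n) \in [seq delta_mx i 0 | i <- enum 'I_n] ++
       [seq - delta_mx i 0 | i <- enum 'I_n].
      by rewrite mem_cat; apply/orP; right; apply/mapP; exists i; rewrite ?mem_enum.
    by rewrite rlN pairingNr pairing_delta_int oppr_ge0.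
  have /h : (delta_mx i 0 : 'cV[int]_n) \in [seq delta_mx i 0 | i <- enum 'I_n] ++
       [seq - delta_mx i 0 | i <- enum 'I_n].
    by rewrite mem_cat; apply/orP; left; apply/mapP; exists i; rewrite ?mem_enum.
  by rewrite pairing_delta_int.
pose ip (l : 'cV[int]_n) := (z *m l) 0 0.
exists ([seq l <- L | 0 <= ip l] ++
  [seq ip p *: q - ip q *: p | p <- [seq l <- L | 0 < ip l], q <- [seq l <- L | ip l < 0]]).
move=> x; rewrite map_cons Cone_cons; split.
  move=> [a a0 /IH h] l; rewrite mem_cat => /orP[|/allpairsP[[p q] /= []]].
    rewrite mem_filter => /andP[zl lL]; have := h _ lL.
    rewrite !pairingE pairing_rz subr_ge0; apply: le_trans.
    by rewrite mulr_ge0 // ler0z.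
  rewrite !mem_filter => /andP[zp pL] /andP[zq qL] ->.
  have := h _ pL; have := h _ qL.
  rewrite rlD rlN !rlZ !pairingE !pairing_rz -/(ip p) -/(ip q) !subr_ge0.
  have : (0 : R) < (ip p)%:~R by rewrite ltr0z.
  have : (ip q)%:~R < (0 : R) by rewrite ltrz0.
  set P := (ip p)%:~R; set Q := (ip q)%:~R; set X := pairing x _; set Y := pairing x _.
  by move=> *; nra.
move=> h; have [|| a a0 ha] := @linear_ineq_solvable_ge0 R
    [seq (pairing x (rl l), (ip l)%:~R) | l <- L].
- move=> _ /mapP[l lL ->] /=; rewrite ler0z => zl; apply: h.
  by rewrite mem_cat mem_filter zl lL.
- move=> _ _ /mapP[l lL ->] /mapP[k kL ->] /=; rewrite ltrz0 ltr0z => zk zl.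
  have /h : ip l *: k - ip k *: l \in [seq l <- L | 0 <= ip l] ++
    [seq ip p *: q - ip q *: p | p <- [seq l <- L | 0 < ip l], q <- [seq l <- L | ip l < 0]].
    rewrite mem_cat; apply/orP; right; apply/allpairsP; exists (l, k) => /=.
    by rewrite !mem_filter zl zk lL kL.
  rewrite rlD rlN !rlZ !pairingE; nra.
exists a => //; apply/IH => l lL; rewrite !pairingE pairing_rz subr_ge0.
by apply: (ha (pairing x (rl l), (ip l)%:~R)); apply/mapP; exists l.
Qed.

Lemma rational_cone_hrep sigma : rational_cone sigma -> exists L : seq 'cV[int]_n,
  forall x, sigma x <-> (forall l, l \in L -> 0 <= pairing x (rl l)).
Proof. by move=> /rational_coneE[s ->]; apply: Cone_hrep. Qed.

Definition hge (l : 'cV[R]_n) : set V := [set x | 0 <= pairing x l].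
Definition heq (l : 'cV[R]_n) : set V := [set x | pairing x l = 0].

Lemma Cone_sign_decomp (s : seq 'rV[int]_n) (l : 'cV[int]_n) x : Cone (map rz s) x ->
  exists p z q, [/\ x = p + z + q,
    Cone (map rz [seq y <- s | 0 < (y *m l) 0 0]) p,
    Cone (map rz [seq y <- s | (y *m l) 0 0 == 0]) z &
    Cone (map rz [seq y <- s | (y *m l) 0 0 < 0]) q].
Proof.
move: x; apply: Cone_ind.
- by exists 0, 0, 0; rewrite !addr0; split=> //; apply: Cone0.
- move=> _ _ [p [z [q [-> pc zc qc]]]] [p' [z' [q' [-> pc' zc' qc']]]].
  exists (p + p'), (z + z'), (q + q'); split; try exact: ConeD.
  by apply/rowP => i; rewrite !mxE; ring.
- move=> a _ a0 [p [z [q [-> pc zc qc]]]].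
  by exists (a *: p), (a *: z), (a *: q); rewrite !scalerDr; split; [by []|exact: ConeZ..].
move=> _ /mapP[y ys ->]; have [lt|gt|e] := ltrgtP ((y *m l) 0 0) 0.
- exists 0, 0, (rz y); rewrite !add0r; split=> //; try exact: Cone0.
  by apply: Cone_mem; apply: map_f; rewrite mem_filter lt.
- exists (rz y), 0, 0; rewrite !addr0; split=> //; try exact: Cone0.
  by apply: Cone_mem; apply: map_f; rewrite mem_filter gt.
exists 0, (rz y), 0; rewrite !addr0 add0r; split=> //; try exact: Cone0.
by apply: Cone_mem; apply: map_f; rewrite mem_filter e eqxx.
Qed.

(** The double description step: generators with l >= 0 are kept, and each pair of generators
    strictly on opposite sides of the hyperplane contributes its combination on the hyperplane. *)
Lemma rational_cone_cut sigma (l : 'cV[int]_n) :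
  rational_cone sigma -> rational_cone (sigma `&` hge (rl l)).
Proof.
move=> /rational_coneE[s ->]; apply/rational_coneE.
pose ip (y : 'rV[int]_n) := (y *m l) 0 0.
pose pos := [seq y <- s | 0 < ip y]; pose neg := [seq y <- s | ip y < 0].
pose zer := [seq y <- s | ip y == 0].
pose mix := [seq ip p *: q - ip q *: p | p <- pos, q <- neg].
exists (pos ++ zer ++ mix); pose K := Cone (map rz (pos ++ zer ++ mix)); rewrite -/K.
have KP p : Cone (map rz pos) p -> K p.
  move: p; apply: Cone_ind; [exact: Cone0|exact: ConeD|by move=> *; apply: ConeZ|].
  by move=> _ /mapP[y yp ->]; apply: Cone_mem; apply: map_f; rewrite mem_cat yp.
have KZ p : Cone (map rz zer) p -> K p.
  move: p; apply: Cone_ind; [exact: Cone0|exact: ConeD|by move=> *; apply: ConeZ|].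
  by move=> _ /mapP[y yp ->]; apply: Cone_mem; apply: map_f; rewrite !mem_cat yp orbT.
have KM p q : Cone (map rz pos) p -> Cone (map rz neg) q ->
    K (pairing p (rl l) *: q - pairing q (rl l) *: p).
  move=> pc; move: q; apply: Cone_ind.
  - by rewrite scaler0 pairing0l scale0r subrr; apply: Cone0.
  - move=> x y Kx Ky; rewrite pairingE scalerDl scalerDr opprD addrACA; exact: ConeD.
  - move=> a x a0 Kx;
    rewrite pairingE (_ : _ - _ = a *: (pairing p (rl l) *: x - pairing x (rl l) *: p)).
      exact: ConeZ.
    by apply/rowP => i; rewrite !mxE; ring.
  move=> _ /mapP[q qn ->]; move: p pc; apply: Cone_ind.
  - by rewrite scaler0 pairing0l scale0r subrr; apply: Cone0.
  - move=> x y Kx Ky; rewrite pairingE scalerDl scalerDr opprD addrACA; exact: ConeD.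
  - move=> a x a0 Kx;
    rewrite pairingE (_ : _ - _ = a *: (pairing x (rl l) *: rz q - pairing (rz q) (rl l) *: x)).
      exact: ConeZ.
    by apply/rowP => i; rewrite !mxE; ring.
  move=> _ /mapP[p pp ->]; apply: Cone_mem; rewrite !pairing_rz -!rzZ -rzN -rzD; apply: map_f.
  by rewrite !mem_cat; apply/orP; right; apply/orP; right; apply/allpairsP; exists (p, q).
apply/seteqP; split=> x /=; last first.
  move: x; apply: Cone_ind; rewrite /hge /=.
  - by split; [apply: Cone0|rewrite pairing0l].
  - by move=> x y [xc x0] [yc y0]; split; [apply: ConeD|rewrite pairingE addr_ge0].
  - by move=> a x a0 [xc x0]; split; [apply: ConeZ|rewrite pairingE mulr_ge0].
  move=> _ /mapP[y + ->]; rewrite !mem_cat => /orP[|/orP[|/allpairsP[[p q] /= []]]].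
  - rewrite mem_filter => /andP[y0 ys]; split; first exact/Cone_mem/map_f.
    by rewrite pairing_rz ler0z ltW.
  - rewrite mem_filter => /andP[/eqP y0 ys]; split; first exact/Cone_mem/map_f.
    by rewrite pairing_rz ler0z -/(ip y) y0.
  rewrite !mem_filter => /andP[p0 ps] /andP[q0 qs] ->; rewrite rzD rzN !rzZ -scaleNr; split.
    apply: ConeD; apply: ConeZ; rewrite ?oppr_ge0 ?ler0z ?lerz0 ?ltW //; exact/Cone_mem/map_f.
  by rewrite !pairingE !pairing_rz -/(ip p) -/(ip q) mulNr mulrC subrr.
move=> [/(Cone_sign_decomp l) [p [z [q [-> pc zc qc]]]]]; rewrite /hge /= !pairingE => l0.
have z0 : pairing z (rl l) = 0.
  move: z zc {l0}; apply: Cone_ind; rewrite ?pairing0l //.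
  + by move=> u v; rewrite pairingE => -> ->; rewrite addr0.
  + by move=> a u _; rewrite pairingE => ->; rewrite mulr0.
  move=> _ /mapP[y + ->]; rewrite mem_filter => /andP[/eqP e _].
  by rewrite pairing_rz e.
have p0 : 0 <= pairing p (rl l).
  move: p pc {l0}; apply: Cone_pairing_ge0 => _ /mapP[y + ->]; rewrite mem_filter => /andP[e _].
  by rewrite pairing_rz ler0z ltW.
(* The negative part q is zero as soon as l vanishes on it, which settles the case where l vanishes
   on the positive part p. *)
have qP : pairing q (rl l) <= 0 /\ (pairing q (rl l) = 0 -> q = 0).
  move: q qc {l0}; apply: Cone_ind; rewrite ?pairing0l //.
  + move=> u v [x0 ex] [y0 ey]; rewrite pairingE; split; first by lra.
    move=> E; have e1 : pairing u (rl l) = 0 by lra.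
    have e2 : pairing v (rl l) = 0 by lra.
    by rewrite ex // ey // addr0.
  + move=> a u a0 [x0 ex]; rewrite pairingE; split; first exact: mulr_ge0_le0.
    by move/eqP; rewrite mulf_eq0 => /orP[/eqP->|/eqP/ex->]; rewrite ?scale0r ?scaler0.
  move=> _ /mapP[y + ->]; rewrite mem_filter => /andP[e _].
  rewrite pairing_rz lerz0 ltW //; split=> // /eqP.
  by rewrite intr_eq0 (lt_eqF e).
case: qP => q0 qe; rewrite z0 addr0 in l0.
have [pe|pn] := eqVneq (pairing p (rl l)) 0.
  rewrite qe ?addr0; last by lra.
  by apply: ConeD; [apply: KP|apply: KZ].
set P := pairing p _ in pn p0 l0; set Q := pairing q _ in q0 l0.
(* Part of p absorbs q: the coefficient [1 + Q / P] is nonnegative because x lies in the half-space,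
   and the last summand is built from mixed generators ([KM]). *)
have -> : p + z + q = (1 + Q / P) *: p + z + P^-1 *: (P *: q - Q *: p).
  by apply/rowP => i; rewrite !mxE; field.
have P0 : 0 < P by rewrite lt_def pn p0.
apply: ConeD; [apply: ConeD|].
- apply: ConeZ; last exact: KP.
  have -> : 1 + Q / P = (P + Q) / P by field.
  by rewrite divr_ge0.
- exact: KZ.
by apply: ConeZ; [rewrite invr_ge0|apply: KM].
Qed.

End RationalCones.

(** * Subdivision of fans by hyperplanes *)

Section FanCuts.
Context {R : realType} {n : nat}.
Local Notation V := 'rV[R]_n.
Local Notation rl := (@realify R n).
Implicit Types (x y v w : V) (l m : 'cV[R]_n) (sigma tau rho kappa : set V) (C : set (set V)).

Definition convex_cone sigma : Prop :=
  [/\ sigma 0, (forall x y, sigma x -> sigma y -> sigma (x + y)) &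
      (forall a x, 0 <= a -> sigma x -> sigma (a *: x))].

Lemma rational_convex_cone sigma : rational_cone sigma -> convex_cone sigma.
Proof.
by move=> /rational_coneE[s ->]; split; [exact: Cone0|exact: ConeD|move=> *; exact: ConeZ].
Qed.

Lemma face_refl sigma : face sigma sigma.
Proof.
exists 0 => [x _|]; first by rewrite pairing0r.
by apply/seteqP; split=> x //=; [rewrite pairing0r|case].
Qed.

Lemma face_sub tau sigma : face tau sigma -> tau `<=` sigma.
Proof. by case=> l _ -> x []. Qed.

(** A functional m cutting rho out of tau may be negative on the rest of sigma, where l > 0; a
    suitable multiple of l repairs this on the finitely many generators. One further l ensures that
    the sum vanishes on sigma only where l and m both do. *)
Lemma face_trans sigma tau rho :
  rational_cone sigma -> face tau sigma -> face rho tau -> face rho sigma.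
Proof.
move=> /rational_coneE[s sE] [l l0 tE] [m m0 rE].
have [||a ha] := @linear_ineq_solvable R [seq (pairing (rz z) m, - pairing (rz z) l) | z <- s].
- move=> _ /mapP[z zs ->] /= /eqP; rewrite oppr_eq0 => /eqP zl; apply: m0.
  by rewrite tE; split=> //; rewrite sE; apply/Cone_mem/map_f.
- move=> _ _ /mapP[z zs ->] /mapP[y ys ->] /= _; rewrite oppr_gt0 ltNge l0 //.
  by rewrite sE; apply/Cone_mem/map_f.
have h x : sigma x -> 0 <= pairing x (a *: l + m).
  rewrite sE; move: x; apply: Cone_pairing_ge0 => _ /mapP[z zs ->].
  have := ha _ (map_f _ zs); rewrite /= !pairingE; lra.
exists (l + (a *: l + m)) => [x sx|].
  by rewrite pairingDr addr_ge0 ?h ?l0.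
rewrite rE tE; apply/seteqP; split=> x /=.
  by move=> [[sx e1] e2]; split=> //; rewrite !pairingE e1 e2 mulr0 !addr0.
move=> [sx]; rewrite pairingDr => e; have := h x sx; have := l0 x sx => a0 b0.
have e1 : pairing x l = 0 by lra.
split=> //; have : pairing x (a *: l + m) = 0 by lra.
by rewrite !pairingE e1 mulr0 add0r.
Qed.

Lemma faceI sigma tau rho : face tau sigma -> face rho sigma -> face (tau `&` rho) sigma.
Proof.
move=> [l l0 ->] [m m0 ->]; exists (l + m) => [x sx|].
  by rewrite pairingDr addr_ge0 ?l0 ?m0.
apply/seteqP; split=> x /=.
  by move=> [[sx e1] [_ e2]]; split=> //; rewrite pairingDr e1 e2 addr0.
move=> [sx]; rewrite pairingDr => e; have := l0 x sx; have := m0 x sx => a0 b0.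
by split; split=> //; lra.
Qed.

(** A Farkas argument: a functional m that is nonnegative on the half of sigma with l >= 0 becomes
    nonnegative on all of sigma after subtracting [a *: l] for some a >= 0. If a = 0 the new face is
    a half of an old one; otherwise m vanishes only where l does, and the face lies in the
    hyperplane. *)
Lemma face_cut_ge sigma kappa l : rational_cone sigma -> face kappa (sigma `&` hge l) ->
  exists2 rho, face rho sigma & kappa = rho `&` hge l \/ kappa = rho `&` heq l.
Proof.
move=> /rational_coneE[s sE] [m m0 kE].
have sin z : z \in s -> sigma (rz z) by move=> zs; rewrite sE; apply/Cone_mem/map_f.
have [||a a0 ha] := @linear_ineq_solvable_ge0 R [seq (pairing (rz z) m, pairing (rz z) l) | z <- s].
- by move=> _ /mapP[z zs ->] /= zl; apply: m0; split=> //; apply: sin.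
- move=> _ _ /mapP[z zs ->] /mapP[y ys ->] /= yl zl.
  have : 0 <= pairing (- pairing (rz y) l *: rz z + pairing (rz z) l *: rz y) m.
    apply: m0; split; last by rewrite /hge /= !pairingE mulNr mulrC addrC subrr.
    by rewrite sE; apply: ConeD; (apply: ConeZ; first by lra); apply/Cone_mem/map_f.
  rewrite !pairingE; lra.
have h x : sigma x -> 0 <= pairing x (m - a *: l).
  rewrite sE; move: x; apply: Cone_pairing_ge0 => _ /mapP[z zs ->].
  have := ha _ (map_f _ zs); rewrite /= !pairingE; lra.
exists [set x | sigma x /\ pairing x (m - a *: l) = 0]; first by exists (m - a *: l).
have [ae|an] := eqVneq a 0; [left|right]; rewrite kE; apply/seteqP; split=> x /=;
  rewrite !pairingE ?ae ?mul0r ?subr0.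
- by case=> -[].
- by case=> -[].
- move=> [[sx lx] mx]; have := h x sx; rewrite !pairingE => hx.
  have : 0 <= a * pairing x l by rewrite mulr_ge0.
  move=> al; have e : a * pairing x l = 0 by lra.
  split; first by split=> //; lra.
  by move/eqP: e; rewrite mulf_eq0 (negbTE an) => /eqP.
- move=> [[sx mx]]; rewrite /heq /= => lx; move: mx; rewrite lx mulr0 subr0 => mx.
  by split=> //; split=> //; rewrite /hge /= lx.
Qed.

Lemma face_cut_eq sigma kappa l : rational_cone sigma -> face kappa (sigma `&` heq l) ->
  exists2 rho, face rho sigma & kappa = rho `&` heq l.
Proof.
move=> /rational_coneE[s sE] [m m0 kE].
have sin z : z \in s -> sigma (rz z) by move=> zs; rewrite sE; apply/Cone_mem/map_f.
have [||a ha] := @linear_ineq_solvable R [seq (pairing (rz z) m, pairing (rz z) l) | z <- s].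
- by move=> _ /mapP[z zs ->] /= zl; apply: m0; split=> //; apply: sin.
- move=> _ _ /mapP[z zs ->] /mapP[y ys ->] /= yl zl.
  have : 0 <= pairing (- pairing (rz y) l *: rz z + pairing (rz z) l *: rz y) m.
    apply: m0; split; last by rewrite /heq /= !pairingE mulNr mulrC addrC subrr.
    by rewrite sE; apply: ConeD; (apply: ConeZ; first by lra); apply/Cone_mem/map_f.
  rewrite !pairingE; lra.
have h x : sigma x -> 0 <= pairing x (m - a *: l).
  rewrite sE; move: x; apply: Cone_pairing_ge0 => _ /mapP[z zs ->].
  have := ha _ (map_f _ zs); rewrite /= !pairingE; lra.
exists [set x | sigma x /\ pairing x (m - a *: l) = 0]; first by exists (m - a *: l).
rewrite kE; apply/seteqP; split=> x /=; rewrite /heq /= !pairingE.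
  by move=> [[sx lx] mx]; rewrite lx mulr0 subr0.
by move=> [[sx mx] lx]; move: mx; rewrite lx mulr0 subr0.
Qed.

Lemma hgeN_eq l : hge l `&` hge (- l) = heq l.
Proof.
apply/seteqP; split=> x; rewrite /hge /heq /= pairingNr; first by case=> *; lra.
by move=> ->; rewrite oppr0 lexx.
Qed.

Lemma heqN l : heq (- l) = heq l.
Proof.
by apply/seteqP; split=> x; rewrite /heq /= pairingNr => /eqP; rewrite ?oppr_eq0 => /eqP;
  [|move=> ->; rewrite oppr0].
Qed.

(** The hyperplane slices are listed as well, since they are faces of the halves and a fan is closed
    under faces. *)
Definition cut1 l C : set (set V) :=
  [set kappa | exists2 sigma, C sigma &
     [\/ kappa = sigma `&` hge l, kappa = sigma `&` hge (- l) | kappa = sigma `&` heq l]].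

Lemma cut1I l C sigma kappa : C sigma ->
  [\/ kappa = sigma `&` hge l, kappa = sigma `&` hge (- l) | kappa = sigma `&` heq l] ->
  cut1 l C kappa.
Proof. by exists sigma. Qed.

Lemma cut1N l C : cut1 (- l) C = cut1 l C.
Proof.
apply/seteqP; split=> k [s Cs []->]; exists s => //; rewrite ?heqN ?opprK.
- by constructor 2. - by constructor 1. - by constructor 3.
- by constructor 2. - by constructor 1. - by constructor 3.
Qed.

Lemma face_cut_eq_ge sigma l : face (sigma `&` heq l) (sigma `&` hge l).
Proof.
exists l => [x []//|]; apply/seteqP; split=> x /=; rewrite /heq /hge /=.
  by move=> [sx e]; split=> //; split=> //; rewrite e.
by move=> [[]].
Qed.

Lemma face_cutI sigma rho A : face rho sigma -> face (rho `&` A) (sigma `&` A).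
Proof.
move=> [m m0 ->]; exists m => [x [sx _]|]; first exact: m0.
by apply/seteqP; split=> x /=; [case=> -[sx mx] Ax|case=> -[]].
Qed.

Lemma is_fan_cut1 (l : 'cV[int]_n) C : is_fan C -> is_fan (cut1 (rl l) C).
Proof.
move=> [finC ratC faceC intC]; split.
- rewrite (_ : cut1 _ C = ((fun s => s `&` hge (rl l)) @` C) `|`
     ((fun s => s `&` hge (- rl l)) @` C) `|` ((fun s => s `&` heq (rl l)) @` C)).
    by rewrite !finite_setU; split; [split|]; apply: finite_image.
  apply/seteqP; split=> k.
    by case=> s Cs [] ->; [left; left|left; right|right]; exists s.
  by case=> [[]|] [s Cs <-]; exists s => //; [constructor 1|constructor 2|constructor 3].
- move=> k [s /ratC rs [] ->]; first exact: rational_cone_cut.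
    by rewrite -rlN; apply: rational_cone_cut.
  by rewrite -hgeN_eq setIA -rlN; do 2! apply: rational_cone_cut.
- move=> k t [s Cs [] ->].
  + move=> F; have [r rs [] ->] := face_cut_ge (ratC _ Cs) F; apply: (cut1I (faceC _ _ Cs rs)).
      by constructor 1.
    by constructor 3.
  + move=> F; have [r rs [] ->] := face_cut_ge (ratC _ Cs) F; apply: (cut1I (faceC _ _ Cs rs)).
      by constructor 2.
    by rewrite heqN; constructor 3.
  + move=> F; have [r rs ->] := face_cut_eq (ratC _ Cs) F; apply: (cut1I (faceC _ _ Cs rs)).
    by constructor 3.
(* The intersection of two pieces is the common face of s and t, cut either by A or by the
   hyperplane bounding A; in both cases this is a face of the piece of s. *)
have key s t A B : C s -> C t -> (exists2 l', A = hge l' & (B `&` A = A \/ B `&` A = heq l')) \/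
    (exists2 l', A = heq l' & B `&` A = A) -> face ((s `&` A) `&` (t `&` B)) (s `&` A).
  move=> Cs Ct H; have [fs _] := intC s t Cs Ct.
  rewrite setIACA [A `&` B]setIC; case: H => -[l' -> H].
    case: H => [->|->]; first exact: face_cutI.
    rewrite (_ : s `&` t `&` heq l' = (s `&` t `&` hge l') `&` (s `&` heq l')).
      apply: faceI; first exact: face_cutI.
      exact: face_cut_eq_ge.
    apply/seteqP; split=> x; rewrite /heq /hge /=; last by move=> [[[sx tx] _] [_ e]].
    by move=> [[sx tx] e]; rewrite e lexx.
  by rewrite H; apply: face_cutI.
have hh m : hge m `&` heq m = heq m by rewrite -hgeN_eq setIA setIid.
have hh' m : heq m `&` hge m = heq m by rewrite setIC hh.
have hh2 m : hge (- m) `&` heq m = heq m by rewrite -heqN hh.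
have hh2' m : heq m `&` hge (- m) = heq m by rewrite setIC hh2.
have hN m : hge (- m) `&` hge m = heq m by rewrite setIC hgeN_eq.
move=> k1 k2 [s Cs Hs] [t Ct Ht].
have key2 s1 t1 A B : C s1 -> C t1 -> [\/ A = hge (rl l), A = hge (- rl l) | A = heq (rl l)] ->
    [\/ B = hge (rl l), B = hge (- rl l) | B = heq (rl l)] ->
    face ((s1 `&` A) `&` (t1 `&` B)) (s1 `&` A).
  move=> Cs1 Ct1 HA HB; apply: key => //; case: HA => ->.
  - left; exists (rl l) => //; case: HB => ->; rewrite ?setIid ?hN ?hh'; by [left|right].
  - left; exists (- rl l) => //; case: HB => ->; rewrite ?setIid ?heqN ?hgeN_eq ?hh2'; by [left|right].
  - right; exists (rl l) => //; case: HB => ->; by rewrite ?setIid ?hh ?hh2.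
have [A HA ->] : exists2 A, [\/ A = hge (rl l), A = hge (- rl l) | A = heq (rl l)] & k1 = s `&` A.
  by case: Hs => ->; [exists (hge (rl l))|exists (hge (- rl l))|exists (heq (rl l))] => //;
    [constructor 1|constructor 2|constructor 3].
have [B HB ->] : exists2 A, [\/ A = hge (rl l), A = hge (- rl l) | A = heq (rl l)] & k2 = t `&` A.
  by case: Ht => ->; [exists (hge (rl l))|exists (hge (- rl l))|exists (heq (rl l))] => //;
    [constructor 1|constructor 2|constructor 3].
split; first exact: key2.
by rewrite setIC; apply: key2.
Qed.

(** Justifies the [xget] in [lin_span]: a subspace of least dimension containing A lies in every W
    containing A, because its intersection with W contains A too. *)
Lemma lin_spanP (A : set V) : (forall x, A x -> x \in lin_span A) /\
  (forall W : {vspace V}, (forall x, A x -> x \in W) -> (lin_span A <= W)%VS).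
Proof.
pose Q d := `[< exists2 U : {vspace V}, (forall x, A x -> x \in U) & \dim U = d >].
have exQ : exists d, Q d.
  by exists (\dim (fullv : {vspace V})); apply/asboolP; exists fullv => // x _; rewrite memvf.
suff : exists U : {vspace V}, (forall x, A x -> x \in U) /\
  (forall W : {vspace V}, (forall x, A x -> x \in W) -> (U <= W)%VS).
  by move=> [U HU]; rewrite /lin_span; case: xgetP => [P -> //|/(_ U)].
case: (ex_minnP exQ) => d /asboolP[U AU dU] dmin; exists U; split=> // W AW.
have AUW x : A x -> x \in (U :&: W)%VS by move=> Ax; rewrite memv_cap AU ?AW.
have le : (d <= \dim (U :&: W))%N by apply: dmin; apply/asboolP; exists (U :&: W)%VS.
have /eqP <- : (U :&: W)%VS == U by rewrite eqEdim capvSl dU.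
exact: capvSr.
Qed.

Lemma mem_lin_span (A : set V) x : A x -> x \in lin_span A.
Proof. by have [h _] := lin_spanP A; apply: h. Qed.

Lemma lin_span_min (A : set V) (W : {vspace V}) :
  (forall x, A x -> x \in W) -> (lin_span A <= W)%VS.
Proof. by have [_ h] := lin_spanP A; apply: h. Qed.

Lemma lin_spanS (A B : set V) : A `<=` B -> (lin_span A <= lin_span B)%VS.
Proof. by move=> AB; apply: lin_span_min => x /AB; apply: mem_lin_span. Qed.

Lemma cone_dimS (A B : set V) : A `<=` B -> (cone_dim A <= cone_dim B)%N.
Proof. by move=> AB; apply: dimvS; apply: lin_spanS. Qed.

Lemma lin_span_eq (A B : set V) : A `<=` B -> (cone_dim B <= cone_dim A)%N ->
  lin_span A = lin_span B.
Proof. by move=> AB d; apply/eqP; rewrite eqEdim lin_spanS. Qed.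

Lemma lin_span_Cone (s : seq V) : lin_span (Cone s) = <<s>>%VS.
Proof.
apply/eqP; rewrite eqEsubv; apply/andP; split.
  apply: lin_span_min; apply: Cone_ind; first exact: mem0v.
  - by move=> x y; apply: memvD.
  - by move=> a x _; apply: memvZ.
  - by move=> z zs; apply: memv_span.
by apply/span_subvP => z zs; apply/mem_lin_span/Cone_mem.
Qed.

(** A large multiple of x0 moves any point of sigma into the half-space, so the half still spans. *)
Lemma cone_dim_cut sigma l x0 : convex_cone sigma -> sigma x0 -> 0 < pairing x0 l ->
  cone_dim (sigma `&` hge l) = cone_dim sigma.
Proof.
move=> [s0 sD sZ] sx0 l0; apply/eqP; rewrite eqn_leq cone_dimS => [|x []//].
apply: dimvS; apply: lin_span_min => z sz.
pose N := Num.max 0 (- pairing z l / pairing x0 l).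
have N0 : 0 <= N by rewrite le_max lexx.
have h : hge l (z + N *: x0).
  rewrite /hge /= !pairingE -lerBlDl sub0r -ler_pdivrMr //.
  by rewrite le_max lexx orbT.
rewrite -[z](addrK (N *: x0)); apply: memvB.
  by apply: mem_lin_span; split=> //; apply: sD => //; apply: sZ.
apply: memvZ; apply: mem_lin_span; split=> //; exact: ltW.
Qed.

Definition pure_family C k : Prop :=
  forall tau, C tau -> exists2 sigma, C sigma /\ cone_dim sigma = k & tau `<=` sigma.

Lemma pure_family_cut1 (l : 'cV[R]_n) C k : (forall s, C s -> convex_cone s) ->
  pure_family C k -> pure_family (cut1 l C) k.
Proof.
move=> ratC pC.
(* Either s has a point with m > 0 and its half keeps the dimension, or m <= 0 on s and the opposite
   half is s itself. *)
have key m s t : C s -> cone_dim s = k -> t `<=` s ->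
    exists2 A, [\/ A = hge m, A = hge (- m) | A = heq m] &
      cone_dim (s `&` A) = k /\ t `&` hge m `<=` s `&` A.
  move=> Cs dk ts; have [[x0 [sx0 mx0]]|N] := pselect (exists x0, s x0 /\ 0 < pairing x0 m).
    exists (hge m); first by constructor 1.
    split; last by move=> x [/ts].
    by rewrite (cone_dim_cut (ratC _ Cs) sx0).
  have sm x : s x -> pairing x m <= 0.
    by move=> sx; rewrite leNgt; apply/negP => h; apply: N; exists x.
  exists (hge (- m)); first by constructor 2.
  have -> : s `&` hge (- m) = s.
    by apply/seteqP; split=> x; [case|move=> sx; split=> //; rewrite /hge /= pairingNr oppr_ge0 sm].
  by split=> // x [/ts].
move=> k1 [t /pC [s [Cs ds] ts]] H.
have keyl : forall B, [\/ B = hge l, B = hge (- l) | B = heq l] ->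
    exists2 s', cut1 l C s' /\ cone_dim s' = k & t `&` B `<=` s'.
  have fin m : cut1 m C = cut1 l C -> exists2 s', cut1 l C s' /\ cone_dim s' = k & t `&` hge m `<=` s'.
    move=> <-; have [A HA [d sub]] := key m s t Cs ds ts.
    exists (s `&` A) => //; split=> //; exists s => //.
    by case: HA => ->; [constructor 1|constructor 2|constructor 3].
  move=> B [] ->; first exact: fin.
    by apply: fin; rewrite cut1N.
  have [s' Hs' sub] := fin l erefl; exists s' => // x [tx xl]; apply: sub; split=> //.
  by rewrite /hge /= xl.
by case: H => ->; apply: keyl; [constructor 1|constructor 2|constructor 3].
Qed.

Definition cut (L : seq 'cV[int]_n) C := foldr (fun l : 'cV[int]_n => cut1 (rl l)) C L.

Lemma is_fan_cut L C : is_fan C -> is_fan (cut L C).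
Proof. by elim: L => //= l L IH /IH; apply: is_fan_cut1. Qed.

Lemma cut_sub L C kappa : cut L C kappa -> exists2 sigma, C sigma & kappa `<=` sigma.
Proof.
elim: L kappa => [|l L IH] k /=; first by exists k.
by case=> s /IH [r Cr sr] H; exists r => //; case: H => -> x [/sr].
Qed.

Lemma cut_cover L C sigma x : C sigma -> sigma x -> exists2 kappa, cut L C kappa & kappa x.
Proof.
elim: L => [|l L IH] Cs sx /=; first by exists sigma.
have [k Ck kx] := IH Cs sx.
have [h|h] := leP 0 (pairing x (rl l)).
  by exists (k `&` hge (rl l)) => //; exists k => //; constructor 1.
exists (k `&` hge (- rl l)); first by exists k => //; constructor 2.
by split=> //; rewrite /hge /= pairingNr oppr_ge0 ltW.
Qed.

Lemma cut_sign L C kappa (l : 'cV[int]_n) : cut L C kappa -> l \in L ->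
  (forall x, kappa x -> 0 <= pairing x (rl l)) \/ (forall x, kappa x -> pairing x (rl l) <= 0).
Proof.
elim: L kappa => // k L IH kappa [s Ls H]; rewrite inE => /orP[/eqP->|lL]; last first.
  by have [h|h] := IH _ Ls lL; [left|right] => x kx; apply: h; move: kx; case: H => -> [].
case: H => ->; [left|right|left] => x [_]; rewrite /hge /heq /= ?pairingNr ?oppr_ge0 //.
by move=> ->.
Qed.

Lemma pure_family_cut L C k : is_fan C -> pure_family C k -> pure_family (cut L C) k.
Proof.
move=> fC; elim: L => //= l L IH /IH; apply: pure_family_cut1 => s.
by have [_ h _ _] := is_fan_cut L fC => /h; apply: rational_convex_cone.
Qed.

(** Separates the fan from the arrangement: [cut L [set setT]] consists of the cells of the
    hyperplanes of L and depends on L alone. *)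
Lemma cutE L C kappa : cut L C kappa <->
  exists sigma c, [/\ C sigma, cut L [set setT] c & kappa = sigma `&` c].
Proof.
elim: L kappa => [|l L IH] k /=; split.
- by move=> Ck; exists k, setT; rewrite setIT.
- by move=> [s [_ [Cs -> ->]]]; rewrite setIT.
- move=> [s /IH [r [c [Cr Lc ->]]] H].
  by case: H => ->; [exists r, (c `&` hge (rl l))|exists r, (c `&` hge (- rl l))|
    exists r, (c `&` heq (rl l))]; split; rewrite ?setIA //; exists c => //;
    [constructor 1|constructor 2|constructor 3].
move=> [s [c0 [Cs [c Lc H] ->]]]; exists (s `&` c); first by apply/IH; exists s, c.
by case: H => ->; rewrite setIA; [constructor 1|constructor 2|constructor 3].
Qed.

End FanCuts.

(** * Local structure of a fan at a lattice vector *)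

Section LatticeNormals.
Context {R : realType} {n : nat}.
Local Notation V := 'rV[R]_n.
Local Notation rl := (@realify R n).
Implicit Types (x y v w : V) (sigma tau rho kappa : set V).

Lemma ZnP x : Zn x <-> exists z, x = rz z.
Proof. by split=> [[z _ <-]|[z ->]]; exists z. Qed.
Lemma Zn_rz z : Zn (rz z : V). Proof. by exists z. Qed.
Lemma ZnD x y : Zn x -> Zn y -> Zn (x + y).
Proof. by move=> [z _ <-] [t _ <-]; exists (z + t) => //; exact: rzD. Qed.
Lemma ZnN x : Zn x -> Zn (- x).
Proof. by move=> [z _ <-]; exists (- z) => //; exact: rzN. Qed.
Lemma ZnZ (a : int) x : Zn x -> Zn (a%:~R *: x).
Proof. by move=> [z _ <-]; exists (a *: z) => //; exact: rzZ. Qed.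
Lemma ZnB x y : Zn x -> Zn y -> Zn (x - y).
Proof. by move=> hx /ZnN; apply: ZnD. Qed.

Definition indep x v := x != 0 /\ v \notin <[x]>%VS.
Definition plane x v := (<[x]> + <[v]>)%VS.

Lemma planeP x v y : reflect (exists a b, y = a *: x + b *: v) (y \in plane x v).
Proof.
apply: (iffP memv_addP) => [[_ /vlineP[a ->] [_ /vlineP[b ->] ->]]|[a [b ->]]].
  by exists a, b.
by exists (a *: x); rewrite ?memvZ ?memv_line //; exists (b *: v); rewrite ?memvZ ?memv_line.
Qed.

Lemma indepP x v : indep x v <-> (forall a b, a *: x + b *: v = 0 -> a = 0 /\ b = 0).
Proof.
split=> [[x0 vx] a b E|h].
  have [b0|b0] := eqVneq b 0.
    move: E; rewrite b0 scale0r addr0 => /eqP; rewrite scaler_eq0 (negbTE x0) orbF.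
    by move/eqP.
  case/negP: vx; apply/vlineP; exists (- (a / b)).
  have : b *: v = - (a *: x) by apply/eqP; rewrite -addr_eq0 addrC E.
  move=> /(congr1 (fun u => b^-1 *: u)); rewrite scalerA mulVf // scale1r => ->.
  by rewrite scalerN scaleNr scalerA mulrC.
split.
  by apply/eqP => x0; have [|/eqP] := h 1 0; rewrite ?x0 ?scaler0 ?scale0r ?addr0 ?oner_eq0.
apply/negP => /vlineP[k vE]; have [|_ /eqP] := h (- k) 1; last by rewrite oner_eq0.
by rewrite vE scale1r scaleNr addNr.
Qed.

Lemma indep_coeff x v a b a' b' : indep x v ->
  a *: x + b *: v = a' *: x + b' *: v -> a = a' /\ b = b'.
Proof.
move=> /indepP h E; have [|/eqP ea /eqP eb] := h (a - a') (b - b').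
  rewrite !scalerBl addrACA -opprD E; exact: subrr.
by rewrite !subr_eq0 in ea eb; rewrite (eqP ea) (eqP eb).
Qed.

Lemma dim_plane x v : indep x v -> \dim (plane x v) = 2%N.
Proof.
move=> [x0 vx]; have v0 : v != 0 by apply: contra vx => /eqP->; apply: mem0v.
rewrite dimv_disjoint_sum ?dim_vline ?x0 ?v0 //.
apply/eqP; rewrite -subv0; apply/subvP => y; rewrite memv_cap memv0.
move=> /andP[yx /vlineP[k yE]]; have [k0|k0] := eqVneq k 0; first by rewrite yE k0 scale0r.
by case/negP: vx; rewrite -[v]scale1r -(mulVf k0) -scalerA -yE memvZ.
Qed.

Lemma span_line tau x : cone_dim tau = 1%N -> x \in lin_span tau -> x != 0 ->
  lin_span tau = <[x]>%VS.
Proof.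
move=> d xt x0; apply/esym/eqP; rewrite eqEdim -memvE xt /=.
by move: d; rewrite /cone_dim dim_vline x0 => ->.
Qed.

Lemma span_plane sigma x v : cone_dim sigma = 2%N -> x \in lin_span sigma ->
  v \in lin_span sigma -> indep x v -> lin_span sigma = plane x v.
Proof.
move=> d xs vs xv; apply/esym/eqP; rewrite eqEdim subv_add -!memvE xs vs /=.
by move: d; rewrite /cone_dim dim_plane // => ->.
Qed.

Lemma dim_ge2 sigma x v : sigma x -> sigma v -> indep x v -> (2 <= cone_dim sigma)%N.
Proof.
move=> sx sv xv; rewrite -(dim_plane xv); apply: dimvS.
by rewrite subv_add -!memvE !mem_lin_span.
Qed.

Lemma dim_ge1 sigma x : sigma x -> x != 0 -> (1 <= cone_dim sigma)%N.
Proof.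
move=> sx x0; have := dim_vline x; rewrite x0 /= => <-; apply: dimvS.
by rewrite -memvE mem_lin_span.
Qed.

Lemma rational_dim1 tau : rational_cone tau -> cone_dim tau = 1%N ->
  exists z, tau (rz z) /\ rz z != 0 :> V.
Proof.
move=> /rational_coneE[s ->] d; apply: contrapT => N.
have : (lin_span (Cone (map (@rz R n) s)) <= 0)%VS.
  rewrite lin_span_Cone; apply/span_subvP => _ /mapP[z zs ->]; rewrite memv0.
  apply/negPn/negP => z0; apply: N; exists z; split=> //; exact/Cone_mem/map_f.
by move/dimvS; rewrite -/(cone_dim _) d dimv0.
Qed.

Lemma rational_dim2 sigma x : rational_cone sigma -> cone_dim sigma = 2%N ->
  x != 0 -> exists z, sigma (rz z) /\ indep x (rz z).
Proof.
move=> /rational_coneE[s ->] d x0; apply: contrapT => N.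
have : (lin_span (Cone (map (@rz R n) s)) <= <[x]>)%VS.
  rewrite lin_span_Cone; apply/span_subvP => _ /mapP[z zs ->].
  apply/negPn/negP => zx; apply: N; exists z; split=> //; exact/Cone_mem/map_f.
by move/dimvS; rewrite -/(cone_dim _) d dim_vline x0.
Qed.

(** Division with remainder by a lattice vector of U on which l takes its least nonzero absolute
    value: the lattice of U modulo the kernel of l is infinite cyclic. *)
Lemma lattice_quotient_generator (U : {vspace V}) (l : 'cV[int]_n) t :
  rz t \in U -> (t *m l) 0 0 != 0 ->
  exists z, [/\ rz z \in U, 0 < pairing (rz z : V) (rl l) &
    forall y, Zn y -> y \in U -> exists a : int, pairing (y - a%:~R *: rz z) (rl l) = 0].
Proof.
pose ip (z : 'rV[int]_n) : int := (z *m l) 0 0.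
rewrite -/(ip t) => tU tl; pose P d := `[< (0 < d)%N /\ exists2 z : 'rV[int]_n, (rz z : V) \in U &
  absz (ip z) = d >].
have exP : exists d, P d.
  by exists (absz (ip t)); apply/asboolP; rewrite absz_gt0; split=> //; exists t.
case: (ex_minnP exP) => d /asboolP[d0 [z zU zd]] dmin.
have ipN (u : 'rV[int]_n) : ip (- u) = - ip u by rewrite /ip mulNmx mxE.
wlog zp : z zU zd / 0 < ip z.
  move=> W; have z0 : ip z != 0 by rewrite -absz_gt0 zd.
  have [lt|gt|e] := ltrgtP (ip z) 0; last by rewrite e eqxx in z0.
    by apply: (W (- z)); rewrite ?rzN ?memvN ?ipN ?abszN // oppr_gt0.
  exact: (W z).
exists z; split=> //; first by rewrite pairing_rz ltr0z.
move=> y /ZnP[s ->] sU; pose q := (ip s %/ ip z)%Z; exists q.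
rewrite -rzZ -rzN -rzD pairing_rz; apply/eqP; rewrite intr_eq0; apply/negPn/negP => ne.
have e : ip (s - q *: z) = (ip s %% ip z)%Z.
  by rewrite /modz -/q /ip mulmxBl -scalemxAl [LHS]mxE [X in _ + X]mxE [X in - X]mxE.
have : P (absz (ip (s - q *: z))).
  apply/asboolP; rewrite absz_gt0; split=> //; exists (s - q *: z) => //.
  by rewrite rzD rzN rzZ memvB ?memvZ.
move/dmin; rewrite leqNgt -zd => /negP; apply.
rewrite e -ltz_nat gez0_abs ?modz_ge0 ?gt_eqF // gtz0_abs //.
exact: ltz_pmod.
Qed.

(** The functional is y |-> s_i y_j - s_j y_i for some i with s_i nonzero; if it vanished at t for
    every j, then t would be a multiple of s. *)
Lemma separating_functional (s t : 'rV[int]_n) : indep (rz s) (rz t : V) ->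
  exists l : 'cV[int]_n, (s *m l) 0 0 = 0 /\ (t *m l) 0 0 != 0.
Proof.
move=> [s0 ts].
have [i si] : exists i, s 0 i != 0.
  apply: contrapT => N; case/eqP: s0; apply/rowP => i; rewrite !mxE.
  apply/eqP; rewrite intr_eq0; apply/negPn/negP => h; apply: N; by exists i.
have [j tj] : exists j, s 0 i * t 0 j - s 0 j * t 0 i != 0.
  apply: contrapT => N; case/negP: ts; apply/vlineP; exists ((t 0 i)%:~R / (s 0 i)%:~R).
  apply/rowP => j; rewrite !mxE; have si' : (s 0 i)%:~R != 0 :> R by rewrite intr_eq0.
  apply: (mulfI si'); rewrite mulrA mulrCA mulfV // mulr1 -!intrM; congr (_%:~R).
  by apply/eqP; rewrite -subr_eq0 [t 0 i * _]mulrC; apply/negPn/negP => h; apply: N; exists j.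
have E u : (u *m (s 0 i *: delta_mx j 0 - s 0 j *: delta_mx i 0 : 'cV[int]_n)) 0 0 =
    s 0 i * u 0 j - s 0 j * u 0 i.
  rewrite mulmxBr -!scalemxAr !mxE; congr (_ * _ - _ * _).
    rewrite (bigD1 j) //= big1 ?addr0 => [|k kj]; rewrite mxE ?eqxx ?mulr1 //.
    by rewrite (negbTE kj) mulr0.
  rewrite (bigD1 i) //= big1 ?addr0 => [|k kj]; rewrite mxE ?eqxx ?mulr1 //.
  by rewrite (negbTE kj) mulr0.
by exists (s 0 i *: delta_mx j 0 - s 0 j *: delta_mx i 0); rewrite !E mulrC subrr.
Qed.

(* v' generates the lattice of the plane spanned by x and v modulo the line Rx
   and points to the side of v. *)
Definition pgen x v v' : Prop :=
  [/\ Zn v', v' \in plane x v,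
      (forall y, Zn y -> y \in plane x v -> exists a : int, y - a%:~R *: v' \in <[x]>%VS) &
      exists a b, 0 < b /\ v' = a *: x + b *: v].

(* A fixed choice of a normal in each half-plane bounded by the line Rx, so that
   [Nset x] contains one vector for each rational half-plane. *)
Definition nrm x v : V := xget 0 [set v' | pgen x v v'].

Lemma plane_half x v v' a b : b != 0 -> v' = a *: x + b *: v -> plane x v' = plane x v.
Proof.
move=> b0 ->; apply/vspaceP => y; apply/planeP/planeP => -[c [d ->]].
  by exists (c + d * a), (d * b); apply/rowP => i; rewrite !mxE; ring.
by exists (c - d / b * a), (d / b); apply/rowP => i; rewrite !mxE; field.
Qed.

Lemma pgen_half x v v' a b : 0 < b -> v' = a *: x + b *: v -> pgen x v' = pgen x v.
Proof.
move=> b0 E; have pl : plane x v' = plane x v by apply: plane_half E; rewrite gt_eqF.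
apply/funext => u; apply/propext; rewrite /pgen pl; split=> -[h1 h2 h3 [c [d [d0 uE]]]]; split=> //.
  exists (c + d * a), (d * b); rewrite mulr_gt0 //; split=> //.
  by rewrite uE E; apply/rowP => i; rewrite !mxE; ring.
exists (c - d / b * a), (d / b); rewrite divr_gt0 //; split=> //.
have bn : b != 0 by rewrite gt_eqF.
by rewrite uE E; apply/rowP => i; rewrite !mxE; field.
Qed.

Lemma nrm_half x v v' a b : 0 < b -> v' = a *: x + b *: v -> nrm x v' = nrm x v.
Proof. by move=> b0 E; rewrite /nrm (pgen_half b0 E). Qed.

Lemma pgen_exists (s t : 'rV[int]_n) : indep (rz s) (rz t : V) ->
  exists v', pgen (rz s) (rz t) v'.
Proof.
move=> st; have [l0 [sl0 tl0]] := separating_functional st.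
have [l [sl tl]] : exists l : 'cV[int]_n, (s *m l) 0 0 = 0 /\ 0 < (t *m l) 0 0.
  have [lt|gt|e] := ltrgtP ((t *m l0) 0 0) 0; last by rewrite e eqxx in tl0.
    by exists (- l0); rewrite !mulmxN [X in X = 0]mxE [X in 0 < X]mxE sl0 oppr0 oppr_gt0.
  by exists l0.
have [||z [zU zl zg]] := @lattice_quotient_generator (plane (rz s) (rz t)) l t.
- by apply/planeP; exists 0, 1; rewrite scale0r scale1r add0r.
- by rewrite gt_eqF.
have tl' : 0 < pairing (rz t : V) (rl l) by rewrite pairing_rz ltr0z.
have sl' : pairing (rz s : V) (rl l) = 0 by rewrite pairing_rz sl.
have ker y : y \in plane (rz s) (rz t) -> pairing y (rl l) = 0 -> y \in <[rz s]>%VS.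
  move=> /planeP[a [b ->]]; rewrite !pairingE sl' mulr0 add0r => /eqP.
  by rewrite mulf_eq0 (gt_eqF tl') orbF => /eqP ->; rewrite scale0r addr0 memvZ ?memv_line.
exists (rz z); split=> //; first exact: Zn_rz.
  move=> y Zy yU; have [a ha] := zg y Zy yU; exists a; apply: ker => //.
  by rewrite memvB // memvZ.
case/planeP: zU zl => a [b E]; rewrite E !pairingE sl' mulr0 add0r => bt.
by exists a, b; split=> //; rewrite pmulr_lgt0 in bt.
Qed.

Lemma pgen_nrm x v : Zn x -> Zn v -> indep x v -> pgen x v (nrm x v).
Proof.
move=> /ZnP[s ->] /ZnP[t ->] /pgen_exists[v' H]; rewrite /nrm.
by case: xgetP => [u -> //|/(_ v')].
Qed.

Definition Nset x : set V := [set v | [/\ indep x v, pgen x v v & nrm x v = v]].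

Lemma indep_half x v v' a b : b != 0 -> v' = a *: x + b *: v -> indep x v -> indep x v'.
Proof.
move=> b0 E /indepP h; apply/indepP => c d; rewrite E => H.
have [|e1 /eqP] := h (c + d * a) (d * b).
  by rewrite -H; apply/rowP => i; rewrite !mxE; ring.
rewrite mulf_eq0 (negbTE b0) orbF => /eqP d0; split=> //.
by rewrite d0 mul0r addr0 in e1.
Qed.

Lemma nrm_Nset x v : Zn x -> Zn v -> indep x v -> Nset x (nrm x v).
Proof.
move=> Zx Zv xv; have P := pgen_nrm Zx Zv xv; have [_ _ _ [a [b [b0 E]]]] := P.
split; first by apply: indep_half E xv; rewrite gt_eqF.
  by rewrite (pgen_half b0 E).
exact: nrm_half E.
Qed.

(* sigma contains x and points near x in direction v; for sigma of dimension 2 and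
   x, v independent this only depends on the half-plane x + Rx + R_{>0} v. *)
Definition germ sigma x v := sigma x /\ exists2 e, 0 < e & sigma (x + e *: v).

Lemma germ_half sigma x v v' a b : convex_cone sigma -> 0 < b -> v' = a *: x + b *: v ->
  germ sigma x v -> germ sigma x v'.
Proof.
move=> [_ sD sZ] b0 -> [sx [e e0 se]]; split=> //.
pose c := e / b; have c0 : 0 < c by rewrite divr_gt0.
(* The number d makes [d + a] nonnegative; for a suitable small step, x plus that multiple of v' is
   a positive multiple of x + e v plus a nonnegative multiple of x. *)
pose d := Num.max 0 (- a) + 1.
have d0 : 0 < d by rewrite ltr_wpDl // le_max lexx.
have da : 0 <= d + a.
  rewrite /d; have : - a <= Num.max 0 (- a) by rewrite le_max lexx orbT.
  lra.
have bn : b != 0 by rewrite gt_eqF.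
exists (c / (1 + c * d)); first by rewrite divr_gt0 // addr_gt0 // mulr_gt0.
have nn : 1 + c * d != 0 by rewrite gt_eqF // addr_gt0 // mulr_gt0.
have ce : e = c * b by rewrite /c mulfVK.
have -> : x + (c / (1 + c * d)) *: (a *: x + b *: v) =
    (1 + c * d)^-1 *: ((x + e *: v) + (c * (d + a)) *: x).
  by apply/rowP => i; rewrite !mxE ce; field.
apply: (sZ); first by rewrite invr_ge0 addr_ge0 // mulr_ge0 // ltW.
by apply: (sD) => //; apply: (sZ) => //; rewrite mulr_ge0 // ltW.
Qed.

Lemma germ_span sigma x v : germ sigma x v -> v \in lin_span sigma.
Proof.
move=> [sx [e e0 se]]; rewrite -[v]scale1r -(mulVf (lt0r_neq0 e0)) -scalerA memvZ //.
by rewrite -[e *: v](addKr x) memvD ?memvN ?mem_lin_span.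
Qed.

Lemma germ_add sigma x y : convex_cone sigma -> sigma x -> sigma y -> germ sigma x y.
Proof. by move=> [_ sD _] sx sy; split=> //; exists 1; rewrite // scale1r; apply: sD. Qed.

Lemma face_line sigma tau x : face tau sigma -> cone_dim tau = 1%N -> tau x -> x != 0 ->
  cone_dim sigma = 2%N ->
  exists2 l, (forall y, sigma y -> 0 <= pairing y l) &
   pairing x l = 0 /\ forall v, v \in lin_span sigma -> v \notin <[x]>%VS -> pairing v l != 0.
Proof.
move=> [l l0 tE] d tx x0 ds; have := tx; rewrite tE => -[sx xl].
exists l => //; split=> // v vs vx; apply/eqP => vl.
have xv : indep x v by [].
have pl : lin_span sigma = plane x v by apply: span_plane => //; apply: mem_lin_span.
have st : sigma `<=` tau.
  move=> y sy; rewrite tE; split=> //.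
  have /planeP[a [b ->]] : y \in plane x v by rewrite -pl mem_lin_span.
  by rewrite !pairingE xl vl !mulr0 addr0.
by have := cone_dimS st; rewrite ds d.
Qed.

(** Equality of the predicates, and not only of the classes modulo Z_tau, makes
    [lattice_normal sigma tau] literally equal to [nrm x v]. The chosen normal thus depends on the
    half-plane alone and survives refinement. *)
Lemma primitive_generator_pgen sigma tau x v : rational_cone sigma -> cone_dim sigma = 2%N ->
  face tau sigma -> cone_dim tau = 1%N -> tau x -> x != 0 ->
  germ sigma x v -> v \notin <[x]>%VS ->
  primitive_generator sigma tau = pgen x v.
Proof.
move=> rs ds ft dt tx x0 gv vx; have [sx [e e0 se]] := gv.
have cs := rational_convex_cone rs; have [_ sD sZ] := cs.
have vs := germ_span gv.
have [l l0 [xl vl]] := face_line ft dt tx x0 ds.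
have st : lin_span tau = <[x]>%VS by apply: span_line => //; apply: mem_lin_span.
have ss : lin_span sigma = plane x v by apply: span_plane => //; apply: mem_lin_span.
have vlp : 0 < pairing v l.
  rewrite lt_def vl //; have := l0 _ se; rewrite !pairingE xl add0r pmulr_rge0 //.
apply/funext => u; apply/propext; split.
  move=> [[Zu us] gen [w wt su]]; rewrite /pgen -ss; split=> //.
    by move=> y Zy ys; have [a [_ ha]] := gen y (conj Zy ys); exists a; rewrite -st.
  have /planeP[a [b uE]] : u \in plane x v by rewrite -ss.
  exists a, b; split=> //.
  have : 0 <= pairing (u + w) l by apply: l0.
  have -> : pairing (u + w) l = b * pairing v l.
    rewrite st in wt; case/vlineP: wt => k ->.
    by rewrite uE !pairingE xl !mulr0 add0r addr0.
  (* If b = 0 then u lies on the line of tau, and so would every lattice vector of sigma, contrary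
     to dimension 2. *)
  rewrite pmulr_lge0 // le_eqVlt => /orP[/eqP b0|//].
  have [t [srt [xt0 xt]]] := rational_dim2 rs ds x0.
  have [k [_]] := gen (rz t) (conj (Zn_rz t) (mem_lin_span srt)).
  rewrite st uE -b0 scale0r addr0 => h; case/negP: xt.
  by rewrite -[rz t](subrK (k%:~R *: (a *: x))) memvD // !memvZ ?memv_line.
move=> [Zu us gen [a [b [b0 uE]]]]; split.
- by split=> //; rewrite ss.
- move=> y [Zy ys]; rewrite ss in ys; have [c hc] := gen y Zy ys; exists c.
  by split; [apply: ZnB => //; apply: ZnZ|rewrite st].
exists ((b / e - a) *: x); first by rewrite st memvZ ?memv_line.
have en : e != 0 by rewrite gt_eqF.
have -> : u + (b / e - a) *: x = (b / e) *: (x + e *: v).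
  by rewrite uE; apply/rowP => i; rewrite !mxE; field.
by apply: sZ => //; rewrite divr_ge0 ?ltW.
Qed.

Lemma Nset_ray sigma tau x : rational_cone sigma -> cone_dim sigma = 2%N ->
  face tau sigma -> cone_dim tau = 1%N -> tau x -> x != 0 -> Zn x ->
  Nset x `&` germ sigma x = [set lattice_normal sigma tau] /\
  indep x (lattice_normal sigma tau) /\ primitive_generator sigma tau (lattice_normal sigma tau).
Proof.
move=> rs ds ft dt tx x0 Zx; have cs := rational_convex_cone rs.
have sx : sigma x by apply: (face_sub ft).
have [z [sz xz]] := rational_dim2 rs ds x0.
have gz := germ_add cs sx sz.
have key v : germ sigma x v -> v \notin <[x]>%VS -> lattice_normal sigma tau = nrm x v.
  by move=> gv vx; rewrite /lattice_normal (primitive_generator_pgen rs ds ft dt tx x0 gv vx).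
have zx : rz z \notin <[x]>%VS by case: xz.
have P := pgen_nrm Zx (Zn_rz z) xz.
have [Ni Np Nn] := nrm_Nset Zx (Zn_rz z) xz.
rewrite (key _ gz zx); split; last first.
  by split=> //; rewrite (primitive_generator_pgen rs ds ft dt tx x0 gz zx).
apply/seteqP; split=> v /=.
  by move=> [[vi vp vn] gv]; case: (vi) => _ vx; rewrite -vn -(key _ gz zx) -(key _ gv vx).
move=> ->; split; first exact: (nrm_Nset Zx (Zn_rz z) xz).
by case: P => _ _ _ [a [b [b0 E]]]; apply: germ_half E gz.
Qed.

Lemma small_step (s : seq (R * R)) :
  (forall p, p \in s -> 0 < p.1 \/ 0 <= p.1 /\ p.2 <= 0) ->
  exists2 e, 0 < e & forall p, p \in s -> e * p.2 <= p.1.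
Proof.
elim: s => [|p s IH] h; first by exists 1.
have [q qs|e e0 he] := IH; first by apply: h; rewrite inE qs orbT.
have [p1|[p1 p2]] := h p (mem_head _ _).
  exists (Num.min e (p.1 / (`|p.2| + 1))).
    by rewrite lt_min e0 divr_gt0 // ltr_wpDl.
  move=> q; rewrite inE => /orP[/eqP->|qs].
    have [p2|p2] := leP p.2 0.
      apply: le_trans (ltW p1); apply: mulr_ge0_le0 => //.
      by rewrite le_min ltW //= divr_ge0 // ?ltW // ltr_wpDl.
    apply: (@le_trans _ _ (p.1 / (`|p.2| + 1) * p.2)).
      by apply: ler_wpM2r; [exact: ltW|rewrite ge_min lexx orbT].
    rewrite mulrAC ler_pdivrMr ?ltr_wpDl // ler_wpM2l // ?ltW //.
    by rewrite gtr0_norm // ltrDl.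
  have [q2|q2] := leP q.2 0.
    apply: (@le_trans _ _ 0); last first.
      by case: (h q); [rewrite inE qs orbT|apply: ltW|case].
    apply: mulr_ge0_le0 => //.
    by rewrite le_min ltW //= divr_ge0 // ?ltW // ltr_wpDl.
  by apply: le_trans (he q qs); apply: ler_wpM2r; [exact: ltW|rewrite ge_min lexx].
exists e => // q; rewrite inE => /orP[/eqP->|]; last exact: he.
by apply: le_trans p1; apply: mulr_ge0_le0 => //; apply: ltW.
Qed.

(** As x lies on no ray of sigma, the cone fills a neighbourhood of x in its plane, and both
    half-planes at x are germs of sigma. Their normals generate the same infinite cyclic quotient
    and point to opposite sides, so v' is - v modulo x. *)
Lemma Nset_interior sigma x : rational_cone sigma -> cone_dim sigma = 2%N ->
  sigma x -> x != 0 -> Zn x -> (forall tau, face tau sigma -> cone_dim tau = 1%N -> ~ tau x) ->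
  exists v v' c, [/\ Nset x `&` germ sigma x = [set v; v'], v <> v', v' = - v + c *: x,
     indep x v & lin_span sigma = plane x v /\ (forall y, Zn y -> y \in lin_span sigma -> exists a : int, y - a%:~R *: v \in <[x]>%VS)].
Proof.
move=> rs ds sx x0 Zx nf; have cs := rational_convex_cone rs.
have [z [sz xz]] := rational_dim2 rs ds x0.
have gz := germ_add cs sx sz.
have pl : lin_span sigma = plane x (rz z).
  by apply: span_plane => //; apply: mem_lin_span.
have gN : germ sigma x (- rz z).
  have [L HL] := rational_cone_hrep rs.
  (* An inequality of sigma that vanishes at x but not at z would cut out a ray of sigma through
     x. *)
  have zero l : l \in L -> pairing x (rl l) = 0 -> pairing (rz z) (rl l) = 0.
    move=> lL xl; apply/eqP/negPn/negP => zl.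
    pose tau := [set y | sigma y /\ pairing y (rl l) = 0].
    have ft : face tau sigma by exists (rl l) => // y /HL h; apply: h.
    apply: (nf tau ft) => //; apply/eqP; rewrite eqn_leq (@dim_ge1 tau x) // andbT.
    have : (lin_span tau <= <[x]>)%VS.
      apply: lin_span_min => y [sy yl].
      have : y \in plane x (rz z) by rewrite -pl mem_lin_span.
      case/planeP=> a [b E]; move: yl; rewrite E !pairingE xl mulr0 add0r => /eqP.
      rewrite mulf_eq0 (negbTE zl) orbF => /eqP->.
      by rewrite scale0r addr0 memvZ ?memv_line.
    by move/dimvS; rewrite dim_vline x0.
  have [p|e e0 he] := @small_step [seq (pairing x (rl l), pairing (rz z) (rl l)) | l <- L].
    move=> /mapP[l lL ->] /=; have h := (HL x).1 sx l lL.
    have [e|ne] := eqVneq (pairing x (rl l)) 0; last by left; rewrite lt_def ne h.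
    by right; rewrite e zero.
  split=> //; exists e => //; apply/HL => l lL.
  by have := he _ (map_f _ lL) => /= h; rewrite !pairingE mulrN subr_ge0.
have Zz := Zn_rz z.
have xNz : indep x (- rz z) by apply: (@indep_half _ (rz z) _ 0 (-1)) xz; rewrite ?oppr_eq0 ?oner_eq0 // scale0r add0r scaleN1r.
pose v := nrm x (rz z); pose v' := nrm x (- rz z).
have [Pv1 Pv2 Pv3 [a [b [b0 vE]]]] := pgen_nrm Zx Zz xz.
have [Pv1' Pv2' Pv3' [a' [b' [b0' vE']]]] := pgen_nrm Zx (ZnN Zz) xNz.
rewrite -/v in vE Pv1 Pv2 Pv3; rewrite -/v' in vE' Pv1' Pv2' Pv3'.
have plN : plane x (- rz z) = plane x (rz z).
  by apply: (@plane_half _ _ _ 0 (-1)); rewrite ?oppr_eq0 ?oner_eq0 // scale0r add0r scaleN1r.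
rewrite plN in Pv2' Pv3'.
have [k /vlineP[c kE]] := Pv3 v' Pv1' Pv2'.
have [k' /vlineP[c' kE']] := Pv3' v Pv1 Pv2.
have iv : indep x v by apply: indep_half vE xz; rewrite gt_eqF.
have E1 : v' = k%:~R *: v + c *: x by rewrite -kE addrC subrK.
have E2 : v = k'%:~R *: v' + c' *: x by rewrite -kE' addrC subrK.
have kk : k * k' = 1.
  have [|_] := @indep_coeff x v 0 1 (k'%:~R * c + c') (k'%:~R * k%:~R) iv.
    rewrite {1}E2 {1}E1 ; apply/rowP => i; rewrite !mxE; ring.
  by move/eqP; rewrite -intrM mulrC eq_sym -[1]/(1%:~R) eqr_int => /eqP.
have kneg : k < 0.
  have [|_ H] := @indep_coeff x (rz z) a' (- b') (k%:~R * a + c) (k%:~R * b) xz.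
    rewrite scaleNr -scalerN -vE' E1 vE; apply/rowP => i; rewrite !mxE; ring.
  have : k%:~R * b < 0 by rewrite -H oppr_lt0.
  by rewrite pmulr_llt0 // ltrz0.
have k1 : k = -1.
  have /eqP := congr1 absz kk; rewrite abszM muln_eq1 => /andP[/eqP ka _].
  by rewrite -[k]opprK -(ltz0_abs kneg) ka.
exists v, v', c; split=> //.
- apply/seteqP; split=> u /=.
    move=> [[ui up un] gu]; have us : u \in lin_span sigma by apply: germ_span gu.
    rewrite pl in us; case/planeP: us => d [f uE].
    have [lt|gt|f0] := ltrgtP f 0.
    + right; rewrite -un; apply: (@nrm_half _ _ _ d (- f)); first by rewrite oppr_gt0.
      by rewrite scalerN scaleNr opprK.
    + by left; rewrite -un; apply: nrm_half uE.
    + by case: ui => _ /negP[]; rewrite uE f0 scale0r addr0 memvZ ?memv_line.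
  case=> ->; split; [exact: nrm_Nset|exact: germ_half vE gz|exact: (nrm_Nset Zx (ZnN Zz) xNz)|exact: germ_half vE' gN].
- move=> vv'; have [|_] := @indep_coeff x v 0 1 c (-1) iv.
    by rewrite scale0r add0r scale1r scaleN1r {1}vv' E1 k1 scaleN1r addrC.
  lra.
- by rewrite E1 k1 scaleN1r.
by rewrite pl; split=> //; rewrite (plane_half _ vE) // gt_eqF.
Qed.

End LatticeNormals.

(** * Densities and local weights of divisors *)

Section Germs.
Context {R : realType} {n : nat}.
Local Notation V := 'rV[R]_n.
Local Notation rl := (@realify R n).
Implicit Types (x y v w : V) (sigma tau rho kappa : set V) (F : wfan R n) (f g : V -> R).

Lemma face_eq_dim sigma tau : face tau sigma -> (cone_dim sigma <= cone_dim tau)%N -> tau = sigma.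
Proof.
move=> ft d; have E := lin_span_eq (face_sub ft) d.
apply/seteqP; split; first exact: face_sub.
case: (ft) => l l0 tE x sx; rewrite tE; split=> //.
have h : (lin_span tau <= lker (linfun (mulmxr l : V -> 'rV_1)))%VS.
  apply: lin_span_min => y; rewrite tE => -[_ e]; rewrite memv_ker lfunE /=.
  by apply/eqP/rowP => i; rewrite [i]ord1 [RHS]mxE; exact: e.
have : x \in lin_span tau by rewrite E mem_lin_span.
by move/(subvP h); rewrite memv_ker lfunE /= => /eqP/rowP/(_ 0); rewrite [RHS]mxE.
Qed.

Lemma cones_dim_eq F k sigma rho kappa : is_fan (cones F) -> cones_of_dim F k sigma ->
  cones_of_dim F k rho -> kappa `<=` sigma -> kappa `<=` rho -> (k <= cone_dim kappa)%N ->
  sigma = rho.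
Proof.
move=> [_ _ _ fI] [Fs ds] [Fr dr] ks kr dk.
have [f1 f2] := fI _ _ Fs Fr.
have d : (k <= cone_dim (sigma `&` rho))%N.
  by apply: leq_trans dk _; apply: cone_dimS => x kx; split; [apply: ks|apply: kr].
by rewrite -(face_eq_dim f1) ?ds // (face_eq_dim f2) ?dr.
Qed.

Lemma fan_ray_face F tau sigma x : is_fan (cones F) -> cones_of_dim F 1 tau -> tau x -> x != 0 ->
  cones F sigma -> sigma x -> face tau sigma.
Proof.
move=> [_ _ _ fI] [Ft dt] tx x0 Fs sx; have [f1 f2] := fI _ _ Ft Fs.
by rewrite -(face_eq_dim f1) // dt; apply: dim_ge1 x0.
Qed.

Lemma finite_cones_of_dim F k : is_fan (cones F) -> finite_set (cones_of_dim F k).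
Proof. by case=> h _ _ _; apply: sub_finite_set h => s []. Qed.

Lemma finite_star F k tau : is_fan (cones F) -> finite_set (star F k tau).
Proof. by move/(finite_cones_of_dim k); apply: sub_finite_set => s []. Qed.

(** Common form of the densities of 2-cycles, 1-cycles and pushforwards: [G] selects cones and [Th]
    is an extra factor. Invariance under refinement is then proved once, in [wsum_refine]. *)
Definition wsum k F (G : set V -> Prop) (Th : set V -> R) : R :=
  \sum_(sigma \in cones_of_dim F k) (if `[< G sigma >] then (weight F sigma)%:R * Th sigma else 0).

(* The weight of the 2-cone with germ (x, v): unlike the cones of F, this is an
   invariant of the cycle and determines it. *)
Definition delta F x v : R := wsum 2 F (fun sigma => germ sigma x v) (fun=> 1).

Lemma finite_Nset_germ F x sigma : is_fan (cones F) -> Zn x -> x != 0 ->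
  cones_of_dim F 2 sigma -> finite_set (Nset x `&` germ sigma x).
Proof.
move=> [_ rF _ _] Zx x0 [Fs ds]; have rs := rF _ Fs.
have [sx|nsx] := pselect (sigma x); last first.
  by have -> : Nset x `&` germ sigma x = set0 by apply/seteqP; split=> // v [_ []].
have [[tau ft [dt tx]]|N] := pselect (exists2 tau, face tau sigma & cone_dim tau = 1%N /\ tau x).
  by have [-> _] := Nset_ray rs ds ft dt tx x0 Zx.
have [|v [v' [c [-> _ _ _ _]]]] := Nset_interior rs ds sx x0 Zx; last by rewrite finite_setU.
by move=> tau ft dt tx; apply: N; exists tau.
Qed.

(** N may be infinite, as [Nset x] or [Prim] are; only the vectors selected by the finitely many s
    in S contribute. *)
Lemma fsum_exchange (I J : choiceType) (M : lmodType R) (S : set I) (N : set J)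
    (G : I -> J -> Prop) (w : I -> R) (g : J -> M) : finite_set S ->
  (forall s, S s -> finite_set (N `&` G s)) ->
  \sum_(v \in N) (\sum_(s \in S) if `[< G s v >] then w s else 0) *: g v =
  \sum_(s \in S) w s *: \sum_(v \in N `&` G s) g v.
Proof.
move=> fc fN; pose K := \bigcup_(s in S) (N `&` G s).
have fK : finite_set K by apply: bigcup_finite.
rewrite -(@fsbig_widen _ _ _ _ K); last 2 first.
- by move=> v [s _ []].
- move=> v [Nv nK] /=; rewrite fsbig1 ?scale0r // => s Fs.
  by case: asboolP => // gv; case: nK; exists s.
transitivity (\sum_(v \in K) \sum_(s \in S) (if `[< G s v >] then w s *: g v else 0)).
  apply: eq_fsbigr => v _; rewrite !fsbig_finite //= scaler_suml.
  by apply: eq_bigr => s _; case: asboolP; rewrite ?scale0r.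
rewrite exchange_fsbig //; apply: eq_fsbigr => s; rewrite inE => Fs.
have fNs := fN _ Fs.
transitivity (\sum_(v \in N `&` G s) (if `[< G s v >] then w s *: g v else 0)).
  apply/esym/fsbig_widen => [v h|v [Kv nv] /=]; first by exists s.
  by case: asboolP => // gv; case: nv; case: Kv => s' _ [].
rewrite !fsbig_finite //= scaler_sumr; apply: eq_big_seq => v.
by rewrite in_fset_set // inE => -[_ gv]; case: asboolP.
Qed.

Lemma germ_sum (M : lmodType R) F x (g : V -> M) : is_fan (cones F) -> Zn x -> x != 0 ->
  \sum_(v \in Nset x) delta F x v *: g v =
  \sum_(sigma \in cones_of_dim F 2) (weight F sigma)%:R *: \sum_(v \in Nset x `&` germ sigma x) g v.
Proof.
move=> fF Zx x0; rewrite -(fsum_exchange (G := fun s => germ s x)).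
- apply: eq_fsbigr => v _; congr (_ *: _); apply: eq_fsbigr => s _.
  by case: ifP; rewrite ?mulr1.
- exact: finite_cones_of_dim.
- by move=> s Fs; apply: finite_Nset_germ Fs.
Qed.

End Germs.

Section LocalWeights.
Context {R : realType} {n : nat}.
Local Notation V := 'rV[R]_n.
Local Notation rl := (@realify R n).
Implicit Types (x y v w : V) (sigma tau rho kappa : set V) (F : wfan R n) (f g : V -> R).

(** Versions of [linear_on] and [linear_ext] for arbitrary real functions: linear functionals, and
    tropical functions composed with a linear map, have to be inserted into the same formulas. *)
Definition lin_on f sigma := exists l : 'cV[R]_n, forall x, sigma x -> f x = pairing x l.
Definition lext f sigma : 'cV[R]_n := xget 0 [set l | forall x, sigma x -> f x = pairing x l].
Definition lin_on_fan f F := forall sigma, cones F sigma -> lin_on f sigma.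

Lemma lextE f sigma x : lin_on f sigma -> sigma x -> f x = pairing x (lext f sigma).
Proof. by move=> [l h]; rewrite /lext; case: xgetP => [l' -> h' /h'|/(_ l)]. Qed.

Lemma pairing_span (A : set V) (l l' : 'cV[R]_n) x : (forall y, A y -> pairing y l = pairing y l') ->
  x \in lin_span A -> pairing x l = pairing x l'.
Proof.
move=> h xA.
have H : (lin_span A <= lker (linfun (mulmxr (l - l') : V -> 'rV_1)))%VS.
  apply: lin_span_min => y /h e; rewrite memv_ker lfunE /=.
  apply/eqP/rowP => i; rewrite [i]ord1 [RHS]mxE -/(pairing y (l - l')) pairingBr e.
  exact: subrr.
move: xA => /(subvP H); rewrite memv_ker lfunE /= => /eqP/rowP/(_ 0).
by rewrite [RHS]mxE -/(pairing x (l - l')) pairingBr => /eqP; rewrite subr_eq0 => /eqP.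
Qed.

(** The one-sided derivative of a piecewise linear function, taken as the slope on an initial
    segment. *)
Definition der f x v : R := xget 0 [set c | exists2 e0, 0 < e0 &
  forall e, 0 <= e <= e0 -> f (x + e *: v) = f x + e * c].

Lemma derE f x v c e0 : 0 < e0 -> (forall e, 0 <= e <= e0 -> f (x + e *: v) = f x + e * c) ->
  der f x v = c.
Proof.
move=> e00 h; rewrite /der; case: xgetP => [d -> [d0 d00 h']|/(_ c)]; last by case; exists e0.
pose m := Num.min e0 d0; have m0 : 0 < m by rewrite lt_min e00.
have m1 : 0 <= m <= d0 by rewrite ltW //= ge_min lexx orbT.
have m2 : 0 <= m <= e0 by rewrite ltW //= ge_min lexx.
have := h m m2; rewrite (h' m m1) => /addrI/mulfI -> //.
by rewrite gt_eqF.
Qed.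

Lemma der_lin f sigma x v (l : 'cV[R]_n) : convex_cone sigma -> (forall y, sigma y -> f y = pairing y l) ->
  germ sigma x v -> der f x v = pairing v l.
Proof.
move=> [_ sD sZ] h [sx [e0 e00 se]]; apply: (derE e00) => e /andP[e1 e2].
rewrite !h // ?pairingE //.
have -> : x + e *: v = (1 - e / e0) *: x + (e / e0) *: (x + e0 *: v).
  by apply/rowP => i; rewrite !mxE; field; rewrite gt_eqF.
apply: (sD); apply: (sZ) => //; last by rewrite divr_ge0 // ltW.
by rewrite subr_ge0 ler_pdivrMr // mul1r.
Qed.

Lemma der_lext f sigma x v : convex_cone sigma -> lin_on f sigma -> germ sigma x v ->
  der f x v = pairing v (lext f sigma).
Proof. by move=> cs ls; apply: der_lin => // y; apply: lextE. Qed.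

(* The weight of the divisor of f at the ray of x, written with the density d instead
   of the cones. *)
Definition is_W (d : V -> V -> R) f x (r : R) : Prop :=
  exists2 k : R, \sum_(v \in Nset x) d x v *: v = k *: x &
    r = \sum_(v \in Nset x) d x v * der f x v - k * f x.

Lemma is_W_unique d f x r r' : x != 0 -> is_W d f x r -> is_W d f x r' -> r = r'.
Proof.
move=> x0 [k E ->] [k']; rewrite E => /eqP; rewrite -subr_eq0 -scalerBl scaler_eq0 (negbTE x0).
by rewrite orbF subr_eq0 => /eqP-> ->.
Qed.

Definition Wt f F tau : R :=
  \sum_(sigma \in star F 2 tau) pairing ((weight F sigma)%:R *: lattice_normal sigma tau) (lext f sigma)
  - pairing (weighted_normals F 2 tau) (lext f tau).

Lemma germ_sum_ray (M : lmodType R) F x tau (g : V -> M) : is_fan (cones F) -> Zn x -> x != 0 ->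
  cones_of_dim F 1 tau -> tau x ->
  \sum_(v \in Nset x) delta F x v *: g v =
  \sum_(sigma \in star F 2 tau) (weight F sigma)%:R *: g (lattice_normal sigma tau).
Proof.
move=> fF Zx x0 Ft tx; rewrite germ_sum //.
transitivity (\sum_(s \in star F 2 tau) (weight F s)%:R *: \sum_(v \in Nset x `&` germ s x) g v).
  apply/esym/fsbig_widen => [s []//|s [Fs ns] /=].
  rewrite fsbig1 ?scaler0 // => v [_ [sx _]]; case: ns; split=> //.
  by apply: (fan_ray_face fF Ft tx x0) => //; case: Fs.
apply: eq_fsbigr => s; rewrite inE => -[[Fs ds] fs]; congr (_ *: _).
have [_ rF _ _] := fF; case: Ft => _ dt.
by have [-> _] := Nset_ray (rF _ Fs) ds fs dt tx x0 Zx; rewrite fsbig_set1.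
Qed.

Lemma weighted_normalsE F tau x : is_fan (cones F) -> Zn x -> x != 0 ->
  cones_of_dim F 1 tau -> tau x ->
  \sum_(v \in Nset x) delta F x v *: v = weighted_normals F 2 tau.
Proof. by move=> *; rewrite (@germ_sum_ray V F x tau id). Qed.

Lemma span_ray tau x : cone_dim tau = 1%N -> tau x -> x != 0 -> lin_span tau = <[x]>%VS.
Proof. by move=> d tx; apply: span_line => //; apply: mem_lin_span. Qed.

Lemma is_W_ray F f tau x : is_fan (cones F) -> balanced F 2 -> lin_on_fan f F -> Zn x -> x != 0 ->
  cones_of_dim F 1 tau -> tau x -> is_W (delta F) f x (Wt f F tau).
Proof.
move=> fF bF lF Zx x0 Ft tx; have [Ftau dt] := Ft; have [_ rF _ _] := fF.
have st := span_ray dt tx x0.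
have := bF _ Ftau; rewrite dt => /(_ erefl); rewrite st => /vlineP[k E].
exists k; first by rewrite (weighted_normalsE fF Zx x0 Ft tx).
rewrite /Wt E pairingZl -(lextE (lF _ Ftau) tx); congr (_ - _).
rewrite -[RHS]/(\sum_(v \in Nset x) delta F x v *: (der f x v : R^o)) (germ_sum_ray _ fF Zx x0 Ft tx).
apply: eq_fsbigr => s; rewrite inE => -[[Fs ds] fs]; rewrite pairingZl; congr (_ * _).
have cs := rational_convex_cone (rF _ Fs).
have [NE _] := Nset_ray (rF _ Fs) ds fs dt tx x0 Zx.
have [_ gs] : (Nset x `&` germ s x) (lattice_normal s tau) by rewrite NE.
by rewrite (der_lext cs (lF _ Fs) gs).
Qed.

(** A point off all rays lies in at most one 2-cone, and only the two opposite directions of that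
    cone count; their sum is a multiple of x. *)
Lemma delta_off (M : lmodType R) F x (g : V -> M) : is_fan (cones F) -> Zn x -> x != 0 ->
  (forall tau, cones_of_dim F 1 tau -> ~ tau x) ->
  (\sum_(v \in Nset x) delta F x v *: g v = 0 /\ \sum_(v \in Nset x) delta F x v *: v = 0) \/
  exists s v c, [/\ cones_of_dim F 2 s, germ s x v, germ s x (- v + c *: x),
    \sum_(v \in Nset x) delta F x v *: g v = (weight F s)%:R *: (g v + g (- v + c *: x)) &
    \sum_(v \in Nset x) delta F x v *: v = ((weight F s)%:R * c) *: x].
Proof.
move=> fF Zx x0 off; have [_ rF cF _] := fF.
have [[s [Fs sx]]|N] := pselect (exists s, cones_of_dim F 2 s /\ s x); last first.
  by left; split; rewrite (germ_sum _ fF Zx x0) fsbig1 // => s Fs;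
    rewrite fsbig1 ?scaler0 // => v [_ [sx _]]; case: N; exists s.
have [Fs1 ds] := Fs.
have [|v [v' [c [NE vv' v'E iv _]]]] := Nset_interior (rF _ Fs1) ds sx x0 Zx.
  by move=> tau ft dt; apply: off; split=> //; apply: cF ft.
right; exists s, v, c.
have uniq s' : cones_of_dim F 2 s' -> s' x -> s' = s.
  move=> Fs' sx'; have [Fs1' ds'] := Fs'; have [_ _ _ fI] := fF; have [f1 f2] := fI _ _ Fs1' Fs1.
  have dI : (1 <= cone_dim (s' `&` s))%N by apply: dim_ge1 x0.
  have [d2|d1] := leqP 2 (cone_dim (s' `&` s)).
    by apply: (cones_dim_eq fF Fs' Fs _ _ d2) => y [].
  case: (off (s' `&` s)) => //; split; first exact: cF f1.
  by apply/eqP; rewrite eqn_leq dI andbT.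
have H (M' : lmodType R) (g' : V -> M') :
    \sum_(v \in Nset x) delta F x v *: g' v = (weight F s)%:R *: (g' v + g' (- v + c *: x)).
  rewrite (germ_sum _ fF Zx x0) -(@fsbig_widen _ _ _ _ [set s]).
  - rewrite fsbig_set1 NE fsbigU0 //; last by move=> u [-> /vv'].
    by rewrite !fsbig_set1 v'E.
  - by move=> s' ->.
  - move=> s' [Fs' ns] /=; rewrite fsbig1 ?scaler0 // => u [_ [sx' _]].
    by case: ns; rewrite (uniq s').
have gs u : [set v; v'] u -> germ s x u by rewrite -NE => -[].
split=> //.
- by apply: gs; left.
- by apply: gs; right; rewrite v'E.
by rewrite H addrA subrr add0r scalerA.
Qed.

(** Near such a point f is linear on the support, so its divisor has weight 0 there. Together with
    [is_W_ray] the local weight is known at every nonzero lattice vector, whichever rays F happens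
    to have. *)
Lemma is_W_off F f x : is_fan (cones F) -> lin_on_fan f F -> Zn x -> x != 0 ->
  (forall tau, cones_of_dim F 1 tau -> ~ tau x) -> is_W (delta F) f x 0.
Proof.
move=> fF lF Zx x0 off; have [_ rF cF _] := fF.
have [[H1 H2]|[s [v [c [[Fs ds] g1 g2 H1 H2]]]]] := @delta_off R^o F x (fun v => der f x v : R^o) fF Zx x0 off.
  exists 0; first by rewrite H2 scale0r.
  by rewrite mul0r subr0; exact: esym H1.
exists ((weight F s)%:R * c) => //.
rewrite [X in X - _]H1.
have cs := rational_convex_cone (rF _ Fs).
have sx : s x by case: g1.
rewrite (der_lext cs (lF _ Fs) g1) (der_lext cs (lF _ Fs) g2) (lextE (lF _ Fs) sx).
by rewrite !pairingE /GRing.scale /=; ring.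
Qed.

(** Balancing stated at every lattice vector, whether or not it lies on a ray of F. With the
    converse [balanced_delta] it becomes a property of the density, inherited by every fan with the
    same density. *)
Lemma delta_balanced F x : is_fan (cones F) -> balanced F 2 -> Zn x -> x != 0 ->
  exists k, \sum_(v \in Nset x) delta F x v *: v = k *: x.
Proof.
move=> fF bF Zx x0.
have [[tau [Ft tx]]|N] := pselect (exists tau, cones_of_dim F 1 tau /\ tau x).
  have [Ftau dt] := Ft; have := bF _ Ftau; rewrite dt => /(_ erefl).
  by rewrite (span_ray dt tx x0) -(weighted_normalsE fF Zx x0 Ft tx) => /vlineP[k ->]; exists k.
have [|[_ H]|[s [v [c [_ _ _ _ H]]]]] := @delta_off V F x id fF Zx x0.
- by move=> tau Ft tx; apply: N; exists tau.
- by exists 0; rewrite scale0r.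
by exists ((weight F s)%:R * c).
Qed.

Lemma balanced_delta F : is_fan (cones F) ->
  (forall x, Zn x -> x != 0 -> exists k, \sum_(v \in Nset x) delta F x v *: v = k *: x) ->
  balanced F 2.
Proof.
move=> fF h tau Ftau [dt]; have [_ rF _ _] := fF.
have [z [tz z0]] := rational_dim1 (rF _ Ftau) dt.
have [k E] := h _ (Zn_rz z) z0.
rewrite -(@weighted_normalsE F tau (rz z)) // ?E; last exact: Zn_rz.
by rewrite memvZ // mem_lin_span.
Qed.

(** The parameters e >= 0 with x + e v in a polyhedral cone form a closed interval, so arbitrarily
    small positive ones force x itself into sigma. *)
Lemma rational_germ sigma x v : rational_cone sigma ->
  (forall e0, 0 < e0 -> exists2 e, 0 < e < e0 & sigma (x + e *: v)) -> germ sigma x v.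
Proof.
move=> rs h; have [L HL] := rational_cone_hrep rs.
have sx : sigma x.
  apply/HL => l lL; rewrite leNgt; apply/negP => xl.
  have [|e e0 he] := @small_step R [:: (- pairing x (rl l) / 2, pairing v (rl l))].
    by move=> p; rewrite inE => /eqP-> /=; left; rewrite divr_gt0 // oppr_gt0.
  have := he _ (mem_head _ _) => /= E; have [e' /andP[e0' lt] /HL/(_ l lL)] := h e e0.
  rewrite !pairingE; have [v0|v0] := leP (pairing v (rl l)) 0.
    have : e' * pairing v (rl l) <= 0 by rewrite mulr_ge0_le0 // ltW.
    lra.
  have : e' * pairing v (rl l) <= e * pairing v (rl l) by rewrite ler_wpM2r // ltW.
  lra.
by split=> //; have [e /andP[e0 _] se] := h 1 ltr01; exists e.
Qed.

(** If no cone had the germ, each of the finitely many cones would miss an initial open piece of the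
    segment, and so would their union. *)
Lemma germ_cover (C : set (set V)) x v : finite_set C -> (forall s, C s -> rational_cone s) ->
  (exists2 e0, 0 < e0 & forall e, 0 < e < e0 -> exists2 s, C s & s (x + e *: v)) ->
  exists2 s, C s & germ s x v.
Proof.
move=> /finite_seqP[S ->] rC [e0 e00 cov]; apply: contrapT => N.
have key (S' : seq (set V)) : {subset S' <= S} -> exists2 e1, 0 < e1 & forall s, s \in S' ->
    forall e, 0 < e < e1 -> ~ s (x + e *: v).
  elim: S' => [|s S' IH] sub; first by exists 1.
  have [t tS|e1 e10 h1] := IH; first by apply: sub; rewrite inE tS orbT.
  have Ss : [set` S] s by apply: sub; apply: mem_head.
  have [e2 e20 h2] : exists2 e2, 0 < e2 & forall e, 0 < e < e2 -> ~ s (x + e *: v).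
    apply: contrapT => N2; apply: N; exists s => //; apply: rational_germ; first exact: rC.
    move=> e2 e20; apply: contrapT => N3; apply: N2; exists e2 => // e he se.
    by apply: N3; exists e.
  exists (Num.min e1 e2); first by rewrite lt_min e10.
  move=> t; rewrite inE => /orP[/eqP->|tS] e; rewrite lt_min => /and3P[e_ lt1 lt2].
    by apply: h2; rewrite e_.
  by apply: h1 => //; rewrite e_.
have [//|e1 e10 h1] := key S.
pose e := Num.min e0 e1 / 2.
have m0 : 0 < Num.min e0 e1 by rewrite lt_min e00.
have eb : 0 < e < Num.min e0 e1 by rewrite /e; apply/andP; split; lra.
have [|s Ss se] := cov e.
  by case/andP: eb => -> /lt_le_trans; apply; rewrite ge_min lexx.
apply: (h1 s Ss e) => //.
by case/andP: eb => -> /lt_le_trans; apply; rewrite ge_min lexx orbT.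
Qed.

End LocalWeights.

(** * Equivalence of fans through densities *)

Section Refinements.
Context {R : realType} {n : nat}.
Local Notation V := 'rV[R]_n.
Local Notation rl := (@realify R n).
Implicit Types (x y v w : V) (sigma tau rho kappa : set V) (F H : wfan R n) (f g : V -> R).

Lemma pure_le F k tau : pure F k -> cones F tau -> (cone_dim tau <= k)%N.
Proof. by move=> p /p[s [_ <-]]; apply: cone_dimS. Qed.

(* [refines] without balancing, which is inherited from F by [balanced_transfer]. *)
Definition prerefines k F' F : Prop :=
  [/\ is_fan (cones F') /\ pure F' k,
      (forall sigma', cones F' sigma' -> exists2 sigma, cones F sigma & sigma' `<=` sigma),
      Defs.support F' = Defs.support F &
      (forall sigma' sigma, cones_of_dim F' k sigma' -> cones_of_dim F k sigma ->
         sigma' `<=` sigma -> weight F' sigma' = weight F sigma)].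

Lemma refines_prerefines k F' F : refines k F' F -> prerefines k F' F.
Proof. by move=> [[f p _] h1 h2 h3]. Qed.

Lemma prerefines_top k F' F sigma' : is_fan (cones F) -> pure F k -> prerefines k F' F ->
  cones_of_dim F' k sigma' -> exists2 sigma, cones_of_dim F k sigma & sigma' `<=` sigma.
Proof.
move=> fF pF [[_ _] sub _ _] [Fs ds]; have [s Fss ss] := sub _ Fs.
exists s => //; split=> //; apply/eqP; rewrite eqn_leq (pure_le pF Fss) -ds.
exact: cone_dimS.
Qed.

Lemma wsumE k F G Th : wsum k F G Th =
  \sum_(sigma \in cones_of_dim F k `&` [set s | G s]) (weight F sigma)%:R * Th sigma.
Proof.
rewrite fsbig_mkcondr; apply: eq_fsbigr => s _.
by have -> : (s \in [set s | G s]) = `[< G s >] by apply/idP/asboolP; rewrite inE.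
Qed.

(** The conditions on G say that each selected cone of F contains exactly one selected cone of F',
    so sending a cone of F' to the cone of F around it is a bijection between the selected cones; it
    preserves weights and [Th]. *)
Lemma wsum_refine k F' F (G : set V -> Prop) (Th : set V -> R) :
  is_fan (cones F) -> pure F k -> prerefines k F' F ->
  (forall s' s, cones_of_dim F' k s' -> cones_of_dim F k s -> s' `<=` s -> G s' -> G s) ->
  (forall s, cones_of_dim F k s -> G s -> exists2 s', cones_of_dim F' k s' & s' `<=` s /\ G s') ->
  (forall s s1 s2, cones_of_dim F k s -> cones_of_dim F' k s1 -> cones_of_dim F' k s2 ->
     s1 `<=` s -> s2 `<=` s -> G s1 -> G s2 -> s1 = s2) ->
  (forall s' s, cones_of_dim F' k s' -> cones_of_dim F k s -> s' `<=` s -> G s' -> Th s' = Th s) ->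
  wsum k F' G Th = wsum k F G Th.
Proof.
move=> fF pF rf mono cov inj Theq; rewrite !wsumE.
pose h s' : set V := xget set0 [set s | cones_of_dim F k s /\ s' `<=` s].
have hP s' : cones_of_dim F' k s' -> cones_of_dim F k (h s') /\ s' `<=` h s'.
  move=> Fs'; rewrite /h; case: xgetP => [s -> //|N].
  by have [s Fs ss] := prerefines_top fF pF rf Fs'; case: (N s).
have hU s' s : cones_of_dim F' k s' -> cones_of_dim F k s -> s' `<=` s -> h s' = s.
  move=> Fs' Fs ss; have [h1 h2] := hP s' Fs'.
  by apply: (cones_dim_eq fF h1 Fs h2 ss); case: Fs' => _ ->.
apply/esym; rewrite (@reindex_fsbig _ _ _ _ _ h (cones_of_dim F' k `&` [set s | G s])); last first.
  split.
  - by move=> s' [Fs' Gs'] /=; have [h1 h2] := hP s' Fs'; exact: (conj h1 (mono s' (h s') Fs' h1 h2 Gs')).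
  - move=> s1 s2; rewrite !inE => -[F1 G1] [F2 G2] E; have [h1 h2] := hP s1 F1.
    by apply: (inj (h s1)) => //; rewrite E; case: (hP s2 F2).
  - move=> s [Fs Gs]; have [s' Fs' [ss Gs']] := cov s Fs Gs.
    by exists s' => //; apply: hU.
apply: eq_fsbigr => s'; rewrite inE => -[Fs' Gs']; have [h1 h2] := hP s' Fs'.
have [_ _ _ wE] := rf; by rewrite (wE _ (h s')) // (Theq _ (h s')).
Qed.

Lemma indep_add x v e : indep x v -> e != 0 -> indep x (x + e *: v).
Proof. by move=> iv e0; apply: (@indep_half _ _ x v _ 1 e e0 _ iv); rewrite scale1r. Qed.

Lemma germ_step sigma x v : convex_cone sigma -> germ sigma x v ->
  exists2 e0, 0 < e0 & forall e, 0 <= e <= e0 -> sigma (x + e *: v).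
Proof.
move=> [_ sD sZ] [sx [e0 e00 se]]; exists e0 => // e /andP[e1 e2].
have -> : x + e *: v = (1 - e / e0) *: x + (e / e0) *: (x + e0 *: v).
  by apply/rowP => i; rewrite !mxE; field; rewrite gt_eqF.
apply: (sD); apply: (sZ) => //; last by rewrite divr_ge0 // ltW.
by rewrite subr_ge0 ler_pdivrMr // mul1r.
Qed.

Lemma germ_dim sigma x v : indep x v -> germ sigma x v -> (2 <= cone_dim sigma)%N.
Proof.
by move=> iv [sx [e e0 se]]; apply: (dim_ge2 sx se); apply: indep_add; rewrite ?gt_eqF.
Qed.

Lemma germI sigma rho x v : convex_cone sigma -> convex_cone rho ->
  germ sigma x v -> germ rho x v -> germ (sigma `&` rho) x v.
Proof.
move=> cs cr gs gr; have [e1 e10 h1] := germ_step cs gs; have [e2 e20 h2] := germ_step cr gr.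
split; first by split; [case: gs|case: gr].
have m0 : 0 < Num.min e1 e2 by rewrite lt_min e10.
exists (Num.min e1 e2) => //.
by split; [apply: h1|apply: h2]; rewrite (ltW m0) /= ge_min lexx ?orbT.
Qed.

Lemma germ_unique F x v s1 s2 : is_fan (cones F) -> indep x v -> cones_of_dim F 2 s1 ->
  cones_of_dim F 2 s2 -> germ s1 x v -> germ s2 x v -> s1 = s2.
Proof.
move=> fF iv F1 F2 g1 g2; have [_ rF _ _] := fF.
have [c1 c2] : convex_cone s1 /\ convex_cone s2.
  by split; apply: rational_convex_cone; apply: rF; [case: F1|case: F2].
apply: (cones_dim_eq fF F1 F2 (@subIsetl _ _ _) (@subIsetr _ _ _)).
by apply: germ_dim iv _; apply: germI.
Qed.

Lemma refine_germ F' F s x v : is_fan (cones F) -> pure F 2 -> prerefines 2 F' F -> indep x v ->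
  cones_of_dim F 2 s -> germ s x v -> exists2 s', cones_of_dim F' 2 s' & s' `<=` s /\ germ s' x v.
Proof.
move=> fF pF [[fF' pF'] sub sup wt] iv Fs gs.
have [fin' rF' cF' _] := fF'; have [_ rF _ _] := fF; have [Fs1 ds] := Fs.
have [e0 e00 h] := germ_step (rational_convex_cone (rF _ Fs1)) gs.
have [|k Fk gk] := @germ_cover R n (cones F') x v fin' rF'.
  exists e0 => // e /andP[e1 e2].
  have : Defs.support F (x + e *: v) by exists s => //; apply: h; rewrite !ltW.
  by rewrite -sup => -[k Fk kx]; exists k.
have [r Fr kr] := sub _ Fk.
have gr : germ r x v by case: gk => kx [e ? ke]; split; [apply: kr|exists e => //; apply: kr].
exists k.
  split=> //; apply/eqP; rewrite eqn_leq (pure_le pF' Fk); exact: germ_dim iv gk.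
split=> //; rewrite (germ_unique fF iv Fs _ gs gr) //.
by split=> //; apply/eqP; rewrite eqn_leq (pure_le pF Fr); exact: germ_dim iv gr.
Qed.

Lemma delta_prerefines F' F x v : is_fan (cones F) -> pure F 2 -> prerefines 2 F' F ->
  indep x v -> delta F' x v = delta F x v.
Proof.
move=> fF pF rf iv; have [[fF' _] _ _ _] := rf; apply: wsum_refine => //.
- by move=> s' s _ _ ss [sx [e e0 se]]; split; [apply: ss|exists e => //; apply: ss].
- by move=> s Fs gs; apply: (refine_germ fF pF rf).
- by move=> s s1 s2 Fs F1 F2 _ _ g1 g2; apply: (germ_unique fF' iv).
Qed.

Lemma delta_val F x v s : is_fan (cones F) -> indep x v -> cones_of_dim F 2 s -> germ s x v ->
  delta F x v = (weight F s)%:R.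
Proof.
move=> fF iv Fs gs; rewrite /delta wsumE -(@fsbig_widen _ _ _ _ [set s]).
- by rewrite fsbig_set1 mulr1.
- by move=> _ ->.
- by move=> s' [[Fs' gs'] /= ne]; case: ne; exact: (germ_unique fF iv Fs' Fs gs' gs).
Qed.

Lemma positive_part_top k F s : cones_of_dim (positive_part k F) k s <->
  cones_of_dim F k s /\ (0 < weight F s)%N.
Proof.
split=> [[[s' [[Fs' d'] w f]] d]|[[Fs d] w]].
  by have -> : s = s' by apply: face_eq_dim => //; rewrite d d'.
by split=> //; exists s; split=> //; apply: face_refl.
Qed.

Lemma is_fan_positive_part k F : is_fan (cones F) -> is_fan (cones (positive_part k F)).
Proof.
move=> [fin rF cF iF].
have sub s : cones (positive_part k F) s -> cones F s.
  by move=> [s' [[Fs' _] _ f]]; apply: cF f.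
split.
- by apply: sub_finite_set fin => s /sub.
- by move=> s /sub; apply: rF.
- move=> s t [s' [[Fs' d'] w f]] ft; exists s'; split=> //.
  by apply: face_trans ft => //; apply: rF.
- by move=> s t /sub Fs /sub Ft; apply: iF.
Qed.

Lemma pure_positive_part k F : pure (positive_part k F) k.
Proof.
move=> t [s [Fs w f]]; exists s; last exact: face_sub f.
by apply/positive_part_top.
Qed.

Lemma wsum_positive_part k F G Th : is_fan (cones F) ->
  wsum k (positive_part k F) G Th = wsum k F G Th.
Proof.
move=> fF; rewrite !wsumE; apply: fsbig_widen.
  by move=> s [/positive_part_top [Fs _] Gs].
move=> s [[Fs Gs] N] /=; case: (posnP (weight F s)) => [->|w]; first by rewrite mul0r.
by case: N; split=> //; apply/positive_part_top.
Qed.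

Lemma delta_positive_part F x v : is_fan (cones F) -> delta (positive_part 2 F) x v = delta F x v.
Proof. exact: wsum_positive_part. Qed.

Lemma delta_equiv_eq F1 F2 x v : is_fan (cones F1) -> is_fan (cones F2) -> fan_equiv 2 F1 F2 ->
  indep x v -> delta F1 x v = delta F2 x v.
Proof.
move=> f1 f2 [F [/refines_prerefines r1 /refines_prerefines r2]] iv.
rewrite -(delta_positive_part _ _ f1) -(delta_positive_part _ _ f2).
rewrite -(delta_prerefines _ _ r1 iv) ?(delta_prerefines _ _ r2 iv) //;
  by [apply: is_fan_positive_part|apply: pure_positive_part].
Qed.

Lemma Nset_sum_eq (M : lmodType R) (d d' : V -> V -> R) x (g : V -> M) :
  (forall v, indep x v -> d x v = d' x v) ->
  \sum_(v \in Nset x) d x v *: g v = \sum_(v \in Nset x) d' x v *: g v.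
Proof. by move=> h; apply: eq_fsbigr => v; rewrite inE => -[iv _ _]; rewrite h. Qed.

Lemma is_W_eq (d d' : V -> V -> R) f x r : (forall v, indep x v -> d x v = d' x v) ->
  is_W d f x r -> is_W d' f x r.
Proof.
move=> h [k E ->]; exists k; first by rewrite -E; apply/esym; apply: Nset_sum_eq.
by congr (_ - _); apply: (@Nset_sum_eq R^o d d' x (fun v => der f x v : R^o)).
Qed.

Lemma balanced_transfer F' F : is_fan (cones F) -> is_fan (cones F') -> balanced F 2 ->
  (forall x v, indep x v -> delta F' x v = delta F x v) -> balanced F' 2.
Proof.
move=> fF fF' bF h; apply: balanced_delta => // x Zx x0.
have [k E] := delta_balanced fF bF Zx x0; exists k; rewrite -E.
by apply: (@Nset_sum_eq V _ _ x id) => v; apply: h.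
Qed.

Lemma prerefines_refines F' F : tropical_fan 2 F -> prerefines 2 F' F -> refines 2 F' F.
Proof.
move=> [fF pF bF] rf; have [[fF' pF'] h1 h2 h3] := rf; split=> //; split=> //.
by apply: (balanced_transfer fF fF' bF) => x v; apply: delta_prerefines.
Qed.

Lemma tropical_positive_part F : tropical_fan 2 F -> tropical_fan 2 (positive_part 2 F).
Proof.
move=> [fF pF bF]; have fP := is_fan_positive_part 2 fF; split=> //; first exact: pure_positive_part.
by apply: (balanced_transfer fF fP bF) => x v _; apply: delta_positive_part.
Qed.

Lemma cut_refines (L : seq 'cV[int]_n) F : tropical_fan 2 F ->
  exists2 F', refines 2 F' F & cones F' = cut L (cones F).
Proof.
move=> tF; have [fF pF bF] := tF.
(* A piece inherits the weight of the 2-cone containing it, which is unique for pieces of dimension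
   2. *)
pose F' := WFan (cut L (cones F))
  (fun s' => weight F (xget set0 [set s | cones_of_dim F 2 s /\ s' `<=` s])).
exists F' => //; apply: prerefines_refines => //; split.
- split; first exact: is_fan_cut.
  by move=> t Ft; have [s [Fs ds] ts] := pure_family_cut fF pF Ft; exists s.
- exact: cut_sub.
- apply/seteqP; split=> x [s Fs sx].
    by have [r Fr sr] := cut_sub Fs; exists r => //; apply: sr.
  by have [k Fk kx] := cut_cover L Fs sx; exists k.
move=> s' s [Fs' d'] Fs ss; rewrite /F' /=; congr (weight F _).
case: xgetP => [r _ [Fr sr]|/(_ s)/not_andP[]//].
by apply: (cones_dim_eq fF Fr Fs sr ss); rewrite d'.
Qed.

Lemma family_hrep (C : set (set V)) : finite_set C -> (forall s, C s -> rational_cone s) ->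
  exists L : seq 'cV[int]_n, forall s, C s -> exists2 L' : seq 'cV[int]_n, {subset L' <= L} &
    forall x, s x <-> (forall l, l \in L' -> 0 <= pairing x (rl l)).
Proof.
move=> /finite_seqP[S ->]; elim: S => [|s S IH] rC; first by exists [::] => s.
have [t tS|L HL] := IH; first by apply: rC => /=; rewrite inE; apply/orP; right.
have [Ls Hs] := rational_cone_hrep (rC s (mem_head s S)).
exists (Ls ++ L) => t /=; rewrite inE => /orP[/eqP->|tS].
  by exists Ls => // l h; rewrite mem_cat h.
have [L' sub HL'] := HL t tS; exists L' => // l /sub h; rewrite mem_cat h orbT //.
Qed.

(** A point x where only those functionals of L vanish that vanish on all of k decides for k: an
    inequality of s that holds at x holds on k, since its functional does not change sign on k. *)
Lemma cut_inside (L L' : seq 'cV[int]_n) C s k : is_fan C -> cut L C k -> {subset L' <= L} ->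
  (forall x, s x <-> (forall l, l \in L' -> 0 <= pairing x (rl l))) ->
  forall x, k x -> (forall l, l \in L -> pairing x (rl l) = 0 -> forall y, k y -> pairing y (rl l) = 0) ->
  s x -> k `<=` s.
Proof.
move=> fC Ck sub Hs x kx gen sx y ky; apply/Hs => l lL'.
have [h|h] := cut_sign Ck (sub _ lL'); first exact: h.
rewrite (gen l (sub _ lL') _ y ky) //; apply/le_anti; rewrite h //=.
by move/Hs: sx; apply.
Qed.

Lemma cut_generic (L : seq 'cV[int]_n) C k : is_fan C -> cut L C k ->
  exists2 x, k x & forall l, l \in L -> pairing x (rl l) = 0 -> forall y, k y -> pairing y (rl l) = 0.
Proof.
move=> fC Ck; have [_ rC _ _] := is_fan_cut L fC.
have /rational_coneE[s sE] := rC _ Ck.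
(* The sum of the generators: as l has constant sign on k, it vanishes at the sum only if it
   vanishes at each generator. *)
exists (\sum_(z <- s) rz z).
  rewrite sE; elim: s {sE} => [|z s IH]; first by rewrite big_nil; apply: Cone0.
  rewrite big_cons /=; apply/Cone_cons; exists 1 => //; by rewrite scale1r addrAC subrr add0r.
move=> l lL xl y; rewrite sE; have sg := cut_sign Ck lL.
have zs z : z \in s -> k (rz z) by move=> h; rewrite sE; apply/Cone_mem/map_f.
have z0 z : z \in s -> pairing (rz z) (rl l) = 0.
  move: xl; rewrite pairing_suml; case: sg => sg.
    move=> /eqP; rewrite big_seq psumr_eq0 => [|u us]; last by apply: sg; apply: zs.
    by move=> /allP h zss; have := h z zss; rewrite zss => /eqP.
  move=> /eqP; rewrite -oppr_eq0 -sumrN big_seq psumr_eq0 => [|u us]; last by rewrite oppr_ge0; apply: sg; apply: zs.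
  by move=> /allP h zss; have := h z zss; rewrite zss oppr_eq0 => /eqP.
move: y; apply: Cone_ind; rewrite ?pairing0l //.
- by move=> u v; rewrite pairingE => -> ->; rewrite addr0.
- by move=> a u _; rewrite pairingE => ->; rewrite mulr0.
- by move=> _ /mapP[z /z0 e ->].
Qed.

Lemma support_positive_part F x : is_fan (cones F) -> x != 0 ->
  Defs.support (positive_part 2 F) x <-> exists2 v, indep x v & 0 < delta F x v.
Proof.
move=> fF x0; have [_ rF _ _] := fF; split.
  move=> [t [s [Fs w f]] tx]; have [Fs1 ds] := Fs; have sx := face_sub f tx.
  have [z [sz iz]] := rational_dim2 (rF _ Fs1) ds x0.
  exists (rz z) => //.
  by rewrite (delta_val fF iz Fs (germ_add (rational_convex_cone (rF _ Fs1)) sx sz)) ltr0n.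
move=> [v iv]; rewrite /delta wsumE => h.
have [s [Fs gs]] := fsumr_gt0 [::] h; rewrite mulr1 ltr0n => w.
exists s; last by case: gs.
by exists s; split=> //; apply: face_refl.
Qed.

(** The common refinement is the positive part of F2, cut by the inequalities that describe the
    cones of the positive part of F1. Away from the origin both supports are read off from the
    density, so a generic point of each piece lies in a cone of F1, and that cone then contains the
    whole piece. *)
Lemma delta_equiv F1 F2 : tropical_fan 2 F2 -> is_fan (cones F1) ->
  (forall x v, indep x v -> delta F1 x v = delta F2 x v) -> fan_equiv 2 F1 F2.
Proof.
move=> t2 f1 dE; have [f2 p2 b2] := t2.
have tP2 := tropical_positive_part t2; have [fP2 pP2 bP2] := tP2.
have fP1 := is_fan_positive_part 2 f1; have [finP1 rP1 _ _] := fP1.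
have pP1 := @pure_positive_part 2 F1.
have [L HL] := family_hrep finP1 rP1.
have [F rF cF] := cut_refines L tP2; exists F; split=> //.
have [tF subF supF wF] := rF; have [fF pF bF] := tF.
(* The density says nothing at the origin, which lies in the support as soon as a nonzero point
   does. *)
have zero_in G : is_fan (cones G) -> (exists2 x, x != 0 & Defs.support G x) -> Defs.support G 0.
  move=> [_ rG _ _] [x _ [s Gs sx]]; exists s => //.
  by have [] := rational_convex_cone (rG _ Gs).
have nz G x : Defs.support (positive_part 2 G) x -> is_fan (cones G) ->
    exists2 x, x != 0 & Defs.support (positive_part 2 G) x.
  move=> [t [s [[Fs d] w f]] _] [_ rG _ _].
  have [y sy y0] : exists2 y, s y & y != 0.
    apply: contrapT => N; have : (lin_span s <= 0)%VS.
      apply: lin_span_min => y sy; rewrite memv0; apply/negPn/negP => y0.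
      by apply: N; exists y.
    by move/dimvS; rewrite dimv0 -/(cone_dim s) d.
  by exists y => //; exists s => //; exists s; split=> //; apply: face_refl.
have sup : Defs.support (positive_part 2 F1) = Defs.support (positive_part 2 F2).
  have half G G' : is_fan (cones G) -> is_fan (cones G') ->
      (forall x v, indep x v -> delta G x v = delta G' x v) ->
      Defs.support (positive_part 2 G) `<=` Defs.support (positive_part 2 G').
    move=> fG fG' h x; have nzx x' : x' != 0 -> Defs.support (positive_part 2 G) x' ->
        Defs.support (positive_part 2 G') x'.
      move=> x0 /(support_positive_part fG x0)[v iv dv].
      by apply/(support_positive_part fG' x0); exists v; rewrite // -h.
    have [->|x0] := eqVneq x 0; last exact: nzx.
    move=> /nz /(_ fG)[y y0 Gy]; apply: zero_in; first exact: is_fan_positive_part.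
    by exists y => //; apply: nzx.
  apply/seteqP; split; first exact: half.
  by apply: half => // x v iv; rewrite dE.
split=> //.
- move=> k Fk; have Ck : cut L (cones (positive_part 2 F2)) k by rewrite -cF.
  have [x kx gen] := cut_generic fP2 Ck.
  have : Defs.support (positive_part 2 F1) x by rewrite sup -supF; exists k.
  move=> [s Fs sx]; exists s => //; have [L' sub Hs] := HL s Fs.
  exact: cut_inside fP2 Ck sub Hs x kx gen sx.
- by rewrite sup.
move=> s' s Fs' /positive_part_top[Fs w] ss; have [Fs1' d'] := Fs'.
have [t Ft st] := prerefines_top fP2 pP2 (refines_prerefines rF) Fs'.
rewrite (wF _ t) //=; move/positive_part_top: Ft => [Ft wt].
have [_ rrF _ _] := fF.
have [y [sy y0]] : exists y, s' y /\ y != 0.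
  apply: contrapT => N; have : (lin_span s' <= 0)%VS.
    apply: lin_span_min => y sy; rewrite memv0; apply/negPn/negP => y0.
    by apply: N; exists y.
  by move/dimvS; rewrite dimv0 -/(cone_dim s') d'.
have [z [sz iz]] := rational_dim2 (rrF _ Fs1') d' y0.
have cs' := rational_convex_cone (rrF _ Fs1').
have [g1 [e e0 g2]] := germ_add cs' sy sz.
have gs : germ s y (rz z) by split; [apply: ss|exists e => //; apply: ss].
have gt : germ t y (rz z) by split; [apply: st|exists e => //; apply: st].
have := dE _ _ iz; rewrite (delta_val f1 iz Fs gs) (delta_val f2 iz Ft gt).
by move/eqP; rewrite eqr_nat => /eqP.
Qed.

End Refinements.

(** * The degree as a function of the density *)

Section Degrees.
Context {R : realType} {n : nat}.
Local Notation V := 'rV[R]_n.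
Local Notation rl := (@realify R n).
Implicit Types (x y v w : V) (sigma tau rho kappa : set V) (F H K : wfan R n) (f g : V -> R)
  (T : tropical_function n).

Definition delta1 F x : R := wsum 1 F (fun sigma => sigma x) (fun=> 1).

Lemma ray_unique F x s1 s2 : is_fan (cones F) -> x != 0 -> cones_of_dim F 1 s1 ->
  cones_of_dim F 1 s2 -> s1 x -> s2 x -> s1 = s2.
Proof.
move=> fF x0 F1 F2 x1 x2.
apply: (cones_dim_eq fF F1 F2 (@subIsetl _ _ _) (@subIsetr _ _ _)).
exact: dim_ge1 x0.
Qed.

Lemma delta1_prerefines F' F x : is_fan (cones F) -> pure F 1 -> prerefines 1 F' F -> x != 0 ->
  delta1 F' x = delta1 F x.
Proof.
move=> fF pF rf x0; have [[fF' pF'] sub sup _] := rf; apply: wsum_refine => //.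
- by move=> s' s _ _ ss; apply: ss.
- move=> s Fs sx; have : Defs.support F x by exists s => //; case: Fs.
  rewrite -sup => -[k Fk kx]; exists k; first split=> //.
    by apply/eqP; rewrite eqn_leq (pure_le pF' Fk); apply: dim_ge1 x0.
  split=> //; have [r Fr kr] := sub _ Fk; rewrite (ray_unique fF x0 Fs _ sx (kr _ kx)) //.
  split=> //; apply/eqP; rewrite eqn_leq (pure_le pF Fr); apply: (dim_ge1 _ x0); exact: kr.
- by move=> s s1 s2 Fs F1 F2 _ _ g1 g2; apply: (ray_unique fF' x0).
Qed.

Lemma delta1_equiv_eq F1 F2 x : is_fan (cones F1) -> is_fan (cones F2) -> fan_equiv 1 F1 F2 ->
  x != 0 -> delta1 F1 x = delta1 F2 x.
Proof.
move=> f1 f2 [F [/refines_prerefines r1 /refines_prerefines r2]] x0.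
rewrite /delta1 -(wsum_positive_part _ _ _ f1) -(wsum_positive_part _ _ _ f2).
rewrite -!/(delta1 _ _) -(delta1_prerefines _ _ r1 x0) ?(delta1_prerefines _ _ r2 x0) //;
  by [apply: is_fan_positive_part|apply: pure_positive_part].
Qed.

Definition Prim : set V := [set u | [/\ Zn u, u != 0 &
  forall y, Zn y -> y \in <[u]>%VS -> exists a : int, y = a%:~R *: u]].

Lemma unit_int (a b : int) : a * b = 1 -> a = 1 \/ a = -1.
Proof.
move=> ab; have /eqP := congr1 absz ab; rewrite abszM muln_eq1 => /andP[/eqP ka _].
by case: a ka {ab} => [[|[|k]]|[|k]] //= _; [left|right].
Qed.

Lemma Prim_unique u u' : Prim u -> Prim u' -> u' \in <[u]>%VS -> u' = u \/ u' = - u.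
Proof.
move=> [Zu u0 Pu] [Zu' u0' Pu'] uu; have [a E] := Pu _ Zu' uu.
have [|b E'] := Pu' _ Zu.
  have a0 : a%:~R != 0 :> R by apply: contra u0' => /eqP a0; rewrite E a0 scale0r.
  by apply/vlineP; exists (a%:~R)^-1; rewrite E scalerA mulVf // scale1r.
have [|a1|a1] := @unit_int a b; rewrite ?E ?a1 ?scale1r ?scaleN1r //; [|by left|by right].
apply/eqP; rewrite -(eqr_int R) intrM eq_sym -subr_eq0.
have : (1 - a%:~R * b%:~R) *: u = 0 by rewrite scalerBl scale1r {1}E' E scalerA mulrC subrr.
by move/eqP; rewrite scaler_eq0 (negbTE u0) orbF.
Qed.

Lemma Prim_exists (z : 'rV[int]_n) : rz z != 0 :> V -> exists2 u, Prim u &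
  exists2 c, 0 < c & u = c *: rz z.
Proof.
move=> z0; have [i zi] : exists i, z 0 i != 0.
  apply: contrapT => N; case/eqP: z0; apply/rowP => i; rewrite !mxE.
  apply/eqP; rewrite intr_eq0; apply/negPn/negP => h; apply: N; by exists i.
have pz (t : 'rV[int]_n) : (t *m (delta_mx i 0 : 'cV_n)) 0 0 = t 0 i.
  rewrite mxE (bigD1 i) //= big1 ?addr0 => [|j ji]; first by rewrite mxE !eqxx mulr1.
  by rewrite mxE (negbTE ji) mulr0.
have [||w [wz wp wg]] := @lattice_quotient_generator R n <[rz z]>%VS (delta_mx i 0) z.
- exact: memv_line.
- by rewrite pz.
have w0 : rz w != 0 :> V by apply: contraTneq wp => ->; rewrite pairing0l ltxx.
have P (e : R) : e = 1 \/ e = -1 -> Prim (e *: rz w).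
  move=> he; split.
  - by case: he => ->; rewrite ?scale1r ?scaleN1r; [exact: Zn_rz|apply: ZnN; exact: Zn_rz].
  - by rewrite scaler_eq0 (negbTE w0) orbF; case: he => ->; rewrite ?oppr_eq0 oner_eq0.
  move=> y Zy yz; have yzz : y \in <[rz z]>%VS.
    case/vlineP: yz => k ->; case/vlineP: wz => c ->.
    by rewrite !memvZ ?memv_line.
  have [a ha] := wg y Zy yzz.
  have ya : y = a%:~R *: rz w.
    apply/eqP; rewrite -subr_eq0; have : y - a%:~R *: rz w \in <[rz z]>%VS by rewrite memvB // memvZ.
    case/vlineP => k kE; move: ha; rewrite kE pairingZl pairing_delta_int => /eqP.
    rewrite mulf_eq0 !mxE intr_eq0 (negbTE zi) orbF => /eqP->.
    by rewrite scale0r.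
  case: he => ->; [exists a|exists (- a)]; rewrite ya ?scale1r // intrN scaleN1r.
  by rewrite scaleNr scalerN opprK.
have /vlineP[c wE] := wz.
have [c0|c0|c0] := ltrgtP c 0.
- exists (-1 *: rz w); first by apply: P; right.
  by exists (- c); rewrite ?oppr_gt0 // wE scaleN1r scaleNr.
- by exists (1 *: rz w); [apply: P; left|exists c; rewrite // scale1r].
- by rewrite wE c0 scale0r eqxx in w0.
Qed.

Lemma face0_ray tau u : face [set 0] tau -> tau u -> u != 0 -> ~ tau (- u).
Proof.
move=> [l l0 E] tu u0 tn; have := l0 _ tu; have := l0 _ tn; rewrite pairingNl oppr_ge0 => a b.
have : [set 0 : V] u by rewrite E; split=> //; apply/le_anti; rewrite a b.
by move/eqP; rewrite (negbTE u0).
Qed.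

Lemma lin_span0 : lin_span [set 0 : V] = 0%VS.
Proof. by apply/eqP; rewrite -subv0; apply: lin_span_min => _ ->; apply: mem0v. Qed.

Lemma primitive_generator_ray tau u : cone_dim tau = 1%N -> rational_cone tau ->
  primitive_generator tau [set 0] u <-> Prim u /\ tau u.
Proof.
move=> d rt; have [z [tz z0]] := rational_dim1 rt d.
have st := span_ray d tz z0; split.
  move=> [[Zu us] gen [w]]; rewrite lin_span0 memv0 => /eqP->; rewrite addr0 => tu.
  have gen' y : Zn y -> y \in lin_span tau -> exists a : int, y = a%:~R *: u.
    move=> Zy ys; have [a [_]] := gen y (conj Zy ys).
    by rewrite lin_span0 memv0 subr_eq0 => /eqP->; exists a.
  have u0 : u != 0.
    apply: contra z0 => /eqP u0; have [a ->] := gen' _ (Zn_rz z) (mem_lin_span tz).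
    by rewrite u0 scaler0.
  by split=> //; split=> // y Zy yu; apply: gen' => //; rewrite (span_ray d tu u0).
move=> [[Zu u0 gen] tu]; split.
- by split=> //; apply: mem_lin_span.
- move=> y [Zy]; rewrite (span_ray d tu u0) => yu; have [a ->] := gen y Zy yu.
  exists a; rewrite subrr; split; last by rewrite mem0v.
  by exists 0; rewrite // map_mx0.
- by exists 0; rewrite ?mem0v // addr0.
Qed.

Lemma Prim_ray tau : rational_cone tau -> cone_dim tau = 1%N -> face [set 0] tau ->
  Prim `&` tau = [set lattice_normal tau [set 0]].
Proof.
move=> rt d f0; have [z [tz z0]] := rational_dim1 rt d.
have [_ tD tZ] := rational_convex_cone rt.
have [u Pu [c c0 uE]] := Prim_exists z0.
have tu : tau u by rewrite uE; apply: tZ => //; apply: ltW.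
have [P1 P2] : Prim (lattice_normal tau [set 0]) /\ tau (lattice_normal tau [set 0]).
  apply/(primitive_generator_ray _ d rt); rewrite /lattice_normal.
  by case: xgetP => [v -> //|/(_ u)[]]; apply/(primitive_generator_ray _ d rt).
apply/seteqP; split=> v /=; last by move=> ->.
move=> [Pv tv]; have [_ n0 _] := P1.
have [|//|E] := @Prim_unique _ v P1 Pv.
  by rewrite -(span_ray d P2 n0) mem_lin_span.
by case: (face0_ray f0 P2 n0); rewrite -E.
Qed.

(** If - u violated an inequality l of tau, then l would be positive at u and vanish on tau only at
    0, making {0} a face. *)
Lemma line_opp tau u : rational_cone tau -> cone_dim tau = 1%N -> ~ face [set 0] tau ->
  tau u -> tau (- u).
Proof.
move=> rt d nf tu; have [L HL] := rational_cone_hrep rt; apply/HL => l lL.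
rewrite leNgt; apply/negP; rewrite pairingNl oppr_lt0 => ul; apply: nf.
have u0 : u != 0 by apply: contraTneq ul => ->; rewrite pairing0l ltxx.
exists (rl l) => [x /HL|]; first by apply.
apply/seteqP; split=> x /=.
  by move=> ->; split; [have [] := rational_convex_cone rt|rewrite pairing0l].
move=> [tx xl]; have : x \in <[u]>%VS by rewrite -(span_ray d tu u0) mem_lin_span.
case/vlineP => k xE; move/eqP: xl; rewrite xE pairingZl mulf_eq0 (gt_eqF ul) orbF => /eqP->.
by rewrite scale0r.
Qed.

Definition Wloc (d : V -> V -> R) f x : R := xget 0 [set r | is_W d f x r].

Lemma WlocE d f x r : x != 0 -> is_W d f x r -> Wloc d f x = r.
Proof.
move=> x0 h; rewrite /Wloc; case: xgetP => [r' -> /= h'|/(_ r) //].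
exact: is_W_unique h' h.
Qed.

Lemma Wloc_fan F f x : is_fan (cones F) -> balanced F 2 -> lin_on_fan f F -> Zn x -> x != 0 ->
  Wloc (delta F) f x = \sum_(tau \in cones_of_dim F 1) if `[< tau x >] then Wt f F tau else 0.
Proof.
move=> fF bF lF Zx x0.
have [[tau [Ft tx]]|N] := pselect (exists tau, cones_of_dim F 1 tau /\ tau x).
  rewrite (WlocE x0 (is_W_ray fF bF lF Zx x0 Ft tx)) -(@fsbig_widen _ _ _ _ [set tau]).
  - by rewrite fsbig_set1; case: asboolP.
  - by move=> _ ->.
  - move=> s [Fs ns] /=; case: asboolP => // sx; case: ns.
    exact: (ray_unique fF x0 Fs Ft sx tx).
rewrite (@WlocE _ _ _ 0 x0).
  rewrite fsbig1 // => s Fs; case: asboolP => // sx; case: N; by exists s.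
by apply: is_W_off => // tau Ft tx; apply: N; exists tau.
Qed.

(* On a fan this is a finite sum over the rays, by [DEG_fan]; the terms at the other
   primitive vectors vanish. *)
Definition DEG (d : V -> V -> R) f g : R := \sum_(u \in Prim) Wloc d g u * f u.

Lemma DEG_eq d d' f g : (forall x v, indep x v -> d x v = d' x v) -> DEG d f g = DEG d' f g.
Proof.
move=> h; apply: eq_fsbigr => u _; congr (_ * _); rewrite /Wloc; congr (xget _ _).
apply/seteqP; split=> r /=; apply: is_W_eq => v iv; by rewrite h.
Qed.

(** Once the origin is a cone of a fan it is a face of every cone, so no cone contains a line; the
    empty fan qualifies. *)
Definition pointed_fan F := forall s, cones F s -> cones F [set 0].

Lemma pointed_face F s : is_fan (cones F) -> pointed_fan F -> cones F s -> face [set 0] s.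
Proof.
move=> [_ rF _ fI] p Fs; have [_] := fI _ _ (p _ Fs) Fs.
rewrite (_ : [set 0] `&` s = [set 0]) //; apply/seteqP; split=> x; first by case.
by move=> ->; split=> //; have [] := rational_convex_cone (rF _ Fs).
Qed.

(** The degree computed on the rays of one fan, whereas [DEG] depends on the density alone. *)
Definition DegF F f g : R :=
  \sum_(tau \in cones_of_dim F 1) Wt g F tau * f (lattice_normal tau [set 0]).

Lemma Prim_ray_finite F s : is_fan (cones F) -> pointed_fan F -> cones_of_dim F 1 s ->
  Prim `&` s = [set lattice_normal s [set 0]].
Proof.
move=> fF pF [Fs ds]; have [_ rF _ _] := fF.
exact: (Prim_ray (rF _ Fs) ds (pointed_face fF pF Fs)).
Qed.

Lemma DEG_fan F f g : is_fan (cones F) -> balanced F 2 -> pointed_fan F -> lin_on_fan g F ->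
  DEG (delta F) f g = DegF F f g.
Proof.
move=> fF bF pF lF.
transitivity (\sum_(u \in Prim) (\sum_(tau \in cones_of_dim F 1) if `[< tau u >] then Wt g F tau else 0) *: (f u : R^o)).
  by apply: eq_fsbigr => u; rewrite inE => -[Zu u0 _]; rewrite Wloc_fan.
rewrite (fsum_exchange (G := fun s => s)).
- by apply: eq_fsbigr => s; rewrite inE => Fs; rewrite (Prim_ray_finite fF pF Fs) fsbig_set1.
- exact: finite_cones_of_dim.
- by move=> s Fs; rewrite (Prim_ray_finite fF pF Fs).
Qed.

Definition DEG1 (d : V -> R) f : R := \sum_(u \in Prim) d u * f u.

Lemma DEG1_pointed H f : is_fan (cones H) -> pointed_fan H ->
  DEG1 (delta1 H) f = \sum_(tau \in cones_of_dim H 1) (weight H tau)%:R * f (lattice_normal tau [set 0]).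
Proof.
move=> fF pF.
transitivity (\sum_(u \in Prim) (\sum_(tau \in cones_of_dim H 1) if `[< tau u >] then ((weight H tau)%:R : R) else 0) *: (f u : R^o)).
  apply: eq_fsbigr => u _; congr (_ * _); apply: eq_fsbigr => s _.
  by case: ifP; rewrite ?mulr1.
rewrite (fsum_exchange (G := fun s => s)).
- by apply: eq_fsbigr => s; rewrite inE => Fs; rewrite (Prim_ray_finite fF pF Fs) fsbig_set1.
- exact: finite_cones_of_dim.
- by move=> s Fs; rewrite (Prim_ray_finite fF pF Fs).
Qed.

(** Without the origin as a cone, the one-dimensional cones are lines; f is linear on them, so the
    contributions of u and - u cancel. This agrees with the value 0 of [origin_weight] when the
    origin is missing. *)
Lemma DEG1_lines H f : is_fan (cones H) -> lin_on_fan f H -> ~ cones H [set 0] ->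
  DEG1 (delta1 H) f = 0.
Proof.
move=> fH lH n0; have [_ rH cH _] := fH.
have opp s u : cones_of_dim H 1 s -> s u -> s (- u).
  move=> [Hs ds]; apply: line_opp => //; first exact: rH.
  by move=> /(cH _ _ Hs).
have dopp u : delta1 H (- u) = delta1 H u.
  rewrite /delta1 /wsum; apply: eq_fsbigr => s; rewrite inE => Hs.
  suff -> : `[< s (- u) >] = `[< s u >] by [].
  by apply/asboolP/asboolP => h; [rewrite -[u]opprK|]; apply: opp.
have fopp u : delta1 H u * f (- u) = - (delta1 H u * f u).
  have [[s [Hs su]]|N] := pselect (exists s, cones_of_dim H 1 s /\ s u).
    have [Hs1 _] := Hs; have [l El] := lH _ Hs1.
    by rewrite (El _ su) (El _ (opp _ _ Hs su)) pairingNl mulrN.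
  suff -> : delta1 H u = 0 by rewrite !mul0r oppr0.
  by rewrite /delta1 /wsum fsbig1 // => s Hs; case: asboolP => // su; case: N; exists s.
have PN u : Prim u -> Prim (- u).
  move=> [Zu u0 Pu]; split; rewrite ?oppr_eq0 //; first exact: ZnN.
  move=> y Zy yu; have [|a ->] := Pu y Zy.
    by case/vlineP: yu => k ->; rewrite memvZ // memvN memv_line.
  by exists (- a); rewrite intrN scaleNr scalerN opprK.
have : DEG1 (delta1 H) f = - DEG1 (delta1 H) f.
  rewrite {1}/DEG1 (@reindex_fsbig _ _ _ _ _ (-%R) Prim Prim); last first.
    split; [exact: PN|by move=> u v _ _ /oppr_inj|].
    by move=> u Pu; exists (- u); rewrite ?opprK //; apply: PN.
  rewrite /DEG1 -mulN1r mulr_fsumr; apply: eq_fsbigr => u _.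
  by rewrite dopp fopp mulN1r.
lra.
Qed.

Lemma origin_weight_divisor T H K : is_fan (cones H) -> balanced H 1 -> is_divisor 0 T H K ->
  (origin_weight K)%:R = DEG1 (delta1 H) (teval T).
Proof.
move=> fH bH [lH cK wK]; have [_ rH cH _] := fH.
have d0 : cone_dim [set 0 : V] = 0%N by rewrite /cone_dim lin_span0 dimv0.
rewrite /origin_weight cK; have [H0|n0] := pselect (cones H [set 0]); last first.
  rewrite DEG1_lines //; case: asboolP => // -[H0 _]; by case: n0.
have pH : pointed_fan H by [].
case: asboolP => [_|]; last by case; split=> //; rewrite d0.
rewrite (wK _ (conj H0 d0)) DEG1_pointed //.
have -> : weighted_normals H 1 [set 0] = 0.
  by apply/eqP; rewrite -memv0 -lin_span0; apply: bH => //; rewrite d0.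
rewrite pairing0l subr0.
have -> : star H 1 [set 0] = cones_of_dim H 1.
  apply/seteqP; split=> s; first by case.
  by move=> Hs; split=> //; apply: (pointed_face fH pH); case: Hs.
apply: eq_fsbigr => s; rewrite inE => Hs; rewrite pairingZl; congr (_ * _).
have [Hs1 ds] := Hs; have : (Prim `&` s) (lattice_normal s [set 0]) by rewrite (Prim_ray_finite fH pH Hs).
by move=> [_ sl]; rewrite (lextE (lH _ Hs1) sl).
Qed.

Lemma delta1_divisor T F H x : is_fan (cones F) -> balanced F 2 -> is_divisor 1 T F H ->
  Zn x -> x != 0 -> delta1 H x = Wloc (delta F) (teval T) x.
Proof.
move=> fF bF [lF cH wH] Zx x0; rewrite Wloc_fan // /delta1 /wsum.
have -> : cones_of_dim H 1 = cones_of_dim F 1.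
  rewrite /cones_of_dim cH; apply/seteqP; split=> s /=; first by move=> [[]].
  by move=> [Fs ds]; rewrite ds.
apply: eq_fsbigr => s; rewrite inE => Fs; case: ifP => // _.
by rewrite mulr1 wH.
Qed.

Lemma is_fan_skeleton F k C : is_fan (cones F) ->
  C = [set tau | cones F tau /\ (cone_dim tau <= k)%N] -> is_fan C.
Proof.
move=> [fin rF cF fI] ->; split.
- by apply: sub_finite_set fin => s [].
- by move=> s [/rF].
- move=> s t [Fs ds] ft; split; first exact: cF ft.
  by apply: leq_trans ds; apply: cone_dimS; apply: face_sub.
- by move=> s t [Fs _] [Ft _]; apply: fI.
Qed.

(** Equivalence discards cones of weight zero, so one fan may contain the origin with weight 0 while
    the other does not contain it; a positive weight on one side is forced on the other. *)
Lemma origin_weight_equiv F1 F2 : is_fan (cones F1) -> is_fan (cones F2) -> fan_equiv 0 F1 F2 ->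
  origin_weight F1 = origin_weight F2.
Proof.
move=> f1 f2 [F [r1 r2]].
have d0 : cone_dim [set 0 : V] = 0%N by rewrite /cone_dim lin_span0 dimv0.
have dim0 s : is_fan (cones F) -> cones F s -> cone_dim s = 0%N -> s = [set 0].
  move=> [_ rF _ _] Fs ds; apply/seteqP; split=> x.
    move=> sx; apply/eqP; have : x \in lin_span s by apply: mem_lin_span.
    by move/eqP: ds; rewrite /cone_dim dimv_eq0 => /eqP->; rewrite memv0.
  by move=> ->; have [] := rational_convex_cone (rF _ Fs).
have key G G' : is_fan (cones G) -> refines 0 F (positive_part 0 G) -> refines 0 F (positive_part 0 G') ->
   is_fan (cones G') -> (0 < origin_weight G)%N -> origin_weight G' = origin_weight G.
  move=> fG rG rG' fG'; rewrite /origin_weight; case: asboolP => // G0 w.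
  have [[fF pF _] _ sup _] := rG; have [_ _ sup' _] := rG'.
  have PG : cones_of_dim (positive_part 0 G) 0 [set 0] by apply/positive_part_top.
  have : Defs.support F 0 by rewrite sup; exists [set 0]; case: PG.
  move=> /[dup] [[s Fs s0]]; rewrite sup' => -[t' Ht' t0].
  have [r [Fr dr] sr] := pF _ Fs.
  have E := dim0 _ fF Fr dr; rewrite E in Fr.
  have F0 : cones_of_dim F 0 [set 0] by split.
  have [q Pq q0] := prerefines_top (is_fan_positive_part 0 fG') (@pure_positive_part _ _ 0 G') (refines_prerefines rG') F0.
  have qE : q = [set 0].
    have [fin' rq' _ _] := is_fan_positive_part 0 fG'.
    case: Pq => Pq dq; apply/seteqP; split=> x; last by move=> ->; apply: q0.
    move=> qx; apply/eqP; have : x \in lin_span q by apply: mem_lin_span.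
    by move/eqP: dq; rewrite /cone_dim dimv_eq0 => /eqP->; rewrite memv0.
  rewrite qE in Pq; have /positive_part_top[[G0' _] w'] := Pq.
  case: asboolP => // _.
  have [_ _ _ wG] := rG; have [_ _ _ wG'] := rG'.
  by rewrite -[LHS](wG' _ _ F0 Pq) // -[RHS](wG _ _ F0 PG).
have [e1|p1] := posnP (origin_weight F1); last by rewrite (key F1 F2).
have [e2|p2] := posnP (origin_weight F2); last by rewrite (key F2 F1).
by rewrite e1 e2.
Qed.

(** Every chain of divisors leads to the same number, so [degree] picks from a set with at most one
    element. *)
Lemma DEG_derivation F0 T1 T2 H : is_fan (cones F0) ->
  cycle_mul_seq 0 [:: T1; T2] (cycle_of 2 F0) H ->
  (origin_weight H)%:R = DEG (delta F0) (teval T1) (teval T2).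
Proof.
move=> f0 /= [H1' [K [[F1 [H1 [[tF1 e01] dv1 [tH1' e1]]]] dv2 [[fH _ _] e2]]]].
have [fF1 pF1 bF1] := tF1; have [fH1' pH1' bH1'] := tH1'.
have fK : is_fan (cones K) by case: dv2 => _ cK _; apply: is_fan_skeleton cK.
have fH1 : is_fan (cones H1) by case: dv1 => _ cH _; apply: is_fan_skeleton cH.
rewrite -(origin_weight_equiv fK fH e2) (origin_weight_divisor fH1' bH1' dv2).
rewrite (DEG_eq _ _ (fun x v => delta_equiv_eq f0 fF1 e01)).
apply: eq_fsbigr => u; rewrite inE => -[Zu u0 _]; congr (_ * _).
by rewrite -(delta1_equiv_eq fH1 fH1' e1 u0) (delta1_divisor fF1 bF1 dv1).
Qed.

End Degrees.

(** * Fine representatives and the rays of 2-cones *)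

Section Fine.
Context {R : realType} {n : nat}.
Local Notation V := 'rV[R]_n.
Local Notation rl := (@realify R n).
Implicit Types (x y v w : V) (sigma tau rho kappa : set V) (F H K : wfan R n) (f g : V -> R)
  (T : tropical_function n).

Lemma bigmax_seq_ge (I : eqType) (r : seq I) (h : I -> R) i : i \in r ->
  h i <= \big[Num.max/0]_(j <- r) h j.
Proof.
elim: r => // j r IH; rewrite inE big_cons => /orP[/eqP->|/IH le]; rewrite le_max ?lexx //.
by rewrite le orbT.
Qed.

Lemma bigmax_seq_att (I : eqType) (r : seq I) (h : I -> R) :
  \big[Num.max/0]_(j <- r) h j = 0 \/ exists2 i, i \in r & \big[Num.max/0]_(j <- r) h j = h i.
Proof.
elim: r => [|j r IH]; first by rewrite big_nil; left.
rewrite big_cons; case: (leP (h j) (\big[Num.max/0]_(k <- r) h k)) => _.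
  by case: IH => [->|[i ir ->]]; [left|right; exists i; rewrite // inE ir orbT].
by right; exists j; rewrite // mem_head.
Qed.

Lemma teval_ge T l x : l \in functionals T -> pairing x (rl l) <= teval T x.
Proof. exact: bigmax_seq_ge. Qed.

Lemma teval_att T x : exists2 l, l \in functionals T & teval T x = pairing x (rl l).
Proof.
rewrite /teval; have [->|[l lT ->]] := bigmax_seq_att (functionals T) (fun l => pairing x (rl l)).
  by exists 0; [exact: functionals0|rewrite rl0 pairing0r].
by exists l.
Qed.

Lemma teval_ge0 T x : 0 <= teval T x.
Proof. by have := teval_ge x (functionals0 T); rewrite rl0 pairing0r. Qed.

(** The walls of T: where no difference changes sign, a single functional attains the maximum
    throughout. *)
Definition diffs T := [seq p - q | p <- functionals T, q <- functionals T].

Lemma mem_diffs T p q : p \in functionals T -> q \in functionals T -> p - q \in diffs T.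
Proof. by move=> hp hq; apply/allpairsP; exists (p, q). Qed.

(** Stronger than linearity: on each cone T is given by one of its own functionals, hence by an
    integral one. The integrality of the weights of divisors in [Wt_nat] rests on this. *)
Definition fineT F T := forall s, cones F s ->
  exists2 l, l \in functionals T & forall x, s x -> teval T x = pairing x (rl l).

Lemma fineT_lin F T : fineT F T -> lin_on_fan (teval T) F.
Proof. by move=> fT s /fT[l _ h]; exists (rl l). Qed.

Lemma fineT_cut F (L : seq 'cV[int]_n) C T : is_fan C -> cones F = cut L C ->
  {subset diffs T <= L} -> fineT F T.
Proof.
move=> fC cF sub k; rewrite cF => Ck; have [x kx gen] := cut_generic fC Ck.
have [l lT xl] := teval_att T x; exists l => // y ky.
have [p pT yp] := teval_att T y.
apply/eqP; rewrite eq_le teval_ge // andbT yp -subr_ge0 -pairingBr -rlN -rlD.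
have dL : l - p \in L by apply/sub/mem_diffs.
have [h|h] := cut_sign Ck dL; first exact: h.
rewrite (gen _ dL _ y ky) //; apply/le_anti; rewrite h //=.
by rewrite rlD rlN pairingBr subr_ge0 -xl teval_ge.
Qed.

Definition coords : seq 'cV[int]_n := [seq delta_mx i 0 | i <- enum 'I_n].

(** A cone inside an orthant is pointed: the sum of the coordinates, taken with the signs of the
    orthant, vanishes only at 0. *)
Lemma pointed_cut F (L : seq 'cV[int]_n) C : is_fan C -> cones F = cut L C ->
  {subset coords <= L} -> pointed_fan F.
Proof.
move=> fC cF sub k; rewrite cF => Ck.
have [_ rF cFace _] := is_fan_cut L fC; apply: (cFace _ _ Ck).
have sg i : exists e : R, (e = 1 \/ e = -1) /\ forall x, k x -> 0 <= e * x 0 i.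
  have dL : delta_mx i 0 \in L by apply/sub/map_f; rewrite mem_enum.
  have [h|h] := cut_sign Ck dL.
    by exists 1; split; [left|move=> x /h; rewrite pairing_delta_int mul1r].
  by exists (-1); split; [right|move=> x /h; rewrite pairing_delta_int mulN1r oppr_ge0].
have [e he] := choice sg.
have E x : pairing x (\sum_i e i *: delta_mx i 0) = \sum_i e i * x 0 i.
  by rewrite pairing_sumr; apply: eq_bigr => i _; rewrite pairingZr pairing_delta.
exists (\sum_i e i *: delta_mx i 0).
  by move=> x kx; rewrite E; apply: sumr_ge0 => i _; apply: (he i).2.
apply/seteqP; split=> x /=.
  by move=> ->; split; [have [] := rational_convex_cone (rF _ Ck)|rewrite pairing0l].
move=> [kx]; rewrite E => /eqP; rewrite psumr_eq0 => [/allP h|i _]; last exact: (he i).2.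
apply/rowP => i; rewrite mxE; have := h i (mem_index_enum i); rewrite /= mulf_eq0.
by case: (he i) => -[->|->] _; rewrite ?oppr_eq0 oner_eq0 => /eqP.
Qed.

Lemma balanced_positive_part k F : is_fan (cones F) -> balanced F k -> balanced (positive_part k F) k.
Proof.
move=> fF bF t Ft dt.
have [s [[Fs ds] w f]] := Ft.
have [_ _ cF _] := fF; have := bF t (cF _ _ Fs f) dt.
suff -> : weighted_normals (positive_part k F) k t = weighted_normals F k t by [].
apply: fsbig_widen => [r [/positive_part_top [Fr _] fr]|r [[Fr fr] N] /=]; first by split.
case: (posnP (weight F r)) => [->|wr]; first by rewrite scale0r.
by case: N; split=> //; apply/positive_part_top.
Qed.

Lemma fan_equiv_refl k F : tropical_fan k F -> fan_equiv k F F.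
Proof.
move=> [fF pF bF]; exists (positive_part k F).
have r : refines k (positive_part k F) (positive_part k F).
  split=> //.
  - by split; [exact: is_fan_positive_part|exact: pure_positive_part|exact: balanced_positive_part].
  - by move=> s Fs; exists s.
  move=> s' s Fs' Fs ss; congr (weight F _).
  by apply: (cones_dim_eq (is_fan_positive_part k fF) Fs' Fs _ ss) => //; case: Fs' => _ ->.
by [].
Qed.

(** A functional m that is positive off the origin makes the slope l / m well defined on nonzero
    points, for an l that is not proportional to m on sigma. The generators of least and of greatest
    slope span the two rays. *)
Lemma two_rays sigma : rational_cone sigma -> cone_dim sigma = 2%N -> face [set 0] sigma ->
  exists t1 t2 y1 y2, [/\ face t1 sigma /\ face t2 sigma, cone_dim t1 = 1%N /\ cone_dim t2 = 1%N,
    t1 y1 /\ t2 y2, indep y1 y2 &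
    t1 <> t2 /\ (forall x, sigma x -> exists a b, [/\ 0 <= a, 0 <= b & x = a *: y1 + b *: y2]) /\
    forall t, face t sigma -> cone_dim t = 1%N -> t = t1 \/ t = t2].
Proof.
move=> rs ds [m m0 mE]; have /rational_coneE[s sE] := rs.
have mp y : sigma y -> y != 0 -> 0 < pairing y m.
  move=> sy y0; rewrite lt_def m0 // andbT; apply: contra y0 => /eqP e.
  by have h : [set 0 : V] y; [rewrite mE|apply/eqP].
have [z0 [sz0 z00]] : exists z : 'rV[int]_n, sigma (rz z) /\ rz z != 0 :> V.
  have [z1 z10] : exists z1 : V, z1 != 0.
    apply: contrapT => N; have : (lin_span sigma <= 0)%VS.
      by apply: lin_span_min => y sy; rewrite memv0; apply/negPn/negP => y0; apply: N; exists y.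
    by move/dimvS; rewrite dimv0 -/(cone_dim sigma) ds.
  have [z [sz iz]] := rational_dim2 rs ds z10; exists z; split=> //.
  by case: iz => _; apply: contraNneq => ->; apply: mem0v.
have [z' [sz' iz']] := rational_dim2 rs ds z00.
have [l [lz lz']] := separating_functional iz'.
pose t y := pairing y (rl l) / pairing y m.
have tz : t (rz z0) = 0 by rewrite /t pairing_rz lz mul0r.
have z'0 : rz z' != 0 :> V by case: iz' => _; apply: contraNneq => ->; apply: mem0v.
have tz' : t (rz z') != 0.
  by apply: mulf_neq0; [rewrite pairing_rz intr_eq0|rewrite invr_eq0 gt_eqF // mp].
pose S : seq V := [seq (rz z : V) | z <- s & (rz z : V) != 0].
have SP y : y \in S -> sigma y /\ y != 0.
  by move=> /mapP[z]; rewrite mem_filter => /andP[z0' zs] ->; rewrite sE; split=> //; apply/Cone_mem/map_f.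
have ext (h : V -> R) : exists2 y, y \in S & forall y', y' \in S -> h y <= h y'.
  have : S != [::].
    apply: contraNneq z00 => S0; move: sz0; rewrite sE => sz0; apply/eqP.
    move: sz0; set x := rz z0; move: (x); apply: Cone_ind => //.
    - by move=> a b -> ->; rewrite addr0.
    - by move=> a b _ ->; rewrite scaler0.
    move=> _ /mapP[z zs ->]; apply/eqP/negPn/negP => zn.
    by have : rz z \in S; [apply: map_f; rewrite mem_filter zn|rewrite S0].
  elim: (S) => // y S' IH _; have [->|/IH[y' y'S mn]] := eqVneq S' [::].
    by exists y; rewrite ?mem_head // => y'; rewrite inE => /eqP->.
  have [le|lt] := leP (h y) (h y').
    exists y; rewrite ?mem_head // => u; rewrite inE => /orP[/eqP->//|/mn]; exact: le_trans.
  by exists y'; rewrite ?inE ?y'S ?orbT // => u; rewrite inE => /orP[/eqP->|/mn//]; exact: ltW.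
have key (h : V -> R) (c : R) : (forall y, y \in S -> c * pairing y m <= pairing y (rl l)) ->
    forall x, sigma x -> 0 <= pairing x (rl l - c *: m).
  move=> H x; rewrite sE; move: x; apply: Cone_pairing_ge0 => _ /mapP[z zs ->].
  have [->|zn] := eqVneq (rz z : V) 0; first by rewrite pairing0l.
  rewrite pairingBr pairingZr subr_ge0; apply: H; apply: map_f; by rewrite mem_filter zn.
have [y1 y1S min1] := ext t; have [y2 y2S max2] := ext (fun y => - t y).
have [[sy1 y10] [sy2 y20]] := (SP _ y1S, SP _ y2S).
pose l1 := rl l - t y1 *: m; pose l2 := t y2 *: m - rl l.
have tE y : sigma y -> y != 0 -> pairing y (rl l) = t y * pairing y m.
  by move=> sy y0; rewrite /t mulfVK // gt_eqF // mp.
have l1P x : sigma x -> 0 <= pairing x l1.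
  apply: (key t) => y yS; have [sy y0] := SP _ yS.
  by rewrite tE // ler_pM2r ?mp // min1.
have l2P x : sigma x -> 0 <= pairing x l2.
  rewrite sE; move: x; apply: Cone_pairing_ge0 => _ /mapP[z zs ->].
  have [->|zn] := eqVneq (rz z : V) 0; first by rewrite pairing0l.
  have zS : rz z \in S by apply: map_f; rewrite mem_filter zn.
  have [sz _] := SP _ zS.
  by rewrite pairingBr pairingZr subr_ge0 tE // ler_pM2r ?mp // -lerN2 max2.
have tlt : t y1 < t y2.
  have a1 : t y1 <= t (rz z0).
    have := l1P _ sz0; rewrite pairingBr pairingZr tE // subr_ge0 ler_pM2r ?mp //.
  have a2 : t (rz z0) <= t y2.
    have := l2P _ sz0; rewrite pairingBr pairingZr tE // subr_ge0 ler_pM2r ?mp //.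
  have b1 : t y1 <= t (rz z').
    have := l1P _ sz'; rewrite pairingBr pairingZr tE // subr_ge0 ler_pM2r ?mp //.
  have b2 : t (rz z') <= t y2.
    have := l2P _ sz'; rewrite pairingBr pairingZr tE // subr_ge0 ler_pM2r ?mp //.
  rewrite tz in a1 a2; rewrite lt_def (le_trans a1 a2) andbT; apply: contra tz' => /eqP e.
  by apply/eqP; lra.
have l11 : pairing y1 l1 = 0 by rewrite pairingBr pairingZr tE // subrr.
have l22 : pairing y2 l2 = 0 by rewrite pairingBr pairingZr tE // subrr.
have l12 : 0 < pairing y2 l1 by rewrite pairingBr pairingZr tE // -mulrBl mulr_gt0 ?mp // subr_gt0.
have l21 : 0 < pairing y1 l2 by rewrite pairingBr pairingZr tE // -mulrBl mulr_gt0 ?mp // subr_gt0.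
have i12 : indep y1 y2.
  split=> //; apply: contraTN l12 => /vlineP[k ->].
  by rewrite pairingZl l11 mulr0 ltxx.
have ss : lin_span sigma = plane y1 y2 by apply: span_plane => //; apply: mem_lin_span.
have dec x : sigma x -> exists a b, [/\ 0 <= a, 0 <= b & x = a *: y1 + b *: y2].
  move=> sx; have /planeP[a [b xE]] : x \in plane y1 y2 by rewrite -ss mem_lin_span.
  exists a, b; split=> //.
    by have := l2P _ sx; rewrite xE !pairingDl !pairingZl l22 mulr0 addr0 pmulr_lge0.
  by have := l1P _ sx; rewrite xE !pairingDl !pairingZl l11 mulr0 add0r pmulr_lge0.
have facedim y l' : sigma y -> y != 0 -> (exists2 x, sigma x & pairing x l' != 0) ->
    pairing y l' = 0 -> (forall x, sigma x -> 0 <= pairing x l') ->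
    cone_dim [set x | sigma x /\ pairing x l' = 0] = 1%N.
  move=> sy y0 [x sx xl] yl l0; set t0 := [set x | _].
  have ft : face t0 sigma by exists l'.
  have d1 : (1 <= cone_dim t0)%N by apply: (@dim_ge1 _ _ _ y).
  have := cone_dimS (face_sub ft); rewrite ds leq_eqVlt => /orP[/eqP d2|d2].
    have E : t0 = sigma by apply: face_eq_dim => //; rewrite ds d2.
    by have : t0 x; [rewrite E|move=> [_ e]; rewrite e eqxx in xl].
  by apply/eqP; rewrite eqn_leq d1 andbT -ltnS.
exists [set x | sigma x /\ pairing x l1 = 0], [set x | sigma x /\ pairing x l2 = 0], y1, y2.
have d1 : cone_dim [set x | sigma x /\ pairing x l1 = 0] = 1%N.
  by apply: (facedim y1) => //; exists y2; rewrite // gt_eqF.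
have d2 : cone_dim [set x | sigma x /\ pairing x l2 = 0] = 1%N.
  by apply: (facedim y2) => //; exists y1; rewrite // gt_eqF.
split=> //; first by split; [exists l1|exists l2].
split; [|split] => //.
  move=> E; have : [set x | sigma x /\ pairing x l2 = 0] y1 by rewrite -E.
  by move=> [_ e]; rewrite e ltxx in l21.
move=> t0 ft dt; have [l' l'0 tE'] := ft.
have [x [tx x0]] : exists x, t0 x /\ x != 0.
  apply: contrapT => N; have : (lin_span t0 <= 0)%VS.
    by apply: lin_span_min => y sy; rewrite memv0; apply/negPn/negP => y0; apply: N; exists y.
  by move/dimvS; rewrite dimv0 -/(cone_dim t0) dt.
have sx := face_sub ft tx; have [a [b [a0 b0 xE]]] := dec x sx.
have xl : pairing x l' = 0 by move: tx; rewrite tE' => -[].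
have ay : 0 <= a * pairing y1 l' by rewrite mulr_ge0 ?l'0.
have bY : 0 <= b * pairing y2 l' by rewrite mulr_ge0 ?l'0.
move: xl; rewrite {1}xE !pairingDl !pairingZl => xl.
have same y l0 : sigma y -> y != 0 -> pairing y l' = 0 -> pairing y l0 = 0 ->
    cone_dim [set x | sigma x /\ pairing x l0 = 0] = 1%N -> t0 = [set x | sigma x /\ pairing x l0 = 0].
  move=> sy y0 yl' yl0 d0.
  have ty : t0 y by rewrite tE'.
  have ly : [set x | sigma x /\ pairing x l0 = 0] y by [].
  apply/seteqP; split=> u.
    move=> tu; split; first exact: face_sub tu.
    have : u \in <[y]>%VS by rewrite -(span_ray dt ty y0) mem_lin_span.
    by case/vlineP => k ->; rewrite pairingZl yl0 mulr0.
  move=> lu; rewrite tE'; split; first by case: lu.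
  have : u \in <[y]>%VS by rewrite -(span_ray d0 ly y0) mem_lin_span.
  by case/vlineP => k ->; rewrite pairingZl yl' mulr0.
have [az|an] := eqVneq a 0; last first.
  left; apply: (same y1) => //; have : a * pairing y1 l' = 0 by lra.
  by move/eqP; rewrite mulf_eq0 (negbTE an) => /eqP.
have bn : b != 0 by apply: contra x0 => /eqP bz; rewrite xE az bz !scale0r addr0.
right; apply: (same y2) => //; have : b * pairing y2 l' = 0 by lra.
by move/eqP; rewrite mulf_eq0 (negbTE bn) => /eqP.
Qed.

End Fine.

(** * Symmetry and existence of the degree *)

Section Symmetry.
Context {R : realType} {n : nat}.
Local Notation V := 'rV[R]_n.
Local Notation rl := (@realify R n).
Implicit Types (x y v w : V) (sigma tau rho kappa : set V) (F H K : wfan R n) (f g : V -> R)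
  (T : tropical_function n).

Lemma lextE_span f sigma x : lin_on f sigma -> x \in lin_span sigma ->
  forall l : 'cV[R]_n, (forall y, sigma y -> f y = pairing y l) -> pairing x (lext f sigma) = pairing x l.
Proof.
move=> ls xs l h; apply: pairing_span xs => y sy.
by rewrite -lextE // h.
Qed.

(* The two flags tau_i < sigma give lattice bases (u1, v1) and (u2, v2) of opposite
   orientation, so the wedges f /\ g at the two rays cancel; this is the symmetry of
   the degree. *)
Lemma flag_relation (u1 u2 v1 v2 : V) (alpha beta gamma dl : R) (p q r s p' q' r' s' : int) :
  indep u1 u2 -> 0 < beta -> 0 < dl ->
  v1 = alpha *: u1 + beta *: u2 -> v2 = gamma *: u2 + dl *: u1 ->
  u2 = p%:~R *: v1 + q%:~R *: u1 -> v2 = r%:~R *: v1 + s%:~R *: u1 ->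
  u1 = p'%:~R *: v2 + q'%:~R *: u2 -> v1 = r'%:~R *: v2 + s'%:~R *: u2 ->
  beta = dl.
Proof.
move=> i12 b0 d0 E1 E2 e1 e2 e3 e4.
have [|A1 A2] := @indep_coeff _ _ u1 u2 0 1 (p%:~R * alpha + q%:~R) (p%:~R * beta) i12.
  by rewrite scale0r add0r scale1r {1}e1 E1; apply/rowP => i; rewrite !mxE; ring.
have [|A3 A4] := @indep_coeff _ _ u1 u2 dl gamma (r%:~R * alpha + s%:~R) (r%:~R * beta) i12.
  by rewrite addrC -E2 e2 E1; apply/rowP => i; rewrite !mxE; ring.
have [|B1 B2] := @indep_coeff _ _ u1 u2 1 0 (p'%:~R * dl) (p'%:~R * gamma + q'%:~R) i12.
  by rewrite scale0r addr0 scale1r {1}e3 E2; apply/rowP => i; rewrite !mxE; ring.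
have [|B3 B4] := @indep_coeff _ _ u1 u2 alpha beta (r'%:~R * dl) (r'%:~R * gamma + s'%:~R) i12.
  by rewrite -E1 e4 E2; apply/rowP => i; rewrite !mxE; ring.
have H1 : dl = (s * p - q * r)%:~R * beta.
  by rewrite intrD intrN !intrM; nra.
have H2 : beta = (s' * p' - q' * r')%:~R * dl.
  by rewrite intrD intrN !intrM; nra.
move: H1 H2; set N := (s * p - q * r)%R; set N' := (s' * p' - q' * r')%R => H1 H2.
have NN : N * N' = 1.
  apply/eqP; rewrite -(eqr_int R) intrM; apply/eqP.
  have : dl * 1 = dl * (N%:~R * N'%:~R) by rewrite mulr1 {1}H1 {1}H2; ring.
  by move/(mulfI (lt0r_neq0 d0)).
have [N1|N1] := unit_int NN; first by rewrite H1 N1 mul1r.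
by move: d0; rewrite H1 N1 mulN1r oppr_gt0 ltNge ltW.
Qed.

Lemma flag_wedge F sigma t1 t2 f g : is_fan (cones F) -> pointed_fan F -> cones_of_dim F 2 sigma ->
  lin_on f sigma -> lin_on g sigma -> face t1 sigma -> face t2 sigma -> cone_dim t1 = 1%N ->
  cone_dim t2 = 1%N -> (exists y1 y2, [/\ t1 y1, t2 y2, indep y1 y2 &
    forall x, sigma x -> exists a b, [/\ 0 <= a, 0 <= b & x = a *: y1 + b *: y2]]) ->
  let B t := pairing (lattice_normal sigma t) (lext g sigma) * f (lattice_normal t [set 0]) -
     pairing (lattice_normal sigma t) (lext f sigma) * g (lattice_normal t [set 0]) in
  B t1 + B t2 = 0.
Proof.
move=> fF pF [Fs ds] lf lg f1 f2 d1 d2 [y1 [y2 [ty1 ty2 i12 dec]]] B.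
have [_ rF cF _] := fF; have rs := rF _ Fs.
have F1 := cF _ _ Fs f1; have F2 := cF _ _ Fs f2.
have N1 := Prim_ray_finite fF pF (conj F1 d1); have N2 := Prim_ray_finite fF pF (conj F2 d2).
set u1 := lattice_normal t1 [set 0] in N1; set u2 := lattice_normal t2 [set 0] in N2.
have [P1 tu1] : (Prim `&` t1) u1 by rewrite N1.
have [P2 tu2] : (Prim `&` t2) u2 by rewrite N2.
have [Zu1 u10 G1] := P1; have [Zu2 u20 G2] := P2.
have [y10 y2y1] := i12; have y20 : y2 != 0 by apply: contraNneq y2y1 => ->; apply: mem0v.
have prop t y u : cone_dim t = 1%N -> cones F t -> t y -> t u -> y != 0 -> u != 0 ->
    exists2 c, 0 < c & y = c *: u.
  move=> dt Ft ty tu y0 u0; have /vlineP[c yE] : y \in <[u]>%VS.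
    by rewrite -(span_ray dt tu u0) mem_lin_span.
  exists c => //; rewrite lt_def; apply/andP; split.
    by apply: contra y0 => /eqP c0; rewrite yE c0 scale0r.
  rewrite leNgt; apply/negP => c0; apply: (face0_ray (pointed_face fF pF Ft) tu u0).
  have [_ _ tZ] := rational_convex_cone (rF _ Ft).
  have := tZ (- c^-1) y; rewrite oppr_ge0 invr_le0 ltW // => /(_ isT ty).
  by rewrite yE scalerA mulNr mulVf ?lt_eqF // scaleN1r.
have [c1 c10 yE1] := prop _ _ _ d1 F1 ty1 tu1 y10 u10.
have [c2 c20 yE2] := prop _ _ _ d2 F2 ty2 tu2 y20 u20.
have iu : indep u1 u2.
  split=> //; apply: contra y2y1 => /vlineP[k u2E].
  apply/vlineP; exists (c2 * k / c1); rewrite yE2 u2E yE1 !scalerA.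
  by congr (_ *: _); field; rewrite gt_eqF.
have dec' x : sigma x -> exists a b, [/\ 0 <= a, 0 <= b & x = a *: u1 + b *: u2].
  move=> /dec[a [b [a0 b0 ->]]]; exists (a * c1), (b * c2).
  split; [by apply: mulr_ge0 => //; apply: ltW|by apply: mulr_ge0 => //; apply: ltW|].
  by rewrite yE1 yE2 !scalerA.
have [s1 s2] := (face_sub f1 tu1, face_sub f2 tu2).
have ss : lin_span sigma = plane u1 u2 by apply: span_plane => //; apply: mem_lin_span.
have ss' : lin_span sigma = plane u2 u1 by rewrite ss /plane addvC.
have [NE1 [iv1 [[Zv1 sv1] gen1 _]]] := Nset_ray rs ds f1 d1 tu1 u10 Zu1.
have [NE2 [iv2 [[Zv2 sv2] gen2 _]]] := Nset_ray rs ds f2 d2 tu2 u20 Zu2.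
have [_ g1] : (Nset u1 `&` germ sigma u1) (lattice_normal sigma t1) by rewrite NE1.
have [_ g2] : (Nset u2 `&` germ sigma u2) (lattice_normal sigma t2) by rewrite NE2.
set v1 := lattice_normal sigma t1 in g1 sv1 Zv1 gen1 iv1.
set v2 := lattice_normal sigma t2 in g2 sv2 Zv2 gen2 iv2.
have gen t u v y : cone_dim t = 1%N -> t u -> Prim u -> lattice_of sigma v ->
    (forall x, lattice_of sigma x -> exists a : int, lattice_of t (x - a%:~R *: v)) ->
    lattice_of sigma y -> exists a b : int, y = a%:~R *: v + b%:~R *: u.
  move=> dt tu [_ u0 Gu] _ gv /gv[a [Zy yt]]; exists a.
  rewrite (span_ray dt tu u0) in yt; have [b E] := Gu _ Zy yt.
  by exists b; rewrite -E addrC subrK.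
have ls x : sigma x -> x \in lin_span sigma by apply: mem_lin_span.
have [p [q e1]] := gen t1 u1 v1 u2 d1 tu1 P1 (conj Zv1 sv1) gen1 (conj Zu2 (ls _ s2)).
have [r [s e2]] := gen t1 u1 v1 v2 d1 tu1 P1 (conj Zv1 sv1) gen1 (conj Zv2 sv2).
have [p' [q' e3]] := gen t2 u2 v2 u1 d2 tu2 P2 (conj Zv2 sv2) gen2 (conj Zu1 (ls _ s1)).
have [r' [s' e4]] := gen t2 u2 v2 v1 d2 tu2 P2 (conj Zv2 sv2) gen2 (conj Zv1 sv1).
have pos u u' v : indep u u' -> (forall x, sigma x -> exists a b, [/\ 0 <= a, 0 <= b & x = a *: u + b *: u']) ->
    lin_span sigma = plane u u' -> indep u v -> germ sigma u v -> v \in lin_span sigma ->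
    exists a b, 0 < b /\ v = a *: u + b *: u'.
  move=> iuu deC sE iv [su [e e0 se]] vs; rewrite sE in vs; have /planeP[a [b vE]] := vs.
  exists a, b; split=> //.
  have [a' [b' [a0' b0' E]]] := deC _ se.
  have [|_ eb] := @indep_coeff _ _ u u' (1 + e * a) (e * b) a' b' iuu.
    by rewrite -E vE; apply/rowP => i; rewrite !mxE; ring.
  rewrite lt_def -(pmulr_rge0 _ e0) eb b0' andbT; case: iv => _; apply: contraNneq => bz.
  by rewrite vE bz scale0r addr0 memvZ ?memv_line.
have iu' : indep u2 u1.
  apply/indepP => a b E; have [|-> ->] := (indepP u1 u2).1 iu b a; by rewrite ?[_ + a *: _]addrC.
have dec'' x : sigma x -> exists a b, [/\ 0 <= a, 0 <= b & x = a *: u2 + b *: u1].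
  by move=> /dec'[a [b [a0 b0 ->]]]; exists b, a; rewrite addrC.
have [al [be [b0 E1]]] := pos _ _ _ iu dec' ss iv1 g1 sv1.
have [ga [de [d0 E2]]] := pos _ _ _ iu' dec'' ss' iv2 g2 sv2.
have bd := flag_relation iu b0 d0 E1 E2 e1 e2 e3 e4.
(* Expressed by u1 and u2, the two terms are the same determinant of f and g with opposite signs,
   multiplied by [be] and by [de]. *)
rewrite /B -/u1 -/u2 -/v1 -/v2 !(lextE lf s1) !(lextE lf s2) !(lextE lg s1) !(lextE lg s2).
by rewrite E1 E2 !pairingDl !pairingZl bd; ring.
Qed.

(** The difference of the two degrees is a sum over flags, that is, over rays inside 2-cones,
    because the correction terms with k cancel. Regrouped by 2-cones, each has exactly two flags,
    which cancel by [flag_wedge]. *)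
Lemma DegF_sym F f g : is_fan (cones F) -> balanced F 2 -> pointed_fan F ->
  lin_on_fan f F -> lin_on_fan g F -> DegF F f g = DegF F g f.
Proof.
move=> fF bF pF lf lg; have [_ rF cF _] := fF.
have f1 := finite_cones_of_dim 1 fF; have f2 := finite_cones_of_dim 2 fF.
pose B (t s : set V) := pairing (lattice_normal s t) (lext g s) * f (lattice_normal t [set 0]) -
     pairing (lattice_normal s t) (lext f s) * g (lattice_normal t [set 0]).
apply/eqP; rewrite -subr_eq0 /DegF.
have -> : \sum_(t \in cones_of_dim F 1) Wt g F t * f (lattice_normal t [set 0]) -
    \sum_(t \in cones_of_dim F 1) Wt f F t * g (lattice_normal t [set 0]) =
    \sum_(t \in cones_of_dim F 1) \sum_(s \in cones_of_dim F 2)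
      if `[< face t s >] then (weight F s)%:R * B t s else 0.
  rewrite !fsbig_finite //= -sumrB; apply: eq_big_seq => t; rewrite in_fset_set // inE => Ft.
  have [Ft1 dt] := Ft.
  have NE := Prim_ray_finite fF pF Ft; set u := lattice_normal t [set 0] in NE *.
  have [[Zu u0 _] tu] : (Prim `&` t) u by rewrite NE.
  have := bF _ Ft1; rewrite dt => /(_ erefl); rewrite (span_ray dt tu u0) => /vlineP[k kE].
  have wE h : lin_on_fan h F -> Wt h F t = \sum_(s \in star F 2 t)
      (weight F s)%:R * pairing (lattice_normal s t) (lext h s) - k * h u.
    move=> lh; rewrite /Wt kE pairingZl -(lextE (lh _ Ft1) tu); congr (_ - _).
    by apply: eq_fsbigr => s _; rewrite pairingZl.
  rewrite (wE g lg) (wE f lf).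
  transitivity (\sum_(s \in star F 2 t) (weight F s)%:R * B t s).
    rewrite !mulrBl opprD addrACA opprK [X in _ + X](_ : _ = 0) ?addr0; last by rewrite mulrAC addNr.
    rewrite !mulr_fsuml !(fsbig_finite _ _ (finite_star 2 t fF)) -sumrB.
    by apply: eq_bigr => s _; rewrite /B -/u mulrBr !mulrA.
  transitivity (\sum_(s \in star F 2 t) if `[< face t s >] then (weight F s)%:R * B t s else 0).
    by apply: eq_fsbigr => s; rewrite inE => -[_ fs]; case: asboolP.
  apply: fsbig_widen => [s []//|s [Fs ns] /=].
  by case: asboolP => // fs; case: ns.
rewrite exchange_fsbig // fsbig1 // => s Fs; have [Fs1 ds] := Fs.
have [t1 [t2 [y1 [y2 [[ft1 ft2] [d1 d2] [ty1 ty2] i12 [t12 [dec all]]]]]]] :=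
  two_rays (rF _ Fs1) ds (pointed_face fF pF Fs1).
rewrite -(@fsbig_widen _ _ _ _ [set t1; t2]).
- rewrite fsbigU0 //; last by move=> t [-> /t12].
  rewrite !fsbig_set1 (asboolT ft1) (asboolT ft2) /=.
  transitivity ((weight F s)%:R * (B t1 s + B t2 s)); first by rewrite [RHS]mulrDr.
  apply/eqP; rewrite mulf_eq0; apply/orP; right; apply/eqP.
  apply: (@flag_wedge F s t1 t2 f g) => //; [exact: lf|exact: lg|by exists y1, y2].
- by move=> t [] ->; split=> //; apply: cF Fs1 _.
- move=> t [[Ft dt] nt] /=; case: asboolP => // ft.
  by case: (all t ft dt) => E; case: nt; [left|right].
Qed.

Lemma Wt_linear F (l : 'cV[R]_n) t : is_fan (cones F) -> cones_of_dim F 1 t ->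
  (forall s, star F 2 t s -> lattice_normal s t \in lin_span s) -> balanced F 2 ->
  Wt (fun x => pairing x l) F t = 0.
Proof.
move=> fF [Ft dt] ns bF; rewrite /Wt.
have lin s : lin_on (fun x => pairing x l) s by exists l.
have -> : pairing (weighted_normals F 2 t) (lext (fun x => pairing x l) t) =
    pairing (weighted_normals F 2 t) l.
  by apply: lextE_span => //; apply: bF => //; rewrite dt.
rewrite /weighted_normals (fsbig_finite _ _ (finite_star 2 t fF)) (fsbig_finite _ _ (finite_star 2 t fF)).
rewrite pairing_suml -sumrB big1_seq // => s /andP[_]; rewrite in_fset_set; last exact: finite_star.
rewrite inE => st; rewrite !pairingZl.
have -> : pairing (lattice_normal s t) (lext (fun x => pairing x l) s) = pairing (lattice_normal s t) l.
  by apply: lextE_span => //; exact: ns.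
by rewrite subrr.
Qed.

Lemma normal_span F s t : is_fan (cones F) -> cones_of_dim F 1 t -> star F 2 t s ->
  lattice_normal s t \in lin_span s /\ Zn (lattice_normal s t).
Proof.
move=> [_ rF _ _] [Ft dt] [[Fs ds] fs].
have [z [tz z0]] := rational_dim1 (rF _ Ft) dt.
by have [_ [_ [[]]]] := Nset_ray (rF _ Fs) ds fs dt tz z0 (Zn_rz z).
Qed.

(** The pairing of the sum with a functional l is the degree of l with g; by symmetry it can be
    computed from the divisor of l, which is zero by [Wt_linear]. *)
Lemma divisor_balanced F g : is_fan (cones F) -> balanced F 2 -> pointed_fan F -> lin_on_fan g F ->
  \sum_(t \in cones_of_dim F 1) Wt g F t *: lattice_normal t [set 0] = 0.
Proof.
move=> fF bF pF lg; apply: pairing_eq0 => l.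
have f1 := finite_cones_of_dim 1 fF.
rewrite fsbig_finite // pairing_suml.
transitivity (DegF F (fun x => pairing x l) g).
  by rewrite /DegF fsbig_finite //; apply: eq_bigr => t _; rewrite pairingZl.
rewrite DegF_sym //; last by move=> s _; exists l.
rewrite /DegF fsbig1 // => t Ft; rewrite Wt_linear ?mul0r // => s st.
by case: (normal_span fF Ft st).
Qed.

(** Weights in [wfan] are natural numbers, so a divisor exists only if the real formula for its
    weights is one. Each normal contributes the jump between the functionals of T on the ray and on
    the 2-cone, evaluated at an integral vector; it is nonnegative because T is a maximum. *)
Lemma Wt_nat F T t : is_fan (cones F) -> balanced F 2 -> fineT F T -> cones_of_dim F 1 t ->
  exists m : nat, m%:R = Wt (teval T) F t.
Proof.
move=> fF bF fT Ft; have [Ft1 dt] := Ft; have [_ rF _ _] := fF.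
have [l lT lE] := fT _ Ft1.
have wn : pairing (weighted_normals F 2 t) (lext (teval T) t) = pairing (weighted_normals F 2 t) (rl l).
  by apply: lextE_span => //; [exists (rl l)|apply: bF => //; rewrite dt].
have term s : star F 2 t s -> exists m : nat, m%:R =
    pairing (lattice_normal s t) (lext (teval T) s) - pairing (lattice_normal s t) (rl l).
  move=> st; have [vs Zv] := normal_span fF Ft st; have [[Fs ds] fs] := st.
  have [k kT kE] := fT _ Fs.
  have -> : pairing (lattice_normal s t) (lext (teval T) s) = pairing (lattice_normal s t) (rl k).
    by apply: lextE_span => //; exists (rl k).
  have [z [tz z0]] := rational_dim1 (rF _ Ft1) dt.
  have [NE _] := Nset_ray (rF _ Fs) ds fs dt tz z0 (Zn_rz z).
  have [_ [_ [e e0 se]]] : (Nset (rz z) `&` germ s (rz z)) (lattice_normal s t) by rewrite NE.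
  have sz := face_sub fs tz.
  have h : 0 <= pairing (lattice_normal s t) (rl k) - pairing (lattice_normal s t) (rl l).
    have := teval_ge (rz z + e *: lattice_normal s t) lT; rewrite (kE _ se) !pairingDl !pairingZl.
    by rewrite -(kE _ sz) (lE _ tz) lerD2l ler_pM2l // subr_ge0.
  move: h; have /ZnP[u ->] := Zv; rewrite !pairing_rz -intrB ler0z => h.
  by move: h; set c := (X in 0 <= X) => h; exists (absz c); rewrite natr_absz ger0_norm.
rewrite /Wt wn /weighted_normals !(fsbig_finite _ _ (finite_star 2 t fF)) pairing_suml -sumrB.
pose SS : seq (set V) := fset_set (star F 2 t); rewrite -/SS.
have : {subset SS <= star F 2 t}.
  by move=> s; rewrite /SS in_fset_set //; exact: finite_star.
elim: SS => [|s S IH] sub; first by exists 0%N; rewrite big_nil.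
have [|m mE] := IH; first by move=> r rS; apply: sub; rewrite inE rS orbT.
have [k kE] : exists k : nat, k%:R = pairing (lattice_normal s t) (lext (teval T) s) - pairing (lattice_normal s t) (rl l).
  by apply: term; have := sub s (mem_head _ _); rewrite inE.
exists (weight F s * k + m)%N; rewrite big_cons -mE natrD natrM kE !pairingZl mulrBr //.
Qed.

Lemma Wt_ge0 F T t : is_fan (cones F) -> balanced F 2 -> fineT F T -> cones_of_dim F 1 t ->
  0 <= Wt (teval T) F t.
Proof. by move=> fF bF fT Ft; have [m <-] := Wt_nat fF bF fT Ft. Qed.

(** Shows that the set from which [degree] picks is nonempty, so that the default value of [xget]
    does not intervene. *)
Lemma derivation_exists (X : set (wfan R n)) F T1 T2 : X F -> tropical_fan 2 F -> pointed_fan F ->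
  fineT F T1 -> fineT F T2 -> exists H, cycle_mul_seq 0 [:: T1; T2] X H.
Proof.
move=> XF [fF pF bF] ptF f1 f2; have [_ rF cF _] := fF.
have d0 : cone_dim [set 0 : V] = 0%N by rewrite /cone_dim lin_span0 dimv0.
pose H := WFan [set t | cones F t /\ (cone_dim t <= 1)%N]
  (fun t => xget 0%N [set m | m%:R = Wt (teval T2) F t]).
have wH t : cones_of_dim F 1 t -> (weight H t)%:R = Wt (teval T2) F t.
  move=> Ft; rewrite /H /=; case: xgetP => [m -> //|N].
  by have [m mE] := Wt_nat fF bF f2 Ft; case: (N m).
have fH : is_fan (cones H) by apply: (@is_fan_skeleton _ _ F 1).
have H1 : cones_of_dim H 1 = cones_of_dim F 1.
  by apply/seteqP; split=> s; [case=> -[]|case=> Fs ds]; split=> //; split=> //; rewrite ds.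
have zero s : cones F s -> cone_dim s = 0%N -> s = [set 0].
  move=> Fs ds; apply/seteqP; split=> x.
    move=> sx; apply/eqP; have : x \in lin_span s by apply: mem_lin_span.
    by move/eqP: ds; rewrite /cone_dim dimv_eq0 => /eqP->; rewrite memv0.
  by move=> ->; have [] := rational_convex_cone (rF _ Fs).
have ptH : pointed_fan H.
  by move=> s [Fs _]; split; [apply: ptF Fs|rewrite d0].
have starH : cones F [set 0] -> star H 1 [set 0] = cones_of_dim H 1.
  move=> F0; apply/seteqP; split=> s; first by case.
  by move=> Hs; split=> //; apply: (pointed_face fH ptH); case: Hs.
have wn0 : cones F [set 0] -> weighted_normals H 1 [set 0] = 0.
  move=> F0; rewrite /weighted_normals starH // H1 -[RHS](divisor_balanced fF bF ptF (fineT_lin f2)).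
  by apply: eq_fsbigr => t; rewrite inE => Ft; rewrite wH.
have tH : tropical_fan 1 H.
  split=> //.
    move=> t [Ft dt]; have [d1|d1] := leqP 1 (cone_dim t).
      by exists t => //; split=> //; apply/eqP; rewrite eqn_leq dt.
    (* Purity of the 1-skeleton at the origin: a pointed 2-cone has a ray. *)
    have [s [Fs ds] ts] := pF _ Ft.
    have [t1 [_ [_ [_ [[f _] [dt1 _] _ _ _]]]]] := two_rays (rF _ Fs) ds (pointed_face fF ptF Fs).
    have F1 := cF _ _ Fs f; exists t1; first by rewrite H1.
    rewrite (zero t Ft); first by move=> _ ->; have [] := rational_convex_cone (rF _ F1).
    by apply/eqP; rewrite -leqn0 -ltnS.
  move=> t [Ft _] [dt]; move: (Ft); rewrite (zero t Ft dt) => F0.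
  by rewrite wn0 // mem0v.
have lH : forall s, cones H s -> linear_on T1 s by move=> s [Fs _]; apply: (fineT_lin f1).
pose K := WFan [set t | cones H t /\ (cone_dim t <= 0)%N]
  (fun t => xget 0%N [set m | m%:R = \sum_(s \in star H 1 t)
            pairing ((weight H s)%:R *: lattice_normal s t) (linear_ext T1 s)
          - pairing (weighted_normals H 1 t) (linear_ext T1 t)]).
have dK : is_divisor 0 T1 H K.
  split=> //= t [[Ft _] dt]; move: (Ft); rewrite (zero t Ft dt) => F0.
  case: xgetP => [m -> //|N].
  suff [m mE] : exists m : nat, m%:R = \sum_(s \in star H 1 [set 0])
            pairing ((weight H s)%:R *: lattice_normal s [set 0]) (linear_ext T1 s)
          - pairing (weighted_normals H 1 [set 0]) (linear_ext T1 [set 0]) by case: (N m).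
  rewrite wn0 // pairing0l subr0 starH // H1.
  rewrite (fsbig_finite _ _ (finite_cones_of_dim 1 fF)).
  pose SS : seq (set V) := fset_set (cones_of_dim F 1); rewrite -/SS.
  have : {subset SS <= cones_of_dim F 1}.
    by move=> s; rewrite /SS in_fset_set //; exact: finite_cones_of_dim.
  elim: SS => [|s S IH] sub; first by exists 0%N; rewrite big_nil.
  have [|m mE] := IH; first by move=> r rS; apply: sub; rewrite inE rS orbT.
  have Fs : cones_of_dim F 1 s by have := sub s (mem_head _ _); rewrite inE.
  have [[Zv _ _] sv] : (Prim `&` s) (lattice_normal s [set 0]) by rewrite (Prim_ray_finite fF ptF Fs).
  have [Fs1 ds] := Fs; have [k kT kE] := f1 _ Fs1.
  have h0 := teval_ge0 T1 (lattice_normal s [set 0]).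
  have e : pairing (lattice_normal s [set 0]) (linear_ext T1 s) = teval T1 (lattice_normal s [set 0]).
    by rewrite [RHS](lextE (fineT_lin f1 Fs1) sv).
  move: h0; rewrite (kE _ sv); have /ZnP[u uE] := Zv; rewrite uE pairing_rz ler0z => h0.
  pose c : int := (u *m k) 0 0; exists (weight H s * absz c + m)%N.
  rewrite big_cons -mE natrD natrM pairingZl e (kE _ sv) uE pairing_rz natr_absz ger0_norm //.
have fK : is_fan (cones K) by apply: (@is_fan_skeleton _ _ H 0).
have tK : tropical_fan 0 K.
  by split=> // t; move=> [Ft dt]; exists t => //; split=> //; apply/eqP; rewrite -leqn0.
have dH : is_divisor 1 T2 F H.
  by split; [exact: (fineT_lin f2)|by []|move=> t Ft; rewrite wH].
have cH : cycle_of 1 H H by split; last exact: fan_equiv_refl.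
have cK : cycle_of 0 K K by split; last exact: fan_equiv_refl.
have mH : cycle_mul 1 T2 X H by exists F, H.
by exists K, H, K.
Qed.

(** Starting from the positive part makes the weights positive; cutting by [coords] makes the cones
    pointed, and cutting by L makes the functions with walls in L fine. *)
Lemma fine_rep F0 (L : seq 'cV[int]_n) : tropical_fan 2 F0 -> exists F,
  [/\ tropical_fan 2 F /\ cycle_of 2 F0 F, (forall x v, indep x v -> delta F x v = delta F0 x v),
     positive 2 F /\ pointed_fan F, (forall T, {subset diffs T <= L} -> fineT F T) &
     forall l s, l \in L -> cones F s ->
       (forall x, s x -> 0 <= pairing x (rl l)) \/ (forall x, s x -> pairing x (rl l) <= 0)].
Proof.
move=> t0; have [f0 p0 b0] := t0; have tP := tropical_positive_part t0.
have [fP pP bP] := tP; have [F rF cF] := cut_refines (coords ++ L) tP.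
have [tF _ _ wF] := rF; exists F.
have dE x v : indep x v -> delta F x v = delta F0 x v.
  by move=> iv; rewrite (delta_prerefines fP pP (refines_prerefines rF) iv) delta_positive_part.
split=> //.
- by split=> //; split=> //; apply: delta_equiv => // x v iv; rewrite dE.
- split.
    move=> s Fs; have [t Ft st] := prerefines_top fP pP (refines_prerefines rF) Fs.
    by rewrite (wF _ _ Fs Ft st); case/positive_part_top: Ft.
  by apply: (pointed_cut fP cF) => l lL; rewrite mem_cat lL.
- by move=> T sub; apply: (fineT_cut fP cF) => l /sub lL; rewrite mem_cat lL orbT.
move=> l s lL; rewrite cF => Cs; apply: (cut_sign Cs); by rewrite mem_cat lL orbT.
Qed.

(** Removes [xget] from the degree; from here on degrees of 2-cycles are computed from densities. *)
Lemma degreeE F0 T1 T2 : tropical_fan 2 F0 ->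
  (degree [:: T1; T2] (cycle_of 2 F0))%:R = DEG (delta F0) (teval T1) (teval T2).
Proof.
move=> t0; have [F [[tF XF] _ [_ pF] fT _]] := fine_rep (diffs T1 ++ diffs T2) t0.
have [||H HH] := derivation_exists XF tF pF (T1 := T1) (T2 := T2).
- by apply: fT => l h; rewrite mem_cat h.
- by apply: fT => l h; rewrite mem_cat h orbT.
rewrite /degree; case: xgetP => [m -> [K KK <-]|/(_ (origin_weight H))]; last by case; exists H.
by apply: DEG_derivation KK; case: t0.
Qed.

End Symmetry.

(** * The wedge bound *)

Section Bound.
Context {R : realType} {n : nat}.
Local Notation V := 'rV[R]_n.
Local Notation rl := (@realify R n).
Implicit Types (x y v w : V) (sigma tau rho kappa : set V) (F H K : wfan R n) (f g : V -> R)
  (T : tropical_function n).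

Definition maxl (l : 'cV[int]_n) : tropical_function n :=
  @TropicalFunction n [:: 0; l] (mem_head _ _).

Lemma teval_maxl (l : 'cV[int]_n) x : teval (maxl l) x = Num.max 0 (pairing x (rl l)).
Proof.
rewrite /teval /= !big_cons big_nil rl0 pairing0r; apply/eqP.
by rewrite [Num.max (pairing _ _) 0]maxC maxA maxxx.
Qed.

Lemma maxl_le (l : 'cV[int]_n) T x : l \in functionals T -> teval (maxl l) x <= teval T x.
Proof. by move=> lT; rewrite teval_maxl ge_max teval_ge0 teval_ge. Qed.

(** A sum with infinite support is 0 by convention, so the finiteness of the support has to be
    supplied. *)
Lemma fsum_ge_term (S : set V) (a : V -> R) x : finite_set (S `&` [set y | a y != 0]) ->
  (forall y, S y -> 0 <= a y) -> S x -> a x <= \sum_(y \in S) a y.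
Proof.
move=> fS a0 Sx; set K := S `&` _ in fS.
rewrite -(@fsbig_widen _ _ _ _ K); last 2 first.
- by move=> y [].
- by move=> y [Sy nK] /=; apply/eqP/negPn/negP => ay; apply: nK.
have [ax|ax] := eqVneq (a x) 0.
  by rewrite ax; apply: fsumr_ge0 => y [Sy _]; apply: a0.
have -> : \sum_(y \in K) a y = a x + \sum_(y \in K `\ x) a y by apply: fsbigD1 => //; split.
rewrite lerDl; apply: fsumr_ge0 => y [[Sy _] _]; exact: a0.
Qed.

Lemma delta_ge0 F x v : 0 <= delta F x v.
Proof.
apply: fsumr_ge0 => s _; case: ifP => // _; by rewrite mulr1 ler0n.
Qed.

Lemma Nset_delta_finite F x : is_fan (cones F) -> Zn x -> x != 0 ->
  finite_set (Nset x `&` [set v | delta F x v != 0]).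
Proof.
move=> fF Zx x0; apply: (@sub_finite_set _ _ (\bigcup_(s in cones_of_dim F 2) (Nset x `&` germ s x))).
  move=> v [Nv /eqP dv]; apply: contrapT => N; apply: dv.
  rewrite /delta /wsum fsbig1 // => s Fs; case: asboolP => // gv.
  by case: N; exists s.
apply: bigcup_finite; first exact: finite_cones_of_dim.
by move=> s Fs; apply: finite_Nset_germ Fs.
Qed.

Lemma Nset_delta_mul_finite F x (h : V -> R) : is_fan (cones F) -> Zn x -> x != 0 ->
  finite_set (Nset x `&` [set v | delta F x v * h v != 0]).
Proof.
move=> fF Zx x0; apply: sub_finite_set (Nset_delta_finite fF Zx x0) => v [Nv].
by move=> /= h0; split=> //=; apply: contra h0 => /eqP->; rewrite mul0r.
Qed.

Lemma der_maxl0 (l : 'cV[int]_n) x v : pairing x (rl l) = 0 ->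
  der (teval (maxl l)) x v = Num.max 0 (pairing v (rl l)).
Proof.
move=> xl; apply: (@derE _ _ _ _ _ _ 1) => // e /andP[e0 _].
rewrite !teval_maxl !pairingE xl add0r maxxx add0r.
by rewrite maxr_pMr // mulr0.
Qed.

Lemma der_maxl_pos (l : 'cV[int]_n) x v : 0 < pairing x (rl l) ->
  der (teval (maxl l)) x v = pairing v (rl l).
Proof.
move=> xl; have [|e e0 he] := @small_step R [:: (pairing x (rl l), - pairing v (rl l))].
  by move=> p; rewrite inE => /eqP-> /=; left.
have /= H := he _ (mem_head _ _).
apply: (derE e0) => d /andP[d0 de]; rewrite !teval_maxl !pairingE.
rewrite (max_r (ltW xl)) max_r //.
have [v0|v0] := leP 0 (pairing v (rl l)); first by rewrite addr_ge0 ?mulr_ge0 // ltW.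
have : d * - pairing v (rl l) <= e * - pairing v (rl l).
  by rewrite ler_wpM2r // oppr_ge0 ltW.
lra.
Qed.

Lemma der_maxl_neg (l : 'cV[int]_n) x v : pairing x (rl l) < 0 ->
  der (teval (maxl l)) x v = 0.
Proof.
move=> xl; have [|e e0 he] := @small_step R [:: (- pairing x (rl l), pairing v (rl l))].
  by move=> p; rewrite inE => /eqP-> /=; left; rewrite oppr_gt0.
have /= H := he _ (mem_head _ _).
apply: (derE e0) => d /andP[d0 de]; rewrite !teval_maxl !pairingE mulr0 addr0.
rewrite (max_l (ltW xl)) max_l //.
have [v0|v0] := leP 0 (pairing v (rl l)); last first.
  have : d * pairing v (rl l) <= 0 by rewrite mulr_ge0_le0 // ltW.
  lra.
have : d * pairing v (rl l) <= e * pairing v (rl l) by rewrite ler_wpM2r.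
lra.
Qed.

Lemma Wloc_maxl0 F (l : 'cV[int]_n) x : is_fan (cones F) -> balanced F 2 -> Zn x -> x != 0 ->
  pairing x (rl l) = 0 ->
  Wloc (delta F) (teval (maxl l)) x = \sum_(v \in Nset x) delta F x v * Num.max 0 (pairing v (rl l)).
Proof.
move=> fF bF Zx x0 xl; have [k kE] := delta_balanced fF bF Zx x0.
apply: WlocE => //; exists k => //.
rewrite teval_maxl xl maxxx mulr0 subr0; apply: eq_fsbigr => v _.
by rewrite der_maxl0.
Qed.

Lemma Wloc_maxl_off F (l : 'cV[int]_n) x : is_fan (cones F) -> balanced F 2 -> Zn x -> x != 0 ->
  pairing x (rl l) != 0 -> Wloc (delta F) (teval (maxl l)) x = 0.
Proof.
move=> fF bF Zx x0 xl; have [k kE] := delta_balanced fF bF Zx x0.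
apply: WlocE => //; exists k => //.
have [lt|gt|e] := ltrgtP (pairing x (rl l)) 0; last by rewrite e eqxx in xl.
  rewrite teval_maxl (max_l (ltW lt)) mulr0 subr0 fsbig1 // => v _.
  by rewrite der_maxl_neg // mulr0.
rewrite teval_maxl (max_r (ltW gt)) -pairingZl -kE.
rewrite [X in X - _](_ : _ = \sum_(v \in Nset x) delta F x v * pairing v (rl l)); last first.
  by apply: eq_fsbigr => v _; rewrite der_maxl_pos.
pose K := Nset x `&` [set v | delta F x v != 0].
have fK : finite_set K by apply: Nset_delta_finite.
have subK : K `<=` Nset x by move=> v [].
rewrite -(@fsbig_widen _ _ _ _ K (Nset x) (fun v => delta F x v * pairing v (rl l))) //; last first.
  move=> v [Nv nK] /=; have [->|d0] := eqVneq (delta F x v) 0; first by rewrite mul0r.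
  by case: nK.
rewrite -(@fsbig_widen _ _ _ _ K (Nset x) (fun v => delta F x v *: v)) //; last first.
  move=> v [Nv nK] /=; have [->|d0] := eqVneq (delta F x v) 0; first by rewrite scale0r.
  by case: nK.
rewrite !(fsbig_finite _ _ fK) pairing_suml -sumrB big1 // => v _.
by rewrite pairingZl subrr.
Qed.

(** Monotonicity in the first function comes from the nonnegative weights of the divisor of T0;
    symmetry gives it in the second. *)
Lemma DegF_le F T T' T0 : is_fan (cones F) -> balanced F 2 -> fineT F T0 ->
  (forall x, teval T x <= teval T' x) ->
  DegF F (teval T) (teval T0) <= DegF F (teval T') (teval T0).
Proof.
move=> fF bF fT le; rewrite /DegF !(fsbig_finite _ _ (finite_cones_of_dim 1 fF)).
rewrite !big_seq; apply: ler_sum => t; rewrite in_fset_set; last exact: finite_cones_of_dim.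
by rewrite inE => Ft; apply: ler_wpM2l => //; apply: Wt_ge0.
Qed.

Lemma DegF_ge0 F T T0 : is_fan (cones F) -> balanced F 2 -> fineT F T0 ->
  0 <= DegF F (teval T) (teval T0).
Proof.
move=> fF bF fT; apply: fsumr_ge0 => t Ft; apply: mulr_ge0; first exact: Wt_ge0.
exact: teval_ge0.
Qed.

(** The functions max(0, l) and max(0, - l) differ by the linear function l, whose sum over the
    divisor of g is 0 by [divisor_balanced]. *)
Lemma DegF_maxlN F (l : 'cV[int]_n) g : is_fan (cones F) -> balanced F 2 -> pointed_fan F ->
  lin_on_fan g F -> DegF F (teval (maxl (- l))) g = DegF F (teval (maxl l)) g.
Proof.
move=> fF bF pF lg; have f1 := finite_cones_of_dim 1 fF.
apply/eqP; rewrite -subr_eq0 /DegF !(fsbig_finite _ _ f1) -sumrB.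
have := divisor_balanced fF bF pF lg; rewrite (fsbig_finite _ _ f1).
move=> /(congr1 (fun x => - pairing x (rl l))); rewrite pairing0l oppr0 pairing_suml -sumrN => E.
apply/eqP; rewrite -[RHS]E; apply: eq_bigr => t _; rewrite pairingZl -mulrBr -mulrN; congr (_ * _).
rewrite !teval_maxl rlN pairingNr; set c := pairing _ _.
by have [c0|c0] := leP 0 c; [rewrite max_l ?oppr_le0 //; lra|rewrite max_r ?oppr_ge0 ?(ltW c0) //; lra].
Qed.

(** L is the combination of s and s' that vanishes at u, and L(v) is their determinant on (u, v) up
    to sign. The divisor of max(0, L) has weight at least delta L(v) at u, where max(0, s') has the
    value c. On the divisor of max(0, s') the functional s' vanishes and max(0, L) equals c max(0,
    s). Computing the degree of max(0, s') and max(0, L) in both orders, the factor c cancels. *)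
Lemma wedge_le_degree_core F u v (s s' : 'cV[int]_n) (L : 'cV[int]_n) (c d : int):
  is_fan (cones F) -> balanced F 2 -> pointed_fan F ->
  c%:~R = pairing u (rl s') -> d%:~R = pairing u (rl s) -> L = c *: s - d *: s' ->
  fineT F (maxl s) -> fineT F (maxl s') -> fineT F (maxl L) ->
  Prim u -> Nset u v -> 0 < c ->
  delta F u v * pairing v (rl L) <= DegF F (teval (maxl s)) (teval (maxl s')).
Proof.
move=> fF bF pF cE dE LE fs fs' fL Pu Nv c0; have [Zu u0 _] := Pu.
have cR : 0 < c%:~R :> R by rewrite ltr0z.
have uL : pairing u (rl L) = 0.
  by rewrite LE rlD rlN !rlZ pairingBr !pairingZr -cE -dE mulrC subrr.
have D0 : 0 <= DegF F (teval (maxl s)) (teval (maxl s')) by apply: DegF_ge0.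
have [le0|gt0] := leP (delta F u v * pairing v (rl L)) 0; first exact: le_trans le0 D0.
have W1 : delta F u v * pairing v (rl L) <= Wloc (delta F) (teval (maxl L)) u.
  rewrite Wloc_maxl0 //.
  apply: (@le_trans _ _ (delta F u v * Num.max 0 (pairing v (rl L)))).
    by apply: ler_wpM2l; [exact: delta_ge0|rewrite le_max lexx orbT].
  apply: (@fsum_ge_term _ (fun v => delta F u v * Num.max 0 (pairing v (rl L)))) => //.
    exact: Nset_delta_mul_finite.
  by move=> y _; rewrite mulr_ge0 ?delta_ge0 // le_max lexx.
have [t [Ft tu]] : exists t, cones_of_dim F 1 t /\ t u.
  apply: contrapT => N; have := is_W_off fF (fineT_lin fL) Zu u0.
  move=> /(_ (fun t Ft tu => N (ex_intro _ t (conj Ft tu)))) /(WlocE u0) E.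
  by move: (lt_le_trans gt0 W1); rewrite E ltxx.
have WE : Wloc (delta F) (teval (maxl L)) u = Wt (teval (maxl L)) F t.
  by apply: WlocE => //; apply: is_W_ray => //; apply: fineT_lin.
have ut : u = lattice_normal t [set 0].
  have : (Prim `&` t) u by []. by rewrite (Prim_ray_finite fF pF Ft).
have f1 := finite_cones_of_dim 1 fF.
have lower : c%:~R * (delta F u v * pairing v (rl L)) <= DegF F (teval (maxl s')) (teval (maxl L)).
  have -> : DegF F (teval (maxl s')) (teval (maxl L)) = Wt (teval (maxl L)) F t *
      teval (maxl s') (lattice_normal t [set 0]) + \sum_(r \in cones_of_dim F 1 `\ t)
      Wt (teval (maxl L)) F r * teval (maxl s') (lattice_normal r [set 0]).
    by apply: (fsbigD1 t).
  rewrite -ut -WE.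
  apply: (@le_trans _ _ (Wloc (delta F) (teval (maxl L)) u * teval (maxl s') u)).
    rewrite mulrC teval_maxl -cE max_r ?(ltW cR) //; apply: ler_wpM2r => //; exact: ltW.
  rewrite lerDl; apply: fsumr_ge0 => y [Fy _]; apply: mulr_ge0; first exact: Wt_ge0.
  exact: teval_ge0.
have upper : DegF F (teval (maxl s')) (teval (maxl L)) = c%:~R * DegF F (teval (maxl s)) (teval (maxl s')).
  rewrite DegF_sym //; try exact: fineT_lin.
  rewrite /DegF mulr_fsumr; apply: eq_fsbigr => r; rewrite inE => Fr.
  have : (Prim `&` r) (lattice_normal r [set 0]) by rewrite (Prim_ray_finite fF pF Fr).
  set x := lattice_normal r [set 0]; move=> [[Zx x0 _] rx].
  have WE' : Wloc (delta F) (teval (maxl s')) x = Wt (teval (maxl s')) F r.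
    by apply: WlocE => //; apply: is_W_ray => //; apply: fineT_lin.
  have [xs'|xs'] := eqVneq (pairing x (rl s')) 0; last first.
    by rewrite -WE' Wloc_maxl_off // !mul0r mulr0.
  rewrite mulrCA; congr (_ * _).
  rewrite !teval_maxl LE rlD rlN !rlZ pairingBr !pairingZr xs' mulr0 subr0.
  by rewrite maxr_pMr ?mulr0 // ltW.
by rewrite upper ler_pM2l in lower.
Qed.

End Bound.

Section Bound.
Context {R : realType} {n : nat}.
Local Notation V := 'rV[R]_n.
Local Notation rl := (@realify R n).
Implicit Types (x y v w : V) (sigma tau rho kappa : set V) (F H K : wfan R n) (f g : V -> R)
  (T : tropical_function n).

Lemma fine_rep_seq F0 (Ts : seq (tropical_function n)) : tropical_fan 2 F0 -> exists F,
  [/\ tropical_fan 2 F /\ cycle_of 2 F0 F, (forall x v, indep x v -> delta F x v = delta F0 x v),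
     positive 2 F /\ pointed_fan F & forall T, List.In T Ts -> fineT F T].
Proof.
move=> t0; have [F [h1 h2 h3 h4 _]] := fine_rep (flatten (map diffs Ts)) t0.
exists F; split=> // T TTs; apply: h4.
elim: Ts TTs {F h1 h2 h3} => // T' Ts IH /= [->|/IH sub] l lT; rewrite mem_cat ?lT //.
by rewrite sub ?orbT.
Qed.

Lemma DEG_DegF F0 F T1 T2 : tropical_fan 2 F -> (forall x v, indep x v -> delta F x v = delta F0 x v) ->
  pointed_fan F -> fineT F T2 -> DEG (delta F0) (teval T1) (teval T2) = DegF F (teval T1) (teval T2).
Proof.
move=> [fF pF bF] dE ptF f2; rewrite -(DEG_eq _ _ dE) DEG_fan //; exact: fineT_lin.
Qed.

Lemma DEG_sym F0 T1 T2 : tropical_fan 2 F0 ->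
  DEG (delta F0) (teval T1) (teval T2) = DEG (delta F0) (teval T2) (teval T1).
Proof.
move=> t0; have [F [[tF _] dE [_ ptF] fT]] := fine_rep_seq [:: T1; T2] t0.
have f1 : fineT F T1 by apply: fT; left.
have f2 : fineT F T2 by apply: fT; right; left.
rewrite !(DEG_DegF _ tF dE ptF) //; case: tF => fF pF bF.
by apply: DegF_sym => //; apply: fineT_lin.
Qed.

Lemma DEG_ge0 F0 T1 T2 : tropical_fan 2 F0 -> 0 <= DEG (delta F0) (teval T1) (teval T2).
Proof. by move=> t0; rewrite -degreeE // ler0n. Qed.

Definition wedge u v (s s' : 'cV[int]_n) : R :=
  pairing u (rl s) * pairing v (rl s') - pairing v (rl s) * pairing u (rl s').

(** The signs of s and s' are chosen so that s' is positive at u and L(v) is the absolute value of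
    the wedge; by [DegF_maxlN] they do not affect the degree. Monotonicity in each argument then
    replaces max(0, s) and max(0, s') by Ta and Tb. *)
Lemma wedge_le_degree_half F0 sigma u v (s s' : 'cV[int]_n) Ta Tb : tropical_fan 2 F0 ->
  cones_of_dim F0 2 sigma -> Prim u -> Nset u v -> germ sigma u v ->
  s \in functionals Ta -> s' \in functionals Tb -> pairing u (rl s') != 0 ->
  (weight F0 sigma)%:R * `|wedge u v s s'| <= DEG (delta F0) (teval Ta) (teval Tb).
Proof.
move=> t0 Fs Pu Nv gv sT sT' us'; have [f0 p0 b0] := t0.
have [Zu u0 _] := Pu; have /ZnP[z uE] := Zu.
have [s1' [s1'E [c cE c0]]] : exists s1', (s1' = s' \/ s1' = - s') /\
    exists2 c : int, c%:~R = pairing u (rl s1') & 0 < c.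
  pose c : int := (z *m s') 0 0; have cE : c%:~R = pairing u (rl s') by rewrite uE pairing_rz.
  have cn : c != 0 by move: us'; rewrite -cE intr_eq0.
  have [c0|c0|c0] := ltrgtP c 0; last by rewrite c0 eqxx in cn.
    by exists (- s'); split; [right|exists (- c); rewrite ?oppr_gt0 // intrN rlN pairingNr cE].
  by exists s'; split; [left|exists c].
pose d : int := (z *m s) 0 0; have dE : d%:~R = pairing u (rl s) by rewrite uE pairing_rz.
have wE : `|pairing v (rl (c *: s - d *: s1'))| = `|wedge u v s s'|.
  rewrite rlD rlN !rlZ pairingBr !pairingZr cE dE /wedge distrC.
  by case: s1'E => ->; [|rewrite rlN !pairingNr -normrN]; congr (`| _ |); ring.
have [s1 [s1E [d1 d1E vL]]] : exists s1, (s1 = s \/ s1 = - s) /\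
    exists2 d1 : int, d1%:~R = pairing u (rl s1) &
    pairing v (rl (c *: s1 - d1 *: s1')) = `|wedge u v s s'|.
  have [h|h] := leP 0 (pairing v (rl (c *: s - d *: s1'))).
    by exists s; split; [left|exists d; rewrite // -wE ger0_norm].
  exists (- s); split; [right|exists (- d)] => //; first by rewrite intrN rlN pairingNr dE.
  rewrite -wE ltr0_norm // -pairingNr -rlN; congr (pairing v (rl _)).
  by rewrite scalerN scaleNr opprD.
set L := c *: s1 - d1 *: s1' in vL.
have [F [[tF _] dF [_ ptF] fT]] := fine_rep_seq [:: Ta; Tb; maxl s; maxl s'; maxl s1; maxl s1'; maxl L] t0.
have [fF pF bF] := tF.
have [fa fb [fs fs' fs1 fs1' fL]] : [/\ fineT F Ta, fineT F Tb & [/\ fineT F (maxl s), fineT F (maxl s'),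
   fineT F (maxl s1), fineT F (maxl s1') & fineT F (maxl L)]].
  by split; [apply: fT => /=; tauto|apply: fT => /=; tauto|split; apply: fT => /=; tauto].
have := wedge_le_degree_core fF bF ptF cE d1E (erefl L) fs1 fs1' fL Pu Nv c0.
have [iv _ _] := Nv; rewrite dF // (delta_val f0 iv Fs gv) vL => /le_trans; apply.
have -> : DegF F (teval (maxl s1)) (teval (maxl s1')) = DegF F (teval (maxl s)) (teval (maxl s')).
  have E1 : DegF F (teval (maxl s1)) (teval (maxl s1')) = DegF F (teval (maxl s)) (teval (maxl s1')).
    by case: s1E => ->; rewrite ?DegF_maxlN //; apply: fineT_lin.
  rewrite E1 DegF_sym //; try exact: fineT_lin.
  rewrite [RHS]DegF_sym //; try exact: fineT_lin.
  by case: s1'E => ->; rewrite ?DegF_maxlN //; apply: fineT_lin.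
rewrite (DEG_DegF _ tF dF ptF fb).
apply: (@le_trans _ _ (DegF F (teval Ta) (teval (maxl s')))).
  by apply: DegF_le => // x; apply: maxl_le.
rewrite DegF_sym //; try exact: fineT_lin.
rewrite [leRHS]DegF_sym //; try exact: fineT_lin.
by apply: DegF_le => // x; apply: maxl_le.
Qed.

Lemma wedge_le_degree F0 sigma u v (s s' : 'cV[int]_n) Ta Tb : tropical_fan 2 F0 ->
  cones_of_dim F0 2 sigma -> Prim u -> Nset u v -> germ sigma u v ->
  s \in functionals Ta -> s' \in functionals Tb ->
  (weight F0 sigma)%:R * `|wedge u v s s'| <= DEG (delta F0) (teval Ta) (teval Tb).
Proof.
move=> t0 Fs Pu Nv gv sT sT'.
have [us'|us'] := eqVneq (pairing u (rl s')) 0; last exact: wedge_le_degree_half gv _ _ _.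
have [us|us] := eqVneq (pairing u (rl s)) 0.
  by rewrite /wedge us us' mul0r mulr0 subrr normr0 mulr0 DEG_ge0.
(* If s' vanishes at u but s does not, the two exchange roles. *)
rewrite DEG_sym // -normrN (_ : - wedge u v s s' = wedge u v s' s); last by rewrite /wedge; ring.
exact: wedge_le_degree_half gv _ _ _.
Qed.

(** Supplies a lattice basis (u, v) of Z_sigma in the form that the wedge bound expects. *)
Lemma cone_basis F0 sigma : is_fan (cones F0) -> cones_of_dim F0 2 sigma ->
  exists u v, [/\ Prim u, Nset u v & germ sigma u v].
Proof.
move=> [_ rF _ _] [Fs ds]; have rs := rF _ Fs; have cs := rational_convex_cone rs.
have [y [sy y0]] : exists y, sigma y /\ y != 0.
  apply: contrapT => N; have : (lin_span sigma <= 0)%VS.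
    by apply: lin_span_min => y sy; rewrite memv0; apply/negPn/negP => y0; apply: N; exists y.
  by move/dimvS; rewrite dimv0 -/(cone_dim sigma) ds.
have [z [sz iz]] := rational_dim2 rs ds y0.
have z0 : rz z != 0 :> V by case: iz => _; apply: contraNneq => ->; apply: mem0v.
have [u Pu [c c0 uE]] := Prim_exists z0.
have [_ _ sZ] := cs; have su : sigma u by rewrite uE; apply: sZ => //; apply: ltW.
have [Zu u0 _] := Pu.
have [w [sw iw]] := rational_dim2 rs ds u0.
exists u, (nrm u (rz w)); split=> //; first exact: nrm_Nset (Zn_rz w) iw.
have [_ _ _ [a [b [b0 E]]]] := pgen_nrm Zu (Zn_rz w) iw.
exact: germ_half E (germ_add cs su sw).
Qed.

End Bound.

(** * A lattice basis with bounded coordinates *)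

Section LatticeBasis.
Context {R : realType} {n : nat}.
Local Notation re := (map_mx (intr : int -> R)).

Lemma re_inj p (x y : 'M[int]_(p, n)) : re x = re y -> x = y.
Proof. by move=> /matrixP h; apply/matrixP => i j; have := h i j; rewrite !mxE => /intr_inj. Qed.

(** A triangular basis in the manner of the Hermite normal form, in coordinates with respect to the
    rows of T. The vector y_i has no coordinate beyond i and the least positive i-th coordinate,
    which is at most 1 because the i-th row of T competes. Subtracting integral combinations of rows
    of T brings the earlier coordinates into [0, 1). *)
Lemma lattice_basis_of (k m : nat) (Sz : 'M[int]_(k, n)) (f : 'I_m -> 'I_k) :
  let T := rowsub f Sz in
  row_free (re T) -> (re Sz <= re T)%MS ->
  exists (Y : 'M[int]_(m, n)) (q : 'M[R]_m),
    [/\ re Y = q *m re T, (forall i j, `|q i j| <= 1), row_free (re Y) &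
        exists C : 'M[int]_(k, m), Sz = C *m Y].
Proof.
move=> T Tfree ST.
have fT : row_full (re T)^T by rewrite /row_full mxrank_tr; exact: Tfree.
pose g := fullrankfun fT; pose B := colsub g T.
have BE : re B = (rowsub g (re T)^T)^T by apply/matrixP => i j; rewrite !mxE.
have uB : re B \in unitmx by rewrite BE unitmx_tr fullrowsub_unit.
pose N := \det B.
have NE : N%:~R = \det (re B) :> R by rewrite det_map_mx.
have N0 : N%:~R != 0 :> R by move: uB; rewrite unitmxE unitfE NE.
pose K (x : 'rV[int]_n) : 'rV[R]_m := re x *m pinvmx (re T).
pose Lam (x : 'rV[int]_n) := exists c : 'rV[int]_k, x = c *m Sz.
(* For x in the lattice, [K x] holds its coordinates with respect to the rows of T, and [kv x] is N
   times [K x]: an integral vector by Cramer's rule, so that a least positive coordinate exists. *)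
pose kv (x : 'rV[int]_n) : 'rV[int]_m := colsub g x *m \adj B.
have KB x y : K (x - y) = K x - K y by rewrite /K map_mxB mulmxBl.
have KZ (a : int) x : K (a *: x) = a%:~R *: K x by rewrite /K map_mxZ scalemxAl.
have LB x y : Lam x -> Lam y -> Lam (x - y).
  by move=> [c ->] [d ->]; exists (c - d); rewrite mulmxBl.
have LZ (a : int) x : Lam x -> Lam (a *: x) by move=> [c ->]; exists (a *: c); rewrite scalemxAl.
have KT x : Lam x -> K x *m re T = re x.
  move=> [c ->]; rewrite /K mulmxKpV // map_mxM; exact: submx_trans (submxMl _ _) ST.
have Krow i : K (row i T) = delta_mx 0 i.
  apply: (row_free_inj Tfree); rewrite /K mulmxKpV; first by rewrite -rowE map_row.
  by rewrite map_row row_sub.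
have Lrow i : Lam (row i T).
  exists (delta_mx 0 (f i)); rewrite -rowE; apply/rowP => j; by rewrite !mxE.
have kvE x j : Lam x -> (kv x 0 j)%:~R = N%:~R * K x 0 j.
  move=> Lx; have E : re (colsub g x) = K x *m re B.
    rewrite /B (_ : re (colsub g T) = colsub g (re T)); last by apply/matrixP => a b; rewrite !mxE.
    by rewrite mulmx_colsub KT //; apply/matrixP => a b; rewrite !mxE.
  have : re (kv x) = N%:~R *: K x.
    rewrite /kv map_mxM E map_mx_adj -mulmxA mul_mx_adj -NE.
    by rewrite mul_mx_scalar.
  by move=> /matrixP/(_ 0 j); rewrite !mxE.
have kvR (x : 'rV[int]_n) j : Lam x -> K x 0 j = (kv x 0 j)%:~R / N%:~R.
  by move=> Lx; rewrite kvE // mulrC mulKf.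
have KeT (e : 'rV[int]_m) : K (e *m T) = re e.
  apply: (row_free_inj Tfree); rewrite /K mulmxKpV map_mxM //; exact: submxMl.
have LeT (e : 'rV[int]_m) : Lam (e *m T).
  exists (e *m rowsub f 1%:M); by rewrite -mulmxA mul_rowsub_mx mul1mx.
clearbody K kv.
have pick (i : 'I_m) : exists y, [/\ Lam y, (forall j : 'I_m, (i < j)%N -> K y 0 j = 0), 0 < K y 0 i,
    (forall j, `|K y 0 j| <= 1) &
    forall x, Lam x -> (forall j : 'I_m, (i < j)%N -> K x 0 j = 0) -> exists a : int, K x 0 i = a%:~R * K y 0 i].
  pose P d := `[< (0 < d)%N /\ exists x, [/\ Lam x, (forall j : 'I_m, (i < j)%N -> K x 0 j = 0) &
     let c : int := kv x 0 i in absz c = d] >].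
  have Pt : P (absz N).
    apply/asboolP; split; first by rewrite absz_gt0 -(intr_eq0 R).
    exists (row i T); split=> //.
      move=> j ij; rewrite Krow mxE eqxx /=.
      by have -> : (j == i) = false by apply: contraTF ij => /eqP->; rewrite ltnn.
    congr absz; apply: (@intr_inj R); by rewrite kvE // Krow mxE !eqxx mulr1.
  have exP : exists d, P d by exists (absz N).
  case: (ex_minnP exP) => d /asboolP[d0 [x [Lx x0 xd]]] dmin.
  have dN : (d <= absz N)%N by apply: dmin.
  have [x1 [Lx1 x10 Kx1 Kx1d]] : exists x1, [/\ Lam x1, (forall j : 'I_m, (i < j)%N -> K x1 0 j = 0),
      0 < K x1 0 i & K x1 0 i = `|K x 0 i|].
    have Kn : K x 0 i != 0.
      by apply: contraTneq d0 => k0; rewrite -xd -leqNgt leqn0 absz_eq0 -(intr_eq0 R) kvE // k0 mulr0.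
    have [K0|K0|K0] := ltrgtP (K x 0 i) 0; last by rewrite K0 eqxx in Kn.
      exists (-1 *: x); split; first exact: LZ.
      - by move=> j /x0 h; rewrite KZ mxE h mulr0.
      - by rewrite KZ mxE mulN1r oppr_gt0.
      - by rewrite KZ mxE mulN1r ltr0_norm.
    by exists x; split=> //; rewrite gtr0_norm.
  (* The integral parts of the coordinates before i; removing them stays in the lattice, which
     contains the rows of T. *)
  pose e : 'rV[int]_m := \row_j (if (j < i)%N then Num.floor (K x1 0 j) else 0).
  have Ky j : K (x1 - e *m T) 0 j = K x1 0 j - (e 0 j)%:~R by rewrite KB KeT !mxE.
  have Kyi : K (x1 - e *m T) 0 i = K x1 0 i by rewrite Ky [e _ _]mxE ltnn subr0.
  have le1 : `|K x 0 i| <= 1.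
    rewrite kvR // normrM normfV ler_pdivrMr ?normr_gt0 // mul1r -!intr_norm ler_int.
    by move: dN; rewrite -xd -lez_nat !abszE.
  exists (x1 - e *m T); split.
  - by apply: LB.
  - by move=> j ij; rewrite Ky x10 // [e _ _]mxE ltnNge (ltnW ij) subr0.
  - by rewrite Kyi.
  - move=> j; have [ji|ij|/val_inj ->] := ltngtP j i.
    + rewrite Ky [e _ _]mxE ji; have /andP[h1 h2] := floor_itv (K x1 0 j).
      by rewrite intrD in h2; rewrite ger0_norm; lra.
    + by rewrite Ky x10 // [e _ _]mxE ltnNge (ltnW ij) subr0 normr0.
    + by rewrite Kyi Kx1d normr_id.
  move=> u Lu u0; pose c : int := kv u 0 i; pose cx : int := kv x 0 i.
  pose q := (c %/ cx)%Z; have cx0 : cx != 0 by rewrite -absz_gt0 xd.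
  have Lux : Lam (u - q *: x) by apply: LB => //; apply: LZ.
  have rE : kv (u - q *: x) 0 i = (c %% cx)%Z.
    apply: (@intr_inj R); rewrite kvE // KB KZ !mxE mulrBr mulrCA -!kvE //.
    by rewrite /modz intrD intrN intrM.
  have r0 : (c %% cx)%Z = 0.
    apply: contrapT => /eqP rn.
    have : P (absz (c %% cx)%Z).
      apply/asboolP; rewrite absz_gt0; split=> //; exists (u - q *: x); split=> //=.
        by move=> j ij; rewrite KB KZ !mxE u0 // x0 // mulr0 subr0.
      by rewrite rE.
    move/dmin; rewrite leqNgt -xd => /negP; apply.
    by rewrite -ltz_nat gez0_abs ?modz_ge0 // abszE ltz_mod.
  have cE : c = q * cx by rewrite {1}(divz_eq c cx) r0 addr0.
  have KuE : K u 0 i = q%:~R * K x 0 i by rewrite !kvR // -/c -/cx cE intrM mulrA.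
  rewrite Kyi Kx1d; have [K0|K0] := leP 0 (K x 0 i).
    by exists q; rewrite KuE ger0_norm.
  by exists (- q); rewrite KuE ltr0_norm // intrN mulrNN.
have [y Hy] := choice pick.
pose Y : 'M[int]_(m, n) := \matrix_i y i; pose q : 'M[R]_m := \matrix_i K (y i).
have rowY i : row i Y = y i by apply/rowP => j; rewrite !mxE.
have YE : re Y = q *m re T.
  apply/row_matrixP => i; rewrite row_mul rowK -map_row rowY KT //.
  by case: (Hy i).
exists Y, q; split=> //.
- by move=> i j; rewrite mxE; case: (Hy i).
- have qu : q \in unitmx.
    rewrite unitmxE unitfE det_trig; last first.
      by apply/is_trig_mxP => i j ij; rewrite mxE; case: (Hy i) => _ h _ _ _; apply: h.
    apply/prodf_neq0 => i _; rewrite mxE; case: (Hy i) => _ _ h _ _; by rewrite gt_eqF.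
  by rewrite /row_free YE mxrankMfree // mxrank_unit.
(* Coordinates are cleared from the last one downwards, as the basis is triangular. *)
have gen b x : (b <= m)%N -> Lam x -> (forall j : 'I_m, (b <= j)%N -> K x 0 j = 0) ->
    exists c : 'rV[int]_m, x = c *m Y.
  elim: b x => [|b IH] x bm Lx x0.
    exists 0; rewrite mul0mx; apply: re_inj; rewrite -KT // map_mx0.
    suff -> : K x = 0 by rewrite mul0mx.
    by apply/rowP => j; rewrite x0 // mxE.
  pose i := Ordinal bm; have [Ly y0 Kp _ gy] := Hy i.
  have [|a aE] := gy x Lx; first by move=> j ij; apply: x0.
  have [||j bj|c cE] := IH (x - a *: y i); first exact: ltnW.
  - by apply: LB => //; apply: LZ.
  - rewrite KB KZ !mxE; have [e|ne] := eqVneq j i.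
      by rewrite e aE subrr.
    have ij : (i < j)%N by rewrite ltn_neqAle bj andbT eq_sym.
    by rewrite x0 // y0 // mulr0 subr0.
  exists (c + a *: delta_mx 0 i); rewrite mulmxDl -cE -scalemxAl -rowE rowY.
  by rewrite subrK.
have gen' (i : 'I_k) : exists c : 'rV[int]_m, row i Sz = c *m Y.
  apply: (gen m) => //; first by exists (delta_mx 0 i); rewrite -rowE.
  by move=> j; rewrite leqNgt ltn_ord.
have [c cE] := choice gen'.
exists (\matrix_i c i); apply/row_matrixP => i.
by rewrite row_mul rowK cE.
Qed.

Lemma lattice_basis (S : seq 'rV[int]_n) : exists (m : nat) (Y : 'M[int]_(m, n)) (q : 'M[R]_m)
    (t : 'I_m -> 'rV[int]_n),
  [/\ (m <= n)%N, row_free (re Y), (forall i j, `|q i j| <= 1),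
     (forall i, t i \in S /\ re (row i Y) = \sum_j q i j *: re (t j)) &
     forall s, s \in S -> exists c : 'rV[int]_m, s = c *m Y].
Proof.
pose Sz : 'M[int]_(size S, n) := \matrix_i S`_i.
pose f := maxrankfun (re Sz); pose T := rowsub f Sz.
have TE : re T = rowsub f (re Sz) by apply/matrixP => i j; rewrite !mxE.
have Tf : row_free (re T) by rewrite TE maxrowsub_free.
have ST : (re Sz <= re T)%MS by rewrite TE eq_maxrowsub.
have [Y [q [YE q1 Yf [C CE]]]] := lattice_basis_of Tf ST.
exists _, Y, q, (fun i => S`_(f i)); split=> //.
- exact: rank_leq_col.
- move=> i; split; first by rewrite mem_nth.
  rewrite map_row YE row_mul mulmx_sum_row; apply: eq_bigr => j _; rewrite !mxE; congr (_ *: _).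
  by apply/rowP => l; rewrite !mxE.
move=> s /(nthP 0)[i iS <-]; exists (row (Ordinal iS) C).
by rewrite -row_mul -CE rowK.
Qed.

End LatticeBasis.

(** * The factorization through a lattice of functionals *)

Section Maps.
Context {R : realType} {n m : nat}.
Local Notation V := 'rV[R]_n.
Local Notation W := 'rV[R]_m.
Implicit Types (p : {linear V -> W}).

Definition pull p (l : 'cV[R]_m) : 'cV[R]_n := lin1_mx p *m l.

Lemma pairing_pull p x l : pairing (p x) l = pairing x (pull p l).
Proof. by rewrite /pairing /pull mulmxA mul_rV_lin1. Qed.

Lemma convex_image p (sigma : set V) : convex_cone sigma -> convex_cone (p @` sigma).
Proof.
move=> [s0 sD sZ]; split.
- by exists 0; rewrite // linear0.
- by move=> _ _ [x sx <-] [y sy <-]; exists (x + y); rewrite ?linearD //; apply: sD.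
- by move=> a _ a0 [x sx <-]; exists (a *: x); rewrite ?linearZ //; apply: sZ.
Qed.

Lemma Cone_image p (s : seq V) : p @` Cone s = Cone (map p s).
Proof.
apply/seteqP; split=> y.
  move=> [x + <-]; move: x; apply: Cone_ind; rewrite ?linear0.
  - exact: Cone0.
  - by move=> x x' hx hx'; rewrite linearD; apply: ConeD.
  - by move=> a x a0 hx; rewrite linearZ; apply: ConeZ.
  - by move=> z zs; apply: Cone_mem; apply: map_f.
have [h0 hD hZ] : convex_cone (p @` Cone s).
  by apply: convex_image; split; [exact: Cone0|exact: ConeD|move=> *; exact: ConeZ].
move: y; apply: Cone_ind => // _ /mapP[z zs ->]; exists z => //; exact: Cone_mem.
Qed.

Lemma zlinear_rz p : zlinear p -> exists f : 'rV[int]_n -> 'rV[int]_m, forall z, p (rz z) = rz (f z).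
Proof.
move=> zp; have h z : exists z', p (rz z) = rz z' by apply/ZnP/zp/Zn_rz.
by have [f Hf] := choice h; exists f.
Qed.

Lemma rational_image p (sigma : set V) : zlinear p -> rational_cone sigma -> rational_cone (p @` sigma).
Proof.
move=> zp /rational_coneE[s ->]; apply/rational_coneE; have [f fE] := zlinear_rz zp.
exists (map f s); rewrite Cone_image -!map_comp; congr Cone.
by apply: eq_map => z /=; rewrite fE.
Qed.

Lemma face_image p (sigma : set V) t : face t (p @` sigma) ->
  exists2 tau, face tau sigma & t = p @` tau.
Proof.
move=> [l l0 ->]; exists [set x | sigma x /\ pairing x (pull p l) = 0].
  by exists (pull p l) => // x sx; rewrite -pairing_pull; apply: l0; exists x.
apply/seteqP; split=> y /=.
  by move=> [[x sx <-]]; rewrite pairing_pull => e; exists x.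
by move=> [x [sx e] <-]; split; [exists x|rewrite pairing_pull].
Qed.

Lemma lin_span_image p (sigma : set V) : lin_span (p @` sigma) = (linfun p @: lin_span sigma)%VS.
Proof.
apply/eqP; rewrite eqEsubv; apply/andP; split.
  apply: lin_span_min => _ [x sx <-]; rewrite -(lfunE p) memv_img // mem_lin_span //.
have : (lin_span sigma <= linfun p @^-1: lin_span (p @` sigma))%VS.
  apply: lin_span_min => x sx; rewrite -memv_preim lfunE /=; apply: mem_lin_span; by exists x.
move=> h; apply/subvP => _ /memv_imgP[x xs ->].
by have := subvP h x xs; rewrite -memv_preim.
Qed.

End Maps.

Section Factor.
Context {R : realType} {n : nat}.
Local Notation rl := (@realify R _).

(** The rows of the basis Y are the coordinates of p, so every functional of T1 and T2, being an
    integral combination of these rows, is the pullback of an integral functional on R^m. The last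
    clauses recover the coordinates of R^m from functionals of M1 and M2 with coefficients in
    [-1, 1]; they feed the bound on the Pluecker coordinates. *)
Lemma factor_maps (T1 T2 : tropical_function n) :
  exists (m : nat) (p : {linear 'rV[R]_n -> 'rV[R]_m}) (M1 M2 : tropical_function m)
    (t : 'I_m -> 'cV[int]_m) (q : 'M[R]_m) (Yf : 'I_m -> 'cV[int]_n),
  [/\ (m <= n)%N, zlinear p, (forall y, exists x, p x = y),
    (forall x i, p x 0 i = pairing x (rl (Yf i))) &
  [/\ (forall x, teval T1 x = teval M1 (p x)) /\ (forall x, teval T2 x = teval M2 (p x)),
      (forall s, s \in functionals T1 -> exists2 c, c \in functionals M1 & forall x, pairing x (rl s) = pairing (p x) (rl c)),
      (forall s, s \in functionals T2 -> exists2 c, c \in functionals M2 & forall x, pairing x (rl s) = pairing (p x) (rl c)),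
      (forall i, exists s, (s \in functionals T1 /\ t i \in functionals M1 \/
         s \in functionals T2 /\ t i \in functionals M2) /\
         forall x, pairing x (rl s) = pairing (p x) (rl (t i))) &
      (forall i (y : 'rV[R]_m), y 0 i = \sum_j q i j * pairing y (rl (t j))) /\ (forall i j, `|q i j| <= 1)]].
Proof.
have [m [Y [q [t0 [mn Yf q1 tS SY]]]]] :=
  @lattice_basis R n [seq trmx s | s <- functionals T1 ++ functionals T2].
pose re k l := map_mx (intr : int -> R) : 'M[int]_(k, l) -> 'M[R]_(k, l).
pose p : {linear 'rV[R]_n -> 'rV[R]_m} := mulmxr (re _ _ Y)^T.
have pE x : p x = x *m (re _ _ Y)^T by [].
have psurj y : exists x, p x = y.
  have /row_freeP[Z YZ] := Yf; exists (y *m Z^T).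
  by rewrite pE -mulmxA -trmx_mul YZ trmx1 mulmx1.
have cex s : exists c : 'cV[int]_m, s \in functionals T1 ++ functionals T2 ->
    forall x, pairing x (rl s) = pairing (p x) (rl c).
  have [sS|] := boolP (s \in functionals T1 ++ functionals T2); last by exists 0.
  have [c cE] := SY _ (map_f trmx sS); exists c^T => _ x.
  rewrite /pairing pE -mulmxA; congr ((_ *m _) 0 0).
  have -> : rl s = (re _ _ (s^T))^T by apply/matrixP => i j; rewrite !mxE.
  by rewrite cE /re map_mxM trmx_mul; congr (_ *m _); apply/matrixP => i j; rewrite !mxE.
have [c cP] := choice cex.
have [h1 h2] : {subset functionals T1 <= functionals T1 ++ functionals T2} /\
   {subset functionals T2 <= functionals T1 ++ functionals T2}.
  by split=> s h; rewrite mem_cat h ?orbT.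
(* The extra 0 is the functional that every tropical function must contain; it does not change the
   values, since T is nonnegative. *)
pose Mof T := @TropicalFunction m (0 :: map c (functionals T)) (mem_head _ _).
have MofE T : {subset functionals T <= functionals T1 ++ functionals T2} ->
    forall x, teval T x = teval (Mof T) (p x).
  move=> sub x; apply/le_anti/andP; split.
    have [l lT ->] := teval_att T x; rewrite (cP _ (sub _ lT)); apply: teval_ge.
    by rewrite inE; apply/orP; right; apply: map_f.
  have [l] := teval_att (Mof T) (p x); rewrite inE => /orP[/eqP->|/mapP[s sT ->]] ->.
    by rewrite rl0 pairing0r teval_ge0.
  by rewrite -(cP _ (sub _ sT)) teval_ge.
have mem T s : s \in functionals T -> c s \in functionals (Mof T).
  by move=> sT; rewrite inE; apply/orP; right; apply: map_f.
have tex i : exists s, s \in functionals T1 ++ functionals T2 /\ t0 i = s^T.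
  by have [/mapP[s sS e] _] := tS i; exists s.
have [s sP] := choice tex.
exists m, p, (Mof T1), (Mof T2), (fun i => c (s i)), q, (fun i => (row i Y)^T).
split=> //.
- move=> x /ZnP[z ->]; apply/ZnP; exists (z *m Y^T).
  by rewrite pE /rz map_mxM; congr (_ *m _); apply/matrixP => i j; rewrite !mxE.
- move=> x i; rewrite pE /pairing !mxE; apply: eq_bigr => j _; by rewrite !mxE.
split.
- by split; apply: MofE.
- by move=> s0 sT; exists (c s0); [apply: mem|apply: cP; apply: h1].
- by move=> s0 sT; exists (c s0); [apply: mem|apply: cP; apply: h2].
- move=> i; have [sS _] := sP i; exists (s i); split; last exact: cP.
  by move: (sS); rewrite mem_cat => /orP[h|h]; [left|right]; split=> //; apply: mem.
split=> // i y; have [x <-] := psurj y.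
have [_ e] := tS i; rewrite pE -[LHS]/((x *m (re _ _ Y)^T) 0 i).
have -> : (x *m (re _ _ Y)^T) 0 i = pairing x (re _ _ (row i Y))^T.
  by rewrite /pairing !mxE; apply: eq_bigr => j _; rewrite !mxE.
rewrite /re e /pairing linear_sum mulmx_sumr summxE; apply: eq_bigr => j _.
have [sS ts] := sP j; rewrite -pE -/(pairing (p x) _) -(cP _ sS) ts.
rewrite linearZ /= -scalemxAr mxE; congr (_ * _).
by rewrite /pairing; congr ((_ *m _) 0 0); apply/matrixP => a b; rewrite !mxE.
Qed.

End Factor.

(** * Degrees on 1-fans and the regular fibration *)

Section DegreeOne.
Context {R : realType} {n : nat}.
Local Notation V := 'rV[R]_n.
Local Notation rl := (@realify R n).
Implicit Types (x y v w : V) (F G H K : wfan R n) (T M : tropical_function n).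

(** One divisor is exhibited, with d as the weight of the origin, and any other chain is compared
    with it through [delta1]. *)
Lemma degree1E G M (d : nat) : tropical_fan 1 G -> pointed_fan G -> (exists s, cones G s) ->
  (forall s, cones G s -> linear_on M s) -> d%:R = DEG1 (delta1 G) (teval M) ->
  degree [:: M] (cycle_of 1 G) = d.
Proof.
move=> tG ptG [s0 Gs0] lG dE; have [fG pG bG] := tG; have [_ rG _ _] := fG.
have G0 := ptG _ Gs0.
have d0 : cone_dim [set 0 : V] = 0%N by rewrite /cone_dim lin_span0 dimv0.
pose K := WFan [set t | cones G t /\ (cone_dim t <= 0)%N] (fun _ => d).
have zero s : cones G s -> cone_dim s = 0%N -> s = [set 0].
  move=> Gs ds; apply/seteqP; split=> x.
    move=> sx; apply/eqP; have : x \in lin_span s by apply: mem_lin_span.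
    by move/eqP: ds; rewrite /cone_dim dimv_eq0 => /eqP->; rewrite memv0.
  by move=> ->; have [] := rational_convex_cone (rG _ Gs).
have wn0 : weighted_normals G 1 [set 0] = 0.
  by apply/eqP; rewrite -memv0 -lin_span0; apply: bG => //; rewrite d0.
have starG : star G 1 [set 0] = cones_of_dim G 1.
  apply/seteqP; split=> s; first by case.
  by move=> Gs; split=> //; apply: (pointed_face fG ptG); case: Gs.
have dK : is_divisor 0 M G K.
  split=> // t [Gt dt]; rewrite (zero t Gt dt) /= wn0 pairing0l subr0 starG dE DEG1_pointed //.
  apply: eq_fsbigr => s; rewrite inE => Gs; rewrite pairingZl; congr (_ * _).
  have [Gs1 ds] := Gs; have : (Prim `&` s) (lattice_normal s [set 0]) by rewrite (Prim_ray_finite fG ptG Gs).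
  by move=> [_ sl]; rewrite (lextE (lG _ Gs1) sl).
have fK : is_fan (cones K) by apply: (@is_fan_skeleton _ _ G 0).
have tK : tropical_fan 0 K.
  by split=> // t; move=> [Gt dt]; exists t => //; split=> //; apply/eqP; rewrite -leqn0.
have KK : cycle_mul_seq 0 [:: M] (cycle_of 1 G) K.
  exists G, K; split=> //; first by split=> //; apply: fan_equiv_refl.
  by split=> //; apply: fan_equiv_refl.
rewrite /degree; case: xgetP => [e -> [H + <-]|/(_ (origin_weight K))]; last by case; exists K.
move=> [G' [K' [[tG' e1] dK' [[fH _ _] e0]]]]; have [fG' pG' bG'] := tG'.
have fK' : is_fan (cones K') by case: dK' => _ cK _; apply: is_fan_skeleton cK.
apply/eqP; rewrite -(eqr_nat R) -(origin_weight_equiv fK' fH e0).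
rewrite (origin_weight_divisor fG' bG' dK') dE; apply/eqP.
apply: eq_fsbigr => u; rewrite inE => -[Zu u0 _]; congr (_ * _).
by rewrite (delta1_equiv_eq fG fG' e1 u0).
Qed.

Lemma tevalZ T a x : 0 <= a -> teval T (a *: x) = a * teval T x.
Proof.
move=> a0; apply/le_anti/andP; split.
  have [l lT ->] := teval_att T (a *: x); rewrite pairingZl.
  by apply: ler_wpM2l => //; apply: teval_ge.
have [l lT ->] := teval_att T x; rewrite -pairingZl; exact: teval_ge.
Qed.

Lemma teval0 T : teval T (0 : V) = 0.
Proof. by rewrite -(scale0r (0 : V)) tevalZ // mul0r. Qed.

Lemma support_positive F : pure F 2 -> positive 2 F ->
  Defs.support (positive_part 2 F) = Defs.support F.
Proof.
move=> pF posF; apply/seteqP; split=> x.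
  by move=> [t [s [[Fs _] _ f]] tx]; exists s => //; apply: face_sub tx.
move=> [t Ft tx]; have [s [Fs ds] ts] := pF _ Ft; exists s; last exact: ts.
by exists s; split=> //; [apply: posF|apply: face_refl].
Qed.

(** The support of the positive part is invariant under equivalence, so all positive representatives
    share it. *)
Lemma cycle_supportE F0 F : tropical_fan 2 F0 -> cycle_of 2 F0 F -> positive 2 F ->
  cycle_support 2 (cycle_of 2 F0) = Defs.support F.
Proof.
move=> t0 XF posF.
have key F' : cycle_of 2 F0 F' -> positive 2 F' -> Defs.support F' = Defs.support (positive_part 2 F0).
  move=> [[fF pF bF] [H [[_ _ e1 _] [_ _ e2 _]]]] pos.
  by rewrite -(support_positive pF pos) -e1 -e2.
apply/seteqP; split=> x.
  by move=> [F' [XF' pos' sx]]; rewrite key // -(key F').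
by move=> sx; exists F.
Qed.

End DegreeOne.

Section Fibration.
Context {R : realType} {n : nat}.
Local Notation V := 'rV[R]_n.
Local Notation rl := (@realify R _).

Definition ray {m} (w : 'rV[R]_m) : set 'rV[R]_m := [set y | exists2 c, 0 <= c & y = c *: w].

Lemma rayZ m (w : 'rV[R]_m) c : 0 < c -> ray (c *: w) = ray w.
Proof.
move=> c0; apply/seteqP; split=> y [a a0 ->].
  by exists (a * c); rewrite ?scalerA // mulr_ge0 // ltW.
exists (a / c); first by rewrite divr_ge0 // ltW.
by rewrite scalerA mulfVK // gt_eqF.
Qed.

Lemma cone_ray m (k : set 'rV[R]_m) w : convex_cone k -> k w -> w != 0 ->
  (forall y, k y -> y \in <[w]>%VS) -> (forall y, k y -> k (- y) -> y = 0) -> k = ray w.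
Proof.
move=> [k0 kD kZ] kw w0 line pt; apply/seteqP; split=> y.
  move=> ky; have /vlineP[c yE] := line _ ky; exists c => //.
  rewrite leNgt; apply/negP => c0; have : w = 0.
    apply: pt => //; have := kZ (- c^-1) y; rewrite oppr_ge0 invr_le0 ltW // => /(_ isT ky).
    by rewrite yE scalerA mulNr mulVf ?lt_eqF // scaleN1r.
  by move/eqP; rewrite (negbTE w0).
by move=> [c c0 ->]; apply: kZ.
Qed.

Lemma dim_ray m (w : 'rV[R]_m) : w != 0 -> cone_dim (ray w) = 1%N.
Proof.
move=> w0; have rw : ray w w by exists 1; rewrite // scale1r.
apply/eqP; rewrite eqn_leq (dim_ge1 rw w0) andbT.
have : (lin_span (ray w) <= <[w]>)%VS by apply: lin_span_min => _ [c _ ->]; rewrite memvZ ?memv_line.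
by move/dimvS; rewrite dim_vline w0.
Qed.

Lemma ray_face0 m (w : 'rV[R]_m) : face [set 0] (ray w).
Proof.
exists w^T => [_ [c c0 ->]|].
  rewrite pairingZl mulr_ge0 // /pairing mxE; apply: sumr_ge0 => i _; rewrite mxE -expr2.
  exact: sqr_ge0.
apply/seteqP; split=> y /=; first by move=> ->; split; [exists 0; rewrite ?scale0r|rewrite pairing0l].
move=> [[c c0 ->]]; rewrite pairingZl => /eqP; rewrite mulf_eq0 => /orP[/eqP->|]; first by rewrite scale0r.
rewrite /pairing mxE psumr_eq0 => [/allP h|i _]; last by rewrite mxE -expr2 sqr_ge0.
suff -> : w = 0 by rewrite scaler0.
apply/rowP => i; rewrite mxE; have := h i (mem_index_enum i); rewrite /= mxE mulf_eq0 orbb.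
by move/eqP.
Qed.

End Fibration.

Section Fibration.
Context {R : realType} {n : nat}.
Local Notation V := 'rV[R]_n.
Local Notation rl := (@realify R _).
Implicit Types (T : tropical_function n).

(** By the wedge bound, degree 0 makes all wedges of functionals of Ta vanish on a 2-cone, so p has
    rank at most one there. As no coordinate of p changes sign on a cone, the image contains no
    line: it is the origin or a single ray. *)
Lemma orthant_images F0 Ta : tropical_fan 2 F0 ->
  DEG (delta F0) (teval Ta) (teval Ta) = 0 ->
  forall m (p : {linear V -> 'rV[R]_m}) (t : 'I_m -> 'cV[int]_m) (q : 'M[R]_m) (Yf : 'I_m -> 'cV[int]_n) F,
  zlinear p -> (forall x i, p x 0 i = pairing x (rl (Yf i))) ->
  (forall i, exists s, s \in functionals Ta /\ forall x, pairing x (rl s) = pairing (p x) (rl (t i))) ->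
  (forall i (y : 'rV[R]_m), y 0 i = \sum_j q i j * pairing y (rl (t j))) ->
  tropical_fan 2 F -> positive 2 F -> (forall x v, indep x v -> delta F x v = delta F0 x v) ->
  (forall i s, cones F s ->
       (forall x, s x -> 0 <= pairing x (rl (Yf i))) \/ (forall x, s x -> pairing x (rl (Yf i)) <= 0)) ->
  forall k, cones F k -> p @` k = [set 0] \/ exists2 z : 'rV[int]_m, (rz z : 'rV[R]_m) != 0 & p @` k = ray (rz z).
Proof.
move=> t0 D0 m p t q Yf F zp pYf sP tq tF posF dF sgF k Fk.
have [fF pF bF] := tF; have [_ rF _ _] := fF.
have [sg [Fs ds] ksg] := pF _ Fk.
have [u [v [Pu Nv gv]]] := cone_basis fF (conj Fs ds).
have DF : DEG (delta F) (teval Ta) (teval Ta) = 0 by rewrite (DEG_eq _ _ dF).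
have wedge0 s s' : s \in functionals Ta -> s' \in functionals Ta -> wedge u v s s' = 0 :> R.
  move=> sT sT'; have := wedge_le_degree tF (conj Fs ds) Pu Nv gv sT sT'; rewrite DF.
  rewrite pmulr_rle0 ?ltr0n ?posF // => h; apply/eqP; rewrite -normr_eq0; apply/eqP/le_anti.
  by rewrite h normr_ge0.
have [s sE] := choice sP.
have wc i j : p u 0 i * p v 0 j = p v 0 i * p u 0 j.
  rewrite !tq; under eq_bigr do rewrite -(sE _).2; under [X in _ * X]eq_bigr do rewrite -(sE _).2.
  under [X in _ = X * _]eq_bigr do rewrite -(sE _).2; under [X in _ = _ * X]eq_bigr do rewrite -(sE _).2.
  rewrite !mulr_suml; apply: eq_bigr => a _; rewrite !mulr_sumr; apply: eq_bigr => b _.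
  have := wedge0 _ _ (sE a).1 (sE b).1; rewrite /wedge => /eqP; rewrite subr_eq0 => /eqP e.
  by rewrite mulrACA e mulrACA.
have [w0 w0P] : exists w0 : 'rV[R]_m, forall y, y \in lin_span sg -> p y \in <[w0]>%VS.
  have su : sg u by case: gv.
  have vs := germ_span gv; have [iv _ _] := Nv.
  have ss : lin_span sg = plane u v by apply: span_plane => //; apply: mem_lin_span.
  have [pu0|pu0] := eqVneq (p u) 0.
    exists (p v) => y; rewrite ss => /planeP[a [b ->]].
    by rewrite linearD !linearZ /= pu0 scaler0 add0r memvZ ?memv_line.
  exists (p u) => y; rewrite ss => /planeP[a [b ->]].
  have [i ui] : exists i, p u 0 i != 0.
    apply: contrapT => N; case/eqP: pu0; apply/rowP => i; rewrite mxE.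
    by apply/eqP/negPn/negP => h; apply: N; exists i.
  rewrite linearD !linearZ /= memvD ?memvZ ?memv_line //.
  apply/vlineP; exists (p v 0 i / p u 0 i); apply/rowP => j; rewrite mxE.
  by rewrite mulrAC -wc mulrAC mulfV // mul1r.
have /rational_coneE[S kE] := rF _ Fk.
have [f fE] := zlinear_rz zp.
have pt y : (p @` k) y -> (p @` k) (- y) -> y = 0.
  move=> [x kx <-] [x' kx' e]; apply/rowP => i; rewrite mxE.
  have := congr1 (fun y : 'rV[R]_m => y 0 i) e; rewrite /= [RHS]mxE !pYf => E.
  have [h|h] := sgF i k Fk; have := h x kx; have := h x' kx' => *; lra.
have ck := rational_convex_cone (rF _ Fk).
have [[z [zS pz]]|N] := pselect (exists z, z \in S /\ p (rz z) != 0).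
  right; exists (f z); first by rewrite -fE.
  have kz : k (rz z) by rewrite kE; apply/Cone_mem/map_f.
  apply: cone_ray => //; first exact: convex_image.
  - by exists (rz z); rewrite // fE.
  - by rewrite -fE.
  move=> _ [x kx <-].
  have /vlineP[a aE] := w0P _ (mem_lin_span (ksg _ kx)).
  have /vlineP[b bE] := w0P _ (mem_lin_span (ksg _ kz)).
  have b0 : b != 0 by apply: contra pz => /eqP b0; rewrite bE b0 scale0r.
  apply/vlineP; exists (a / b); rewrite -fE aE bE scalerA mulfVK //.
left; apply/seteqP; split=> y /=; last first.
  by move=> ->; exists 0; [have [] := ck|rewrite linear0].
move=> [x + <-]; rewrite kE; move: x; apply: Cone_ind.
- by rewrite linear0.
- by move=> x x' hx hx'; rewrite linearD hx hx' addr0.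
- by move=> a x _ hx; rewrite linearZ /= hx scaler0.
- move=> _ /mapP[z zS ->]; apply/eqP/negPn/negP => pz; apply: N; by exists z.
Qed.

(** Two rays with a common nonzero point are equal, so no compatibility between the rays has to be
    assumed. *)
Lemma ray_fan m (C : set (set 'rV[R]_m)) : finite_set C ->
  (forall s, C s -> s = [set 0] \/ exists2 z : 'rV[int]_m, (rz z : 'rV[R]_m) != 0 & s = ray (rz z)) ->
  C [set 0] -> is_fan C.
Proof.
move=> fC rC C0.
have f00 : face [set 0] [set 0 : 'rV[R]_m] by apply: face_refl.
have f0 s : C s -> face [set 0] s.
  by move=> /rC[->|[z z0 ->]]; [|exact: ray_face0].
have s0 s : C s -> s 0.
  by move=> /rC[->|[z z0 ->]] //; exists 0; rewrite ?scale0r.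
split=> //.
- move=> s /rC[->|[z z0 ->]]; apply/rational_coneE.
    by exists [::]; rewrite Cone_nil.
  exists [:: z]; apply/seteqP; split=> y.
    by move=> [c c0 ->]; apply: ConeZ => //; apply: Cone_mem; rewrite inE.
  by rewrite /= Cone_cons => -[a a0]; rewrite Cone_nil => /eqP; rewrite subr_eq0 => /eqP->; exists a.
- move=> s t Cs ft; have [sE|[z z0 sE]] := rC _ Cs.
    suff -> : t = [set 0] by [].
    move: ft; rewrite sE => -[l l0 ->]; apply/seteqP; split=> y /=; first by case.
    by move=> ->; rewrite pairing0l.
  have [l l0 tE] := ft; have [e|ne] := eqVneq (pairing (rz z) l) 0.
    suff -> : t = s by [].
    rewrite tE sE; apply/seteqP; split=> y; first by case.
    by move=> [c c0 ->]; split; [exists c|rewrite pairingZl e mulr0].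
  suff -> : t = [set 0] by [].
  rewrite tE sE; apply/seteqP; split=> y /=.
    move=> [[c c0 ->]]; rewrite pairingZl => /eqP; rewrite mulf_eq0 (negbTE ne) orbF => /eqP->.
    by rewrite scale0r.
  by move=> ->; split; [exists 0; rewrite ?scale0r|rewrite pairing0l].
move=> s t Cs Ct; have [E|ne] := eqVneq (s `&` t) [set 0].
  by rewrite E; split; apply: f0.
have [y [[sy ty] y0]] : exists y, (s `&` t) y /\ y != 0.
  apply: contrapT => N; case/eqP: ne; apply/seteqP; split=> y.
    by move=> h; apply/eqP/negPn/negP => y0; apply: N; exists y.
  by move=> ->; split; apply: s0.
have key r : C r -> r y -> r = ray y.
  move=> /rC[->|[z z0 ->]]; first by move=> e; rewrite e eqxx in y0.
  move=> [c c0 yE]; rewrite yE rayZ // lt_def c0 andbT.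
  by apply: contra y0 => /eqP ce; rewrite yE ce scale0r.
by rewrite (key s) // (key t) // setIid; split; apply: face_refl.
Qed.

(** G carries the pushforward of the divisor of Tb: a ray receives the divisor weights of the rays
    of F above it, multiplied by their lattice indices. By homogeneity of M its degree equals that
    of Ta and Tb on F, which is 1. *)
Lemma fibration F0 Ta Tb : tropical_fan 2 F0 ->
  DEG (delta F0) (teval Ta) (teval Ta) = 0 -> DEG (delta F0) (teval Ta) (teval Tb) = 1 ->
  exists m (p : {linear V -> 'rV[R]_m}) (G : wfan R m) (M : tropical_function m),
    [/\ zlinear p, tropical_fan 1 G, degree [:: M] (cycle_of 1 G) = 1%N,
        p @` cycle_support 2 (cycle_of 2 F0) = Defs.support G &
        forall x, teval Ta x = teval M (p x)].
Proof.
move=> t0 D0 D1.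
(* Both arguments are Ta, so the lattice is generated by the functionals of Ta alone. *)
have [m [p [M [M2 [t [q [Yf [mn zp psurj pYf [[TaM _] sM _ tP [tq q1]]]]]]]]]] := @factor_maps R n Ta Ta.
have [F [[tF XF] dF [posF ptF] fT sgF]] :=
  fine_rep (diffs Ta ++ diffs Tb ++ [seq Yf i | i <- enum 'I_m]) t0.
have [fF pF bF] := tF; have [finF rF cF _] := fF.
have fTa : fineT F Ta by apply: fT => l h; rewrite mem_cat h.
have fTb : fineT F Tb by apply: fT => l h; rewrite !mem_cat h orbT.
have sgY i s : cones F s -> (forall x, s x -> 0 <= pairing x (rl (Yf i))) \/ (forall x, s x -> pairing x (rl (Yf i)) <= 0).
  by apply: sgF; rewrite !mem_cat; apply/orP; right; apply/orP; right; apply: map_f; rewrite mem_enum.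
have tP' i : exists s, s \in functionals Ta /\ forall x, pairing x (rl s) = pairing (p x) (rl (t i)).
  by have [s [[[h1 _]|[h1 _]] h2]] := tP i; exists s.
have img := orthant_images t0 D0 zp pYf tP' tq tF posF dF sgY.
have DF : DegF F (teval Ta) (teval Tb) = 1 by rewrite -D1 (DEG_DegF _ tF dF).
have f1 := finite_cones_of_dim 1 fF.
pose u (s : set V) : V := lattice_normal s [set 0].
have uP s : cones_of_dim F 1 s -> [/\ Zn (u s), u s != 0, s (u s) & s = ray (u s)].
  move=> Fs; have [Fs1 ds] := Fs.
  have [[Zu u0 _] su] : (Prim `&` s) (u s) by rewrite (Prim_ray_finite fF ptF Fs).
  split=> //; apply: cone_ray => //; first exact: rational_convex_cone (rF _ Fs1).
    by move=> y sy; rewrite -(span_ray ds su u0) mem_lin_span.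
  move=> y sy syn; apply/eqP/negPn/negP => y0.
  exact: (face0_ray (pointed_face fF ptF Fs1) sy y0).
have pray w : p @` ray w = ray (p w).
  apply/seteqP; split=> y.
    by move=> [_ [c c0 ->] <-]; exists c; rewrite // linearZ.
  by move=> [c c0 ->]; exists (c *: w); [exists c|rewrite linearZ].
(* All images are kept, including rays that receive weight 0, so that the support of G is the image
   of the support of F. *)
pose C := [set p @` k | k in cones F].
have [s0 Fs0] : exists s, cones_of_dim F 1 s.
  apply: contrapT => N; have : DegF F (teval Ta) (teval Tb) = 0.
    by rewrite /DegF fsbig1 // => s Fs; case: N; exists s.
  by rewrite DF => /eqP; rewrite oner_eq0.
have F0' : cones F [set 0] by apply: ptF (Fs0.1).
have p0 : p @` [set 0] = [set 0] by rewrite image_set1 linear0.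
have C0 : C [set 0] by exists [set 0].
have CP s : C s -> s = [set 0] \/ exists2 z : 'rV[int]_m, (rz z : 'rV[R]_m) != 0 & s = ray (rz z).
  by move=> [k Fk <-]; apply: img.
have fC : is_fan C by apply: ray_fan => //; apply: finite_image.
pose un (r : set 'rV[R]_m) : 'rV[R]_m := lattice_normal r [set 0].
(* The lattice index of a ray: p maps its primitive vector to [cf s] times the primitive vector of
   the image. *)
pose cf s : nat := xget 0%N [set c | p (u s) = c%:R *: un (p @` s)].
pose S r : R := \sum_(s \in cones_of_dim F 1) if `[< p @` s = r >] then Wt (teval Tb) F s * (cf s)%:R else 0.
pose G := WFan C (fun r => xget 0%N [set c | c%:R = S r]).
have ptG : pointed_fan G by [].
have GG : is_fan (cones G) by exact: fC.
have unP r : cones_of_dim G 1 r -> Prim (un r) /\ r (un r).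
  by move=> Gr; have : (Prim `&` r) (un r) by rewrite (Prim_ray_finite GG ptG Gr).
have cfP s : cones_of_dim F 1 s -> p (u s) != 0 -> cones_of_dim G 1 (p @` s) /\
    p (u s) = (cf s)%:R *: un (p @` s).
  move=> Fs pu0; have [Zu u0 su sE] := uP s Fs.
  have prE : p @` s = ray (p (u s)) by rewrite {1}sE pray.
  have Gr : cones_of_dim G 1 (p @` s).
    by split; [exists s => //; case: Fs|rewrite prE dim_ray].
  split=> //; have [Pn rn] := unP _ Gr; have [Zn_ n0 Gn] := Pn.
  have : p (u s) \in <[un (p @` s)]>%VS.
    by rewrite -(span_ray (proj2 Gr) rn n0); apply: mem_lin_span; exists (u s).
  move=> /(Gn _ (zp _ Zu)) [a aE].
  have a0 : 0 < a%:~R :> R.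
    have [c c0 nE] : ray (p (u s)) (un (p @` s)) by rewrite -prE.
    rewrite lt_def; apply/andP; split.
      by apply: contra pu0 => /eqP e; rewrite aE e scale0r.
    rewrite leNgt; apply/negP => an; have : un (p @` s) = (c * a%:~R) *: un (p @` s).
      by rewrite -scalerA -aE -nE.
    move/eqP; rewrite -[X in X == _]scale1r -subr_eq0 -scalerBl scaler_eq0 (negbTE n0) orbF subr_eq0 => /eqP e.
    have := mulr_ge0_le0 c0 (ltW an); lra.
  rewrite /cf; case: xgetP => [c -> //|/(_ (absz a))]; case; rewrite /= natr_absz.
  by rewrite gtr0_norm ?ltr0z -?(ltr0z R).
have Snat r : exists c : nat, c%:R = S r.
  rewrite /S (fsbig_finite _ _ f1); pose SS : seq (set V) := fset_set (cones_of_dim F 1); rewrite -/SS.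
  have : {subset SS <= cones_of_dim F 1} by move=> s; rewrite /SS in_fset_set.
  elim: SS => [|s SS IH] sub; first by exists 0%N; rewrite big_nil.
  have [|c cE] := IH; first by move=> k kS; apply: sub; rewrite inE kS orbT.
  rewrite big_cons -cE; case: ifP => _; last by exists c; exact: esym (add0r _).
  have [|d <-] := Wt_nat fF bF fTb (t := s); first by have := sub s (mem_head _ _); rewrite inE.
  by exists (d * cf s + c)%N; rewrite natrD natrM.
have wG r : (weight G r)%:R = S r.
  rewrite /=; case: xgetP => [c -> //|N]; by have [c cE] := Snat r; case: (N c).
(* Used with the identity for the balancing of G, and with M for its degree. *)
have sumG (M' : lmodType R) (h : 'rV[R]_m -> M') : (forall a x, 0 <= a -> h (a *: x) = a *: h x) ->
    h 0 = 0 -> \sum_(r \in cones_of_dim G 1) (weight G r)%:R *: h (un r) =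
    \sum_(s \in cones_of_dim F 1) Wt (teval Tb) F s *: h (p (u s)).
  move=> hZ h0.
  transitivity (\sum_(r \in cones_of_dim G 1) S r *: h (un r)).
    by apply: eq_fsbigr => r _; rewrite wG.
  rewrite (fsum_exchange (G := fun (s : set V) r => p @` s = r)) //; last first.
    by move=> s _; apply: finite_setIl; exact: finite_cones_of_dim.
  apply: eq_fsbigr => s; rewrite inE => Fs.
  have [pu0|pu0] := eqVneq (p (u s)) 0.
    have [_ _ _ sE] := uP s Fs.
    rewrite pu0 h0 scaler0 fsbig1 ?scaler0 // => r [[_ dr] e].
    move: dr; rewrite -e sE pray pu0 => dr.
    have : (lin_span (ray (0 : 'rV[R]_m)) <= 0)%VS.
      by apply: lin_span_min => _ [c _ ->]; rewrite scaler0 mem0v.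
    by move/dimvS; rewrite dimv0 -/(cone_dim _) dr.
  have [Gr puE] := cfP s Fs pu0.
  have -> : cones_of_dim G 1 `&` (fun r => p @` s = r) = [set p @` s].
    by apply/seteqP; split=> r; [case=> _ <-|move=> ->].
  by rewrite fsbig_set1 puE hZ ?ler0n // scalerA.
have star0 : star G 1 [set 0] = cones_of_dim G 1.
  apply/seteqP; split=> s; first by case.
  by move=> Gs; split=> //; apply: (pointed_face GG ptG); case: Gs.
have tG : tropical_fan 1 G.
  split=> //.
    move=> r Gr; have [r0|[z z0 rE]] := CP r Gr; last first.
      by exists r => //; split=> //; rewrite rE dim_ray.
    (* Purity at the origin asks for a ray that p does not collapse; without one the degree would be
       0. *)
    have [s1 [Fs1 pu1]] : exists s, cones_of_dim F 1 s /\ p (u s) != 0.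
      apply: contrapT => N; have : DegF F (teval Ta) (teval Tb) = 0.
        rewrite /DegF fsbig1 // => s Fs; rewrite TaM -/(u s).
        have [->|ne] := eqVneq (p (u s)) 0; first by rewrite teval0 mulr0.
        by case: N; exists s.
      by rewrite DF => /eqP; rewrite oner_eq0.
    have [Gr1 _] := cfP s1 Fs1 pu1; exists (p @` s1) => //.
    rewrite r0 => _ ->; have [_ _ su _] := uP s1 Fs1.
    by exists 0; rewrite ?linear0 //; have [] := rational_convex_cone (rF _ (proj1 Fs1)).
  move=> r Gr [dr]; have [r0|[z z0 rE]] := CP r Gr; last by rewrite rE dim_ray in dr.
  rewrite r0 lin_span0 memv0 /weighted_normals star0; apply/eqP.
  rewrite (sumG _ id) //.
  transitivity (p (\sum_(s \in cones_of_dim F 1) Wt (teval Tb) F s *: u s)).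
    by rewrite !(fsbig_finite _ _ f1) linear_sum; apply: eq_bigr => s _; rewrite linearZ.
  by rewrite (divisor_balanced fF bF ptF (fineT_lin fTb)) linear0.
have linG s : cones G s -> linear_on M s.
  move=> /CP[->|[z z0 ->]].
    by exists 0 => _ ->; rewrite teval0 pairing0l.
  have [l lM lE] := teval_att M (rz z : 'rV[R]_m).
  by exists (rl l) => _ [c c0 ->]; rewrite tevalZ // lE pairingZl.
exists m, p, G, M; split=> //.
- apply: degree1E => //; first by exists [set 0].
  rewrite DEG1_pointed //.
  transitivity (\sum_(s \in cones_of_dim F 1) Wt (teval Tb) F s *: (teval M (p (u s)) : R^o)).
    by rewrite -[LHS]DF; apply: eq_fsbigr => s _; rewrite TaM.
  apply/esym; apply: (sumG R^o (fun x => teval M x)); last exact: teval0.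
  by move=> a x a0; apply: tevalZ.
rewrite (cycle_supportE t0 XF posF); apply/seteqP; split=> y.
  by move=> [x [s Fs sx] <-]; exists (p @` s); [exists s|exists x].
by move=> [_ [s Fs <-] [x sx <-]]; exists x => //; exists s.
Qed.

End Fibration.

(** * Pushforward and projection formula *)

Section Images.
Context {R : realType} {n m : nat}.
Local Notation V := 'rV[R]_n.
Local Notation W := 'rV[R]_m.
Local Notation rl := (@realify R _).
Context (p : {linear V -> W}) (Yf : 'I_m -> 'cV[int]_n).
Context (zp : zlinear p) (pYf : forall x i, p x 0 i = pairing x (rl (Yf i))).

Definition pullz (l : 'cV[int]_m) : 'cV[int]_n := \sum_i l i 0 *: Yf i.

Lemma pairing_pullz x l : pairing x (rl (pullz l)) = pairing (p x) (rl l).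
Proof.
have -> : rl (pullz l) = \sum_i (l i 0)%:~R *: rl (Yf i) :> 'cV[R]_n.
  rewrite /pullz; elim/big_rec2: _ => [|i a b _ <-]; first exact: rl0.
  by rewrite rlD rlZ.
rewrite pairing_sumr [RHS]mxE; apply: eq_bigr => i _.
by rewrite pairingZr -pYf mxE mulrC.
Qed.

Lemma is_fan_setT k : is_fan [set (setT : set 'rV[R]_k)].
Proof.
have fT : forall t, face t (setT : set 'rV[R]_k) -> t = setT.
  move=> t [l l0 ->]; apply/seteqP; split=> x // _; split=> //.
  apply/le_anti; rewrite (l0 x I) andbT -oppr_ge0 -pairingNl; exact: l0.
split.
- exact: finite_set1.
- move=> _ ->; apply/rational_coneE.
  exists ([seq delta_mx 0 i | i <- enum 'I_k] ++ [seq - delta_mx 0 i | i <- enum 'I_k]).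
  apply/seteqP; split=> x // _; rewrite (row_sum_delta x).
  elim/big_ind: _ => [|a b|i _]; [exact: Cone0|exact: ConeD|].
  have rd : rz (delta_mx 0 i) = delta_mx 0 i :> 'rV[R]_k by apply: map_delta_mx.
  have [h|h] := leP 0 (x 0 i).
    apply: ConeZ => //; apply: Cone_mem; rewrite -rd; apply: map_f.
    by rewrite mem_cat; apply/orP; left; apply: map_f; rewrite mem_enum.
  rewrite -[x 0 i]opprK scaleNr -scalerN; apply: ConeZ; first by rewrite oppr_ge0 ltW.
  apply: Cone_mem; rewrite -rd -rzN; apply: map_f.
  by rewrite mem_cat; apply/orP; right; apply: map_f; rewrite mem_enum.
- by move=> _ t -> /fT ->.
- by move=> _ _ -> ->; rewrite setTI; split; apply: face_refl.
Qed.

Lemma cut_preimage (L : seq 'cV[int]_m) c : cut (map pullz L) [set (setT : set V)] c ->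
  exists2 c', cut L [set (setT : set W)] c' & c = p @^-1` c'.
Proof.
elim: L c => [|l L IH] c /=; first by move=> ->; exists setT; rewrite ?preimage_setT.
move=> [k /IH[k' Lk' ->] H].
have e1 : hge (rl (pullz l)) = p @^-1` hge (rl l).
  by apply/seteqP; split=> x; rewrite /hge /= pairing_pullz.
have e2 : hge (- rl (pullz l)) = p @^-1` hge (- rl l).
  by apply/seteqP; split=> x; rewrite /hge /= !pairingNr pairing_pullz.
have e3 : heq (rl (pullz l)) = p @^-1` heq (rl l).
  by apply/seteqP; split=> x; rewrite /heq /= pairing_pullz.
case: H => ->.
- by exists (k' `&` hge (rl l)); [exists k' => //; constructor 1|rewrite e1].
- by exists (k' `&` hge (- rl l)); [exists k' => //; constructor 2|rewrite e2].
- by exists (k' `&` heq (rl l)); [exists k' => //; constructor 3|rewrite e3].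
Qed.

(** Since l has constant sign on c, cutting by its half-space gives c itself or a face of c. *)
Lemma cell_hge (L : seq 'cV[int]_m) c l : cut L [set (setT : set W)] c -> l \in L ->
  cut L [set setT] (c `&` hge (rl l)).
Proof.
move=> Lc lL; have [h|h] := cut_sign Lc lL.
  suff -> : c `&` hge (rl l) = c by [].
  by apply/seteqP; split=> x; [case|move=> cx; split=> //; apply: h].
have [_ _ cF _] := is_fan_cut L (is_fan_setT m); apply: (cF _ _ Lc).
exists (- rl l) => [x /h|]; first by rewrite pairingNr oppr_ge0.
apply/seteqP; split=> x /=.
  move=> [cx lx]; split=> //; apply/eqP; rewrite pairingNr oppr_eq0; apply/eqP/le_anti.
  by rewrite h.
by move=> [cx /eqP]; rewrite pairingNr oppr_eq0 => /eqP e; split=> //; rewrite /hge /= e.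
Qed.

Lemma cell_hges (L L' : seq 'cV[int]_m) c : cut L [set (setT : set W)] c -> {subset L' <= L} ->
  cut L [set setT] (c `&` [set y | forall l, l \in L' -> 0 <= pairing y (rl l)]).
Proof.
elim: L' c => [|l L' IH] c Lc sub.
  suff -> : c `&` [set y | forall l, l \in [::] -> 0 <= pairing y (rl l)] = c by [].
  by apply/seteqP; split=> x; [case|move=> cx; split].
rewrite (_ : c `&` _ = (c `&` hge (rl l)) `&` [set y | forall l, l \in L' -> 0 <= pairing y (rl l)]).
  apply: IH; first by apply: cell_hge => //; apply: sub; apply: mem_head.
  by move=> k kL; apply: sub; rewrite inE kL orbT.
apply/seteqP; split=> x /=.
  move=> [cx h]; split; first by split=> //; apply: h; apply: mem_head.
  by move=> k kL; apply: h; rewrite inE kL orbT.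
move=> [[cx lx] h]; split=> // k; rewrite inE => /orP[/eqP->//|]; exact: h.
Qed.

Lemma inj_span (s : set V) : cone_dim s = 2%N -> cone_dim (p @` s) = 2%N ->
  forall a, a \in lin_span s -> p a = 0 -> a = 0.
Proof.
move=> ds dps a sa pa; have := limg_ker_dim (linfun p) (lin_span s).
rewrite -lin_span_image -/(cone_dim s) -/(cone_dim (p @` s)) ds dps => /eqP.
rewrite -[X in _ == X]add0n eqn_add2r dimv_eq0 => /eqP e.
apply/eqP; rewrite -memv0 -e memv_cap sa memv_ker lfunE /= pa //.
Qed.

Lemma cone_dim_image (s : set V) : (cone_dim (p @` s) <= cone_dim s)%N.
Proof. by rewrite /cone_dim lin_span_image -(limg_ker_dim (linfun p) (lin_span s)) leq_addl. Qed.

Lemma set_inj_image (s : set V) : cone_dim s = 2%N -> cone_dim (p @` s) = 2%N -> set_inj s p.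
Proof.
move=> ds dps x y; rewrite !inE => sx sy e; apply/eqP; rewrite -subr_eq0; apply/eqP.
apply: (inj_span ds dps); first by rewrite memvB ?mem_lin_span.
by rewrite linearB /= e subrr.
Qed.

Lemma face0_sub (s k : set V) : face [set 0] s -> k `<=` s -> k 0 -> face [set 0] k.
Proof.
move=> [l l0 E] ks k0; exists l => [x /ks|]; first exact: l0.
apply/seteqP; split=> x /=; first by move=> ->; rewrite pairing0l.
by move=> [kx xl]; have : [set 0 : V] x by rewrite E; split=> //; apply: ks.
Qed.

Definition push_fan (F : wfan R n) : wfan R m :=
  WFan [set t | exists s, [/\ cones_of_dim F 2 s, cone_dim (p @` s) = 2%N & face t (p @` s)]]
    (fun s' => (\big[addn/0]_(s \in [set s | cones_of_dim F 2 s /\ p @` s = s'])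
       (weight F s * lattice_index (lattice_of s') (p @` lattice_of s)))%N).

(** The images of the cones need not form a fan. Cutting by the preimages of all hyperplanes that
    describe these images turns each image into a cell of one arrangement in R^m, and such cells
    meet in common faces. *)
Lemma pushforward_exists F0 T1 T2 : tropical_fan 2 F0 -> exists F,
  [/\ tropical_fan 2 F /\ cycle_of 2 F0 F, (forall x v, indep x v -> delta F x v = delta F0 x v),
     positive 2 F /\ pointed_fan F, fineT F T1 /\ fineT F T2 &
     is_pushforward 2 p F (push_fan F)].
Proof.
move=> t0; have [f0 _ _] := t0; have [F1 [[tF1 XF1] dF1 [pos1 pt1] fT1]] := fine_rep_seq [:: T1; T2] t0.
have [fF1 pF1 bF1] := tF1; have [fin1 r1 c1 i1] := fF1.
have [L HL] : exists L : seq 'cV[int]_m, forall s, cones F1 s -> exists2 L' : seq 'cV[int]_m, {subset L' <= L} &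
    forall y, (p @` s) y <-> (forall l, l \in L' -> 0 <= pairing y (rl l)).
  have [||L HL] := @family_hrep R m [set p @` s | s in cones F1].
  - exact: finite_image.
  - by move=> _ [s Fs <-]; apply: rational_image => //; apply: r1.
  by exists L => s Fs; apply: HL; exists s.
have [F rF cF] := cut_refines (map pullz L) tF1.
have [tF subF supF wF] := rF; have [fF pF bF] := tF; have [finF ratF faceF interF] := fF.
exists F.
have dF x v : indep x v -> delta F x v = delta F0 x v.
  by move=> iv; rewrite (delta_prerefines fF1 pF1 (refines_prerefines rF) iv) dF1.
have fine T : fineT F1 T -> fineT F T.
  move=> fT s /subF[r Fr sr]; have [l lT lE] := fT r Fr.
  by exists l => // x sx; apply: lE; apply: sr.
split=> //.
- by split=> //; split=> //; apply: delta_equiv => // x v iv; rewrite dF.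
- split.
    move=> s Fs; have [t Ft st] := prerefines_top fF1 pF1 (refines_prerefines rF) Fs.
    by rewrite (wF _ _ Fs Ft st) pos1.
  move=> s Fs; have [r Fr sr] := subF _ Fs.
  apply: (faceF _ _ Fs); apply: (face0_sub (pointed_face fF1 pt1 Fr) sr).
  by have [] := rational_convex_cone (ratF _ Fs).
- by split; apply: fine; apply: fT1 => /=; tauto.
have cell s : cones F s -> cut L [set setT] (p @` s).
  rewrite cF => /cutE[r [c [Fr /cut_preimage[c' Lc' ->] ->]]].
  have [L' sub E] := HL r Fr.
  rewrite (_ : p @` (r `&` p @^-1` c') = c' `&` [set y | forall l, l \in L' -> 0 <= pairing y (rl l)]).
    exact: cell_hges.
  apply/seteqP; split=> y.
    by move=> [x [rx cx] <-]; split=> //; apply/E; exists x.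
  by move=> [cy /E[x rx xy]]; exists x => //; split=> //=; rewrite xy.
have [_ _ _ interA] := is_fan_cut L (is_fan_setT m).
split=> //; split.
- by apply: finite_image; apply: sub_finite_set finF => s [].
- by move=> _ [s [Fs _] <-]; apply: rational_image => //; apply: ratF.
- move=> _ t [s [Fs inj] <-] /face_image[k ks ->]; exists k => //; split; first exact: faceF ks.
  by move=> x y; rewrite !inE => kx ky; apply: inj; rewrite inE; apply: (face_sub ks).
- by move=> _ _ [s [Fs _] <-] [r [Fr _] <-]; apply: interA; apply: cell.
Qed.

Lemma pushforward_fan F H : is_fan (cones F) -> is_pushforward 2 p F H ->
  is_fan (cones H) /\ pure H 2.
Proof.
move=> fF [[fin rat fac int] cH wH]; have [_ rF cF _] := fF.
have sub t : cones H t -> [set p @` s | s in [set s | cones F s /\ set_inj s p]] t.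
  rewrite cH => -[s [[Fs ds] dps ft]]; apply: fac ft.
  by exists s => //; split=> //; apply: set_inj_image.
split; [split|].
- by apply: sub_finite_set fin.
- by move=> s /sub/rat.
- move=> s t; rewrite cH => -[r [Fr dr fs]] ft; exists r; split=> //.
  apply: face_trans ft => //; apply: rational_image => //; apply: rF; by case: Fr.
- by move=> s t /sub h1 /sub h2; apply: int.
move=> t; rewrite cH => -[s [Fs dps ft]]; exists (p @` s); last exact: face_sub ft.
by split=> //; rewrite cH; exists s; split=> //; apply: face_refl.
Qed.

End Images.

Section Index.
Context {R : realType} {m : nat}.
Local Notation W := 'rV[R]_m.

(** The vectors i y + j w with i < c and j < d represent the cosets; k < c d numbers them by its
    remainder i and its quotient j modulo c. *)
Lemma lattice_index_basis (y w : W) (c d : nat) (e : int) (L L' : set W) : indep y w ->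
  (0 < c)%N -> (0 < d)%N ->
  (forall x, L x <-> exists a b : int, x = a%:~R *: y + b%:~R *: w) ->
  (forall x, L' x <-> exists a b : int, x = a%:~R *: (c%:R *: y) + b%:~R *: (d%:R *: w + e%:~R *: y)) ->
  lattice_index L L' = (c * d)%N.
Proof.
move=> iyw c0 d0 LP LP'.
pose coset x : set W := [set x + z | z in L'].
have coset_eq x x' : L' (x - x') -> coset x = coset x'.
  move=> /LP'[a [b E]]; apply/seteqP; split=> _ [z /LP'[a' [b' ->]] <-].
    exists (x - x' + (a'%:~R *: (c%:R *: y) + b'%:~R *: (d%:R *: w + e%:~R *: y))).
      by apply/LP'; exists (a + a'), (b + b'); rewrite E !intrD; apply/rowP => i; rewrite !mxE; ring.
    by apply/rowP => i; rewrite !mxE; ring.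
  exists (- (x - x') + (a'%:~R *: (c%:R *: y) + b'%:~R *: (d%:R *: w + e%:~R *: y))).
    by apply/LP'; exists (a' - a), (b' - b); rewrite E !intrB; apply/rowP => i; rewrite !mxE; ring.
  by apply/rowP => i; rewrite !mxE; ring.
pose rep k : W := (k %% c)%:R *: y + (k %/ c)%:R *: w.
rewrite /lattice_index; apply: card_fset_set.
suff -> : [set [set x + y0 | y0 in L'] | x in L] = (fun k => coset (rep k)) @` `I_(c * d).
  apply: inj_card_eq => k k'; rewrite !inE /= => kl kl' E.
  have : coset (rep k') (rep k).
    by rewrite -E; exists 0; [apply/LP'; exists 0, 0; rewrite !scale0r addr0|rewrite addr0].
  move=> [_ /LP'[a [b ->]]] /esym H.
  have [|e1 e2] := @indep_coeff _ _ y w (k %% c)%:R (k %/ c)%:R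
    ((k' %% c)%:R + a%:~R * c%:R + b%:~R * e%:~R) ((k' %/ c)%:R + b%:~R * d%:R) iyw.
    by rewrite -/(rep k) H /rep; apply/rowP => i; rewrite !mxE; ring.
  have E2 : (k %/ c)%:Z = (k' %/ c)%:Z + b * d%:Z.
    by apply: (@intr_inj R); rewrite intrD intrM.
  have kd : (k %/ c < d)%N by rewrite ltn_divLR // mulnC.
  have kd' : (k' %/ c < d)%N by rewrite ltn_divLR // mulnC.
  have b0 : b = 0 by move: E2 kd kd'; move: (k %/ c)%N (k' %/ c)%N d0; clear; move=> i j d0 E hi hj; nia.
  have E1 : (k %% c)%:Z = (k' %% c)%:Z + a * c%:Z.
    apply: (@intr_inj R); rewrite intrD intrM; move: e1; rewrite b0 mul0r addr0; exact.
  have ic : (k %% c < c)%N by rewrite ltn_mod.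
  have ic' : (k' %% c < c)%N by rewrite ltn_mod.
  have a0 : a = 0 by move: E1 ic ic'; move: (k %% c)%N (k' %% c)%N c0; clear; move=> i j c0 E hi hj; nia.
  move: E1 E2; rewrite a0 b0 !mul0r !addr0 => -[E1] [E2].
  by rewrite (divn_eq k c) (divn_eq k' c) E1 E2.
apply/seteqP; split=> C.
  move=> [x /LP[a [b ->]] <-].
  pose q := (b %/ d%:Z)%Z; pose r := absz (b %% d%:Z)%Z.
  pose q' := ((a - q * e) %/ c%:Z)%Z; pose i := absz ((a - q * e) %% c%:Z)%Z.
  have dz : d%:Z != 0 by rewrite eqz_nat -lt0n.
  have cz : c%:Z != 0 by rewrite eqz_nat -lt0n.
  have rE : r%:Z = (b %% d%:Z)%Z by rewrite /r gez0_abs // modz_ge0.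
  have iE : i%:Z = ((a - q * e) %% c%:Z)%Z by rewrite /i gez0_abs // modz_ge0.
  have rd : (r < d)%N by rewrite -ltz_nat rE ltz_pmod.
  have ic : (i < c)%N by rewrite -ltz_nat iE ltz_pmod.
  exists (r * c + i)%N; first by rewrite /=; nia.
  apply/esym/coset_eq/LP'; exists q', q.
  rewrite /rep modnMDl modn_small // divnMDl // divn_small // addn0.
  have bE : b%:~R = q%:~R * d%:R + r%:R :> R.
    have : b = q * d%:Z + r%:Z by rewrite rE -divz_eq.
    by move=> {1}->; rewrite intrD intrM.
  have aE : a%:~R = q'%:~R * c%:R + i%:R + q%:~R * e%:~R :> R.
    have : a - q * e = q' * c%:Z + i%:Z by rewrite iE -divz_eq.
    by move/eqP; rewrite subr_eq => /eqP {1}->; rewrite !intrD !intrM.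
  by rewrite bE aE; apply/rowP => j; rewrite !mxE; ring.
move=> [k _ <-]; exists (rep k) => //; apply/LP.
by exists (k %% c)%N, (k %/ c)%N.
Qed.

End Index.

Section Invariance.
Context {R : realType} {n m : nat}.
Local Notation V := 'rV[R]_n.
Local Notation W := 'rV[R]_m.
Implicit Types (F : wfan R n) (H : wfan R m).
Context (p : {linear V -> W}).

Definition push_index (s : set V) : R := (lattice_index (lattice_of (p @` s)) (p @` lattice_of s))%:R.

(* The density of the pushforward, computed before refining so that the images form a
   fan. *)
Definition push_delta F (y w : W) : R := wsum 2 F (fun s => germ (p @` s) y w) push_index.

Lemma germ_lift (s : set V) y w : indep y w -> germ (p @` s) y w ->
  exists x v, [/\ p x = y, p v = w, indep x v & germ s x v].
Proof.
move=> iyw [[x sx xy] [e e0 [x' sx' xy']]].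
exists x, (e^-1 *: (x' - x)).
have en : e != 0 by rewrite gt_eqF.
have pv : p (e^-1 *: (x' - x)) = w.
  by rewrite linearZ linearB /= xy xy' addrAC subrr add0r scalerA mulVf // scale1r.
split=> //.
  move: (e^-1 *: (x' - x)) pv => v pv; apply/indepP => a b E; apply: ((indepP y w).1 iyw).
  have -> : a *: y + b *: w = p (a *: x + b *: v) by rewrite linearD !linearZ /= xy pv.
  by rewrite E linear0.
by split=> //; exists e; rewrite // scalerA mulfV // scale1r addrC subrK.
Qed.

Lemma push_dim F s y w : indep y w -> cones_of_dim F 2 s -> germ (p @` s) y w ->
  cone_dim (p @` s) = 2%N.
Proof.
move=> iyw [_ ds] g; apply/eqP; rewrite eqn_leq (germ_dim iyw g) andbT -ds.
exact: cone_dim_image.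
Qed.

Lemma push_index_span (s s' : set V) : lin_span s = lin_span s' -> push_index s = push_index s'.
Proof. by move=> E; rewrite /push_index /lattice_of !lin_span_image E. Qed.

Lemma push_delta_refine F' F y w : is_fan (cones F) -> pure F 2 -> prerefines 2 F' F -> indep y w ->
  push_delta F' y w = push_delta F y w.
Proof.
move=> fF pF rf iyw; have [[fF' pF'] sub sup wt] := rf; apply: wsum_refine => //.
- move=> s' s _ _ ss [[x sx xy] [e e0 [x' sx' xy']]].
  by split; [exists x => //; apply: ss|exists e => //; exists x' => //; apply: ss].
- move=> s Fs /(germ_lift iyw)[x [v [xy vw ixv g]]].
  have [s' Fs' [ss [sx [e e0 se]]]] := refine_germ fF pF rf ixv Fs g.
  exists s' => //; split=> //; split; first by exists x.
  by exists e => //; exists (x + e *: v); rewrite // linearD linearZ /= xy vw.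
- move=> s s1 s2 Fs F1 F2 ss1 ss2 g1 g2.
  have gs : germ (p @` s) y w.
    case: g1 => [[x sx xy] [e e0 [x' sx' xy']]].
    by split; [exists x => //; apply: ss1|exists e => //; exists x' => //; apply: ss1].
  have dps := push_dim iyw Fs gs; have [_ ds] := Fs.
  have [x [v [xy vw ixv g]]] := germ_lift iyw g1.
  have [x' [v' [xy' vw' _ g']]] := germ_lift iyw g2.
  have sp t : t `<=` s -> forall a, a \in lin_span t -> a \in lin_span s.
    by move=> ts a; apply: subvP; apply: lin_spanS.
  (* On the span of s the map p is injective, so the two lifts of the germ (y, w) coincide and
     belong to one cone of F'. *)
  have xx : x = x'.
    apply/eqP; rewrite -subr_eq0; apply/eqP; apply: (inj_span ds dps).
      by rewrite memvB ?mem_lin_span //; [apply: ss1; case: g|apply: ss2; case: g'].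
    by rewrite linearB /= xy xy' subrr.
  have vv : v = v'.
    apply/eqP; rewrite -subr_eq0; apply/eqP; apply: (inj_span ds dps).
      by rewrite memvB //; [apply: (sp s1) => //; apply: germ_span g|apply: (sp s2) => //; apply: germ_span g'].
    by rewrite linearB /= vw vw' subrr.
  by rewrite -xx -vv in g'; apply: (germ_unique fF' ixv).
- move=> s' s [_ d'] [_ ds] ss _; apply: push_index_span; apply: lin_span_eq => //.
  by rewrite ds d'.
Qed.

Lemma push_delta_equiv F1 F2 y w : is_fan (cones F1) -> is_fan (cones F2) -> fan_equiv 2 F1 F2 ->
  indep y w -> push_delta F1 y w = push_delta F2 y w.
Proof.
move=> f1 f2 [F [/refines_prerefines r1 /refines_prerefines r2]] iv.
rewrite /push_delta -(wsum_positive_part _ _ _ f1) -(wsum_positive_part _ _ _ f2).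
rewrite -!/(push_delta _ _ _) -(push_delta_refine _ _ r1 iv) ?(push_delta_refine _ _ r2 iv) //;
  by [apply: is_fan_positive_part|apply: pure_positive_part].
Qed.

Lemma push_weight F H s' : is_fan (cones F) -> is_pushforward 2 p F H -> cones_of_dim H 2 s' ->
  (weight H s')%:R = \sum_(s \in cones_of_dim F 2) (if `[< p @` s = s' >] then (weight F s)%:R * push_index s else 0).
Proof.
move=> fF [_ cH wH] Hs'; rewrite (wH _ Hs').
have ff := finite_cones_of_dim 2 fF.
have fA : finite_set [set s | cones_of_dim F 2 s /\ p @` s = s'] by apply: sub_finite_set ff => s [].
rewrite (fsbig_finite _ _ fA) natr_sum.
transitivity (\sum_(s \in [set s | cones_of_dim F 2 s /\ p @` s = s'])
    (if `[< p @` s = s' >] then (weight F s)%:R * push_index s else 0)).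
  rewrite (fsbig_finite _ _ fA); apply: eq_big_seq => s; rewrite in_fset_set // inE => -[Fs e].
  by rewrite asboolT // natrM /push_index e.
apply: fsbig_widen => [s []//|s [Fs ns] /=].
by case: asboolP => // e; case: ns.
Qed.

Lemma delta_push F H y w : is_fan (cones F) -> is_pushforward 2 p F H -> zlinear p -> indep y w ->
  delta H y w = push_delta F y w.
Proof.
move=> fF pH zp iyw; have [_ cH _] := pH; have [fH _] := pushforward_fan zp fF pH.
have ff := finite_cones_of_dim 2 fF; have fh := finite_cones_of_dim 2 fH.
rewrite /delta /push_delta /wsum.
transitivity (\sum_(s' \in cones_of_dim H 2) \sum_(s \in cones_of_dim F 2)
    (if `[< germ s' y w /\ p @` s = s' >] then (weight F s)%:R * push_index s else 0)).
  apply: eq_fsbigr => s'; rewrite inE => Hs'; case: asboolP => g.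
    rewrite mulr1 (push_weight fF pH Hs'); apply: eq_fsbigr => s _.
    suff -> : `[< p @` s = s' >] = `[< germ s' y w /\ p @` s = s' >] by [].
    by apply/asboolP/asboolP => [|[]].
  by rewrite fsbig1 // => s _; case: asboolP => // -[].
rewrite exchange_fsbig //; apply: eq_fsbigr => s; rewrite inE => Fs.
case: asboolP => g; last first.
  by rewrite fsbig1 // => s' _; case: asboolP => // -[g' e]; case: g; rewrite e.
have dps := push_dim iyw Fs g.
have Hps : cones_of_dim H 2 (p @` s).
  by split=> //; rewrite cH; exists s; split=> //; apply: face_refl.
rewrite -(@fsbig_widen _ _ _ _ [set p @` s]).
- by rewrite fsbig_set1 asboolT.
- by move=> _ ->.
- by move=> s' [_ ns] /=; case: asboolP => // -[_ e]; case: ns.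
Qed.

(** Whichever representative is pushed forward, the density of the result is [push_delta] of that
    representative, which is invariant under equivalence. *)
Lemma pushforward_cycle F0 F H : zlinear p -> tropical_fan 2 F0 -> cycle_of 2 F0 F ->
  is_pushforward 2 p F H -> tropical_fan 2 H -> pushforward 2 p (cycle_of 2 F0) = cycle_of 2 H.
Proof.
move=> zp t0 XF pH tH; have [f0 _ _] := t0; have [[fF _ _] eF] := XF.
have [fH _ _] := tH.
apply/seteqP; split=> K; last by move=> HK; exists F, H.
move=> [F' [H' [XF' pH' [tK eK]]]]; split=> //.
have [[fF' _ _] eF'] := XF'; have [fK _ _] := tK.
have [fH' _] := pushforward_fan zp fF' pH'.
apply: delta_equiv => // y w iyw.
rewrite -(delta_equiv_eq fH' fK eK iyw) (delta_push fF pH zp iyw) (delta_push fF' pH' zp iyw).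
by rewrite -(push_delta_equiv f0 fF eF iyw) -(push_delta_equiv f0 fF' eF' iyw).
Qed.

End Invariance.

Section Flags.
Context {R : realType} {n : nat}.
Local Notation V := 'rV[R]_n.
Implicit Types (x y v w : V) (sigma tau : set V).

Lemma indep_functional x v : indep x v -> exists l : 'cV[R]_n, pairing x l = 0 /\ 0 < pairing v l.
Proof.
move=> [x0 xv]; suff [l [xl vl]] : exists l : 'cV[R]_n, pairing x l = 0 /\ pairing v l != 0.
  have [h|h|h] := ltrgtP (pairing v l) 0; last by rewrite h eqxx in vl.
    by exists (- l); rewrite !pairingNr xl oppr0 oppr_gt0.
  by exists l.
apply: contrapT => N; case/negP: xv.
have [i xi] : exists i, x 0 i != 0.
  apply: contrapT => N'; case/eqP: x0; apply/rowP => i; rewrite mxE.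
  by apply/eqP/negPn/negP => h; apply: N'; exists i.
apply/vlineP; exists (v 0 i / x 0 i); apply/rowP => j; rewrite mxE.
have pd (z : V) k : pairing z (delta_mx k 0) = z 0 k.
  rewrite /pairing mxE (bigD1 k) //= big1 ?addr0 => [|j' ji]; first by rewrite mxE !eqxx mulr1.
  by rewrite mxE (negbTE ji) mulr0.
pose l : 'cV[R]_n := x 0 i *: delta_mx j 0 - x 0 j *: delta_mx i 0.
have lE (z : V) : pairing z l = x 0 i * z 0 j - x 0 j * z 0 i.
  by rewrite pairingBr !pairingZr !pd.
have : pairing v l = 0.
  apply/eqP/negPn/negP => h; apply: N; exists l; split=> //; rewrite lE; ring.
rewrite lE => /eqP; rewrite subr_eq0 => /eqP e; apply: (mulfI xi); rewrite e; field.
exact: xi.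
Qed.

Lemma ray_decomp sigma tau : rational_cone sigma -> cone_dim sigma = 2%N -> face [set 0] sigma ->
  face tau sigma -> cone_dim tau = 1%N -> exists y1 y2, [/\ tau y1, sigma y2, indep y1 y2 &
   forall x, sigma x -> exists a b, [/\ 0 <= a, 0 <= b & x = a *: y1 + b *: y2]].
Proof.
move=> rs ds f0 ft dt.
have [t1 [t2 [y1 [y2 [[f1 f2] _ [h1 h2] iv [_ [dec all]]]]]]] := two_rays rs ds f0.
case: (all _ ft dt) => ->; first by exists y1, y2; split=> //; apply: (face_sub f2).
exists y2, y1; split=> //; first exact: (face_sub f1).
  apply/indepP => a b; rewrite addrC => /((indepP _ _).1 iv)[-> ->] //.
by move=> x /dec[a [b [a0 b0 ->]]]; exists b, a; rewrite addrC.
Qed.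

Lemma flag_lattice sigma tau : rational_cone sigma -> rational_cone tau -> cone_dim sigma = 2%N ->
  face tau sigma -> cone_dim tau = 1%N -> face [set 0] tau ->
  let u := lattice_normal tau [set 0] in let v := lattice_normal sigma tau in
  [/\ Prim u /\ tau u, indep u v, germ sigma u v &
    forall x, lattice_of sigma x <-> exists a b : int, x = a%:~R *: u + b%:~R *: v].
Proof.
move=> rs rt ds ft dt f0 u v.
have [Pu tu] : (Prim `&` tau) u by rewrite (Prim_ray rt dt f0).
have [Zu u0 Gu] := Pu.
have [NE [iv [[Zv vs] gen _]]] := Nset_ray rs ds ft dt tu u0 Zu.
have [_ g] : (Nset u `&` germ sigma u) v by rewrite NE.
split=> // x; split.
  move=> /gen[a [Zy yt]]; rewrite (span_ray dt tu u0) in yt; have [b E] := Gu _ Zy yt.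
  by exists b, a; rewrite -E subrK.
move=> [a [b ->]]; split; first by apply: ZnD; apply: ZnZ.
by rewrite memvD ?memvZ // mem_lin_span //; apply: (face_sub ft).
Qed.

End Flags.

Section Projection.
Context {R : realType} {n m : nat}.
Local Notation V := 'rV[R]_n.
Local Notation W := 'rV[R]_m.
Implicit Types (F : wfan R n) (H : wfan R m) (sigma tau : set V).
Context (p : {linear V -> W}) (zp : zlinear p).

Lemma image_indep sigma y1 y2 : cone_dim sigma = 2%N -> cone_dim (p @` sigma) = 2%N ->
  sigma y1 -> y2 \in lin_span sigma -> indep y1 y2 -> indep (p y1) (p y2).
Proof.
move=> ds dps s1 s2 iv; apply/indepP => a b E; apply: ((indepP _ _).1 iv).
apply: (inj_span ds dps); first by rewrite memvD ?memvZ // mem_lin_span.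
by rewrite linearD !linearZ.
Qed.

Lemma image_ray_face sigma tau : rational_cone sigma -> cone_dim sigma = 2%N -> face [set 0] sigma ->
  cone_dim (p @` sigma) = 2%N -> face tau sigma -> cone_dim tau = 1%N ->
  face (p @` tau) (p @` sigma) /\ cone_dim (p @` tau) = 1%N.
Proof.
move=> rs ds f0 dps ft dt; have [y1 [y2 [t1 s2 iv dec]]] := ray_decomp rs ds f0 ft dt.
have iv' := image_indep ds dps (face_sub ft t1) (mem_lin_span s2) iv.
have [l [l1 l2]] := indep_functional iv'; have [y10 _] := iv; have [py10 _] := iv'.
have [_ _ tZ] : convex_cone sigma by apply: rational_convex_cone.
split; last first.
  have le1 := cone_dim_image p tau; rewrite dt in le1.
  apply/eqP; rewrite eqn_leq le1 /=; apply: (dim_ge1 _ py10); by exists y1.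
exists l.
  move=> _ [x /dec[a [b [a0 b0 ->]]] <-].
  by rewrite linearD !linearZ /= pairingDl !pairingZl l1 mulr0 add0r mulr_ge0 // ltW.
apply/seteqP; split=> z.
  move=> [x tx <-]; split; first by exists x => //; apply: (face_sub ft).
  have : x \in <[y1]>%VS by rewrite -(span_ray dt t1 y10) mem_lin_span.
  by case/vlineP => k ->; rewrite linearZ /= pairingZl l1 mulr0.
move=> [[x sx <-] xl]; exists x => //; have [a [b [a0 b0 xE]]] := dec _ sx.
move: xl; rewrite xE linearD !linearZ /= pairingDl !pairingZl l1 mulr0 add0r => /eqP.
rewrite mulf_eq0 (gt_eqF l2) orbF => /eqP->; rewrite scale0r addr0.
move: t1; have [k k0 ->] := ft; move=> [s1 k1]; split; first exact: tZ.
by rewrite pairingZl k1 mulr0.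
Qed.

Lemma image_pointed sigma : rational_cone sigma -> cone_dim sigma = 2%N -> face [set 0] sigma ->
  cone_dim (p @` sigma) = 2%N -> face [set 0] (p @` sigma).
Proof.
move=> rs ds f0 dps; have [t1 [_ [_ [_ [[ft _] [dt _] _ _ _]]]]] := two_rays rs ds f0.
have [y1 [y2 [ty1 s2 iv dec]]] := ray_decomp rs ds f0 ft dt.
have iv' := image_indep ds dps (face_sub ft ty1) (mem_lin_span s2) iv.
have iv'' : indep (p y2) (p y1).
  by apply/indepP => a b; rewrite addrC => /((indepP _ _).1 iv')[-> ->].
have [l1 [l11 l12]] := indep_functional iv'; have [l2 [l21 l22]] := indep_functional iv''.
have E a b : pairing (p (a *: y1 + b *: y2)) (l1 + l2) = a * pairing (p y1) l2 + b * pairing (p y2) l1.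
  by rewrite linearD !linearZ /= pairingDl !pairingZl !pairingDr l11 l21 add0r addr0.
have [s0 _ _] : convex_cone sigma by apply: rational_convex_cone.
exists (l1 + l2).
  move=> _ [x /dec[a [b [a0 b0 ->]]] <-]; rewrite E addr_ge0 // mulr_ge0 // ltW //.
apply/seteqP; split=> z.
  by move=> ->; split; [exists 0; rewrite ?linear0|rewrite pairing0l].
move=> [[x /dec[a [b [a0 b0 ->]]] <-]]; rewrite E => /eqP.
rewrite paddr_eq0 ?mulr_ge0 ?(ltW l12) ?(ltW l22) // !mulf_eq0 (gt_eqF l12) (gt_eqF l22) !orbF.
by move=> /andP[/eqP-> /eqP->]; rewrite !scale0r addr0 linear0.
Qed.

Lemma pushforward_pointed F H : is_fan (cones F) -> pointed_fan F -> is_pushforward 2 p F H ->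
  pointed_fan H.
Proof.
move=> fF ptF pH t; have [fH _] := pushforward_fan zp fF pH; have [_ _ cH _] := fH.
have [_ rF _ _] := fF; have [_ hE _] := pH; rewrite {1}hE => -[s [[Fs ds] dps ft]].
rewrite hE; exists s; split=> //; apply: image_pointed => //; first exact: rF.
exact: pointed_face ptF Fs.
Qed.

Lemma image_flag sigma rho : cone_dim sigma = 2%N -> cone_dim (p @` sigma) = 2%N ->
  face rho (p @` sigma) -> cone_dim rho = 1%N ->
  exists tau, [/\ face tau sigma, cone_dim tau = 1%N, p @` tau = rho &
    forall tau', face tau' sigma -> p @` tau' = rho -> tau' = tau].
Proof.
move=> ds dps fr dr; have [t ft tE] := face_image fr.
have inj := set_inj_image ds dps.
exists t; split=> //.
  have d1 : (1 <= cone_dim t)%N by rewrite -dr tE cone_dim_image.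
  have := cone_dimS (face_sub ft); rewrite ds leq_eqVlt => /orP[/eqP d2|]; last first.
    by rewrite ltnS => h; apply/eqP; rewrite eqn_leq h.
  by have := face_eq_dim ft; rewrite d2 ds leqnn => /(_ isT) e; move: dr; rewrite tE e dps.
have half a b : face a sigma -> face b sigma -> p @` a = p @` b -> a `<=` b.
  move=> fa fb e x ax; have : (p @` a) (p x) by exists x.
  rewrite e => -[z bz pz]; suff <- : z = x by [].
  by apply: inj => //; rewrite inE; [apply: (face_sub fb)|apply: (face_sub fa)].
by move=> t' ft' t'E; apply/seteqP; split; apply: half => //; rewrite t'E.
Qed.

(** With respect to the flag bases of the two lattices p is triangular with diagonal entries c and
    d, and the index is its determinant. *)
Lemma push_index_flag sigma tau rho : rational_cone sigma -> rational_cone tau -> rational_cone rho ->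
  cone_dim sigma = 2%N -> cone_dim (p @` sigma) = 2%N -> face tau sigma -> cone_dim tau = 1%N ->
  face [set 0] tau -> p @` tau = rho -> face rho (p @` sigma) -> cone_dim rho = 1%N -> face [set 0] rho ->
  exists (c d : nat) (e : int), [/\ p (lattice_normal tau [set 0]) = c%:R *: lattice_normal rho [set 0],
    p (lattice_normal sigma tau) = d%:R *: lattice_normal (p @` sigma) rho + e%:~R *: lattice_normal rho [set 0] &
    push_index p sigma = c%:R * d%:R].
Proof.
move=> rs rt rr ds dps ft dt f0t tE fr dr f0r.
have [[[Zu u0 Gu] tu] iuv guv LP] := flag_lattice rs rt ds ft dt f0t.
set u := lattice_normal tau [set 0] in Zu u0 Gu tu iuv guv LP *.
set v := lattice_normal sigma tau in iuv guv LP *.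
have [[[Zy y0 Gy] ry] iyw gyw LP'] := flag_lattice (rational_image zp rs) rr dps fr dr f0r.
set y := lattice_normal rho [set 0] in Zy y0 Gy ry iyw gyw LP' *.
set w := lattice_normal (p @` sigma) rho in iyw gyw LP' *.
have su : sigma u := face_sub ft tu.
have rpu : rho (p u) by rewrite -tE; exists u.
have ipu := image_indep ds dps su (germ_span guv) iuv; have [pu0 _] := ipu.
have [a puE] : exists a : int, p u = a%:~R *: y.
  by apply: Gy; [apply: zp|rewrite -(span_ray dr ry y0) mem_lin_span].
have a0 : 0 < a.
  have an : a != 0 by apply: contra pu0 => /eqP a0; rewrite puE a0 scale0r.
  rewrite lt_def an /= leNgt; apply/negP => an0.
  have [_ _ rZ] := rational_convex_cone rr; apply: (face0_ray f0r ry y0).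
  have -> : - y = (- a%:~R)^-1 *: p u.
    by rewrite puE scalerA invrN mulNr mulVf ?scaleN1r // intr_eq0.
  by apply: rZ => //; rewrite invr_ge0 -intrN ler0z oppr_ge0 ltW.
have Lpv : lattice_of (p @` sigma) (p v).
  have /LP [Zv sv] : exists a b : int, v = a%:~R *: u + b%:~R *: v.
    by exists 0, 1; rewrite scale0r add0r scale1r.
  split; first exact: zp.
  by rewrite lin_span_image; apply/memv_imgP; exists v; rewrite // lfunE.
have [e [d pvE]] := (LP' _).1 Lpv.
have gpuv : germ (p @` sigma) (p u) (p v).
  case: guv => _ [k k0 sk]; split; first by exists u.
  by exists k => //; exists (u + k *: v); rewrite // linearD linearZ.
have d0 : 0 < d.
  have := primitive_generator_pgen (rational_image zp rs) dps fr dr rpu pu0 gpuv.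
  move=> /(_ ipu.2) E; have : pgen (p u) (p v) w.
    have [_ [_ h]] := Nset_ray (rational_image zp rs) dps fr dr ry y0 Zy; by rewrite -E.
  move=> [_ _ _ [al [be [b0 wE]]]].
  have [|_] := @indep_coeff _ _ y w (al * a%:~R + be * e%:~R) (be * d%:~R) 0 1 iyw.
    by rewrite scale0r add0r scale1r {2}wE puE pvE; apply/rowP => i; rewrite !mxE; ring.
  by move=> bd; rewrite -(ltr0z R) -(pmulr_rgt0 _ b0) bd ltr01.
exists (absz a), (absz d), e.
have aE : (absz a)%:R = a%:~R :> R by rewrite natr_absz gtr0_norm.
have dE : (absz d)%:R = d%:~R :> R by rewrite natr_absz gtr0_norm.
rewrite aE dE; split=> //; first by rewrite addrC.
rewrite /push_index (@lattice_index_basis _ _ y w (absz a) (absz d) e) //.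
- by rewrite natrM aE dE.
- by rewrite absz_gt0 gt_eqF.
- by rewrite absz_gt0 gt_eqF.
move=> x; rewrite aE dE; have E b b' : b%:~R *: (a%:~R *: y) + b'%:~R *: (d%:~R *: w + e%:~R *: y) =
    p (b%:~R *: u + b'%:~R *: v).
  have -> : p (b%:~R *: u + b'%:~R *: v) = b%:~R *: p u + b'%:~R *: p v by rewrite linearD !linearZ.
  by rewrite puE pvE; congr (_ + _ *: _); rewrite addrC.
split=> [[z /LP[b [b' ->]] <-]|[b [b' ->]]]; first by exists b, b'.
by rewrite E; exists (b%:~R *: u + b'%:~R *: v) => //; apply/LP; exists b, b'.
Qed.

End Projection.

Section Projection.
Context {R : realType} {n m : nat}.
Local Notation V := 'rV[R]_n.
Local Notation W := 'rV[R]_m.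
Implicit Types (F : wfan R n) (H : wfan R m) (sigma tau : set V).
Context (p : {linear V -> W}) (zp : zlinear p).
Context (F : wfan R n) (H : wfan R m) (fF : is_fan (cones F)) (ptF : pointed_fan F)
  (pH : is_pushforward 2 p F H).

Let fH : is_fan (cones H). Proof. by case: (pushforward_fan zp fF pH). Qed.
Let ptH : pointed_fan H. Proof. exact: pushforward_pointed pH. Qed.

(* The lattice index of the map from the ray tau to the ray of y. *)
Definition cofactor tau (y : W) : R := xget 0 [set c | p (lattice_normal tau [set 0]) = c *: y].

Lemma cofactorE tau (y : W) c : y != 0 -> p (lattice_normal tau [set 0]) = c *: y -> cofactor tau y = c.
Proof.
move=> y0 E; rewrite /cofactor; case: xgetP => [d -> /=|/(_ c) //]; rewrite E => /eqP.
by rewrite -subr_eq0 -scalerBl scaler_eq0 (negbTE y0) orbF subr_eq0 => /eqP.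
Qed.

Lemma cofactor_ray tau rho : cones_of_dim F 1 tau -> cones_of_dim H 1 rho -> p @` tau = rho ->
  let y := lattice_normal rho [set 0] in
  0 <= cofactor tau y /\ p (lattice_normal tau [set 0]) = cofactor tau y *: y.
Proof.
move=> Ft Hr tE y; have [[Zy y0 _] ry] : (Prim `&` rho) y by rewrite (Prim_ray_finite fH ptH Hr).
have [_ tu] : (Prim `&` tau) (lattice_normal tau [set 0]) by rewrite (Prim_ray_finite fF ptF Ft).
have [Hr1 dr] := Hr; have [_ rH _ _] := fH.
have ru : rho (p (lattice_normal tau [set 0])) by rewrite -tE; exists (lattice_normal tau [set 0]).
have : p (lattice_normal tau [set 0]) \in <[y]>%VS by rewrite -(span_ray dr ry y0) mem_lin_span.
case/vlineP => c cE; rewrite (cofactorE y0 cE); split=> //; rewrite leNgt; apply/negP => c0.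
have [_ _ rZ] := rational_convex_cone (rH _ Hr1); apply: (face0_ray (pointed_face fH ptH Hr1) ry y0).
have -> : - y = (- c)^-1 *: p (lattice_normal tau [set 0]).
  by rewrite cE scalerA invrN mulNr mulVf ?scaleN1r // lt_eqF.
by apply: rZ => //; rewrite invr_ge0 oppr_ge0 ltW.
Qed.

Lemma collapsed_normal sigma tau (x : W) : star F 2 tau sigma -> cones_of_dim F 1 tau ->
  cone_dim (p @` sigma) <> 2%N -> (p @` sigma) x -> x != 0 ->
  p (lattice_normal sigma tau) \in <[x]>%VS.
Proof.
move=> st Ft nd sx x0; have [vs _] := normal_span fF Ft st; have [[Fs ds] fs] := st.
have d1 : cone_dim (p @` sigma) = 1%N.
  have := cone_dim_image p sigma; rewrite ds leq_eqVlt => /orP[/eqP //|].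
  by rewrite ltnS => h; apply/eqP; rewrite eqn_leq h (dim_ge1 sx x0).
rewrite -(span_ray d1 sx x0) lin_span_image; apply/memv_imgP.
by exists (lattice_normal sigma tau); rewrite // lfunE.
Qed.

(* For an injective sigma over a ray tau over rho the index of the lattices is the
   product of the cofactor of tau and the factor d with p(v) = d v' mod y; where p
   collapses sigma the term on the right vanishes. *)
Lemma push_sum rho (k : set W -> 'cV[R]_m) : cones_of_dim H 1 rho ->
  let y := lattice_normal rho [set 0] in
  (forall s, cones F s -> (p @` s) y -> pairing y (k (p @` s)) = 0) ->
  \sum_(s' \in star H 2 rho) (weight H s')%:R * pairing (lattice_normal s' rho) (k s') =
  \sum_(tau \in cones_of_dim F 1) if `[< p @` tau = rho >] then cofactor tau y *
    \sum_(s \in star F 2 tau) (weight F s)%:R * pairing (p (lattice_normal s tau)) (k (p @` s)) else 0.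
Proof.
move=> Hr y hk; have [Hr1 dr] := Hr; have [_ rF cF _] := fF; have [_ rH _ _] := fH.
have f1 := finite_cones_of_dim 1 fF; have f2 := finite_cones_of_dim 2 fF.
have h2 := finite_cones_of_dim 2 fH; have [_ hE _] := pH.
have [[Zy y0 _] ry] : (Prim `&` rho) y by rewrite (Prim_ray_finite fH ptH Hr).
transitivity (\sum_(s \in cones_of_dim F 2) if `[< cone_dim (p @` s) = 2%N /\ face rho (p @` s) >]
    then (weight F s)%:R * push_index p s * pairing (lattice_normal (p @` s) rho) (k (p @` s)) else 0).
  transitivity (\sum_(s' \in cones_of_dim H 2) \sum_(s \in cones_of_dim F 2)
     if `[< face rho s' /\ p @` s = s' >] then
      (weight F s)%:R * push_index p s * pairing (lattice_normal s' rho) (k s') else 0).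
    transitivity (\sum_(s' \in cones_of_dim H 2) if `[< face rho s' >] then
        (weight H s')%:R * pairing (lattice_normal s' rho) (k s') else 0).
      transitivity (\sum_(s' \in star H 2 rho) if `[< face rho s' >] then
        (weight H s')%:R * pairing (lattice_normal s' rho) (k s') else 0).
        by apply: eq_fsbigr => s'; rewrite inE => -[_ fr]; rewrite asboolT.
      apply: fsbig_widen => [s []//|s [Hs ns] /=].
      by case: asboolP => // fr; case: ns.
    apply: eq_fsbigr => s'; rewrite inE => Hs'; case: asboolP => fr; last first.
      by rewrite fsbig1 // => s _; case: asboolP => // -[].
    rewrite (push_weight fF pH Hs') !(fsbig_finite _ _ f2) mulr_suml; apply: eq_bigr => s _.
    rewrite (_ : `[< face rho s' /\ p @` s = s' >] = `[< p @` s = s' >]).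
      by case: ifP => _; rewrite ?mul0r.
    by apply/asboolP/asboolP => [[]|].
  rewrite exchange_fsbig //; apply: eq_fsbigr => s; rewrite inE => Fs.
  case: asboolP => [[dps fr]|N]; last first.
    rewrite fsbig1 // => s' [Hs' ds']; case: asboolP => // -[fr e]; case: N.
    by rewrite e.
  rewrite -(@fsbig_widen _ _ _ _ [set p @` s]).
  - by rewrite fsbig_set1 asboolT.
  - by move=> _ ->; split=> //; rewrite hE; exists s; split=> //; apply: face_refl.
  - by move=> s' [_ ns] /=; case: asboolP => // -[_ e]; case: ns.
transitivity (\sum_(s \in cones_of_dim F 2) \sum_(tau \in cones_of_dim F 1)
   if `[< p @` tau = rho /\ face tau s >] then
    cofactor tau y * ((weight F s)%:R * pairing (p (lattice_normal s tau)) (k (p @` s))) else 0); last first.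
  rewrite -exchange_fsbig //; apply: eq_fsbigr => tau; rewrite inE => Ft.
  case: asboolP => e; last by rewrite fsbig1 // => s _; case: asboolP => // -[].
  transitivity (\sum_(s \in star F 2 tau) cofactor tau y * ((weight F s)%:R * pairing (p (lattice_normal s tau)) (k (p @` s)))).
    transitivity (\sum_(s \in star F 2 tau) if `[< p @` tau = rho /\ face tau s >] then
      cofactor tau y * ((weight F s)%:R * pairing (p (lattice_normal s tau)) (k (p @` s))) else 0).
      apply/esym/fsbig_widen => [s []//|s [Fs ns] /=].
      by case: asboolP => // -[_ fs]; case: ns.
    by apply: eq_fsbigr => s; rewrite inE => -[_ fs]; rewrite asboolT.
  by rewrite !(fsbig_finite _ _ (finite_star 2 tau fF)) mulr_sumr.
apply: eq_fsbigr => s; rewrite inE => -[Fs ds].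
have f0 := pointed_face fF ptF Fs.
case: asboolP => [[dps fr]|N]; last first.
  rewrite fsbig1 // => tau Ft; have [_ dt] := Ft; case: asboolP => // -[e ft].
  have st : star F 2 tau s by [].
  have psy : (p @` s) y.
    by move: ry; rewrite -e => -[x tx <-]; exists x => //; apply: (face_sub ft).
  have nd : cone_dim (p @` s) <> 2%N.
    move=> d2; case: N; split=> //; rewrite -e.
    by case: (image_ray_face (rF _ Fs) ds f0 d2 ft dt).
  have /vlineP[c ->] := collapsed_normal st Ft nd psy y0.
  by rewrite pairingZl (hk _ Fs psy) !mulr0.
have [tau [ft dt tE uq]] := image_flag ds dps fr dr.
have Ft : cones_of_dim F 1 tau by split=> //; apply: cF ft.
rewrite -(@fsbig_widen _ _ _ _ [set tau]).
- rewrite fsbig_set1 asboolT //; have [Ft1 _] := Ft.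
  have [c [d [e [puE pvE ->]]]] := push_index_flag zp (rF _ Fs) (rF _ Ft1) (rH _ Hr1) ds dps ft dt
    (pointed_face fF ptF Ft1) tE fr dr (pointed_face fH ptH Hr1).
  have psy : (p @` s) y := face_sub fr ry.
  rewrite (cofactorE y0 puE) pvE pairingDl !pairingZl (hk _ Fs psy) mulr0 addr0; ring.
- by move=> _ ->.
- by move=> t [Ft' nt] /=; case: asboolP => // -[e ft']; case: nt; apply: uq.
Qed.

Lemma ray_image_span tau rho : cones_of_dim F 1 tau -> cones_of_dim H 1 rho -> p @` tau = rho ->
  forall x, x \in lin_span tau -> p x \in <[lattice_normal rho [set 0%R]]>%VS.
Proof.
move=> Ft Hr tE x xt; have [[_ y0 _] ry] : (Prim `&` rho) (lattice_normal rho [set 0]).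
  by rewrite (Prim_ray_finite fH ptH Hr).
have [_ dr] := Hr; rewrite -(span_ray dr ry y0) -tE lin_span_image; apply/memv_imgP.
by exists x; rewrite // lfunE.
Qed.

(** Tested on a functional l that vanishes on the ray: [push_sum] with the constant family l turns
    the pairing into values of l at images of the weighted normals of F, which lie on the line of
    the ray because F is balanced. *)
Lemma pushforward_balanced : balanced F 2 -> balanced H 2.
Proof.
move=> bF rho Hr1 [dr]; have Hr : cones_of_dim H 1 rho by [].
have [[_ y0 _] ry] : (Prim `&` rho) (lattice_normal rho [set 0]) by rewrite (Prim_ray_finite fH ptH Hr).
rewrite (span_ray dr ry y0); apply/negPn/negP => N.
have [l [yl]] := indep_functional (conj y0 N).
suff -> : pairing (weighted_normals H 2 rho) l = 0 by rewrite ltxx.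
rewrite /weighted_normals (fsbig_finite _ _ (finite_star 2 rho fH)) pairing_suml.
rewrite -[RHS](_ : \sum_(s' \in star H 2 rho) (weight H s')%:R * pairing (lattice_normal s' rho) l = 0).
  by rewrite (fsbig_finite _ _ (finite_star 2 rho fH)); apply: eq_bigr => s _; rewrite pairingZl.
rewrite (@push_sum rho (fun=> l)) // fsbig1 // => tau Ft; case: asboolP => // tE.
have [Ft1 dt] := Ft.
rewrite (_ : \sum_(s \in _) _ = pairing (p (weighted_normals F 2 tau)) l).
  have /(ray_image_span Ft Hr tE)/vlineP[c ->] : weighted_normals F 2 tau \in lin_span tau.
    by apply: bF => //; rewrite dt.
  by rewrite pairingZl yl !mulr0.
rewrite /weighted_normals !(fsbig_finite _ _ (finite_star 2 tau fF)) linear_sum pairing_suml.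
by apply: eq_bigr => s _; rewrite linearZ pairingZl.
Qed.

Lemma Wt_image (f : V -> R) (N : W -> R) tau : balanced F 2 -> (forall x, f x = N (p x)) ->
  (forall s, cones F s -> lin_on N (p @` s)) -> cones_of_dim F 1 tau ->
  Wt f F tau = \sum_(s \in star F 2 tau) (weight F s)%:R *
    pairing (p (lattice_normal s tau)) (lext N (p @` s) - lext N (p @` tau)).
Proof.
move=> bF fE lN Ft; have [Ft1 dt] := Ft.
have lf s : cones F s -> lin_on f s.
  by move=> /lN[l h]; exists (pull p l) => x sx; rewrite fE -pairing_pull h //; exists x.
have ext s x : cones F s -> x \in lin_span s -> pairing x (lext f s) = pairing (p x) (lext N (p @` s)).
  move=> Fs xs; rewrite pairing_pull; apply: lextE_span => //; first exact: lf.
  move=> z sz; rewrite fE -pairing_pull; apply: lextE; [exact: lN|by exists z].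
have wt : weighted_normals F 2 tau \in lin_span tau by apply: bF => //; rewrite dt.
rewrite /Wt (ext _ _ Ft1 wt) /weighted_normals.
rewrite !(fsbig_finite _ _ (finite_star 2 tau fF)) linear_sum pairing_suml -sumrB.
apply: eq_big_seq => s; rewrite in_fset_set; last exact: finite_star.
rewrite inE => st; have [vs _] := normal_span fF Ft st; have [[Fs _] _] := st.
by rewrite linearZ !pairingZl pairingBr mulrBr (ext _ _ Fs vs).
Qed.

(** The projection formula. Here [wt'] says that the divisor of N on the pushforward is the
    pushforward of the divisor of the pulled back function; homogeneity of M then matches the values
    at primitive vectors. *)
Lemma push_DegF (M N : W -> R) : balanced F 2 -> (forall s, cones F s -> lin_on N (p @` s)) ->
  (forall c x, 0 <= c -> M (c *: x) = c * M x) ->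
  DegF H M N = DegF F (fun x => M (p x)) (fun x => N (p x)).
Proof.
move=> bF lN hM; have [_ rF cF _] := fF; have [_ rH _ _] := fH; have [_ hE _] := pH.
have f1 := finite_cones_of_dim 1 fF; have h1 := finite_cones_of_dim 1 fH.
have wt tau := @Wt_image (fun x => N (p x)) N tau bF (fun=> erefl) lN.
have wt' rho : cones_of_dim H 1 rho -> Wt N H rho =
  \sum_(tau \in cones_of_dim F 1) if `[< p @` tau = rho >] then
    cofactor tau (lattice_normal rho [set 0]) * Wt (fun x => N (p x)) F tau else 0.
  move=> Hr; have [Hr1 dr] := Hr; set y := lattice_normal rho [set 0].
  have [_ ry] : (Prim `&` rho) y by rewrite (Prim_ray_finite fH ptH Hr).
  have lr : lin_on N rho.
    have := Hr1; rewrite hE => -[s [[Fs _] _ fs]]; have [l h] := lN _ Fs.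
    by exists l => x rx; apply: h; apply: (face_sub fs).
  transitivity (\sum_(s' \in star H 2 rho) (weight H s')%:R *
      pairing (lattice_normal s' rho) (lext N s' - lext N rho)).
    rewrite /Wt /weighted_normals !(fsbig_finite _ _ (finite_star 2 rho fH)) pairing_suml -sumrB.
    by apply: eq_bigr => s _; rewrite !pairingZl pairingBr mulrBr.
  rewrite (@push_sum rho (fun s' => lext N s' - lext N rho)) //.
    apply: eq_fsbigr => tau; rewrite inE => Ft; case: asboolP => // e.
    by rewrite (wt _ Ft) e.
  move=> s Fs sy; rewrite pairingBr -(lextE lr ry) -(lextE (lN _ Fs) sy); exact: subrr.
rewrite /DegF.
transitivity (\sum_(rho \in cones_of_dim H 1) \sum_(tau \in cones_of_dim F 1)
  if `[< p @` tau = rho >] then cofactor tau (lattice_normal rho [set 0]) * Wt (fun x => N (p x)) F tau *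
    M (lattice_normal rho [set 0]) else 0).
  apply: eq_fsbigr => rho; rewrite inE => Hr; rewrite wt' // !(fsbig_finite _ _ f1) mulr_suml.
  by apply: eq_bigr => tau _; case: ifP => _; rewrite ?mul0r.
rewrite exchange_fsbig //; apply: eq_fsbigr => tau; rewrite inE => Ft.
have [Ft1 dt] := Ft; have [[_ u0 _] tu] : (Prim `&` tau) (lattice_normal tau [set 0]).
  by rewrite (Prim_ray_finite fF ptF Ft).
set u := lattice_normal tau [set 0] in u0 tu *.
have [Hr|nr] := pselect (cones_of_dim H 1 (p @` tau)).
  have [c0 puE] := cofactor_ray Ft Hr erefl.
  rewrite -(@fsbig_widen _ _ _ _ [set p @` tau]).
  - by rewrite fsbig_set1 asboolT // -/u puE hM // mulrAC mulrC mulrA.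
  - by move=> _ ->.
  - by move=> r [_ nr] /=; case: asboolP => // e; case: nr.
rewrite fsbig1; last by move=> r Hr; case: asboolP => // e; case: nr; rewrite e.
(* The image of tau is not a ray of H. Either p kills u and M vanishes there, or p collapses every
   2-cone at tau; then the linear extensions of N agree along the line of [p u] and the weight is
   0. *)
have [pu0|pu0] := eqVneq (p u) 0.
  by rewrite pu0 -[X in M X](scale0r 0) hM // mul0r mulr0.
rewrite wt // fsbig1 ?mul0r // => s st; have [[Fs ds] fs] := st.
have ptu : (p @` tau) (p u) by exists u.
have psu : (p @` s) (p u) by exists u => //; apply: (face_sub fs).
have nd : cone_dim (p @` s) <> 2%N.
  move=> d2; case: nr; have [fr dr] := image_ray_face (rF _ Fs) ds (pointed_face fF ptF Fs) d2 fs dt.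
  by split=> //; rewrite hE; exists s.
have /vlineP[c ->] := collapsed_normal st Ft nd psu pu0.
rewrite pairingZl pairingBr -(lextE (lN _ Fs) psu) -(lextE (lN _ Ft1) ptu) subrr; ring.
Qed.

End Projection.

(** * Finiteness *)

Section Spreading.
Context {R : realType} {n : nat}.
Local Notation V := 'rV[R]_n.
Local Notation rl := (@realify R n).
Implicit Types (x v z : V) (sigma tau : set V) (G : wfan R n).

Lemma delta_half G x v v' a b : is_fan (cones G) -> 0 < b -> v' = a *: x + b *: v ->
  delta G x v' = delta G x v.
Proof.
move=> [_ rG _ _] b0 E; apply: eq_fsbigr => s; rewrite inE => -[Gs _].
have cs := rational_convex_cone (rG _ Gs).
suff -> : `[< germ s x v' >] = `[< germ s x v >] by [].
apply/asboolP/asboolP; last exact: germ_half E.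
apply: (@germ_half _ _ _ _ _ _ (- a / b) b^-1) => //; first by rewrite invr_gt0.
by rewrite E; apply/rowP => i; rewrite !mxE; field; rewrite gt_eqF.
Qed.

Lemma germ_scale sigma x v k : convex_cone sigma -> 0 < k -> germ sigma x v -> germ sigma (k *: x) v.
Proof.
move=> [_ _ sZ] k0 [sx [e e0 se]]; split; first by apply: sZ => //; apply: ltW.
by exists (k * e); rewrite ?mulr_gt0 // -scalerA -scalerDr; apply: sZ => //; apply: ltW.
Qed.

Lemma delta_scale G x v k : is_fan (cones G) -> 0 < k -> delta G (k *: x) v = delta G x v.
Proof.
move=> [_ rG _ _] k0; apply: eq_fsbigr => s; rewrite inE => -[Gs _].
have cs := rational_convex_cone (rG _ Gs).
suff -> : `[< germ s (k *: x) v >] = `[< germ s x v >] by [].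
apply/asboolP/asboolP; last exact: germ_scale.
have ki : 0 < k^-1 by rewrite invr_gt0.
by move/(germ_scale cs ki); rewrite scalerA mulVf ?scale1r // gt_eqF.
Qed.

Lemma delta_neq0 G x v : delta G x v != 0 ->
  exists s, [/\ cones_of_dim G 2 s, (0 < weight G s)%N & germ s x v].
Proof.
apply: contra_neqP => N; rewrite /delta /wsum fsbig1 // => s Gs; case: asboolP => // g.
rewrite mulr1; case: (posnP (weight G s)) => [->//|w0]; by case: N; exists s.
Qed.

(** A plane is a cone without proper faces, so [Nset_interior] applies to it and yields the two
    opposite normals at a lattice vector. *)
Lemma plane_cone (s t : 'rV[int]_n) : indep (rz s) (rz t : V) ->
  let P := [set y | y \in plane (rz s : V) (rz t)] in
  [/\ rational_cone P, cone_dim P = 2%N, lin_span P = plane (rz s) (rz t) &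
      forall tau, face tau P -> tau = P].
Proof.
move=> iv P; have Ps : P (rz s) by apply/planeP; exists 1, 0; rewrite scale1r scale0r addr0.
have Pt : P (rz t) by apply/planeP; exists 0, 1; rewrite scale1r scale0r add0r.
have sp : lin_span P = plane (rz s) (rz t).
  apply/eqP; rewrite eqEsubv; apply/andP; split; first by apply: lin_span_min.
  by rewrite subv_add -!memvE !mem_lin_span.
split=> //.
- apply/rational_coneE; exists [:: s; t; - s; - t].
  apply/seteqP; split=> y.
    move=> /planeP[a [b ->]].
    have key c (z : 'rV[int]_n) : z \in [:: s; t; - s; - t] -> - z \in [:: s; t; - s; - t] ->
        Cone (map (@rz R n) [:: s; t; - s; - t]) (c *: rz z).
      move=> h1 h2; have [c0|c0] := leP 0 c; first by apply: ConeZ => //; apply: Cone_mem; apply: map_f.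
      rewrite -[c]opprK scaleNr -scalerN; apply: ConeZ; first by rewrite oppr_ge0 ltW.
      by apply: Cone_mem; rewrite -rzN; apply: map_f.
    by apply: ConeD; apply: key; rewrite !inE ?eqxx ?orbT.
  apply: Cone_ind => [|u w|c u _|u]; rewrite /P /=; [exact: mem0v|exact: memvD|exact: memvZ|].
  by rewrite !inE => /or4P[] /eqP->; rewrite ?rzN ?memvN.
- by rewrite /cone_dim sp dim_plane.
move=> tau [l l0 ->]; apply/seteqP; split=> y; first by case.
move=> Py; split=> //; apply/le_anti; rewrite (l0 _ Py) andbT -oppr_ge0 -pairingNl.
by apply: l0; rewrite /P /= memvN.
Qed.

(* The two half-planes at s have opposite normals, so balancing forces equal weights. *)
Lemma local_balance G (s t : 'rV[int]_n) : tropical_fan 2 G -> indep (rz s) (rz t : V) ->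
  (forall k, cones_of_dim G 2 k -> (0 < weight G k)%N -> k (rz s) ->
     lin_span k = plane (rz s) (rz t)) ->
  delta G (rz s) (rz t) = delta G (rz s) (- rz t).
Proof.
move=> [fG _ bG] iv hyp; have [rP dP sP fP] := plane_cone iv; have [s0 _] := iv.
set P := [set y | _] in rP dP sP fP.
have Ps : P (rz s) by apply/planeP; exists 1, 0; rewrite scale1r scale0r addr0.
have [|v [v' [c [NE vv' v'E ivv [pl _]]]]] := Nset_interior rP dP Ps s0 (Zn_rz s).
  by move=> tau /fP->; rewrite dP.
have [k] := delta_balanced fG bG (Zn_rz s) s0.
rewrite -(@fsbig_widen _ _ _ _ [set v; v']); last 2 first.
- by move=> u; rewrite -NE => -[].
- move=> u [Nu nu] /=; have [->|] := eqVneq (delta G (rz s) u) 0; first by rewrite scale0r.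
  move/delta_neq0 => [r [Gr w0 g]]; case: nu; rewrite -NE; split=> //; split=> //.
  have ru := germ_span g; have rs : r (rz s) by case: g.
  rewrite (hyp _ Gr w0 rs) in ru; exists 1; rewrite // scale1r; apply: memvD => //; exact: Ps.
rewrite fsbigU0 //; last by move=> u [-> /vv'].
rewrite !fsbig_set1 => E.
have dd : delta G (rz s) v = delta G (rz s) v'.
  have [|_] := @indep_coeff _ _ (rz s) v (delta G (rz s) v' * c) (delta G (rz s) v - delta G (rz s) v') k 0 ivv.
    rewrite scale0r addr0 -E v'E; apply/rowP => i; rewrite !mxE; ring.
  by move/eqP; rewrite subr_eq0 => /eqP.
have : rz t \in plane (rz s : V) v by rewrite -pl sP; apply/planeP; exists 0, 1; rewrite scale1r scale0r add0r.
case/planeP => a [b tE].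
have bn : b != 0.
  by apply/eqP => b0; case: iv => _ /negP[]; rewrite tE b0 scale0r addr0 memvZ ?memv_line.
have [b0|b0|b0] := ltrgtP b 0; last by rewrite b0 eqxx in bn.
  rewrite (@delta_half G _ v' (rz t) (a + b * c) (- b)) ?oppr_gt0 //; last first.
    by rewrite tE v'E; apply/rowP => i; rewrite !mxE; ring.
  rewrite (@delta_half G _ v (- rz t) (- a) (- b)) ?oppr_gt0 //.
  by rewrite tE; apply/rowP => i; rewrite !mxE; ring.
rewrite (delta_half fG b0 tE) (@delta_half G _ v' (- rz t) (- a - b * c) b) //.
by rewrite tE v'E; apply/rowP => i; rewrite !mxE; ring.
Qed.

Lemma boundary_point sigma x v : rational_cone sigma -> cone_dim sigma = 2%N -> sigma x ->
  indep x v -> v \in lin_span sigma -> ~ germ sigma x v ->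
  germ sigma x (- v) /\ exists tau, [/\ face tau sigma, cone_dim tau = 1%N & tau x].
Proof.
move=> rs ds sx iv vs ng; have [x0 _] := iv; have [L HL] := rational_cone_hrep rs.
have cs := rational_convex_cone rs.
have [l lL [xl vl]] : exists2 l, l \in L & pairing x (rl l) = 0 /\ pairing v (rl l) < 0.
  apply: contrapT => N; apply: ng; split=> //.
  have [p|e e0 he] := @small_step R [seq (pairing x (rl l), - pairing v (rl l)) | l <- L].
    move=> /mapP[l lL ->] /=; have h := (HL x).1 sx l lL.
    have [e|ne] := eqVneq (pairing x (rl l)) 0; last by left; rewrite lt_def ne h.
    right; rewrite e oppr_le0; split=> //; rewrite leNgt; apply/negP => vl; by apply: N; exists l.
  exists e => //; apply/HL => l lL; have := he _ (map_f _ lL) => /= h.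
  by rewrite !pairingE -lerBlDr sub0r -mulrN.
have pl : lin_span sigma = plane x v by apply: span_plane => //; apply: mem_lin_span.
split.
  have [z [sz xz]] := rational_dim2 rs ds x0.
  have : rz z \in plane x v by rewrite -pl mem_lin_span.
  case/planeP => a [b zE]; have := (HL _).1 sz l lL.
  rewrite zE !pairingE xl mulr0 add0r nmulr_lge0 // le_eqVlt => /orP[/eqP b0|b0].
    by case: xz => _ /negP[]; rewrite zE b0 scale0r addr0 memvZ ?memv_line.
  apply: (@germ_half _ _ _ x (rz z) (- v) (a / b) (- b^-1)) => //.
  - by rewrite oppr_gt0 invr_lt0.
  - by rewrite zE; apply/rowP => i; rewrite !mxE; field; rewrite lt_eqF.
  - exact: germ_add.
pose tau := [set y | sigma y /\ pairing y (rl l) = 0].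
have ft : face tau sigma by exists (rl l) => // y /HL h; apply: h.
exists tau; split=> //; apply/eqP; rewrite eqn_leq (@dim_ge1 _ _ tau x) // andbT.
have : (lin_span tau <= <[x]>)%VS.
  apply: lin_span_min => y [sy yl]; have : y \in plane x v by rewrite -pl mem_lin_span.
  case/planeP=> a [b E]; move: yl; rewrite E !pairingE xl mulr0 add0r => /eqP.
  by rewrite mulf_eq0 (lt_eqF vl) orbF => /eqP->; rewrite scale0r addr0 memvZ ?memv_line.
by move/dimvS; rewrite dim_vline x0.
Qed.

(** If sigma does not continue from x in direction v, then x lies on a boundary ray of sigma and
    sigma has the germ (x, - v). The weight is carried across by [local_balance], which applies
    because x is a positive multiple of a lattice vector on the line of that ray. *)
Lemma delta_constant G x v sigma : tropical_fan 2 G -> cones_of_dim G 2 sigma -> (0 < weight G sigma)%N ->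
  sigma x -> indep x v ->
  (forall k, cones_of_dim G 2 k -> (0 < weight G k)%N -> k x -> lin_span k = plane x v) ->
  delta G x v = (weight G sigma)%:R.
Proof.
move=> tG Gs w0 sx iv hyp; have [fG _ _] := tG; have [_ rG _ _] := fG; have [Gs1 ds] := Gs.
have rs := rG _ Gs1; have sp := hyp _ Gs w0 sx; have [x0 _] := iv.
have [g|ng] := pselect (germ sigma x v); first exact: delta_val.
have vs : v \in lin_span sigma by rewrite sp; apply/planeP; exists 0, 1; rewrite scale1r scale0r add0r.
have [gN [tau [ft dt tx]]] := boundary_point rs ds sx iv vs ng.
have iN : indep x (- v).
  by apply: (@indep_half _ _ x v _ 0 (-1)) => //; rewrite ?oppr_eq0 ?oner_eq0 // scale0r add0r scaleN1r.
rewrite -(delta_val fG iN Gs gN).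
have rt : rational_cone tau by have [_ _ cG _] := fG; apply: rG; apply: cG ft.
have [z0 [tz z00]] := rational_dim1 rt dt.
have : x \in <[rz z0]>%VS by rewrite -(span_ray dt tz z00) mem_lin_span.
case/vlineP => k xk; have kn : k != 0 by apply: contra x0 => /eqP k0; rewrite xk k0 scale0r.
have [z [c c0 xE]] : exists z : 'rV[int]_n, exists2 c : R, 0 < c & x = c *: rz z.
  have [k0|k0|k0] := ltrgtP k 0; last by rewrite k0 eqxx in kn.
    by exists (- z0); exists (- k); rewrite ?oppr_gt0 // rzN scalerN scaleNr opprK.
  by exists z0; exists k.
have [t [st xt]] := rational_dim2 rs ds x0.
have : rz t \in plane x v by rewrite -sp mem_lin_span.
case/planeP => a [b tE]; have bn : b != 0.
  by apply/eqP => b0; case: xt => _ /negP[]; rewrite tE b0 scale0r addr0 memvZ ?memv_line.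
have pt : plane x (rz t) = plane x v by apply: plane_half tE.
have cn : c != 0 by rewrite gt_eqF.
have pz w : plane (rz z) w = plane x w.
  apply/vspaceP => y; apply/planeP/planeP => -[al [be ->]].
    by exists (al / c), be; rewrite xE scalerA divfK.
  by exists (al * c), be; rewrite xE scalerA.
have izt : indep (rz z) (rz t : V).
  apply/indepP => al be E; have [|e1 ->] := (indepP _ _).1 xt (al / c) be.
    by rewrite xE scalerA divfK.
  by split=> //; move/eqP: e1; rewrite mulf_eq0 invr_eq0 (negbTE cn) orbF => /eqP.
have E : delta G (rz z) (rz t) = delta G (rz z) (- rz t).
  apply: (local_balance tG izt) => r Gr wr rz0; rewrite pz pt; apply: hyp => //; rewrite xE.
  by have [_ _ kZ] := rational_convex_cone (rG _ Gr.1); apply: kZ => //; apply: ltW.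
move: E; rewrite -(delta_scale _ _ fG c0) -(delta_scale _ (- rz t) fG c0) -xE => E.
have [b0|b0|b0] := ltrgtP b 0; last by rewrite b0 eqxx in bn.
  rewrite (@delta_half G x (- rz t) v (- a / b) (- b^-1)) ?oppr_gt0 ?invr_lt0 //; last first.
    by rewrite tE; apply/rowP => i; rewrite !mxE; field.
  rewrite -E; apply/esym; apply: (@delta_half G x (rz t) (- v) (a / b) (- b^-1)) => //.
    by rewrite oppr_gt0 invr_lt0.
  by rewrite tE; apply/rowP => i; rewrite !mxE; field.
rewrite (@delta_half G x (rz t) v (- a / b) (b^-1)) ?invr_gt0 //; last first.
  by rewrite tE; apply/rowP => i; rewrite !mxE; field.
rewrite E; apply/esym; apply: (@delta_half G x (- rz t) (- v) (a / b) (b^-1)) => //.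
  by rewrite invr_gt0.
by rewrite tE; apply/rowP => i; rewrite !mxE; field.
Qed.

(** The last parameter is a supremum, attained because sigma is closed. *)
Lemma segment_exit sigma a v : rational_cone sigma -> (exists2 t, 0 <= t <= 1 & sigma (a + t *: v)) ->
  exists2 t, 0 <= t <= 1 & sigma (a + t *: v) /\
    forall t', 0 <= t' <= 1 -> sigma (a + t' *: v) -> t' <= t.
Proof.
move=> rs [t0 t01 st0]; pose T := [set t | 0 <= t <= 1 /\ sigma (a + t *: v)].
have hT : has_sup T.
  by split; [exists t0|exists 1 => t [/andP[]]].
have ub t : T t -> t <= sup T by move=> Tt; apply: ub_le_sup => //; case: hT.
have [L HL] := rational_cone_hrep rs.
have t0s : t0 <= sup T by apply: ub.
have s01 : 0 <= sup T <= 1.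
  have /andP[h _] := t01; rewrite (le_trans h t0s) /=.
  by apply: ge_sup; [exists t0|move=> t [/andP[_ ?] _]].
exists (sup T) => //; split; last by move=> t t1 st; apply: ub.
apply/HL => l lL; rewrite leNgt; apply/negP => neg.
pose e := - pairing (a + sup T *: v) (rl l) / (`|pairing v (rl l)| + 1).
have dn : 0 < `|pairing v (rl l)| + 1 by rewrite ltr_wpDl.
have e0 : 0 < e by rewrite divr_gt0 // oppr_gt0.
have [t Tt lt] := sup_adherent e0 hT.
have le := ub _ Tt; have [_ st] := Tt; have := (HL _).1 st l lL.
rewrite !pairingE in neg *.
have h : (sup T - t) * - pairing v (rl l) <= e * (`|pairing v (rl l)|).
  apply: (@le_trans _ _ ((sup T - t) * `|pairing v (rl l)|)).
    by rewrite ler_wpM2l ?subr_ge0 // -normrN ler_norm.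
  by rewrite ler_wpM2r //; lra.
have h2 : e * (`|pairing v (rl l)| + 1) = - (pairing a (rl l) + sup T * pairing v (rl l)).
  by rewrite /e !pairingE mulfVK // gt_eqF.
move: h h2 e0 neg; move: (pairing a _) (pairing v _) => p q h h2 e0 neg h3.
have : e * (`|q| + 1) = e * `|q| + e by ring.
have : (sup T - t) * - q = t * q - sup T * q by ring.
lra.
Qed.

(* Follow the segment from a to a + v: at the last point covered by a cone of weight w,
   [delta_constant] gives another cone of weight w covering the points that follow. *)
Lemma segment_transfer G a v sigma : tropical_fan 2 G -> cones_of_dim G 2 sigma -> (0 < weight G sigma)%N ->
  sigma a -> indep a v ->
  (forall t k, 0 <= t <= 1 -> cones_of_dim G 2 k -> (0 < weight G k)%N -> k (a + t *: v) ->
     lin_span k = plane a v) ->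
  exists2 k, cones_of_dim G 2 k & k (a + v) /\ weight G k = weight G sigma.
Proof.
move=> tG Gs w0 sa iv hyp; have [fG _ _] := tG; have [_ rG _ _] := fG.
have [S SE] := (finite_seqP _).1 (finite_cones_of_dim 2 fG).
pose good k := cones_of_dim G 2 k /\ weight G k = weight G sigma.
have maxS (S' : seq (set V)) : (exists k t, [/\ k \in S', good k, 0 <= t <= 1 & k (a + t *: v)]) ->
  exists k t, [/\ good k, 0 <= t <= 1, k (a + t *: v) &
   forall k' t', k' \in S' -> good k' -> 0 <= t' <= 1 -> k' (a + t' *: v) -> t' <= t].
  elim: S' => [|r S' IH] [k [t [kS gk t01 kt]]]; first by [].
  have [[gr [t1 t11 rt1]]|nr] := pselect (good r /\ exists2 t, 0 <= t <= 1 & r (a + t *: v)).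
    have [b b01 [rb bmax]] := segment_exit (rG _ gr.1.1) (ex_intro2 _ _ t1 t11 rt1).
    have [|nS] := pselect (exists k t, [/\ k \in S', good k, 0 <= t <= 1 & k (a + t *: v)]).
      move=> /IH[k2 [t2 [g2 t21 kt2 m2]]]; have [le|lt] := leP t2 b.
        exists r, b; split=> // k' t'; rewrite inE => /orP[/eqP->|k'S] gk' t'1 kt'; first exact: bmax.
        by apply: le_trans le; apply: m2 kt'.
      exists k2, t2; split=> // k' t'; rewrite inE => /orP[/eqP->|k'S] gk' t'1 kt'; last exact: m2 kt'.
      by apply: le_trans (ltW lt); apply: bmax.
    exists r, b; split=> // k' t'; rewrite inE => /orP[/eqP->|k'S] gk' t'1 kt'; first exact: bmax.
    by case: nS; exists k', t'.
  have nk : k \in S'.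
    move: kS; rewrite inE => /orP[/eqP e|//]; case: nr; rewrite -e; split=> //; by exists t.
  have [|k2 [t2 [g2 t21 kt2 m2]]] := IH; first by exists k, t.
  exists k2, t2; split=> // k' t'; rewrite inE => /orP[/eqP e|k'S] gk' t'1 kt'; last exact: m2 kt'.
  by case: nr; rewrite -e; split=> //; exists t'.
have inS k : cones_of_dim G 2 k -> k \in S by rewrite SE.
have [|k [t [[Gk wk] t01 kt mx]]] := maxS S.
  by exists sigma, 0; split=> //; [apply: inS|rewrite lexx ler01|rewrite scale0r addr0].
have [t1|t1] := leP 1 t.
  have tE : t = 1 by apply/le_anti; case/andP: t01 => _ ->; rewrite t1.
  by exists k => //; split=> //; move: kt; rewrite tE scale1r.
have pl : plane (a + t *: v) v = plane a v.
  apply/vspaceP => y; apply/planeP/planeP => -[al [be ->]].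
    by exists al, (al * t + be); apply/rowP => i; rewrite !mxE; ring.
  by exists al, (be - al * t); apply/rowP => i; rewrite !mxE; ring.
have iv' : indep (a + t *: v) v.
  apply/indepP => al be E; have [|e1 e2] := (indepP _ _).1 iv al (al * t + be).
    by rewrite -E; apply/rowP => i; rewrite !mxE; ring.
  by move: e2; rewrite e1 mul0r add0r.
have wk0 : (0 < weight G k)%N by rewrite wk.
have dE : delta G (a + t *: v) v = (weight G k)%:R.
  by apply: (delta_constant tG Gk wk0 kt iv') => r Gr wr rt; rewrite pl; apply: hyp t01 Gr wr rt.
have [|r [Gr wr gr]] := @delta_neq0 G (a + t *: v) v.
  by rewrite dE pnatr_eq0 -lt0n.
have wrE : weight G r = weight G sigma.
  by have := delta_val fG iv' Gr gr; rewrite dE wk => /eqP; rewrite eqr_nat => /eqP.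
have cr := rational_convex_cone (rG _ Gr.1).
have [e0 e00 he] := germ_step cr gr.
pose e := Num.min e0 (1 - t); have ep : 0 < e by rewrite lt_min e00 subr_gt0.
have : t + e <= t.
  apply: (mx r (t + e) (inS _ Gr) (conj Gr wrE)).
- have e1 : e <= 1 - t by rewrite ge_min lexx orbT.
  case/andP: t01 => h1 _; apply/andP; split; lra.
- rewrite scalerDl addrA; apply: he; rewrite ltW //= ge_min lexx //.
lra.
Qed.

End Spreading.

Lemma finite_factor (T Z : Type) (K : finType) (A : set T) (f : T -> K) (g : T -> set Z) :
  (forall x y, A x -> A y -> f x = f y -> g x = g y) -> finite_set (g @` A).
Proof.
move=> h; pose k c := [set z | exists x, [/\ A x, f x = c & g x z]].
apply: (@sub_finite_set _ _ (k @` [set: K])); last by apply: finite_image; apply: finite_finset.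
move=> _ [x Ax <-]; exists (f x) => //; apply/seteqP; split=> z; last by move=> gz; exists x.
by move=> [y [Ay e gz]]; rewrite -(h y x).
Qed.

Section Finiteness.
Context {R : realType} {m : nat} (B : nat).
Local Notation V := 'rV[R]_m.
Local Notation rl := (@realify R m).
Implicit Types (x v y z : V) (sigma c : set V) (G : wfan R m).

Definition minor (s t : 'rV[int]_m) i k : int := s 0 i * t 0 k - t 0 i * s 0 k.

(* The Pluecker coordinates [minor s t] of a rational basis of the span of each cone of
   positive weight are bounded by B, also after multiplication by the weight. *)
Definition bounded_fan G := tropical_fan 2 G /\
  forall sigma, cones_of_dim G 2 sigma -> (0 < weight G sigma)%N ->
  exists s t : 'rV[int]_m, [/\ indep (rz s) (rz t : V), rz s \in lin_span sigma, rz t \in lin_span sigma &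
    forall i k, (weight G sigma * absz (minor s t i k) <= B)%N].

Lemma bounded_columns K : exists L : seq 'cV[int]_m,
  forall l, l \in L <-> forall i, (absz (l i 0%R) <= K)%N.
Proof.
exists [seq \col_i ((f i : nat)%:Z - K%:Z) | f : {ffun 'I_m -> 'I_(2 * K).+1}] => l; split.
  move=> /mapP[f _ ->] i; rewrite mxE; have := ltn_ord (f i); move: (nat_of_ord (f i)) => a; clear; lia.
move=> h; apply/mapP; exists [ffun i => inord (absz (l i 0 + K%:Z))]; first by rewrite mem_enum.
apply/colP => i; rewrite mxE ffunE inordK; have := h i; lia.
Qed.

Lemma minor_neq0 (u v : V) : indep u v -> exists j k, u 0 j * v 0 k - v 0 j * u 0 k != 0.
Proof.
move=> [u0 vu]; apply: contrapT => N.
have [j uj] : exists j, u 0 j != 0.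
  apply: contrapT => N'; case/eqP: u0; apply/rowP => i; rewrite mxE.
  by apply/eqP/negPn/negP => h'; apply: N'; exists i.
case/negP: vu; apply/vlineP; exists (v 0 j / u 0 j); apply/rowP => k; rewrite mxE.
have /eqP : u 0 j * v 0 k - v 0 j * u 0 k = 0.
  by apply/eqP/negPn/negP => h'; apply: N; exists j, k.
rewrite subr_eq0 => /eqP e; apply: (mulfI uj); rewrite e; field; exact: uj.
Qed.

(** The equations are the coordinates of y /\ u /\ v = 0; a nonzero minor of u and v allows Cramer's
    rule to solve for y. *)
Lemma plane_equations (u v : V) y : indep u v ->
  (forall i j k, y 0 i * (u 0 j * v 0 k - v 0 j * u 0 k) + y 0 j * (u 0 k * v 0 i - v 0 k * u 0 i) +
    y 0 k * (u 0 i * v 0 j - v 0 i * u 0 j) = 0) -> y \in plane u v.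
Proof.
move=> iv h.
have [j [k jk]] := minor_neq0 iv.
apply/planeP; exists ((y 0 j * v 0 k - y 0 k * v 0 j) / (u 0 j * v 0 k - v 0 j * u 0 k)).
exists ((y 0 k * u 0 j - y 0 j * u 0 k) / (u 0 j * v 0 k - v 0 j * u 0 k)).
apply/rowP => i; rewrite !mxE; apply: (mulIf jk).
have -> : y 0 i * (u 0 j * v 0 k - v 0 j * u 0 k) =
    (y 0 j * v 0 k - y 0 k * v 0 j) * u 0 i + (y 0 k * u 0 j - y 0 j * u 0 k) * v 0 i.
  by apply/eqP; rewrite -subr_eq0; apply/eqP; rewrite -[RHS](h i j k); ring.
by field.
Qed.

Lemma weight_bound G sigma : bounded_fan G -> cones_of_dim G 2 sigma -> (weight G sigma <= B)%N.
Proof.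
move=> [_ h] Gs; case: (posnP (weight G sigma)) => [->//|w0].
have [s [t [iv _ _ hb]]] := h _ Gs w0; have [j [k jk]] := minor_neq0 iv.
apply: leq_trans (hb j k); apply: leq_pmulr; rewrite absz_gt0.
by move: jk; rewrite /minor !mxE -!intrM -intrB intr_eq0.
Qed.

(** The equations in [span_cut] have three terms with coefficients at most B in absolute value,
    which gives 3 B. The extra 1 admits the coordinate functionals even when B = 0. *)
Context (L : seq 'cV[int]_m) (HL : forall l, l \in L <-> forall i, (absz (l i 0%R) <= 3 * B + 1)%N).
Let cells := cut L [set (setT : set V)].

Lemma L_opp l : l \in L -> - l \in L.
Proof. by move=> /HL h; apply/HL => i; rewrite mxE abszN. Qed.

Lemma L_delta i : delta_mx i 0 \in L.
Proof. apply/HL => j; rewrite mxE; case: (_ && _) => /=; lia. Qed.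

(** The plane of sigma is cut out by three-term equations whose coefficients are its Pluecker
    coordinates, and these equations belong to L. *)
Lemma span_cut G sigma y : bounded_fan G -> cones_of_dim G 2 sigma -> (0 < weight G sigma)%N ->
  (forall l, l \in L -> (forall z, z \in lin_span sigma -> pairing z (rl l) = 0) -> pairing y (rl l) = 0) ->
  y \in lin_span sigma.
Proof.
move=> [_ h] Gs w0 hy; have [s [t [iv ss tt hb]]] := h _ Gs w0; have [_ ds] := Gs.
have sp := span_plane ds ss tt iv; rewrite sp; apply: plane_equations => // i j k.
pose N := minor s t.
pose l : 'cV[int]_m := N j k *: delta_mx i 0 + N k i *: delta_mx j 0 + N i j *: delta_mx k 0.
have Nb a b : (absz (N a b) <= B)%N.
  by apply: leq_trans (hb a b); apply: leq_pmull.
have lE z : pairing z (rl l) = z 0 i * (N j k)%:~R + z 0 j * (N k i)%:~R + z 0 k * (N i j)%:~R.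
  by rewrite /l !rlD !rlZ !pairingDr !pairingZr !pairing_delta_int ![_%:~R * _]mulrC.
have NE a b : (N a b)%:~R = (rz s : V) 0 a * (rz t : V) 0 b - (rz t : V) 0 a * (rz s : V) 0 b.
  by rewrite !mxE -!intrM -intrB.
rewrite -!NE -lE; apply: hy.
  apply/HL => q; rewrite !mxE; have := Nb j k; have := Nb k i; have := Nb i j.
  move: (N j k) (N k i) (N i j) => a b d.
  by case: (_ && _); case: (_ && _); case: (_ && _); rewrite ?mulr1 ?mulr0; lia.
move=> z; rewrite sp => /planeP[a [b ->]]; rewrite lE !NE !mxE; ring.
Qed.

Definition relint c y := c y /\
  forall l, l \in L -> pairing y (rl l) = 0 -> forall z, c z -> pairing z (rl l) = 0.

Lemma cell_convex c : cells c -> convex_cone c.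
Proof.
by move=> Lc; have [_ rC _ _] := is_fan_cut L (@is_fan_setT R m); apply: rational_convex_cone; apply: (rC).
Qed.

Lemma positive_sum0 (a b p q : R) : 0 < a -> 0 < b ->
  (0 <= p /\ 0 <= q) \/ (p <= 0 /\ q <= 0) -> a * p + b * q = 0 -> p = 0 /\ q = 0.
Proof.
move=> a0 b0 H E; suff [/eqP e1 /eqP e2] : a * p = 0 /\ b * q = 0.
  by move: e1 e2; rewrite !mulf_eq0 (gt_eqF a0) (gt_eqF b0) => /eqP-> /eqP->.
case: H => -[p0 q0].
  have := mulr_ge0 (ltW a0) p0; have := mulr_ge0 (ltW b0) q0; move: (a * p) (b * q) E => r s; lra.
have := mulr_ge0_le0 (ltW a0) p0; have := mulr_ge0_le0 (ltW b0) q0; move: (a * p) (b * q) E => r s; lra.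
Qed.

Lemma relint_germ c x v e0 e : cells c -> cone_dim c = 2%N -> indep x v -> c x -> c (x + e0 *: v) ->
  0 < e < e0 -> relint c (x + e *: v).
Proof.
move=> Lc dc iv cx cv /andP[e_gt e_lt]; have e00 := lt_trans e_gt e_lt.
have g : germ c x v by split=> //; exists e0.
have sp : lin_span c = plane x v.
  by apply: span_plane => //; [apply: mem_lin_span|apply: germ_span g].
have E : x + e *: v = (1 - e / e0) *: x + (e / e0) *: (x + e0 *: v).
  by apply/rowP => i; rewrite !mxE; field; rewrite gt_eqF.
have k0 : 0 < e / e0 by rewrite divr_gt0.
have k1 : 0 < 1 - e / e0 by rewrite subr_gt0 ltr_pdivrMr // mul1r.
have [_ cD cZ] := cell_convex Lc; split.
  by rewrite E; apply: cD; apply: cZ => //; apply: ltW.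
move=> l lL; rewrite E pairingDl !pairingZl => H z cz.
have [l1 l2] : pairing x (rl l) = 0 /\ pairing (x + e0 *: v) (rl l) = 0.
  by apply: positive_sum0 H => //; have [h|h] := cut_sign Lc lL; [left|right]; split; apply: h.
have lv : pairing v (rl l) = 0.
  by move: l2; rewrite pairingDl pairingZl l1 add0r => /eqP; rewrite mulf_eq0 (gt_eqF e00) => /eqP.
have : z \in plane x v by rewrite -sp mem_lin_span.
by case/planeP => a [b ->]; rewrite !pairingE l1 lv !mulr0 addr0.
Qed.

(** A functional of L vanishing on sigma vanishes at y, hence on c. By [span_cut] the cell lies in
    the plane of sigma, and the dimensions agree. *)
Lemma relint_span G c y sigma : bounded_fan G -> cone_dim c = 2%N -> relint c y ->
  cones_of_dim G 2 sigma -> (0 < weight G sigma)%N -> sigma y -> lin_span sigma = lin_span c.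
Proof.
move=> bG dc [cy ry] Gs w0 sy; have [_ ds] := Gs; apply/esym/eqP.
rewrite eqEdim -/(cone_dim c) -/(cone_dim sigma) dc ds leqnn andbT.
apply: lin_span_min => z cz; apply: (span_cut bG Gs w0) => l lL h.
by apply: ry cz => //; apply: h; apply: mem_lin_span.
Qed.

Lemma relint_segment c y y' t : cells c -> relint c y -> relint c y' -> 0 <= t <= 1 ->
  relint c (y + t *: (y' - y)).
Proof.
move=> Lc [cy ry] [cy' ry'] /andP[t0 t1].
have E : y + t *: (y' - y) = (1 - t) *: y + t *: y'.
  by apply/rowP => i; rewrite !mxE; ring.
have [_ cD cZ] := cell_convex Lc; split.
  by rewrite E; apply: cD; apply: cZ => //; rewrite subr_ge0.
move=> l lL; rewrite E pairingDl !pairingZl => H.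
have [t1'|tn] := eqVneq t 1; first by move: H; rewrite t1' subrr mul0r add0r mul1r => /ry'; apply.
have k1 : 0 < 1 - t by rewrite subr_gt0 lt_neqAle tn.
have [t0'|t0'] := eqVneq t 0; first by move: H; rewrite t0' subr0 mul1r mul0r addr0 => /ry; apply.
apply: ry => //; have tp : 0 < t by rewrite lt_def t0'.
suff S : (0 <= pairing y (rl l) /\ 0 <= pairing y' (rl l)) \/
    (pairing y (rl l) <= 0 /\ pairing y' (rl l) <= 0).
  by case: (positive_sum0 k1 tp S H).
by have [h|h] := cut_sign Lc lL; [left|right]; split; apply: h.
Qed.

Lemma relint_transfer G c y y' sigma : bounded_fan G -> cells c -> cone_dim c = 2%N ->
  relint c y -> relint c y' -> cones_of_dim G 2 sigma -> (0 < weight G sigma)%N -> sigma y ->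
  exists2 k, cones_of_dim G 2 k & k y' /\ weight G k = weight G sigma.
Proof.
move=> bG Lc dc ry ry' Gs w0 sy; have [tG _] := bG.
have nz z : relint c z -> exists2 i, z 0 i != 0 & True.
  move=> [cz rz]; apply: contrapT => N.
  have : (lin_span c <= 0)%VS.
    apply: lin_span_min => w cw; rewrite memv0; apply/eqP/rowP => i; rewrite mxE -pairing_delta_int.
    apply: (rz _ (L_delta i)) cw; rewrite pairing_delta_int.
    by apply/eqP/negPn/negP => h; apply: N; exists i.
  by move/dimvS; rewrite -/(cone_dim c) dc dimv0.
have y0 : y != 0 by have [i yi _] := nz _ ry; apply: contra yi => /eqP->; rewrite mxE.
(* Proportional points span no plane for [segment_transfer]; as coordinates keep their sign on c, y'
   is then a nonnegative multiple of y and stays in sigma. *)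
have [iv|ni] := boolP (y' - y \in <[y]>%VS).
  case/vlineP: iv => k /eqP; rewrite subr_eq => /eqP y'E.
  exists sigma => //; split=> //; have [fG _ _] := tG; have [_ rG _ _] := fG.
  have [_ _ sZ] := rational_convex_cone (rG _ Gs.1).
  have {}y'E : y' = (k + 1) *: y by rewrite scalerDl scale1r.
  rewrite y'E; apply: sZ => //; have [i yi _] := nz _ ry.
  have e : y' 0 i = (k + 1) * y 0 i by rewrite y'E mxE.
  have [h|h] := cut_sign Lc (L_delta i); have := h _ ry.1; have := h _ ry'.1;
    rewrite !pairing_delta_int e; move: yi; move: (y 0 i) (k + 1) => p q p0.
    by move=> h1 h2; move: h1; rewrite pmulr_lge0 // lt_def p0.
  by move=> h1 h2; move: h1; rewrite nmulr_lle0 // lt_def eq_sym p0.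
have iv : indep y (y' - y) by split.
have [t k t01 Gk wk kt|k Gk [ky wk]] := segment_transfer tG Gs w0 sy iv.
  have rt := relint_segment Lc ry ry' t01.
  rewrite (relint_span bG dc rt Gk wk kt); apply: span_plane => //.
    by apply: mem_lin_span; case: ry.
  by rewrite memvB ?mem_lin_span //; [case: ry'|case: ry].
by exists k => //; split=> //; move: ky; rewrite addrC subrK.
Qed.

(** Points of the two germs slightly away from x and x' lie in the relative interior of c, where
    [relint_transfer] moves the weight. Then [germ_cover], applied to the cones of that weight only,
    finds one with the germ (x', v'). *)
Lemma cell_transfer G c x v x' v' : bounded_fan G -> cells c -> cone_dim c = 2%N ->
  indep x v -> germ c x v -> indep x' v' -> germ c x' v' -> delta G x v != 0 ->
  delta G x' v' = delta G x v.
Proof.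
move=> bG Lc dc iv g iv' g' /delta_neq0[s [Gs w0 gs]]; have [[fG _ _] _] := bG; have [_ rG _ _] := fG.
rewrite (delta_val fG iv Gs gs).
have [e1 e10 h1] := germ_step (cell_convex Lc) g.
have [e2 e20 h2] := germ_step (rational_convex_cone (rG _ Gs.1)) gs.
pose e := Num.min e1 e2 / 2; have m0 : 0 < Num.min e1 e2 by rewrite lt_min e10.
have em : e < Num.min e1 e2 by rewrite /e; lra.
have ep : 0 < e by rewrite /e; lra.
have ry : relint c (x + e *: v).
  apply: (@relint_germ c x v e1) => //; [by case: g|by apply: h1; rewrite ltW //= lexx|].
  by rewrite ep (lt_le_trans em) // ge_min lexx.
have sy : s (x + e *: v).
  by apply: h2; rewrite ltW //= ltW // (lt_le_trans em) // ge_min lexx orbT.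
have [e3 e30 h3] := germ_step (cell_convex Lc) g'.
have [|||k [Gk wk] gk] := @germ_cover R m [set k | cones_of_dim G 2 k /\ weight G k = weight G s] x' v'.
- by apply: sub_finite_set (finite_cones_of_dim 2 fG) => k [].
- by move=> k [[Gk _] _]; apply: rG.
- exists e3 => // d d01.
  have ry' : relint c (x' + d *: v').
    by apply: (@relint_germ c x' v' e3) => //; [case: g'|apply: h3; rewrite ltW //= lexx].
  by have [k Gk [kd wk]] := relint_transfer bG Lc dc ry ry' Gs w0 sy; exists k.
by rewrite (delta_val fG iv' Gk gk) wk.
Qed.

(* [density G c] is the weight of G on the cell c; it is constant on c by
   [cell_transfer]. *)
Definition sample c : V * V := xget (0, 0) [set q | indep q.1 q.2 /\ germ c q.1 q.2].

Definition density G c : nat := xget 0%N [set k : nat | k%:R = delta G (sample c).1 (sample c).2].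

Lemma densityE G c x v : bounded_fan G -> indep x v -> germ c x v ->
  (density G c)%:R = delta G (sample c).1 (sample c).2 /\ (density G c <= B)%N.
Proof.
move=> bG iv g; have [[fG _ _] _] := bG.
have [ivs gs] : indep (sample c).1 (sample c).2 /\ germ c (sample c).1 (sample c).2.
  by rewrite /sample; case: xgetP => [q -> //|/(_ (x, v))[]].
suff [k kE kB] : exists2 k : nat, k%:R = delta G (sample c).1 (sample c).2 & (k <= B)%N.
  rewrite /density; case: xgetP => [j -> /= jE|/(_ k) //]; split=> //.
  have /eqP := etrans kE (esym jE); rewrite eqr_nat => /eqP <-; exact: kB.
have [->|/delta_neq0[s [Gs w0 gs']]] := eqVneq (delta G (sample c).1 (sample c).2) 0; first by exists 0%N.
by exists (weight G s); [rewrite (delta_val fG ivs Gs gs')|exact: weight_bound].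
Qed.

(** The alternatives with B in the hypothesis allow for overflow: a cell without a germ in
    independent directions has the default sample (0, 0), where the density may exceed B. On the
    2-dimensional cell used here [densityE] excludes this. *)
Lemma density_determines G G' : bounded_fan G -> bounded_fan G' ->
  (forall c, cells c -> density G c = density G' c \/ (B < density G c)%N \/ (B < density G' c)%N) ->
  forall x v, indep x v -> delta G x v != 0 -> delta G x v = delta G' x v.
Proof.
move=> bG bG' hd x v iv d0; have /delta_neq0[s [Gs w0 gs]] := d0; have [_ ds] := Gs.
have fA := is_fan_cut L (@is_fan_setT R m); have [finA rA _ _] := fA.
have [//|//||c0 Lc0 g0] := @germ_cover R m cells x v.
  exists 1 => // e _; exact: (@cut_cover _ _ L [set setT] setT).
(* The functionals of L vanishing on the plane of s. As L is closed under negation, imposing them as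
   inequalities on a cell with germ (x, v) leaves a cell inside this plane. *)
pose Ls := [seq l <- L | `[< forall z, z \in lin_span s -> pairing z (rl l) = 0 >]].
have sub : {subset Ls <= L} by move=> l; rewrite mem_filter => /andP[].
have Lc := cell_hges Lc0 sub; set c := c0 `&` _ in Lc.
have cs y : c y -> y \in lin_span s.
  move=> [_ cy]; apply: (span_cut bG Gs w0) => l lL h.
  apply/le_anti; rewrite cy; last by rewrite mem_filter lL andbT; apply/asboolP.
  rewrite andbT -oppr_ge0 -pairingNr -rlN; apply: cy.
  rewrite mem_filter L_opp // andbT; apply/asboolP => z /h e.
  by rewrite rlN pairingNr e oppr0.
have gc : germ c x v.
  have sc y : c0 y -> y \in lin_span s -> c y.
    by move=> c0y ys; split=> // l; rewrite mem_filter => /andP[/asboolP h _]; rewrite h.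
  case: g0 => c0x [e e0 c0e]; have sx : x \in lin_span s by apply: mem_lin_span; case: gs.
  split; first exact: sc.
  by exists e => //; apply: sc => //; rewrite memvD // memvZ // (germ_span gs).
have dc : cone_dim c = 2%N.
  apply/eqP; rewrite eqn_leq (germ_dim iv gc) andbT -ds; apply: dimvS.
  by apply: lin_span_min.
have [ivs gs'] : indep (sample c).1 (sample c).2 /\ germ c (sample c).1 (sample c).2.
  by rewrite /sample; case: xgetP => [q -> //|/(_ (x, v))[]].
have [dE dB] := densityE bG iv gc; have [dE' dB'] := densityE bG' iv gc.
have e1 := cell_transfer bG Lc dc iv gc ivs gs' d0.
have e2 : delta G' (sample c).1 (sample c).2 = delta G (sample c).1 (sample c).2.
  have [e|[e|e]] := hd _ Lc; first by rewrite -dE -dE' e.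
    by rewrite ltnNge dB in e.
  by rewrite ltnNge dB' in e.
rewrite -e1 -e2; apply/esym/(cell_transfer bG' Lc dc ivs gs' iv gc).
by rewrite e2 e1.
Qed.

End Finiteness.

Lemma cycle_of_delta (R : realType) m (G G' : wfan R m) : tropical_fan 2 G -> tropical_fan 2 G' ->
  (forall x v, indep x v -> delta G x v = delta G' x v) -> cycle_of 2 G = cycle_of 2 G'.
Proof.
have half (H H' : wfan R m) : tropical_fan 2 H -> tropical_fan 2 H' ->
    (forall x v, indep x v -> delta H x v = delta H' x v) -> cycle_of 2 H `<=` cycle_of 2 H'.
  move=> tH tH' E K [tK eK]; split=> //; have [fH _ _] := tH; have [fH' _ _] := tH'; have [fK _ _] := tK.
  by apply: delta_equiv => // x v iv; rewrite -E // (delta_equiv_eq fH fK eK iv).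
by move=> tG tG' E; apply/seteqP; split; apply: half => // x v iv; rewrite E.
Qed.

Lemma finite_bounded_cycles (R : realType) (m B : nat) :
  finite_set [set cycle_of 2 G | G in [set G : wfan R m | bounded_fan B G]].
Proof.
have [L HL] := @bounded_columns m (3 * B + 1).
have [finA _ _ _] := is_fan_cut L (@is_fan_setT R m).
have [S SE] := (finite_seqP _).1 finA.
(* Here [inord] keeps a density up to B and loses larger ones, which [density_determines]
   tolerates. *)
pose code (G : wfan R m) : {ffun 'I_(size S) -> 'I_B.+1} :=
  [ffun i : 'I_(size S) => inord (density G (nth setT S i))].
apply: (@finite_factor _ _ _ _ code) => G G' bG bG' E.
have [tG _] := bG; have [tG' _] := bG'; apply: cycle_of_delta => // x v iv.
have cE c : cut L [set setT] c ->
    density G c = density G' c \/ (B < density G c)%N \/ (B < density G' c)%N.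
  rewrite SE => cS; have ic : (index c S < size S)%N by rewrite index_mem.
  have := congr1 (fun f : {ffun _ -> _} => nat_of_ord (f (Ordinal ic))) E; rewrite !ffunE /= nth_index // => e.
  have [d1|] := leqP (density G c) B; last by right; left.
  have [d2|] := leqP (density G' c) B; last by right; right.
  by left; move: e; rewrite !inordK.
have [d0|d0] := eqVneq (delta G x v) 0; last exact: (density_determines HL bG bG' cE).
have [d1|d1] := eqVneq (delta G' x v) 0; first by rewrite d0.
apply/esym/(density_determines HL bG' bG) => // c /cE[->|[h|h]]; [left|right; right|right; left] => //.
Qed.

(** * Minimal models and the dichotomy *)

Section MinimalModel.
Context {R : realType} {n : nat}.
Local Notation rl := (@realify R _).

Lemma sum_bound m (c : 'I_m -> 'I_m -> R) : (forall i j, `|c i j| <= 1) ->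
  `|\sum_i \sum_j c i j| <= (m * m)%:R.
Proof.
move=> h; apply: (le_trans (ler_norm_sum _ _ _)).
apply: (@le_trans _ _ (\sum_(i < m) m%:R)); last by rewrite sumr_const card_ord natrM mulr_natr.
apply: ler_sum => i _; apply: (le_trans (ler_norm_sum _ _ _)).
apply: (@le_trans _ _ (\sum_(j < m) 1)); last by rewrite sumr_const card_ord.
by apply: ler_sum => j _.
Qed.

(** A Cauchy-Binet expansion of the minors of u and v into determinants of pairs of functionals,
    which the degrees bound. *)
Lemma wedge_sum m (u v : 'rV[R]_m) (t : 'I_m -> 'cV[int]_m) (q : 'M[R]_m) :
  (forall i (y : 'rV[R]_m), y 0 i = \sum_j q i j * pairing y (rl (t j))) ->
  forall i k, u 0 i * v 0 k - v 0 i * u 0 k = \sum_j \sum_l q i j * q k l * wedge u v (t j) (t l).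
Proof.
move=> h i k; rewrite !(h i) !(h k) !big_distrlr -sumrB; apply: eq_bigr => j _.
rewrite -sumrB; apply: eq_bigr => l _; rewrite /wedge /=. ring.
Qed.

Lemma minimal_model (F0 : wfan R n) (T1 T2 : tropical_function n) : tropical_fan 2 F0 ->
  DEG (delta F0) (teval T1) (teval T1) = 1 -> DEG (delta F0) (teval T1) (teval T2) = 1 ->
  DEG (delta F0) (teval T2) (teval T2) = 1 ->
  exists (m : nat) (p : {linear 'rV[R]_n -> 'rV[R]_m}) (H : wfan R m) (M1 M2 : tropical_function m),
  [/\ (m <= n)%N, zlinear p, (forall y, exists x, p x = y),
      bounded_fan (n * n) H /\ pushforward 2 p (cycle_of 2 F0) = cycle_of 2 H &
      [/\ degree [:: M1; M2] (cycle_of 2 H) = 1%N,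
          (forall x, teval T1 x = teval M1 (p x)) & (forall x, teval T2 x = teval M2 (p x))]].
Proof.
move=> t0 d11 d12 d22.
have [m [p [M1 [M2 [t [q [Yf [mn zp sp pY [[E1 E2] h1 h2 ht [hq qb]]]]]]]]]] := @factor_maps R n T1 T2.
have [F [[tF XF] dF [posF ptF] [f1 f2] pH]] := pushforward_exists zp pY T1 T2 t0.
set H := push_fan p F in pH; have [fF _ bF] := tF.
have [fH pureH] := pushforward_fan zp fF pH; have [_ hE _] := pH.
have tH : tropical_fan 2 H by split=> //; exact: (pushforward_balanced zp fF ptF pH bF).
have ptH := pushforward_pointed zp fF ptF pH.
have lin (T : tropical_function n) M : fineT F T -> (forall x, teval T x = teval M (p x)) ->
    (forall s, s \in functionals T -> exists2 c, c \in functionals M &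
       forall x, pairing x (rl s) = pairing (p x) (rl c)) ->
    forall s, cones F s -> lin_on (teval M) (p @` s).
  move=> fT E h s /fT[l /h[c _ cE] lE]; exists (rl c) => _ [x sx <-].
  by rewrite -E lE.
have deg (Ta Tb : tropical_function n) Ma Mb : (forall x, teval Ta x = teval Ma (p x)) ->
    (forall x, teval Tb x = teval Mb (p x)) -> fineT F Tb ->
    (forall s, cones F s -> lin_on (teval Mb) (p @` s)) ->
    DEG (delta H) (teval Ma) (teval Mb) = DEG (delta F0) (teval Ta) (teval Tb).
  move=> Ea Eb fb lb; rewrite (DEG_DegF _ tF dF ptF fb) DEG_fan //; last 2 first.
  - by case: tH.
  - move=> s; rewrite hE => -[r [[Fr _] _ fs]]; have [l h] := lb _ Fr.
    by exists l => x sx; apply: h; apply: (face_sub fs).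
  rewrite (push_DegF zp fF ptF pH bF lb (fun c x => @tevalZ _ _ Ma c x)).
  by congr DegF; apply/funext => x.
have l1 := lin _ _ f1 E1 h1; have l2 := lin _ _ f2 E2 h2.
have D11 := deg _ _ _ _ E1 E1 f1 l1; have D12 := deg _ _ _ _ E1 E2 f2 l2.
have D22 := deg _ _ _ _ E2 E2 f2 l2.
rewrite d11 in D11; rewrite d12 in D12; rewrite d22 in D22.
have D21 : DEG (delta H) (teval M2) (teval M1) = 1 by rewrite DEG_sym.
exists m, p, H, M1, M2; split=> //; last first.
  by split=> //; apply/eqP; rewrite -(eqr_nat R) degreeE // D12.
split; last exact: (pushforward_cycle zp t0 XF pH tH).
split=> // s Hs w0; have [u [v [Pu Nv g]]] := cone_basis fH Hs; have [Zu _ _] := Pu.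
have [iv [Zv _ _ _] _] := Nv.
have [a uE] := (ZnP _).1 Zu; have [b vE] := (ZnP _).1 Zv.
exists a, b; rewrite -uE -vE; split=> //; [by apply: mem_lin_span; case: g|exact: germ_span g|].
move=> i k; rewrite -(ler_nat R) natrM natr_absz intr_norm.
have -> : (minor a b i k)%:~R = u 0 i * v 0 k - v 0 i * u 0 k :> R.
  by rewrite uE vE !mxE /minor intrB !intrM.
rewrite (wedge_sum _ _ hq) -normr_nat -normrM.
(* The weighted minor is a sum of m^2 terms of absolute value at most 1, and m <= n gives the
   constant n * n. *)
apply: (@le_trans _ _ (m * m)%:R); last by rewrite ler_nat leq_mul.
rewrite mulr_sumr (eq_bigr (fun j => \sum_l (weight H s)%:R * (q i j * q k l * wedge u v (t j) (t l)))); last first.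
  by move=> j _; rewrite mulr_sumr.
apply: sum_bound => j l.
have -> : (weight H s)%:R * (q i j * q k l * wedge u v (t j) (t l)) =
   q i j * q k l * ((weight H s)%:R * wedge u v (t j) (t l)) by ring.
rewrite !normrM; apply: mulr_ile1; rewrite ?mulr_ge0 //; first by apply: mulr_ile1.
rewrite normr_nat.
have [sj [hj _]] := ht j; have [sl [hl _]] := ht l.
case: hj => -[_ tj]; case: hl => -[_ tl].
- by apply: (le_trans (wedge_le_degree tH Hs Pu Nv g tj tl)); rewrite D11.
- by apply: (le_trans (wedge_le_degree tH Hs Pu Nv g tj tl)); rewrite D12.
- by apply: (le_trans (wedge_le_degree tH Hs Pu Nv g tj tl)); rewrite D21.
- by apply: (le_trans (wedge_le_degree tH Hs Pu Nv g tj tl)); rewrite D22.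
Qed.

Lemma regular_fibration_of (F0 : wfan R n) (T1 T2 Ta Tb : tropical_function n) (i : 'I_2) :
  tropical_fan 2 F0 -> regular_tuple [tuple T1; T2] (cycle_of 2 F0) -> tnth [tuple T1; T2] i = Ta ->
  DEG (delta F0) (teval Ta) (teval Ta) = 0 -> DEG (delta F0) (teval Ta) (teval Tb) = 1 ->
  regular_fibration [tuple T1; T2] (cycle_of 2 F0).
Proof.
move=> t0 rX iE d0 d1; split=> //.
have [m [p [G [M [zp tG dG suppG E]]]]] := fibration t0 d0 d1.
exists m, p, 1%N, G; split=> //.
  by split=> //; exists [tuple M]; split=> //; exists G.
exists (fun=> i), [tuple M]; split=> //.
  by move=> j k _; rewrite [j]ord1 [k]ord1.
by move=> j x; rewrite iE E [j]ord1.
Qed.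

End MinimalModel.

Theorem theorem1p7 (R : realType) (n : nat) :
  exists MD : set {m : nat & set (wfan R m)},
    [/\ finite_set MD,
        (forall (m : nat) (Y : set (wfan R m)),
           MD (existT (fun m => set (wfan R m)) m Y) -> is_cycle 2 Y) &
        (forall (X : set (wfan R n)) (T1 T2 : tropical_function n),
           is_cycle 2 X -> hodge_index X ->
           regular_tuple [tuple T1; T2] X -> reduced R T1 -> reduced R T2 ->
           regular_fibration [tuple T1; T2] X \/
           exists (m : nat) (pi : {linear 'rV[R]_n -> 'rV[R]_m}),
             [/\ zlinear pi,
                 (forall y, exists x, pi x = y),
                 MD (existT (fun m => set (wfan R m)) m (pushforward 2 pi X)) &
                 exists M1 M2 : tropical_function m,
                   [/\ regular_tuple [tuple M1; M2] (pushforward 2 pi X),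
                       (forall x, teval T1 x = teval M1 (pi x)) &
                       (forall x, teval T2 x = teval M2 (pi x))]])].
Proof.
(* The class depends on n alone: all cycles with Pluecker bound n * n in ambient dimension at most
   n. *)
pose C m := [set cycle_of 2 G | G in [set G : wfan R m | bounded_fan (n * n) G]].
pose MD : set {m : nat & set (wfan R m)} := \bigcup_(m in `I_n.+1)
  [set existT (fun m => set (wfan R m)) m Y | Y in C m].
have MDP m G : (m <= n)%N -> bounded_fan (n * n) G ->
    MD (existT (fun m => set (wfan R m)) m (cycle_of 2 G)).
  by move=> mn bG; exists m => //; exists (cycle_of 2 G) => //; exists G.
exists MD; split.
- apply: bigcup_finite; first exact: finite_II.
  by move=> m _; apply: finite_image; apply: finite_bounded_cycles.
- move=> m Y [k _ [_ [G [tG _] <-] E]].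
  (* The property is carried across the equality of dependent pairs by projecting to the second
     component. *)
  have : is_cycle 2 (projT2 (existT (fun m => set (wfan R m)) k (cycle_of 2 G))) by exists G.
  by rewrite E.
move=> X T1 T2 [F0 t0 ->] hodge rX _ _; have [_ /= d12] := rX.
have := hodge T1 T2; rewrite d12 => h.
have D12 : DEG (delta F0) (teval T1) (teval T2) = 1 by rewrite -degreeE // d12.
have [d11|d11] := eqVneq (degree [:: T1; T1] (cycle_of 2 F0)) 0%N.
  left; apply: (@regular_fibration_of R n F0 T1 T2 T1 T2 ord0) => //.
  by rewrite -degreeE // d11.
have [d22|d22] := eqVneq (degree [:: T2; T2] (cycle_of 2 F0)) 0%N.
  left; apply: (@regular_fibration_of R n F0 T1 T2 T2 T1 ord_max) => //.
    by rewrite -degreeE // d22.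
  by rewrite DEG_sym.
right; have [d11E d22E] : degree [:: T1; T1] (cycle_of 2 F0) = 1%N /\ degree [:: T2; T2] (cycle_of 2 F0) = 1%N.
  by move: h d11 d22; move: (degree _ _) (degree _ _) => a b; nia.
have [||m [p [H [M1 [M2 [mn zp sp [bH pE] [dM E1 E2]]]]]]] := minimal_model t0 _ D12 _.
- by rewrite -degreeE // d11E.
- by rewrite -degreeE // d22E.
exists m, p; split=> //; first by rewrite pE; apply: MDP.
exists M1, M2; split=> //; rewrite pE; split=> //.
by have [tH _] := bH; exists H.
Qed.
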